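(* Let $(\mathfrak b,H,\widehat\beta,\alpha,\beta,V)$ be a $C^*$-pseudo-multiplicative unitary, $\mathfrak b=(\mathfrak K,\mathfrak B,\mathfrak B^\dagger)$, and put $\tilde\Omega_{\beta,\alpha}:=\Omega_{\beta,\alpha}(\rho_{\widehat\beta}(\mathfrak B)')$ and $\tilde\Omega_{\alpha,\widehat\beta}:=\Omega_{\alpha,\widehat\beta}(\rho_\beta(\mathfrak B)')$. (i) There exist linear contractions $$\tilde\Omega_{\beta,\alpha}\,\hat\otimes\,\tilde\Omega_{\beta,\alpha}\to\Omega_{(\beta\triangleleft\beta),(\alpha\triangleright\alpha)}\big((\rho_{\widehat\beta}(\mathfrak B)\,{}_\alpha\otimes_\beta\,\rho_{\widehat\beta}(\mathfrak B))'\big),\quad \omega\otimes\omega'\mapsto\omega\boxtimes\omega',$$ $$\tilde\Omega_{\alpha,\widehat\beta}\,\hat\otimes\,\tilde\Omega_{\alpha,\widehat\beta}\to\Omega_{(\alpha\triangleleft\alpha),(\widehat\beta\triangleright\widehat\beta)}\big((\rho_{\beta}(\mathfrak B)\,{}_{\widehat\beta}\otimes_\alpha\,\rho_{\beta}(\mathfrak B))'\big),\quad \omega\otimes\omega'\mapsto\omega\boxtimes\omega',$$ such that for all $\xi,\xi'\in\beta^\infty$, $\eta,\eta'\in\alpha^\infty$, $\zeta,\zeta'\in\widehat\beta^\infty$ and each bijection $i\colon\mathbb N\times\mathbb N\to\mathbb N$, one has $\omega_{\xi,\eta}\boxtimes\omega_{\xi',\eta'}=\omega_{\theta,\theta'}$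 and $\omega_{\eta,\zeta}\boxtimes\omega_{\eta',\zeta'}=\omega_{\kappa,\kappa'}$, where for all $m,n\in\mathbb N$ $$\theta_{i(m,n)}=|\xi'_n\rangle_2\xi_m\in\beta\triangleleft\beta,\quad\theta'_{i(m,n)}=|\eta_m\rangle_1\eta'_n\in\alpha\triangleright\alpha,\quad\kappa_{i(m,n)}=|\eta'_n\rangle_2\eta_m\in\alpha\triangleleft\alpha,\quad\kappa'_{i(m,n)}=|\zeta_m\rangle_1\zeta'_n\in\widehat\beta\triangleright\widehat\beta.$$ (ii) The Banach spaces $\tilde\Omega_{\beta,\alpha}$ and $\tilde\Omega_{\alpha,\widehat\beta}$ carry the structure of Banach algebras, where the multiplication is given by $\omega*\omega'=(\omega\boxtimes\omega')\circ\Delta_V$ and $\omega*\omega'=(\omega\boxtimes\omega')\circ\widehat\Delta_V$, respectively. (iii) There exist contractive algebra homomorphisms $\widehat\pi_V\colon\tilde\Omega_{\beta,\alpha}\to\widehat A_V$ and $\pi_V\colon\tilde\Omega_{\alpha,\widehat\beta}\to A_V$ such that for all $\xi\in\beta^\infty$, $\eta\in\alpha^\infty$, $\zeta\in\widehat\beta^\infty$, $$\widehat\pi_V(\omega_{\xi,\eta})=\sum_n\langle\xi_n|_2V|\eta_n\rangle_2,\qquad\pi_V(\omega_{\eta,\zeta})=\sum_n\langle\eta_n|_1V|\zeta_n\rangle_1.$$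
   Context: General notions. $[Y]$ denotes the closed linear span of $Y$; products of sets of operators are elementwise; $X'$ is the commutant of $X$; $\hat\otimes$ is the projective tensor product of Banach spaces. A $C^*$-base is a triple $\mathfrak b=(\mathfrak K,\mathfrak B,\mathfrak B^\dagger)$ of a Hilbert space and two commuting nondegenerate $C^*$-algebras $\mathfrak B,\mathfrak B^\dagger\subseteq\mathcal L(\mathfrak K)$; $\mathfrak b^\dagger=(\mathfrak K,\mathfrak B^\dagger,\mathfrak B)$. A $C^*$-$\mathfrak b$-module $H_\alpha=(H,\alpha)$ is a Hilbert space $H$ with a closed subspace $\alpha\subseteq\mathcal L(\mathfrak K,H)$ such that $[\alpha\mathfrak K]=H$, $[\alpha\mathfrak B]=\alpha$, $[\alpha^*\alpha]=\mathfrak B$; it carries the representation $\rho_\alpha\colon\mathfrak B^\dagger\to\mathcal L(H)$, $\rho_\alpha(b^\dagger)\xi\zeta=\xi b^\dagger\zeta$ ($\xi\in\alpha,\zeta\in\mathfrak K$). For $C^*$-$\mathfrak b^\dagger$-modules the roles of $\mathfrak B,\mathfrak B^\dagger$ are swapped. A $C^*$-$(\mathfrak b_1,\dots,\mathfrak b_n)$-module is a tuple $(H,\alpha_1,\dots,\alpha_n)$ with each $(H,\alpha_i)$ a $C^*$-$\mathfrak b_i$-module and $[\rho_{\alpha_i}(\mathfrak B_i^\dagger)\alpha_j]=\alpha_j$ for $i\neq j$. Relative tensor product. For a $C^*$-$\mathfrak b$-module $H_\beta$ and a $C^*$-$\mathfrak b^\dagger$-module $K_\gamma$, $H\,{}_\beta\otimes_\gamma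 K$ (the base is suppressed in the notation; the same definition applies with $\mathfrak b$, $\mathfrak b^\dagger$ interchanged) is the Hilbert space generated by elements $\xi\otimes\zeta\otimes\eta$ ($\xi\in\beta,\zeta\in\mathfrak K,\eta\in\gamma$) with $\langle\xi\otimes\zeta\otimes\eta|\xi'\otimes\zeta'\otimes\eta'\rangle=\langle\zeta|\xi^*\xi'\eta^*\eta'\zeta'\rangle$. The operators $|\xi\rangle_1\colon K\to H\,{}_\beta\otimes_\gamma K$ and $|\eta\rangle_2\colon H\to H\,{}_\beta\otimes_\gamma K$ are given by $|\xi\rangle_1\eta\zeta=\xi\otimes\zeta\otimes\eta=|\eta\rangle_2\xi\zeta$; $\langle\xi|_1,\langle\eta|_2$ are their adjoints; $|\beta\rangle_1=\{|\xi\rangle_1:\xi\in\beta\}$, and similarly $\langle\beta|_1,|\gamma\rangle_2,\langle\gamma|_2$. For further module structures $\alpha$ on $H$, $\delta$ on $K$ put $\alpha\triangleleft\gamma=[|\gamma\rangle_2\alpha]$, $\beta\triangleright\delta=[|\beta\rangle_1\delta]$; these are module structures on $H\,{}_\beta\otimes_\gamma K$. Operators $S\otimes\mathrm{id}$ and $\mathrm{id}\otimes T$ are determined by $(S\otimes\mathrm{id})|\eta\rangle_2=|\eta\rangle_2S$ and $(\mathrm{id}\otimes T)|\xi\rangle_1=|\xi\rangle_1T$ whenever $S$ intertwines the representations $\rho_\beta$ of the first leg, resp. $T$ the representations $\rho_\gamma$ of the second leg. For $C^*$-algebras $A,B$ of such operators, $A\,{}_\beta\otimes_\gamma B$ denotes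 the set of operators $a\otimes b:=(a\otimes\mathrm{id})(\mathrm{id}\otimes b)$. Iterated relative tensor products are identified via the canonical associativity isomorphisms; $\Sigma$ denotes the flip $\xi\otimes\zeta\otimes\eta\mapsto\eta\otimes\zeta\otimes\xi$. $C^*$-pseudo-multiplicative unitary: a tuple $(\mathfrak b,H,\widehat\beta,\alpha,\beta,V)$ with $\mathfrak b$ a $C^*$-base, $(H,\widehat\beta,\alpha,\beta)$ a $C^*$-$(\mathfrak b^\dagger,\mathfrak b,\mathfrak b^\dagger)$-module and $V\colon H\,{}_{\widehat\beta}\otimes_\alpha H\to H\,{}_\alpha\otimes_\beta H$ a unitary with $V(\alpha\triangleleft\alpha)=\alpha\triangleright\alpha$, $V(\widehat\beta\triangleright\beta)=\widehat\beta\triangleleft\beta$, $V(\widehat\beta\triangleright\widehat\beta)=\alpha\triangleright\widehat\beta$, $V(\beta\triangleleft\alpha)=\beta\triangleleft\beta$, satisfying the pentagon equation $V_{23}V_{12}=V_{12}V_{13}V_{23}$ as operators $H\,{}_{\widehat\beta}\otimes_\alpha H\,{}_{\widehat\beta}\otimes_\alpha H\to H\,{}_\alpha\otimes_\beta H\,{}_\alpha\otimes_\beta H$. Here $V_{12}=V\otimes\mathrm{id}$, $V_{23}=\mathrm{id}\otimes V$, and $V_{13}\colon H\,{}_{\widehat\beta}\otimes_{\alpha\triangleright\alpha}(H\,{}_\alpha\otimes_\beta H)\to(H\,{}_{\widehat\beta}\otimes_\alpha H)\,{}_{\alpha\triangleleft\alpha}\otimes_\beta H$ is $\Sigma_{23}(V\otimes\mathrm{id})(\mathrm{id}\otimes\Sigma)$,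 where $\Sigma_{23}\colon(H\,{}_\alpha\otimes_\beta H)\,{}_{\widehat\beta\triangleleft\beta}\otimes_\alpha H\to(H\,{}_{\widehat\beta}\otimes_\alpha H)\,{}_{\alpha\triangleleft\alpha}\otimes_\beta H$ sends $|\eta\rangle_2|\xi\rangle_2\omega$ to $|\xi\rangle_2|\eta\rangle_2\omega$ ($\omega\in H,\xi\in\beta,\eta\in\alpha$). Legs. $\widehat A_V=[\langle\beta|_2V|\alpha\rangle_2]\subseteq\mathcal L(H)$, $A_V=[\langle\alpha|_1V|\widehat\beta\rangle_1]\subseteq\mathcal L(H)$ (with $|\alpha\rangle_2,|\widehat\beta\rangle_1\subseteq\mathcal L(H,H\,{}_{\widehat\beta}\otimes_\alpha H)$ and $\langle\beta|_2,\langle\alpha|_1\subseteq\mathcal L(H\,{}_\alpha\otimes_\beta H,H)$). These are algebras. $\widehat\Delta_V\colon\rho_\beta(\mathfrak B)'\to\mathcal L(H\,{}_{\widehat\beta}\otimes_\alpha H)$, $y\mapsto V^*(\mathrm{id}\otimes y)V$, and $\Delta_V\colon\rho_{\widehat\beta}(\mathfrak B)'\to\mathcal L(H\,{}_\alpha\otimes_\beta H)$, $z\mapsto V(z\otimes\mathrm{id})V^*$; they take values in $(\rho_\beta(\mathfrak B)\,{}_{\widehat\beta}\otimes_\alpha\rho_\beta(\mathfrak B))'$ and $(\rho_{\widehat\beta}(\mathfrak B)\,{}_\alpha\otimes_\beta\rho_{\widehat\beta}(\mathfrak B))'$, respectively. Spaces of maps. For a module structure $\alpha\subseteq\mathcal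 L(\mathfrak K,H)$ let $\alpha^\infty$ be the space of sequences $\eta=(\eta_k)_{k\in\mathbb N}$ in $\alpha$ such that $\sum_k\eta_k^*\eta_k$ converges in norm, $\|\eta\|=\|\sum_k\eta_k^*\eta_k\|^{1/2}$. For module structures $\beta,\alpha$ on $H$ and a $C^*$-algebra $A\subseteq\mathcal L(H)$, each $\eta\in\beta^\infty,\eta'\in\alpha^\infty$ defines $\omega_{\eta,\eta'}\colon A\to\mathcal L(\mathfrak K)$, $T\mapsto\sum_k\eta_k^*T\eta_k'$; $\Omega_{\beta,\alpha}(A)$ is the set of all these maps, a Banach space for the norm $\|\omega\|=\inf\{\|\eta\|\|\eta'\|:\omega=\omega_{\eta,\eta'},\eta\in\beta^\infty,\eta'\in\alpha^\infty\}$. *)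

(* Defs.v *)
From HB Require Import structures.
From mathcomp Require Import all_boot all_order all_algebra.
From mathcomp Require Import complex.
From mathcomp Require Import all_classical all_reals all_analysis.

Set Implicit Arguments.
Unset Strict Implicit.
Unset Printing Implicit Defensive.

Import Order.TTheory GRing.Theory Num.Theory.
Import numFieldNormedType.Exports.

Local Open Scope classical_set_scope.
Local Open Scope ring_scope.
Local Open Scope complex_scope.

HB.mixin Record isHilbert (R : realType) H
    & CompleteNormedModule R[i] H := {
  hdot : {dot H for (@Num.conj R[i])} ;
  hdot_norm : forall x : H, hdot x x = `|x| ^+ 2
}.

#[short(type="hilbertType")]
HB.structure Definition Hilbert (R : realType) :=
  {H of isHilbert R H & CompleteNormedModule R[i] H}.

(* MathComp forms are linear in the first argument; the inner product <x|y>
   is linear in the second one. *)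
Definition iprod (R : realType) (H : hilbertType R) (x y : H) : R[i] :=
  hdot y x.

(* MathComp-Analysis norms on spaces over [R[i]] take values in [R[i]]. *)
Definition rnorm (R : realType) (V : normedModType R[i]) (x : V) : R :=
  complex.Re `|x|.

Definition lspan (K : pzRingType) (V : lmodType K) (Y : set V) : set V :=
  [set v | exists (n : nat) (a : 'I_n -> K) (y : 'I_n -> V),
    (forall i, Y (y i)) /\ v = \sum_(i < n) a i *: y i].

Definition op_bound (R : realType) (H K : hilbertType R) (T : H -> K) (M : R)
    : Prop :=
  0 <= M /\ forall x, rnorm (T x) <= M * rnorm x.

Definition bounded_op (R : realType) (H K : hilbertType R) : set (H -> K) :=
  [set T | linear T /\ exists M, op_bound T M].

Definition opnorm (R : realType) (H K : hilbertType R) (T : H -> K) : R :=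
  inf [set M | op_bound T M].

(* Here and below, an operator determined by an equation is introduced by
   [xget]; it is unique whenever it exists (the adjoint exists for bounded T). *)
Definition adj (R : realType) (H K : hilbertType R) (T : H -> K) : K -> H :=
  xget (fun=> 0) [set S | forall x y, iprod (S y) x = iprod y (T x)].

(* [Y], for a set Y of vectors. *)
Definition cspan_vec (R : realType) (H : hilbertType R) (Y : set H) : set H :=
  closure (lspan Y).

(* [Y], for a set Y of bounded operators: closure in the operator norm. *)
Definition cspan (R : realType) (H K : hilbertType R) (Y : set (H -> K))
    : set (H -> K) :=
  [set T | bounded_op T /\
    forall e : R, 0 < e -> exists2 S, lspan Y S & op_bound (T - S) e].

(* The series [\sum_k u k] of bounded operators converges in norm to S. *)
Definition op_series_to (R : realType) (H K : hilbertType R)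
    (u : nat -> H -> K) (S : H -> K) : Prop :=
  bounded_op S /\
  forall e : R, 0 < e -> \forall n \near \oo, op_bound (series u n - S) e.

Definition op_series (R : realType) (H K : hilbertType R) (u : nat -> H -> K)
    : H -> K :=
  xget (fun=> 0) [set S | op_series_to u S].

Definition commutant (R : realType) (H : hilbertType R) (X : set (H -> H))
    : set (H -> H) :=
  [set T | bounded_op T /\ forall S, X S -> T \o S = S \o T].

Definition unitary_op (R : realType) (H K : hilbertType R) (U : H -> K)
    : Prop :=
  [/\ linear U, forall x y, iprod (U x) (U y) = iprod x y &
      forall y, exists x, U x = y].

Definition cstar_algebra (R : realType) (H : hilbertType R) (A : set (H -> H))
    : Prop :=
  [/\ cspan A = A, forall S T, A S -> A T -> A (S \o T) &
      forall T, A T -> A (adj T)].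

Definition nondegenerate (R : realType) (H : hilbertType R) (A : set (H -> H))
    : Prop :=
  cspan_vec [set T x | T in A & x in [set: H]] = [set: H].

Record cbase (R : realType) := CBase {
  bspace : hilbertType R ;
  balg : set (bspace -> bspace) ;
  balgd : set (bspace -> bspace) ;
  balg_cstar : cstar_algebra balg ;
  balgd_cstar : cstar_algebra balgd ;
  balg_nondeg : nondegenerate balg ;
  balgd_nondeg : nondegenerate balgd ;
  balg_comm : forall S T, balg S -> balgd T -> S \o T = T \o S
}.

Arguments balg {R} c.
Arguments balgd {R} c.

Lemma balg_commC (R : realType) (b : cbase R) (S T : bspace b -> bspace b) :
  balgd b S -> balg b T -> S \o T = T \o S.
Proof. by move=> bS bT; rewrite (balg_comm bT bS). Qed.

Definition dagger (R : realType) (b : cbase R) : cbase R :=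
  CBase (balgd_cstar b) (balg_cstar b) (balgd_nondeg b) (balg_nondeg b)
        (@balg_commC R b).

Record cmodule (R : realType) (b : cbase R) (H : hilbertType R)
    (alpha : set (bspace b -> H)) : Prop := CModule {
  cmod_closed : cspan alpha = alpha ;
  cmod_total : cspan_vec [set xi z | xi in alpha & z in [set: bspace b]]
               = [set: H] ;
  cmod_alg : cspan [set xi \o T | xi in alpha & T in balg b] = alpha ;
  cmod_inner : cspan [set adj xi \o xi' | xi in alpha & xi' in alpha]
               = balg b
}.

Definition rho (R : realType) (L H : hilbertType R) (alpha : set (L -> H))
    (c : L -> L) : H -> H :=
  xget (fun=> 0)
    [set X | bounded_op X /\ forall xi z, alpha xi -> X (xi z) = xi (c z)].

Record cmodule3 (R : realType) (b1 b2 b3 : cbase R) (H : hilbertType R)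
    (a1 : set (bspace b1 -> H))
    (a2 : set (bspace b2 -> H)) (a3 : set (bspace b3 -> H)) : Prop :=
  CModule3 {
    cmod3_1 : @cmodule R b1 H a1 ;
    cmod3_2 : @cmodule R b2 H a2 ;
    cmod3_3 : @cmodule R b3 H a3 ;
    cmod3_12 : cspan [set rho a1 c \o xi | c in balgd b1 & xi in a2] = a2 ;
    cmod3_13 : cspan [set rho a1 c \o xi | c in balgd b1 & xi in a3] = a3 ;
    cmod3_21 : cspan [set rho a2 c \o xi | c in balgd b2 & xi in a1] = a1 ;
    cmod3_23 : cspan [set rho a2 c \o xi | c in balgd b2 & xi in a3] = a3 ;
    cmod3_31 : cspan [set rho a3 c \o xi | c in balgd b3 & xi in a1] = a1 ;
    cmod3_32 : cspan [set rho a3 c \o xi | c in balgd b3 & xi in a2] = a2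
  }.

(* A Hilbert space generated by elements [xi (x) z (x) eta] with the prescribed
   inner products.  It is determined by the data up to a unique unitary that
   respects these elements; all results are stated for an arbitrary one.
   [tens] is only meaningful on [beta] and [gamma]. *)
Record rtp (R : realType) (L H K : hilbertType R) (beta : set (L -> H))
    (gamma : set (L -> K)) := Rtp {
  rtp_space :> hilbertType R ;
  tens : (L -> H) -> L -> (L -> K) -> rtp_space ;
  tens_iprod : forall xi xi' z z' eta eta',
    beta xi -> beta xi' -> gamma eta -> gamma eta' ->
    iprod (tens xi z eta) (tens xi' z' eta')
    = iprod z (adj xi (xi' (adj eta (eta' z')))) ;
  tens_total : cspan_vec [set v | exists xi z eta,
    [/\ beta xi, gamma eta & v = tens xi z eta]] = [set: rtp_space]
}.

Section Ket.
Variables (R : realType) (L H K : hilbertType R).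
Variables (beta : set (L -> H)) (gamma : set (L -> K)).
Variable T : rtp beta gamma.

Definition ket1 (xi : L -> H) : K -> T :=
  xget (fun=> 0) [set X | bounded_op X /\
    forall eta z, gamma eta -> X (eta z) = tens T xi z eta].

Definition ket2 (eta : L -> K) : H -> T :=
  xget (fun=> 0) [set X | bounded_op X /\
    forall xi z, beta xi -> X (xi z) = tens T xi z eta].

(* alpha <| gamma = [ |gamma>_2 alpha ] *)
Definition ltri (J : hilbertType R) (alpha : set (J -> H)) : set (J -> T) :=
  cspan [set ket2 eta \o x | eta in gamma & x in alpha].

(* beta |> delta = [ |beta>_1 delta ] *)
Definition rtri (J : hilbertType R) (delta : set (J -> K)) : set (J -> T) :=
  cspan [set ket1 xi \o y | xi in beta & y in delta].

End Ket.

Arguments ket1 {R L H K beta gamma} T xi.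
Arguments ket2 {R L H K beta gamma} T eta.
Arguments ltri {R L H K beta gamma} T {J} alpha.
Arguments rtri {R L H K beta gamma} T {J} delta.

Definition op_id (R : realType) (L H H' K : hilbertType R)
    (beta : set (L -> H)) (beta' : set (L -> H'))
    (gamma : set (L -> K)) (T : rtp beta gamma) (T' : rtp beta' gamma)
    (S : H -> H') : T -> T' :=
  xget (fun=> 0) [set X | bounded_op X /\
    forall eta, gamma eta -> X \o ket2 T eta = ket2 T' eta \o S].

Arguments op_id {R L H H' K beta beta' gamma} T T' S.

Definition id_op (R : realType) (L H K K' : hilbertType R)
    (beta : set (L -> H)) (gamma : set (L -> K))
    (gamma' : set (L -> K')) (T : rtp beta gamma) (T' : rtp beta gamma')
    (S : K -> K') : T -> T' :=
  xget (fun=> 0) [set X | bounded_op X /\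
    forall xi, beta xi -> X \o ket1 T xi = ket1 T' xi \o S].

Arguments id_op {R L H K K' beta gamma gamma'} T T' S.

Definition op_op (R : realType) (L H K : hilbertType R) (beta : set (L -> H))
    (gamma : set (L -> K))
    (T : rtp beta gamma) (A : set (H -> H)) (B : set (K -> K)) : set (T -> T) :=
  [set op_id T T a \o id_op T T b | a in A & b in B].

Arguments op_op {R L H K beta gamma} T A B.

Definition flip (R : realType) (L H K : hilbertType R) (beta : set (L -> H))
    (gamma : set (L -> K))
    (T : rtp beta gamma) (T' : rtp gamma beta) : T -> T' :=
  xget (fun=> 0) [set X | bounded_op X /\
    forall xi z eta, beta xi -> gamma eta ->
      X (tens T xi z eta) = tens T' eta z xi].

Arguments flip {R L H K beta gamma} T T'.

(* The canonical isomorphism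
     (H (x) K)_{b1 |> b2} (x)_{g3} M -> H_{b1} (x)_{g2 <| g3} (K (x) M),
   which maps |eta>_2 |xi>_1 w to |xi>_1 |eta>_2 w, and its inverse. *)
Section Assoc.
Variables (R : realType) (L H K M : hilbertType R).
Variables (b1 : set (L -> H)) (g2 b2 : set (L -> K)) (g3 : set (L -> M)).
Variables (T12 : rtp b1 g2) (T23 : rtp b2 g3).
Variables (Pl : rtp (rtri T12 b2) g3) (Pr : rtp b1 (ltri T23 g2)).

Definition assoc : Pl -> Pr :=
  xget (fun=> 0) [set X | bounded_op X /\
    forall xi w eta, b1 xi -> g3 eta ->
      X (ket2 Pl eta (ket1 T12 xi w)) = ket1 Pr xi (ket2 T23 eta w)].

Definition assocV : Pr -> Pl :=
  xget (fun=> 0) [set X | bounded_op X /\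
    forall xi w eta, b1 xi -> g3 eta ->
      X (ket1 Pr xi (ket2 T23 eta w)) = ket2 Pl eta (ket1 T12 xi w)].

End Assoc.

Arguments assoc {R L H K M b1 g2 b2 g3 T12 T23} Pl Pr.
Arguments assocV {R L H K M b1 g2 b2 g3 T12 T23} Pl Pr.

(* [hb] is beta-hat, [T] is H_{hb} (x)_{al} H and
   [T'] is H_{al} (x)_{be} H. *)
Section Pentagon.
Variables (R : realType) (L H : hilbertType R) (hb al be : set (L -> H)).
Variables (T : rtp hb al) (T' : rtp al be) (V : T -> T').

Definition flip23 (P : rtp (ltri T' hb) al) (Q : rtp (ltri T al) be) : P -> Q :=
  xget (fun=> 0) [set X | bounded_op X /\
    forall xi eta w, be xi -> al eta ->
      X (ket2 P eta (ket2 T' xi w)) = ket2 Q xi (ket2 T eta w)].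

Arguments flip23 : clear implicits.

(* V_13 = Sigma_23 (V (x) id)(id (x) Sigma), where
     id (x) Sigma : P -> Q1r    with  Sigma : T' -> T0 = H_{be} (x)_{al} H,
     V (x) id     : Q1l -> Q2,
     Sigma_23     : Q2 -> Q,
   and [assocV] identifies Q1r with Q1l. *)
Definition V13 (T0 : rtp be al)
    (P : rtp hb (rtri T' al))
    (Q1r : rtp hb (ltri T0 al)) (Q1l : rtp (rtri T be) al)
    (Q2 : rtp (ltri T' hb) al)
    (Q : rtp (ltri T al) be) : P -> Q :=
  flip23 Q2 Q \o op_id Q1l Q2 V \o assocV Q1l Q1r
    \o id_op P Q1r (flip T' T0).

Arguments V13 : clear implicits.

(* V_23 V_12 = V_12 V_13 V_23.  The iterated products (with [l]: bracketed to
   the left, [r]: to the right) may be realized arbitrarily: since realizations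
   are unique up to unique isomorphism, the equation does not depend on their
   choice. *)
Definition pentagon : Prop :=
  exists (T0 : rtp be al)
    (P0l : rtp (rtri T hb) al) (P0r : rtp hb (ltri T al))
    (P1l : rtp (rtri T' hb) al) (P1r : rtp al (ltri T be))
    (P2l : rtp (rtri T' al) be) (P2r : rtp al (ltri T' be))
    (P3 : rtp hb (rtri T' al))
    (Q1r : rtp hb (ltri T0 al)) (Q1l : rtp (rtri T be) al)
    (Q2 : rtp (ltri T' hb) al)
    (P4 : rtp (ltri T al) be),
    id_op P1r P2r V \o assoc P1l P1r \o op_id P0l P1l V
    = assoc P2l P2r \o op_id P4 P2l V \o V13 T0 P3 Q1r Q1l Q2 P4
      \o id_op P0r P3 V \o assoc P0l P0r.

End Pentagon.

Record cpmu (R : realType) (b : cbase R) (H : hilbertType R)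
    (hb al be : set (bspace b -> H))
    (T : rtp hb al) (T' : rtp al be) (V : T -> T') : Prop := CPMU {
  cpmu_module : @cmodule3 R (dagger b) b (dagger b) H hb al be ;
  cpmu_unitary : unitary_op V ;
  cpmu_aa : [set V \o x | x in ltri T al] = rtri T' al ;
  cpmu_hb : [set V \o x | x in rtri T be] = ltri T' hb ;
  cpmu_hh : [set V \o x | x in rtri T hb] = rtri T' hb ;
  cpmu_ba : [set V \o x | x in ltri T be] = ltri T' be ;
  cpmu_pentagon : pentagon V
}.

Section Legs.
Variables (R : realType) (L H : hilbertType R) (hb al be : set (L -> H)).
Variables (T : rtp hb al) (T' : rtp al be) (V : T -> T').

Definition leg_hat : set (H -> H) :=
  cspan [set adj (ket2 T' xi) \o V \o ket2 T eta | xi in be & eta in al].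

Definition leg : set (H -> H) :=
  cspan [set adj (ket1 T' eta) \o V \o ket1 T zeta | eta in al & zeta in hb].

Definition Delta_hat (y : H -> H) : T -> T := adj V \o id_op T' T' y \o V.

Definition Delta (z : H -> H) : T' -> T' := V \o op_id T T z \o adj V.

End Legs.

Definition seqs (R : realType) (L H : hilbertType R) (alpha : set (L -> H))
    : set (nat -> L -> H) :=
  [set eta | (forall k, alpha (eta k)) /\
    exists S, op_series_to (fun k => adj (eta k) \o eta k) S].

Definition seqs_norm (R : realType) (L H : hilbertType R) (eta : nat -> L -> H)
    : R :=
  Num.sqrt (opnorm (op_series (fun k => adj (eta k) \o eta k))).

(* A map defined on a set A of operators is encoded by its extension by 0. *)
Definition on_set (R : realType) (H : hilbertType R) (V : zmodType)
    (A : set (H -> H)) (f : (H -> H) -> V) :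
  (H -> H) -> V := patch (fun=> 0) A f.

Definition omega (R : realType) (L H : hilbertType R) (A : set (H -> H))
    (eta eta' : nat -> L -> H) :
  (H -> H) -> L -> L :=
  on_set A (fun T => op_series (fun k => adj (eta k) \o T \o eta' k)).

Definition Omega (R : realType) (L H : hilbertType R)
    (beta alpha : set (L -> H)) (A : set (H -> H)) :
  set ((H -> H) -> L -> L) :=
  [set omega A eta eta' | eta in seqs beta & eta' in seqs alpha].

Definition Omega_norm (R : realType) (L H : hilbertType R)
    (beta alpha : set (L -> H)) (A : set (H -> H))
    (w : (H -> H) -> L -> L) : R :=
  inf [set r | exists eta eta', [/\ seqs beta eta, seqs alpha eta',
    w = omega A eta eta' & r = seqs_norm eta * seqs_norm eta']].

Record banach_space (R : realType) (E : lmodType R[i]) (S : set E) (N : E -> R)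
    : Prop :=
  BanachSpace {
    bs_zero : S 0 ;
    bs_lin : forall (a : R[i]) x y, S x -> S y -> S (a *: x + y) ;
    bs_ge0 : forall x, S x -> 0 <= N x ;
    bs_eq0 : forall x, S x -> N x = 0 -> x = 0 ;
    bs_scale : forall (a : R[i]) x, S x -> N (a *: x) = complex.Re `|a| * N x ;
    bs_tri : forall x y, S x -> S y -> N (x + y) <= N x + N y ;
    bs_complete : forall u : nat -> E, (forall n, S (u n)) ->
      (forall e : R, 0 < e -> exists n0,
         forall m n, (n0 <= m)%N -> (n0 <= n)%N -> N (u m - u n) < e) ->
      exists2 x, S x & (fun n => N (u n - x)) @ \oo --> (0 : R)
  }.

Definition bilinear_on (R : realType) (E F G : lmodType R[i]) (S : set E)
    (S' : set F) (m : E -> F -> G) : Prop :=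
  (forall (a : R[i]) x x' y, S x -> S x' -> S' y ->
     m (a *: x + x') y = a *: m x y + m x' y) /\
  (forall (a : R[i]) x y y', S x -> S' y -> S' y' ->
     m x (a *: y + y') = a *: m x y + m x y').

Record banach_algebra (R : realType) (E : lmodType R[i]) (S : set E)
    (N : E -> R) (mul : E -> E -> E) : Prop := BanachAlgebra {
  ba_space : banach_space S N ;
  ba_closed : forall x y, S x -> S y -> S (mul x y) ;
  ba_bilinear : bilinear_on S S mul ;
  ba_assoc : forall x y z, S x -> S y -> S z ->
    mul x (mul y z) = mul (mul x y) z ;
  ba_submul : forall x y, S x -> S y -> N (mul x y) <= N x * N y
}.

Section ProjectiveTensor.
Variables (R : realType) (E F : lmodType R[i]) (S : set E) (N : E -> R)
  (S' : set F) (N' : F -> R).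

(* Finite families (x_i, y_i) stand for the formal sums \sum_i x_i (x) y_i. *)
Definition in_tensor (s : seq (E * F)) : Prop :=
  forall p, p \in s -> S p.1 /\ S' p.2.

(* Two formal sums represent the same element of the algebraic tensor product. *)
Definition tensor_eq (s s' : seq (E * F)) : Prop :=
  forall (W : lmodType R[i]) (m : {bilinear E -> F -> W}),
    \sum_(p <- s) m p.1 p.2 = \sum_(p <- s') m p.1 p.2.

Definition proj_norm (s : seq (E * F)) : R :=
  inf [set r | exists s', [/\ in_tensor s', tensor_eq s s' &
    r = \sum_(p <- s') N p.1 * N' p.2]].

(* (P, t) is the projective tensor product of (S, N) and (S', N'): a completion
   of the algebraic tensor product for the projective norm. *)
Record projective_tensor (P : completeNormedModType R[i]) (t : E -> F -> P) :
  Prop := ProjectiveTensor {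
    pt_bilinear : bilinear_on S S' t ;
    pt_norm : forall s, in_tensor s ->
      rnorm (\sum_(p <- s) t p.1 p.2) = proj_norm s ;
    pt_dense : closure (lspan [set t x y | x in S & y in S']) = [set: P]
  }.

(* m induces a linear contraction, x (x) y |-> m x y, from the projective tensor
   product to (U, NU). *)
Definition proj_contraction (G : lmodType R[i]) (U : set G) (NU : G -> R)
    (m : E -> F -> G) : Prop :=
  forall (P : completeNormedModType R[i]) (t : E -> F -> P),
    projective_tensor t ->
    exists f : {linear P -> G},
      (forall p, U (f p) /\ NU (f p) <= rnorm p) /\
      (forall x y, S x -> S' y -> f (t x y) = m x y).

End ProjectiveTensor.

Definition contractive_hom (R : realType) (E : lmodType R[i]) (S : set E)
    (N : E -> R) (mul : E -> E -> E) (H : hilbertType R) (A : set (H -> H))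
    (f : E -> H -> H) : Prop :=
  [/\ forall x, S x -> A (f x),
      forall (a : R[i]) x y, S x -> S y -> f (a *: x + y) = a *: f x + f y,
      forall x y, S x -> S y -> f (mul x y) = f x \o f y &
      forall x, S x -> opnorm (f x) <= N x].

(* Main.v *)
(** A map [omega_{xi,eta}] is a pairing [T |-> \sum_k xi_k^* T eta_k] of two
    square-summable families.  On matrix coefficients
    [omega (x) omega' (S) = \sum_{m,n} xi_m^* (xi'_n)^*_2 S (eta_m)_1 eta'_n], and
    since the slices [(xi)^*_2 S (xi')_2] and [(eta)^*_1 S (eta')_1] of [S] lie again in
    the commutant, this double sum depends on each factor only through the map
    it defines; this gives the box product.

    The point where composition with [Delta_V] could fail to land in [Omega] is
    handled by cutting a family [psi] in [ [k_e alpha | e] ], with kets [k_e], into pieces: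
    if [g] is a multiple of a finite sum [\sum_i k_i k_i^*] with [0 <= g <= 1], then the
    recursion [u_{l+1} = u_l - g u_l^2], [u_0 = 1], satisfies
    [1 - u_n = \sum_{l<n} u_l g u_l], a sum of squares of the maps [k_i^* u_l], which send [psi]
    into [alpha], while [u_n psi] is small.

    The pentagon equation enters through the threefold products only: conjugating
    [Z (x) 1 (x) 1] along its two sides shows that both slices of
    [(Delta (x) id) Delta Z = (id (x) Delta) Delta Z] come from one operator, so the two
    ways of bracketing a product are rearrangements of one triple sum.  The
    representation is determined by
    [<alpha z, pi(omega) zeta z'> = <z, omega(<alpha|_1 V |zeta>_1) z'>], and similarly for the other
    leg, and it is multiplicative because of the pentagon equation again. *)

From HB Require Import structures.
Require Import Defs.
From mathcomp Require Import all_boot all_order all_algebra.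
From mathcomp Require Import complex.
From mathcomp Require Import all_classical all_reals all_analysis.
From mathcomp Require Import ring lra.

Set Implicit Arguments.
Unset Strict Implicit.
Unset Printing Implicit Defensive.

Import Order.TTheory GRing.Theory Num.Theory.
Import numFieldNormedType.Exports.

Local Open Scope classical_set_scope.
Local Open Scope ring_scope.
Local Open Scope complex_scope.

(** * Hilbert spaces and adjoints *)

(** Nearly every operator is chosen by [xget], so its existence and boundedness have to be proved.
    On generators only inner products are known, and the form of the image is that of the source
    twisted by a positive map such as [eta^* eta]; the norm bound comes from Cauchy-Schwarz and
    log-convexity of the iterated twist, without square roots of operators. Sums are unordered and
    read on matrix coefficients, so rearrangement and Fubini are elementary and index sets may be
    products or unions; sequences return through zero padding.

    The obstacle behind the cutting: [V^*] sends [|xi'>_2 xi] into a closed span, and an element of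
    a closed span is not given as a column sum of controlled norm. One cut leaves a remainder.
    Repeated with geometrically shrinking bounds, the norms of the pieces add up to the original
    bound plus an arbitrarily small error, whence submultiplicativity with constant 1.

    Duality halves much of the work: exchanging the legs and passing to [V^*] swaps [hb] and
    [be]. *)

Local Notation "a ^cj" := (@Num.conj _ a) (at level 2, format "a ^cj").

Section Scalars.
Variable R : realType.
Implicit Types a c : R[i].

(** [R[i]] is only partially ordered and its norm takes values in [R[i]]; estimates are carried out
    in [R], where order tactics apply. *)
Definition cabs (a : R[i]) : R := complex.Re `|a|.

Lemma normcE' a : `|a| = (cabs a)%:C.
Proof. by rewrite /cabs normc_def. Qed.

Lemma cabs_ge0 a : 0 <= cabs a.
Proof. by rewrite -ler0c -normcE'. Qed.

Lemma cabsM a c : cabs (a * c) = cabs a * cabs c.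
Proof. by apply: complexI; rewrite rmorphM -!normcE' normrM. Qed.

Lemma cabsD a c : cabs (a + c) <= cabs a + cabs c.
Proof. by rewrite -lecR rmorphD -!normcE' ler_normD. Qed.

Lemma cabs0 : cabs 0 = 0.
Proof. by apply: complexI; rewrite -normcE' normr0. Qed.

Lemma cabs1 : cabs 1 = 1.
Proof. by apply: complexI; rewrite -normcE' normr1. Qed.

Lemma cabs_eq0 a : cabs a = 0 -> a = 0.
Proof. by move=> h; apply/eqP; rewrite -normr_eq0 normcE' h. Qed.

Lemma cabsN a : cabs (- a) = cabs a.
Proof. by apply: complexI; rewrite -!normcE' normrN. Qed.

Lemma cabsB a c : cabs (a - c) = cabs (c - a).
Proof. by rewrite -cabsN opprB. Qed.

Lemma cabs_conj a : cabs (a^cj) = cabs a.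
Proof. by apply: complexI; rewrite -!normcE' norm_conjC. Qed.

Lemma cabs_real (r : R) : cabs (r%:C) = `|r|.
Proof. by apply: complexI; rewrite -normcE' normc_def /= expr0n /= addr0 sqrtr_sqr. Qed.

Lemma Re_le_cabs a : complex.Re a <= cabs a.
Proof.
apply: le_trans (ler_norm _) _.
by rewrite -lecR -normcE' normc_ge_Re.
Qed.

Lemma Re_conj a : complex.Re (a^cj) = complex.Re a.
Proof. by apply: complexI; rewrite !complexRe Re_conj. Qed.

Lemma conj_real (r : R) : (r%:C)^cj = r%:C.
Proof. by apply/CrealP; rewrite complex_real. Qed.

Lemma mulc_conj a : a * a^cj = (cabs a ^+ 2)%:C.
Proof. by rewrite -normCK normcE' rmorphXn. Qed.

Lemma ReD a c : complex.Re (a + c) = complex.Re a + complex.Re c.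
Proof. by case: a c => [? ?] [? ?]. Qed.

Lemma ReN a : complex.Re (- a) = - complex.Re a.
Proof. by case: a. Qed.

Lemma ReB a c : complex.Re (a - c) = complex.Re a - complex.Re c.
Proof. by rewrite ReD ReN. Qed.

Lemma Re_realM (r : R) a : complex.Re (r%:C * a) = r * complex.Re a.
Proof. by case: a => x y /=; rewrite mul0r subr0. Qed.

Lemma cabs_sum (I : Type) (s : seq I) (F : I -> R[i]) :
  cabs (\sum_(i <- s) F i) <= \sum_(i <- s) cabs (F i).
Proof.
elim/big_ind2: _ => [|x x' y y' h h'|//]; first by rewrite cabs0.
by apply: le_trans (cabsD _ _) _; apply: lerD.
Qed.

Lemma cabs_small a : (forall e : R, 0 < e -> cabs a <= e) -> a = 0.
Proof.
move=> h; apply: cabs_eq0; apply/eqP; rewrite eq_le cabs_ge0 andbT.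
by apply/ler_addgt0Pr => e e0; rewrite add0r h.
Qed.

End Scalars.

Lemma ltcR0 (R : realType) (r : R) : (0 < r%:C) = (0 < r).
Proof. exact: ltcR. Qed.

Section Norm.
Variables (R : realType) (V : normedModType R[i]).
Implicit Types x y : V.

Lemma rnormE x : `|x| = (rnorm x)%:C.
Proof.
have : 0 <= `|x| by [].
by rewrite /rnorm; case: (`|x|) => p q; rewrite lecE /= => /andP[/eqP -> _].
Qed.

Lemma rnorm_ge0 x : 0 <= rnorm x.
Proof. by rewrite -ler0c -rnormE. Qed.

Lemma rnormD x y : rnorm (x + y) <= rnorm x + rnorm y.
Proof. by rewrite -lecR rmorphD /= -!rnormE ler_normD. Qed.

Lemma rnormZ (a : R[i]) x : rnorm (a *: x) = cabs a * rnorm x.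
Proof. by apply: complexI; rewrite rmorphM -[X in X * _]normcE' -[X in _ * X]rnormE -normrZ rnormE. Qed.

Lemma rnorm0 : rnorm (0 : V) = 0.
Proof. by apply: complexI; rewrite -rnormE normr0. Qed.

Lemma rnorm_eq0 x : rnorm x = 0 -> x = 0.
Proof. by move=> h; apply/eqP; rewrite -normr_eq0 rnormE h. Qed.

Lemma rnormN x : rnorm (- x) = rnorm x.
Proof. by apply: complexI; rewrite -!rnormE normrN. Qed.

Lemma rnormB x y : rnorm (x - y) = rnorm (y - x).
Proof. by rewrite -rnormN opprB. Qed.

Lemma rnorm_small x : (forall e : R, 0 < e -> rnorm x <= e) -> x = 0.
Proof.
move=> h; apply: rnorm_eq0; apply/eqP; rewrite eq_le rnorm_ge0 andbT.
by apply/ler_addgt0Pr => e e0; rewrite add0r h.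
Qed.

Lemma rnorm_dist x y z : rnorm (x - z) <= rnorm (x - y) + rnorm (y - z).
Proof. by have := rnormD (x - y) (y - z); rewrite addrA subrK. Qed.

Lemma rnorm_small_sub x y :
  (forall e : R, 0 < e -> rnorm (x - y) <= e) -> x = y.
Proof. by move=> h; apply/eqP; rewrite -subr_eq0; apply/eqP/rnorm_small. Qed.

(** Radii of balls are elements of [R[i]]; a positive one is real, so real radii suffice. *)
Lemma closureP_rnorm (A : set V) x :
  closure A x <-> forall e : R, 0 < e -> exists2 y, A y & rnorm (x - y) <= e.
Proof.
split=> [cA e e0|h B].
  have : nbhs x (ball x (e%:C : R[i])) by apply: nbhsx_ballx; rewrite ltcR0.
  move/cA => [y [Ay]]; rewrite -ball_normE /= rnormE ltcR => /ltW h.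
  by exists y.
move/nbhs_normP => [e] /= e0 eB.
have eE : e = (complex.Re e)%:C.
  by move: (ltW e0); case: e {e0 eB} => p q; rewrite lecE /= => /andP[/eqP -> _].
have e0' : 0 < complex.Re e by rewrite -ltcR0 -eE //.
have [y Ay xy] := h _ (divr_gt0 e0' (ltr0n _ 2)).
exists y; split=> //; apply: eB => /=.
rewrite rnormE eE ltcR; apply: le_lt_trans xy _.
by rewrite ltr_pdivrMr ?ltr0n // ltr_pMr // ltr1n.
Qed.

End Norm.

Lemma complete_rnorm (R : realType) (V : completeNormedModType R[i])
    (u : nat -> V) :
  (forall e : R, 0 < e -> exists N, forall m n, (N <= m)%N -> (N <= n)%N ->
     rnorm (u m - u n) <= e) ->
  exists x, forall e : R, 0 < e -> exists N, forall n, (N <= n)%N ->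
    rnorm (u n - x) <= e.
Proof.
move=> h.
have cu : cauchy (u @ \oo).
  apply: cauchy_exP => e e0.
  have eE : e = (complex.Re e)%:C.
    by move: (ltW e0); case: e {e0} => p q; rewrite lecE /= => /andP[/eqP -> _].
  have e0' : 0 < complex.Re e by rewrite -ltcR0 -eE.
  have [N hN] := h _ (divr_gt0 e0' (ltr0n _ 2)).
  exists (u N), N => // n /= Nn; rewrite -ball_normE /= rnormE eE ltcR.
  apply: le_lt_trans (hN _ _ (leqnn N) Nn) _.
  by rewrite ltr_pdivrMr ?ltr0n // ltr_pMr // ltr1n.
have /cauchy_cvgP /cvg_ex [x ux] := cu.
exists x => e e0.
have /cvgrPdist_le := ux; move=> /(_ e%:C).
rewrite ltcR0 => /(_ e0) [N _ hN].
by exists N => n Nn; have := hN n Nn; rewrite rnormE lecR rnormB.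
Qed.

Section LinearLemmas.
Variables (K : pzRingType) (V W : lmodType K) (f : V -> W).
Hypothesis lf : linear f.

Lemma linD x y : f (x + y) = f x + f y.
Proof. by have := lf 1 x y; rewrite !scale1r. Qed.

Lemma lin0 : f 0 = 0.
Proof. by apply: (addIr (f 0)); rewrite -linD !add0r. Qed.

Lemma linZ a x : f (a *: x) = a *: f x.
Proof. by have := lf a x 0; rewrite !addr0 lin0 addr0. Qed.

Lemma linN x : f (- x) = - f x.
Proof. by rewrite -scaleN1r linZ scaleN1r. Qed.

Lemma linB x y : f (x - y) = f x - f y.
Proof. by rewrite linD linN. Qed.

Lemma lin_sum (I : Type) (s : seq I) (F : I -> V) :
  f (\sum_(i <- s) F i) = \sum_(i <- s) f (F i).
Proof. by elim/big_rec2: _ => [|i y x _ <-]; rewrite ?lin0 ?linD. Qed.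

End LinearLemmas.

Section Lspan.
Variables (K : pzRingType) (V : lmodType K).
Implicit Types Y : set V.

Lemma lspan0 Y : lspan Y 0.
Proof.
by exists 0%N, (fun=> 0), (fun=> 0); split=> [[] //|]; rewrite big_ord0.
Qed.

Lemma lspan_gen Y v : Y v -> lspan Y v.
Proof.
move=> Yv; exists 1%N, (fun=> 1), (fun=> v); split=> //.
by rewrite big_ord1 scale1r.
Qed.

Lemma lspan_lin Y a u v : lspan Y u -> lspan Y v -> lspan Y (a *: u + v).
Proof.
move=> [n [c [x [Yx ->]]]] [m [d [y [Yy ->]]]].
exists (n + m)%N.
exists (fun i : 'I_(n + m) =>
          match fintype.split i with inl j => a * c j | inr j => d j end).
exists (fun i : 'I_(n + m) =>
          match fintype.split i with inl j => x j | inr j => y j end).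
split=> [i|]; first by case: (fintype.split i).
rewrite big_split_ord scaler_sumr; congr (_ + _); apply: eq_bigr => i _.
  by rewrite (unsplitK (inl i : 'I_n + 'I_m)) scalerA.
by rewrite (unsplitK (inr i : 'I_n + 'I_m)).
Qed.

Lemma lspan_ind Y (P : V -> Prop) :
  P 0 -> (forall a u v, Y u -> P v -> P (a *: u + v)) ->
  forall v, lspan Y v -> P v.
Proof.
move=> P0 PS v [n [a [y [Yy ->]]]].
elim: n a y Yy => [|n IH] a y Yy; first by rewrite big_ord0.
by rewrite big_ord_recl; apply: PS => //; apply: IH.
Qed.

Lemma lspan_sub Y Z : Y `<=` lspan Z -> lspan Y `<=` lspan Z.
Proof.
move=> YZ; apply: lspan_ind; first exact: lspan0.
by move=> a u v Yu Zv; apply: lspan_lin => //; apply: YZ.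
Qed.

Lemma lspan_range (I : Type) (e : I -> V) v :
  lspan (range e) v -> exists s : seq (K * I), v = \sum_(p <- s) p.1 *: e p.2.
Proof.
move: v; apply: lspan_ind; first by exists [::]; rewrite big_nil.
by move=> a _ v [i _ <-] [s ->]; exists ((a, i) :: s); rewrite big_cons.
Qed.

End Lspan.

(** * Inner products and the Riesz representation *)

Section InnerProduct.
Variables (R : realType) (H : hilbertType R).
Implicit Types x y z : H.
Implicit Types a : R[i].

Lemma iprodDr x y z : iprod x (y + z) = iprod x y + iprod x z.
Proof. exact: linearDl. Qed.

Lemma iprodZr a x y : iprod x (a *: y) = a * iprod x y.
Proof. exact: linearZl_LR. Qed.

Lemma iprodDl x y z : iprod (x + y) z = iprod x z + iprod y z.
Proof. exact: linearDr. Qed.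

Lemma iprodZl a x y : iprod (a *: x) y = a^cj * iprod x y.
Proof. exact: linearZr_LR. Qed.

Lemma iprodC x y : iprod y x = (iprod x y)^cj.
Proof. by rewrite /iprod hermC expr0 mul1r. Qed.

Lemma iprod0r x : iprod x 0 = 0.
Proof. by rewrite -(scale0r x) iprodZr mul0r. Qed.

Lemma iprod0l x : iprod 0 x = 0.
Proof. by rewrite iprodC iprod0r conjC0. Qed.

Lemma iprodNr x y : iprod x (- y) = - iprod x y.
Proof. by rewrite -scaleN1r iprodZr mulN1r. Qed.

Lemma iprodBr x y z : iprod x (y - z) = iprod x y - iprod x z.
Proof. by rewrite iprodDr iprodNr. Qed.

Lemma iprodNl x y : iprod (- x) y = - iprod x y.
Proof. by rewrite -scaleN1r iprodZl rmorphN rmorph1 mulN1r. Qed.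

Lemma iprodBl x y z : iprod (x - y) z = iprod x z - iprod y z.
Proof. by rewrite iprodDl iprodNl. Qed.

Lemma iprod_sumr (I : Type) (s : seq I) x (F : I -> H) :
  iprod x (\sum_(i <- s) F i) = \sum_(i <- s) iprod x (F i).
Proof. by elim/big_rec2: _ => [|i y z _ <-]; rewrite ?iprod0r ?iprodDr. Qed.

Lemma iprod_suml (I : Type) (s : seq I) x (F : I -> H) :
  iprod (\sum_(i <- s) F i) x = \sum_(i <- s) iprod (F i) x.
Proof. by elim/big_rec2: _ => [|i y z _ <-]; rewrite ?iprod0l ?iprodDl. Qed.

Lemma iprodxx x : iprod x x = (rnorm x ^+ 2)%:C.
Proof. by rewrite /iprod hdot_norm rnormE rmorphXn. Qed.

Lemma Re_iprodxx x : complex.Re (iprod x x) = rnorm x ^+ 2.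
Proof. by rewrite iprodxx. Qed.

Lemma rnorm_sqD x y :
  rnorm (x + y) ^+ 2 = rnorm x ^+ 2 + rnorm y ^+ 2
                       + 2 * complex.Re (iprod x y).
Proof.
rewrite -!Re_iprodxx iprodDr !iprodDl !ReD.
have -> : complex.Re (iprod y x) = complex.Re (iprod x y).
  by rewrite iprodC Re_conj.
by lra.
Qed.

Lemma rnorm_sqB x y :
  rnorm (x - y) ^+ 2 = rnorm x ^+ 2 + rnorm y ^+ 2
                       - 2 * complex.Re (iprod x y).
Proof. by rewrite rnorm_sqD rnormN iprodNr ReN mulrN. Qed.

Lemma cauchy_schwarz x y : cabs (iprod x y) <= rnorm x * rnorm y.
Proof.
have [/rnorm_eq0 ->|y0] := eqVneq (rnorm y) 0.
  by rewrite iprod0r cabs0 rnorm0 mulr0.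
have yp : 0 < rnorm y by rewrite lt0r y0 rnorm_ge0.
(* [t *: y] is the orthogonal projection of [x] onto the line through [y]; the squared length of the
   remainder is nonnegative. *)
set c := iprod y x; pose t := c / (rnorm y ^+ 2)%:C.
have : 0 <= rnorm (x - t *: y) ^+ 2 by rewrite sqr_ge0.
rewrite rnorm_sqB rnormZ iprodZr.
have cE : iprod x y = c^cj by rewrite /c -iprodC.
have tE : cabs t = cabs c / rnorm y ^+ 2.
  rewrite /t cabsM; congr (_ * _).
  by rewrite -fmorphV cabs_real ger0_norm // invr_ge0 sqr_ge0.
have -> : complex.Re (t * iprod x y) = cabs c ^+ 2 / rnorm y ^+ 2.
  rewrite cE /t mulrAC mulc_conj -fmorphV -rmorphM /=.
  by [].
rewrite cE cabs_conj tE.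
have -> : (cabs c / rnorm y ^+ 2 * rnorm y) ^+ 2 = cabs c ^+ 2 / rnorm y ^+ 2.
  by field.
move=> h.
have : cabs c ^+ 2 / rnorm y ^+ 2 <= rnorm x ^+ 2 by lra.
rewrite ler_pdivrMr ?exprn_gt0 // -exprMn ler_sqr ?nnegrE //.
  exact: cabs_ge0.
by rewrite mulr_ge0 ?rnorm_ge0.
Qed.

Lemma iprod_ext x y : (forall z, iprod z x = iprod z y) -> x = y.
Proof.
move=> h; apply/eqP; rewrite -subr_eq0; apply/eqP/rnorm_eq0.
apply/eqP; rewrite -sqrf_eq0 -Re_iprodxx iprodBr h subrr.
by rewrite eqxx.
Qed.

Lemma iprod_extl x y : (forall z, iprod x z = iprod y z) -> x = y.
Proof. by move=> h; apply: iprod_ext => z; rewrite iprodC h -iprodC. Qed.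

End InnerProduct.

(** A nonzero slope at [t = 0] makes the quadratic negative nearby. The point [- B / (A + 1)] also
    works for [A = 0]; the value there is [- B ^+ 2 / (A + 1) ^+ 2]. *)
Lemma real_quad_ge0 (R : realType) (A B : R) :
  0 <= A -> (forall t : R, 0 <= t ^+ 2 * A + t * B) -> B = 0.
Proof.
move=> A0 h; apply/eqP; apply: contraT => B0.
have h1 : 0 < B ^+ 2 by rewrite lt0r sqr_ge0 sqrf_eq0 B0.
have := h (- B / (A + 1)).
have -> : (- B / (A + 1)) ^+ 2 * A + - B / (A + 1) * B
        = - (B ^+ 2 / (A + 1) ^+ 2).
  by field; apply/eqP; lra.
rewrite oppr_ge0 leNgt divr_gt0 // exprn_gt0 //; lra.
Qed.

Lemma archi_inv (R : realType) (e : R) : 0 < e ->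
  exists N : nat, forall n, (N <= n)%N -> n.+1%:R^-1 <= e.
Proof.
move=> e0; exists (Num.truncn e^-1) => n hn.
rewrite -[e]invrK lef_pV2 ?posrE ?ltr0n ?invr_gt0 //.
by apply: le_trans (ltW (truncnS_gt _)) _; rewrite ler_nat ltnS.
Qed.

(* The representing vector is the minimiser of [|x|^2 - 2 Re (phi x)]; a
   minimising sequence is Cauchy by the parallelogram law. *)
Lemma riesz (R : realType) (H : hilbertType R) (phi : H -> R[i]) (M : R) :
  (forall a x y, phi (a *: x + y) = a * phi x + phi y) ->
  (forall x, cabs (phi x) <= M * rnorm x) ->
  exists y, forall x, iprod y x = phi x.
Proof.
move=> lphi bphi.
have phiD x y : phi (x + y) = phi x + phi y.
  by have := lphi 1 x y; rewrite scale1r mul1r.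
have phi0 : phi 0 = 0 by apply: (addIr (phi 0)); rewrite -phiD !add0r.
have phiZ a x : phi (a *: x) = a * phi x.
  by have := lphi a x 0; rewrite addr0 phi0 addr0.
have phiB x y : phi (x - y) = phi x - phi y.
  by rewrite phiD -scaleN1r phiZ mulN1r.
pose J x := rnorm x ^+ 2 - 2 * complex.Re (phi x).
have Jlb x : - M ^+ 2 <= J x.
  have h1 := le_trans (Re_le_cabs (phi x)) (bphi x).
  have h2 := sqr_ge0 (rnorm x - M).
  rewrite /J; nra.
pose JJ := [set J x | x in [set: H]].
have JJinf : has_inf JJ.
  by split; [exists (J 0), 0|exists (- M ^+ 2) => _ [x _ <-]].
pose m := inf JJ.
have Jm x : m <= J x by apply: ge_inf; [case: JJinf|exists x].
have par x y : rnorm (x - y) ^+ 2 <= 2 * ((J x - m) + (J y - m)).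
  have := Jm ((2^-1)%:C *: (x + y)).
  rewrite /J phiZ Re_realM phiD ReD rnormZ cabs_real ger0_norm; last by lra.
  rewrite exprMn rnorm_sqD rnorm_sqB.
  by lra.
have ex n : exists x, J x <= m + n.+1%:R^-1.
  have [_ [x _ <-] h] : exists2 r, JJ r & r < m + n.+1%:R^-1.
    by apply: inf_adherent => //; rewrite invr_gt0 ltr0n.
  by exists x; exact: ltW.
have [u hu] := choice ex.
have [e e0|y hy] := complete_rnorm (u := u).
  have e2 : 0 < e ^+ 2 / 4 by rewrite divr_gt0 ?exprn_gt0.
  have [N hN] := archi_inv e2.
  exists N => i j Ni Nj.
  rewrite -ler_sqr ?nnegrE ?rnorm_ge0 ?(ltW e0) //.
  apply: le_trans (par _ _) _.
  have := hN i Ni; have := hN j Nj; have := hu i; have := hu j.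
  move: (J (u i)) (J (u j)) (i.+1%:R^-1) (j.+1%:R^-1) (e ^+ 2) => p q r s t.
  lra.
(* First variation at the limit [y]: since [m <= J (u n + t v)] and [J (u n)] tends to [m], the
   quadratic [t^2 |v|^2 + 2 t Re (<y, v> - phi v)] is nonnegative up to an arbitrary error [d]. *)
have key v : complex.Re (iprod y v - phi v) = 0.
  suff: 2 * complex.Re (iprod y v - phi v) = 0 by lra.
  apply: (real_quad_ge0 (sqr_ge0 (rnorm v))) => t.
  apply/ler_addgt0Pr => d d0.
  have [N1 h1] := archi_inv (divr_gt0 d0 (ltr0n _ 2)).
  have e0 : 0 < d / 2 / (2 * `|t| * rnorm v + 1).
    rewrite divr_gt0 ?divr_gt0 //.
    by have := mulr_ge0 (normr_ge0 t) (rnorm_ge0 v); lra.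
  have [N2 h2] := hy _ e0.
  pose n := maxn N1 N2.
  have {}h1 := h1 n (leq_maxl _ _); have {}h2 := h2 n (leq_maxr _ _).
  have := Jm (u n + t%:C *: v); have := hu n.
  rewrite /J.
  have -> : complex.Re (phi (u n + t%:C *: v))
          = complex.Re (phi (u n)) + t * complex.Re (phi v).
    by rewrite phiD phiZ ReD Re_realM.
  have -> : rnorm (u n + t%:C *: v) ^+ 2 = rnorm (u n) ^+ 2
      + t ^+ 2 * rnorm v ^+ 2 + 2 * (t * complex.Re (iprod (u n) v)).
    rewrite rnorm_sqD rnormZ cabs_real iprodZr Re_realM exprMn real_normK //.
    exact: num_real.
  rewrite [in X in _ -> _ -> X]ReB.
  have : `|t * complex.Re (iprod (u n - y) v)| <= d / 4.
    rewrite normrM.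
    have : `|complex.Re (iprod (u n - y) v)| <= rnorm (u n - y) * rnorm v.
      apply: le_trans (cauchy_schwarz _ _).
      by rewrite ler_norml Re_le_cabs andbT lerNl -ReN -cabsN Re_le_cabs.
    move=> h3.
    apply: le_trans (ler_wpM2l (normr_ge0 t) h3) _.
    have h4 : 0 < 2 * `|t| * rnorm v + 1.
      by have := mulr_ge0 (normr_ge0 t) (rnorm_ge0 v); lra.
    move: h2; rewrite ler_pdivlMr // => h2.
    have := mulr_ge0 (normr_ge0 t) (rnorm_ge0 v).
    have := rnorm_ge0 (u n - y); move: h2.
    by set X := rnorm _; set T := `|t|; set Y := rnorm v; nra.
  rewrite iprodBl ReB ler_norml => /andP[].
  move: (d : R) h1 (complex.Re (iprod (u n) v)) (complex.Re (iprod y v)).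
  move: (rnorm (u n) ^+ 2) (complex.Re (phi (u n))) (complex.Re (phi v)).
  move: (n.+1%:R^-1) (m) (t ^+ 2 * rnorm v ^+ 2); clear => *; lra.
exists y => v; apply/eqP; rewrite -subr_eq0; apply/eqP/cabs_eq0.
set w := _ - _.
(* Only real parts are known to vanish; the factor [w^cj] turns the real part into [|w|^2]. *)
have := key (w^cj *: v).
rewrite iprodZr phiZ -mulrBr -/w mulrC mulc_conj /= => /eqP.
by rewrite sqrf_eq0 => /eqP.
Qed.

(** * Bounded operators and their adjoints *)

Section Operators.
Variable R : realType.
Implicit Types H K L : hilbertType R.

Lemma bounded_lin H K (T : H -> K) : bounded_op T -> linear T.
Proof. by case. Qed.

Lemma op_bound_le H K (T : H -> K) M N :
  M <= N -> op_bound T M -> op_bound T N.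
Proof.
move=> MN [M0 h]; split=> [|x]; first exact: le_trans MN.
by apply: le_trans (h x) _; rewrite ler_wpM2r // rnorm_ge0.
Qed.

Lemma op_bound_gt0 H K (T : H -> K) :
  bounded_op T -> exists2 M, 0 < M & op_bound T M.
Proof.
move=> [_ [M h]]; exists (M + 1); last by apply: op_bound_le h; rewrite lerDl.
by case: h => M0 _; apply: ltr_wpDl.
Qed.

Lemma op_bound0 H K : op_bound (fun _ : H => 0 : K) 0.
Proof. by split=> // x; rewrite rnorm0 mul0r. Qed.

Lemma op_boundD H K (S T : H -> K) M N :
  op_bound S M -> op_bound T N -> op_bound (S + T) (M + N).
Proof.
move=> [M0 hM] [N0 hN]; split=> [|x]; first exact: addr_ge0.
by apply: le_trans (rnormD _ _) _; rewrite mulrDl lerD.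
Qed.

Lemma op_boundZ H K (a : R[i]) (T : H -> K) M :
  op_bound T M -> op_bound (a *: T) (cabs a * M).
Proof.
move=> [M0 hM]; split=> [|x]; first by rewrite mulr_ge0 ?cabs_ge0.
by rewrite -mulrA rnormZ ler_wpM2l ?cabs_ge0.
Qed.

Lemma op_boundN H K (T : H -> K) M : op_bound T M -> op_bound (- T) M.
Proof. by move=> [M0 hM]; split=> // x; rewrite rnormN. Qed.

Lemma op_boundB H K (S T : H -> K) M N :
  op_bound S M -> op_bound T N -> op_bound (S - T) (M + N).
Proof. by move=> hS /op_boundN; apply: op_boundD. Qed.

Lemma op_bound_comp H K L (S : K -> L) (T : H -> K) M N :
  op_bound S M -> op_bound T N -> op_bound (S \o T) (M * N).
Proof.
move=> [M0 hM] [N0 hN]; split=> [|x]; first exact: mulr_ge0.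
by apply: le_trans (hM _) _; rewrite -mulrA ler_wpM2l.
Qed.

Lemma bounded0 H K : bounded_op (0 : H -> K).
Proof.
split; first by move=> a x y; rewrite scaler0 addr0.
by exists 0; exact: op_bound0.
Qed.

Lemma bounded_id H : bounded_op (@id H).
Proof. by split=> //; exists 1; split=> // x; rewrite mul1r. Qed.

Lemma bounded_lin_comb H K (a : R[i]) (S T : H -> K) :
  bounded_op S -> bounded_op T -> bounded_op (a *: S + T).
Proof.
move=> [lS [M hM]] [lT [N hN]]; split.
  move=> c x y; rewrite /= !fctE lS lT !scalerDr !scalerA (mulrC a).
  by rewrite addrACA.
by exists (cabs a * M + N); apply: op_boundD => //; apply: op_boundZ.
Qed.

Lemma boundedD H K (S T : H -> K) :
  bounded_op S -> bounded_op T -> bounded_op (S + T).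
Proof. by move=> bS bT; rewrite -[S]scale1r; apply: bounded_lin_comb. Qed.

Lemma boundedZ H K (a : R[i]) (T : H -> K) : bounded_op T -> bounded_op (a *: T).
Proof.
by move=> bT; rewrite -[_ *: _]addr0; apply: bounded_lin_comb => //; exact: bounded0.
Qed.

Lemma boundedN H K (T : H -> K) : bounded_op T -> bounded_op (- T).
Proof. by move=> bT; rewrite -scaleN1r; apply: boundedZ. Qed.

Lemma boundedB H K (S T : H -> K) :
  bounded_op S -> bounded_op T -> bounded_op (S - T).
Proof. by move=> bS /boundedN; apply: boundedD. Qed.

Lemma bounded_sum H K (I : Type) (s : seq I) (F : I -> H -> K) :
  (forall i, bounded_op (F i)) -> bounded_op (\sum_(i <- s) F i).
Proof. by move=> h; elim/big_ind: _ => //; [exact: bounded0|exact: boundedD]. Qed.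

Lemma bounded_comp H K L (S : K -> L) (T : H -> K) :
  bounded_op S -> bounded_op T -> bounded_op (S \o T).
Proof.
move=> [lS [M hM]] [lT [N hN]]; split; first by move=> c x y; rewrite /= lT lS.
by exists (M * N); apply: op_bound_comp.
Qed.

Lemma adj_exists H K (T : H -> K) : bounded_op T ->
  exists S : K -> H, forall x y, iprod (S y) x = iprod y (T x).
Proof.
move=> [lT [M [M0 hM]]].
have ex y : exists z, forall x, iprod z x = iprod y (T x).
  apply: (riesz (M := rnorm y * M)) => [a x x'|x].
    by rewrite lT iprodDr iprodZr.
  apply: le_trans (cauchy_schwarz _ _) _.
  by rewrite -mulrA ler_wpM2l ?rnorm_ge0.
by have [S hS] := choice ex; exists S.
Qed.

Lemma adjP H K (T : H -> K) x y : bounded_op T ->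
  iprod (adj T y) x = iprod y (T x).
Proof.
move=> bT; have := @xgetPex _ (fun=> 0) _ (adj_exists bT).
exact.
Qed.

Lemma adjPr H K (T : H -> K) x y : bounded_op T ->
  iprod x (adj T y) = iprod (T x) y.
Proof. by move=> bT; rewrite iprodC adjP // -iprodC. Qed.

Lemma adj_unique H K (T : H -> K) (S : K -> H) : bounded_op T ->
  (forall x y, iprod (S y) x = iprod y (T x)) -> adj T = S.
Proof.
by move=> bT h; apply/funext => y; apply: iprod_extl => x; rewrite adjP // h.
Qed.

Lemma op_bound_iprod H K (T : H -> K) M : 0 <= M ->
  (forall x y, cabs (iprod y (T x)) <= M * rnorm x * rnorm y) -> op_bound T M.
Proof.
move=> M0 h; split=> // x; have := h x (T x).
rewrite iprodxx cabs_real ger0_norm ?sqr_ge0 // expr2.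
have [-> _|n0] := eqVneq (rnorm (T x)) 0.
  by rewrite mulr_ge0 ?rnorm_ge0.
by rewrite ler_pM2r // lt0r n0 rnorm_ge0.
Qed.

Lemma adj_bound H K (T : H -> K) M :
  bounded_op T -> op_bound T M -> op_bound (adj T) M.
Proof.
move=> bT [M0 hM]; apply: op_bound_iprod => // x y.
rewrite adjPr //; apply: le_trans (cauchy_schwarz _ _) _.
by rewrite mulrAC ler_wpM2r ?rnorm_ge0.
Qed.

Lemma bounded_adj H K (T : H -> K) : bounded_op T -> bounded_op (adj T).
Proof.
move=> bT; split; last first.
  by case: (bT) => _ [M hM]; exists M; apply: adj_bound.
move=> a x y; apply: iprod_ext => z.
by rewrite adjPr // !iprodDr !iprodZr !adjPr.
Qed.

Lemma adjK H K (T : H -> K) : bounded_op T -> adj (adj T) = T.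
Proof.
move=> bT; apply: adj_unique; first exact: bounded_adj.
by move=> x y; rewrite adjPr.
Qed.

Lemma adj_comp H K L (S : K -> L) (T : H -> K) :
  bounded_op S -> bounded_op T -> adj (S \o T) = adj T \o adj S.
Proof.
move=> bS bT; apply: adj_unique; first exact: bounded_comp.
by move=> x y /=; rewrite !adjP.
Qed.

End Operators.

(** * Total sets and extension of densely defined operators *)

Section Density.
Variable R : realType.
Implicit Types G H K L : hilbertType R.

Lemma cspan_vecP H (D : set H) :
  cspan_vec D = setT <->
  forall x (e : R), 0 < e -> exists2 y, lspan D y & rnorm (x - y) <= e.
Proof.
split=> [h x e e0|h]; last by apply/seteqP; split=> // x _; apply/closureP_rnorm/h.
have : [set: H] x by [].
by rewrite -h => /closureP_rnorm /(_ e e0).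
Qed.

Lemma total_sub H (D E : set H) :
  cspan_vec D = setT -> D `<=` lspan E -> cspan_vec E = setT.
Proof.
move=> /cspan_vecP h DE; apply/cspan_vecP => x e e0.
by have [y Dy xy] := h x e e0; exists y => //; apply: lspan_sub Dy.
Qed.

Lemma total_closure H (D E : set H) :
  cspan_vec D = setT ->
  (forall x, D x -> forall e : R, 0 < e -> exists2 y, lspan E y & rnorm (x - y) <= e) ->
  cspan_vec E = setT.
Proof.
move=> /cspan_vecP h hE; apply/cspan_vecP => x e e0.
have e2 : 0 < e / 2 by lra.
have [y Dy xy] := h x _ e2.
suff [z Ez yz] : exists2 z, lspan E z & rnorm (y - z) <= e / 2.
  exists z => //; apply: le_trans (rnorm_dist _ y _) _; lra.
move: {x xy} (e / 2) e2 => {e0}e e0; move: y Dy e e0; apply: lspan_ind.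
  by move=> e e0; exists 0; [exact: lspan0|rewrite subrr rnorm0 ltW].
move=> a u v Du IH e e0.
have [z Ez vz] := IH _ (divr_gt0 e0 (ltr0n _ 2)).
have ca : 0 < cabs a + 1 by have := cabs_ge0 a; lra.
have [w Ew uw] := hE _ Du _ (divr_gt0 (divr_gt0 e0 (ltr0n _ 2)) ca).
exists (a *: w + z); first exact: lspan_lin.
have -> : a *: u + v - (a *: w + z) = a *: (u - w) + (v - z).
  by rewrite scalerBr opprD addrACA.
apply: le_trans (rnormD _ _) _; rewrite rnormZ.
have : (cabs a + 1) * rnorm (u - w) <= e / 2.
  by rewrite mulrC -ler_pdivlMr.
by have := rnorm_ge0 (u - w); lra.
Qed.

Lemma eq_bounded_total H K (D : set H) (S T : H -> K) :
  cspan_vec D = setT -> bounded_op S -> bounded_op T ->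
  (forall x, D x -> S x = T x) -> S = T.
Proof.
move=> /cspan_vecP h bS bT eqD; apply/funext => x.
have [M M0 [_ hM]] := op_bound_gt0 (boundedB bS bT).
apply: rnorm_small_sub => e e0.
have [y Dy xy] := h x _ (divr_gt0 e0 M0).
have Ey : S y = T y.
  move: y Dy {xy}; apply: lspan_ind; first by rewrite !lin0 //; case: bS bT => ? _ [].
  by move=> a u v Du Ev; rewrite (bounded_lin bS) (bounded_lin bT) eqD // Ev.
have := hM (x - y); rewrite !fctE (linB (bounded_lin bS)) (linB (bounded_lin bT)).
rewrite Ey opprB addrA subrK => /le_trans -> //.
by rewrite mulrC -ler_pdivlMr.
Qed.

Section Extension.
Variables (G G' : hilbertType R) (I : Type) (e : I -> G) (f : I -> G') (M : R).

Let E (s : seq (R[i] * I)) := \sum_(p <- s) p.1 *: e p.2.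
Let F (s : seq (R[i] * I)) := \sum_(p <- s) p.1 *: f p.2.

Lemma ext_lin :
  0 <= M -> cspan_vec (range e) = setT ->
  (forall s, rnorm (\sum_(p <- s) p.1 *: f p.2)
             <= M * rnorm (\sum_(p <- s) p.1 *: e p.2)) ->
  exists X : G -> G', [/\ linear X, op_bound X M & forall i, X (e i) = f i].
Proof.
move=> M0 /cspan_vecP te bFE.
pose sc (a : R[i]) (s : seq (R[i] * I)) := [seq (a * p.1, p.2) | p <- s].
have Ecat a s t : E (sc a s ++ t) = a *: E s + E t.
  rewrite /E big_cat big_map scaler_sumr; congr (_ + _).
  by apply: eq_bigr => p _; rewrite scalerA.
have Fcat a s t : F (sc a s ++ t) = a *: F s + F t.
  rewrite /F big_cat big_map scaler_sumr; congr (_ + _).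
  by apply: eq_bigr => p _; rewrite scalerA.
have EB s t : E (sc (-1) t ++ s) = E s - E t by rewrite Ecat scaleN1r addrC.
have FB s t : F (sc (-1) t ++ s) = F s - F t by rewrite Fcat scaleN1r addrC.
have M1 : 0 < M + 1 by lra.
(* The closure of the graph [E s |-> F s]. Completeness makes it total, the bound [M] makes it
   single-valued, and it is linear because formal sums can be combined. *)
pose rel x y := forall d : R, 0 < d ->
  exists s, rnorm (x - E s) <= d /\ rnorm (y - F s) <= d.
have rel_ex x : exists y, rel x y.
  have ex n : exists s, rnorm (x - E s) <= n.+1%:R^-1.
    have n0 : 0 < n.+1%:R^-1 :> R by rewrite invr_gt0 ltr0n.
    by have [y /lspan_range [s ->] h] := te x _ n0; exists s.
  have [s hs] := choice ex.
  have [d d0|y hy] := complete_rnorm (u := F \o s).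
    have [N hN] := archi_inv (divr_gt0 (divr_gt0 d0 M1) (ltr0n _ 2)).
    exists N => m n Nm Nn /=; rewrite -FB; apply: le_trans (bFE _) _.
    rewrite -/(E _) EB.
    have h : rnorm (E (s m) - E (s n)) <= d / (M + 1).
      apply: le_trans (rnorm_dist _ x _) _.
      rewrite rnormB.
      have := hs m; have := hs n; have := hN m Nm; have := hN n Nn.
      move: (d / (M + 1)) (n.+1%:R^-1) (m.+1%:R^-1).
      by move: (rnorm (x - E (s n))) (rnorm (x - E (s m))) => *; lra.
    have : (M + 1) * rnorm (E (s m) - E (s n)) <= d.
      by rewrite mulrC -ler_pdivlMr.
    by have := rnorm_ge0 (E (s m) - E (s n)); move: (rnorm _) => q; lra.
  exists y => d d0.
  have [N1 h1] := archi_inv d0; have [N2 h2] := hy _ d0.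
  exists (s (maxn N1 N2)); split.
    by apply: le_trans (hs _) _; apply: h1; apply: leq_maxl.
  by rewrite rnormB; apply: h2; apply: leq_maxr.
have rel_bd x y : rel x y -> rnorm y <= M * rnorm x.
  move=> h; apply/ler_addgt0Pr => d d0.
  have [s [h1 h2]] := h _ (divr_gt0 d0 M1).
  have h3 : rnorm y <= rnorm (y - F s) + rnorm (F s).
    by have := rnormD (y - F s) (F s); rewrite subrK.
  have h4 : rnorm (E s) <= rnorm (x - E s) + rnorm x.
    by have := rnormD (E s - x) x; rewrite subrK rnormB.
  have h5 := ler_wpM2l M0 (le_trans h4 (lerD h1 (lexx _))).
  have h6 := bFE s; rewrite -/(E s) -/(F s) in h6.
  have h7 : (M + 1) * (d / (M + 1)) = d by field; apply/eqP; lra.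
  move: h2 h3 h5 h6 h7; move: (d / _) (rnorm _) (rnorm (F s)) (rnorm _) (rnorm x) (rnorm (E s)).
  by move=> *; nra.
have rel_lin a x y x' y' : rel x y -> rel x' y' -> rel (a *: x + x') (a *: y + y').
  move=> h h' d d0.
  have ca : 0 < cabs a + 1 by have := cabs_ge0 a; lra.
  have [s [h1 h2]] := h _ (divr_gt0 (divr_gt0 d0 (ltr0n _ 2)) ca).
  have [t [h3 h4]] := h' _ (divr_gt0 d0 (ltr0n _ 2)).
  have key (V : normedModType R[i]) (u u' v v' : V) :
      rnorm (u - u') <= d / 2 / (cabs a + 1) -> rnorm (v - v') <= d / 2 ->
      rnorm (a *: u + v - (a *: u' + v')) <= d.
    move=> hu hv.
    have -> : a *: u + v - (a *: u' + v') = a *: (u - u') + (v - v').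
      by rewrite scalerBr opprD addrACA.
    apply: le_trans (rnormD _ _) _; rewrite rnormZ.
    have : (cabs a + 1) * rnorm (u - u') <= d / 2.
      by rewrite mulrC -ler_pdivlMr.
    by have := rnorm_ge0 (u - u'); lra.
  by exists (sc a s ++ t); rewrite Ecat Fcat; split; apply: key.
have rel_uniq x y y' : rel x y -> rel x y' -> y = y'.
  move=> h h'; apply/eqP; rewrite -subr_eq0; apply/eqP/rnorm_eq0.
  have := rel_bd _ _ (rel_lin (-1) _ _ _ _ h' h).
  rewrite !scaleN1r addNr rnorm0 mulr0 addrC => h0.
  by apply/eqP; rewrite eq_le h0 rnorm_ge0.
have [X hX] := choice rel_ex.
exists X; split.
- by move=> a x y; apply: rel_uniq (hX _) _; apply: rel_lin.
- by split=> // x; apply: rel_bd.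
move=> i; apply: rel_uniq (hX _) _ => d d0.
by exists [:: (1, i)]; rewrite /E /F !big_seq1 !scale1r !subrr !rnorm0 ltW.
Qed.

End Extension.

(** The ratios of a log-convex sequence increase, so a first ratio [r > M] would force
    [x n >= x 0 * r ^+ n], which by Bernoulli's inequality eventually exceeds [C * M ^+ n]. *)
Lemma logconvex_ratio (x : nat -> R) (C M : R) :
  0 <= M -> (forall n, 0 <= x n) ->
  (forall n, x n.+1 ^+ 2 <= x n * x n.+2) ->
  (forall n, x n <= C * M ^+ n) -> x 1%N <= M * x 0%N.
Proof.
move=> M0 x0 conv gr; rewrite leNgt; apply/negP => lt1.
have x0p : 0 < x 0%N.
  rewrite lt0r x0 andbT; apply/eqP => x00.
  have := conv 0%N; rewrite x00 mul0r => h.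
  have := x0 1%N; move: lt1; rewrite x00 mulr0; nra.
pose r := x 1%N / x 0%N.
have Mr : M < r by rewrite ltr_pdivlMr.
have ratio n : 0 < x n /\ r * x n <= x n.+1.
  elim: n => [|n [xp IH]]; first by split=> //; rewrite /r divfK ?gt_eqF.
  have xp1 : 0 < x n.+1.
    by apply: lt_le_trans IH; rewrite mulr_gt0 //; apply: le_lt_trans Mr.
  split=> //; rewrite -(ler_pM2l xp); apply: le_trans (conv n).
  by rewrite expr2 mulrCA mulrA ler_pM2r.
have low n : x 0%N * r ^+ n <= x n.
  elim: n => [|n IH]; first by rewrite mulr1.
  apply: le_trans (proj2 (ratio n)); rewrite exprS mulrCA ler_pM2l //.
  exact: le_lt_trans Mr.
have [M00|Mp] := eqVneq M 0.
  have := gr 1%N; rewrite M00 expr1 mulr0; have := proj1 (ratio 1%N); lra.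
have {}Mp : 0 < M by rewrite lt0r Mp.
pose d := r / M - 1.
have dp : 0 < d by rewrite subr_gt0 ltr_pdivlMr // mul1r.
have bern n : 1 + n%:R * d <= (r / M) ^+ n.
  elim: n => [|n IH]; first by rewrite mul0r addr0 expr0.
  rewrite exprS -natr1.
  have -> : r / M = 1 + d by rewrite /d addrC subrK.
  move: IH; have -> : r / M = 1 + d by rewrite /d addrC subrK.
  have := ler0n R n; move: (n%:R) ((1 + d) ^+ n) dp => a c; nra.
have bd n : n%:R * d <= C / x 0%N.
  have : (r / M) ^+ n <= C / x 0%N.
    rewrite exprMn exprVn ler_pdivrMr ?exprn_gt0 // mulrAC ler_pdivlMr //.
    by rewrite mulrC; apply: le_trans (low n) (gr n).
  by have := bern n; lra.
have := bd (Num.truncn (C / x 0%N / d)).+1.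
rewrite -ler_pdivlMr // leNgt => /negP; apply; exact: truncnS_gt.
Qed.

(** [a] plays the part of the positive operator [X^* X], known only on generators. For a formal sum
    let [E n] be its image after [n] twists. The Gram identity gives [|E (n+1)|^2 = <E n, E (n+2)>],
    hence log-convexity, and growth of order [M ^+ n], with a constant that may depend on the
    generator, yields [|E 1| <= M |E 0|]. Then [|F 0|^2 = <E 0, E 1> <= M |E 0|^2]. *)
Lemma ext_dom G G' (I : Type) (e : I -> G) (f : I -> G') (a : I -> I)
    (M : R) :
  0 <= M -> cspan_vec (range e) = setT ->
  (forall i j, iprod (f i) (f j) = iprod (e i) (e (a j))) ->
  (forall i, exists C, forall n, rnorm (e (iter n a i)) <= C * M ^+ n) ->
  exists X : G -> G',
    [/\ linear X, op_bound X (Num.sqrt M) & forall i, X (e i) = f i].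
Proof.
move=> M0 te fE gr; apply: ext_lin => // s.
pose E n := \sum_(p <- s) p.1 *: e (iter n a p.2).
pose F n := \sum_(p <- s) p.1 *: f (iter n a p.2).
have FE m n : iprod (F m) (F n) = iprod (E m) (E n.+1).
  rewrite !iprod_suml; apply: eq_bigr => p _; rewrite !iprod_sumr.
  by apply: eq_bigr => q _; rewrite !iprodZl !iprodZr fE.
have symE m n : iprod (E m.+1) (E n) = iprod (E m) (E n.+1).
  by rewrite iprodC -FE -iprodC FE.
have conv n : rnorm (E n.+1) ^+ 2 <= rnorm (E n) * rnorm (E n.+2).
  rewrite -Re_iprodxx symE; apply: le_trans (Re_le_cabs _) _.
  exact: cauchy_schwarz.
have [C hC] : exists C, forall n, rnorm (E n) <= C * M ^+ n.
  rewrite /E; elim: (s) => [|p t [C hC]].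
    by exists 0 => n; rewrite big_nil rnorm0 mul0r.
  have [C' hC'] := gr p.2; exists (cabs p.1 * C' + C) => n.
  rewrite big_cons; apply: le_trans (rnormD _ _) _; rewrite mulrDl lerD //.
  by rewrite rnormZ -mulrA ler_wpM2l ?cabs_ge0.
have h1 := logconvex_ratio M0 (fun n => rnorm_ge0 (E n)) conv hC.
have h2 : rnorm (F 0%N) ^+ 2 <= M * rnorm (E 0%N) ^+ 2.
  rewrite -Re_iprodxx FE; apply: le_trans (Re_le_cabs _) _.
  apply: le_trans (cauchy_schwarz _ _) _.
  by rewrite expr2 mulrCA ler_wpM2l ?rnorm_ge0.
rewrite -/(F 0%N) -/(E 0%N) -ler_sqr ?nnegrE ?rnorm_ge0 ?mulr_ge0 ?sqrtr_ge0 ?rnorm_ge0 //.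
by rewrite exprMn sqr_sqrtr.
Qed.

Lemma ext_isom G G' (I : Type) (e : I -> G) (f : I -> G') :
  cspan_vec (range e) = setT ->
  (forall i j, iprod (f i) (f j) = iprod (e i) (e j)) ->
  exists X : G -> G', bounded_op X /\ forall i, X (e i) = f i.
Proof.
move=> te fE.
have gr i : exists C : R, forall n, rnorm (e (iter n id i)) <= C * 1 ^+ n.
  by exists (rnorm (e i)) => n; rewrite expr1n mulr1; elim: n.
have [X [lX bX Xe]] := ext_dom ler01 te fE gr.
by exists X; split=> //; split=> //; exists (Num.sqrt 1).
Qed.

End Density.

(** * Operator norm and closed linear spans *)

Section ClosedSpan.
Variable R : realType.
Implicit Types G H K L : hilbertType R.

Lemma op_bound_opnorm H K (T : H -> K) :
  bounded_op T -> op_bound T (opnorm T).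
Proof.
move=> [_ [M hM]].
have hi : has_inf [set M | op_bound T M].
  by split; [exists M|exists 0 => N []].
have n0 : 0 <= opnorm T by apply: lb_le_inf => [|N []]; first by exists M.
split=> // x; apply/ler_addgt0Pr => e e0.
have xp : 0 < rnorm x + 1 by have := rnorm_ge0 x; lra.
have [N [N0 hN] lt] := inf_adherent (divr_gt0 e0 xp) hi.
apply: le_trans (hN x) _.
apply: le_trans (ler_wpM2r (rnorm_ge0 x) (ltW lt)) _.
rewrite mulrDl lerD2l mulrAC ler_pdivrMr // ler_wpM2l ?ltW //.
by rewrite ltrDl.
Qed.

Lemma opnorm_le H K (T : H -> K) M : op_bound T M -> opnorm T <= M.
Proof. by move=> hM; apply: ge_inf => //; exists 0 => N []. Qed.

Lemma opnorm_ge0 H K (T : H -> K) : bounded_op T -> 0 <= opnorm T.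
Proof. by move=> /op_bound_opnorm []. Qed.

Lemma op_bound_eq H K (S T : H -> K) : 
  (forall e : R, 0 < e -> op_bound (S - T) e) -> S = T.
Proof.
move=> h; apply/funext => x; apply: rnorm_small_sub => e e0.
have xp : 0 < rnorm x + 1 by have := rnorm_ge0 x; lra.
have [_ /(_ x) hx] := h _ (divr_gt0 e0 xp).
apply: le_trans hx _; rewrite mulrAC ler_pdivrMr // ler_wpM2l ?ltW //.
by rewrite ltrDl.
Qed.

Lemma op_bound_tri H K (S T U : H -> K) M N :
  op_bound (S - T) M -> op_bound (T - U) N -> op_bound (S - U) (M + N).
Proof. by move=> h /(op_boundD h); rewrite addrA subrK. Qed.

Lemma op_bound_sym H K (S T : H -> K) M : op_bound (S - T) M -> op_bound (T - S) M.
Proof. by move/op_boundN; rewrite opprB. Qed.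

Lemma cspan_bounded H K (Y : set (H -> K)) T : cspan Y T -> bounded_op T.
Proof. by case. Qed.

Lemma lspan_cspan H K (Y : set (H -> K)) T :
  bounded_op T -> lspan Y T -> cspan Y T.
Proof.
move=> bT YT; split=> // e e0; exists T => //; rewrite subrr.
by apply: op_bound_le (op_bound0 _ _); exact: ltW.
Qed.

Lemma cspan_gen H K (Y : set (H -> K)) T : bounded_op T -> Y T -> cspan Y T.
Proof. by move=> bT YT; apply: lspan_cspan => //; apply: lspan_gen. Qed.

Lemma cspan0 H K (Y : set (H -> K)) : cspan Y 0.
Proof. by apply: lspan_cspan; [exact: bounded0|exact: lspan0]. Qed.

Lemma cspan_lin H K (Y : set (H -> K)) a S T :
  cspan Y S -> cspan Y T -> cspan Y (a *: S + T).
Proof.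
move=> [bS hS] [bT hT]; split=> [|e e0]; first exact: bounded_lin_comb.
have ca : 0 < cabs a + 1 by have := cabs_ge0 a; lra.
have [S' YS' hS'] := hS _ (divr_gt0 (divr_gt0 e0 (ltr0n _ 2)) ca).
have [T' YT' hT'] := hT _ (divr_gt0 e0 (ltr0n _ 2)).
exists (a *: S' + T'); first exact: lspan_lin.
have -> : a *: S + T - (a *: S' + T') = a *: (S - S') + (T - T').
  by rewrite scalerBr opprD addrACA.
apply: op_bound_le (op_boundD (op_boundZ a hS') hT').
have h : (cabs a + 1) * (e / 2 / (cabs a + 1)) = e / 2.
  by field; apply/eqP; lra.
have : 0 <= e / 2 / (cabs a + 1) by rewrite ltW // divr_gt0 ?divr_gt0.
by move: h; rewrite mulrDl mul1r => h1 h2; move: h1 h2; move: (e / 2 / (cabs a + 1)) (cabs a) => x y; move: (y * x) => *; lra.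
Qed.

Lemma cspan_lim H K (Y : set (H -> K)) T :
  bounded_op T ->
  (forall e : R, 0 < e -> exists2 S, cspan Y S & op_bound (T - S) e) ->
  cspan Y T.
Proof.
move=> bT h; split=> // e e0.
have e2 : 0 < e / 2 by lra.
have [S [bS hS] TS] := h _ e2; have [S' YS' SS'] := hS _ e2.
exists S' => //; apply: op_bound_le (op_bound_tri TS SS'); lra.
Qed.

Lemma cspan_ind H K (Y : set (H -> K)) (P : (H -> K) -> Prop) :
  P 0 -> (forall a S T, Y S -> P T -> P (a *: S + T)) ->
  (forall T, bounded_op T ->
     (forall e : R, 0 < e -> exists2 S, P S & op_bound (T - S) e) -> P T) ->
  cspan Y `<=` P.
Proof.
move=> P0 PS Plim T [bT hT]; apply: Plim => // e e0.
by have [S YS TS] := hT _ e0; exists S => //; apply: lspan_ind YS.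
Qed.

Lemma cspan_sub H K (Y Z : set (H -> K)) : Y `<=` cspan Z -> cspan Y `<=` cspan Z.
Proof.
move=> YZ; apply: cspan_ind; first exact: cspan0.
  by move=> a S T YS ZT; apply: cspan_lin => //; apply: YZ.
by move=> T bT; apply: cspan_lim.
Qed.

Lemma cspan_comp_left H K L (Y : set (H -> K)) (Z : set (H -> L)) (A : K -> L) :
  bounded_op A -> (forall S, Y S -> cspan Z (A \o S)) ->
  forall T, cspan Y T -> cspan Z (A \o T).
Proof.
move=> bA hA; apply: cspan_ind.
- have -> : A \o (0 : H -> K) = 0 by apply/funext => x /=; rewrite (lin0 (bounded_lin bA)).
  exact: cspan0.
- move=> a S T YS ZT; have -> : A \o (a *: S + T) = a *: (A \o S) + (A \o T).
    by apply/funext => x /=; rewrite !fctE (bounded_lin bA).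
  by apply: cspan_lin => //; apply: hA.
move=> T bT h; apply: cspan_lim; first exact: bounded_comp.
move=> e e0; have [M M0 hM] := op_bound_gt0 bA.
have [S ZS TS] := h _ (divr_gt0 e0 M0); exists (A \o S) => //.
have -> : (A \o T) - (A \o S) = A \o (T - S).
  by apply/funext => x; rewrite /= !fctE (linB (bounded_lin bA)).
by have := op_bound_comp hM TS; rewrite mulrC divfK ?gt_eqF.
Qed.

Lemma cspan_eq H K L (Y : set (H -> K)) (A B : K -> L) z w :
  bounded_op A -> bounded_op B ->
  (forall S, Y S -> A (S z) = B (S w)) ->
  forall T, cspan Y T -> A (T z) = B (T w).
Proof.
move=> bA bB hY; apply: cspan_ind.
- by rewrite !lin0 //; apply: bounded_lin.
- move=> a S T YS TE; rewrite !fctE (bounded_lin bA) (bounded_lin bB).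
  by rewrite hY // TE.
move=> T bT h; apply: rnorm_small_sub => e e0.
have [M M0 hM] := op_bound_gt0 bA; have [N N0 hN] := op_bound_gt0 bB.
pose C := M * rnorm z + N * rnorm w + 1.
have C0 : 0 < C.
  have := mulr_ge0 (ltW M0) (rnorm_ge0 z); have := mulr_ge0 (ltW N0) (rnorm_ge0 w).
  by rewrite /C; lra.
have q0 := divr_gt0 e0 C0; have hC : C * (e / C) = e by field; apply/eqP; lra.
move: (e / C) q0 hC => q q0 hC.
have [S SE TS] := h _ q0.
have -> : A (T z) - B (T w) = A ((T - S) z) - B ((T - S) w).
  rewrite !fctE (linB (bounded_lin bA)) (linB (bounded_lin bB)) SE.
  by rewrite opprB addrA subrK.
apply: le_trans (rnormD _ _) _; rewrite rnormN.
have [_ /(_ z)] := op_bound_comp hM TS.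
have [_ /(_ w)] := op_bound_comp hN TS.
move: hC; rewrite /C /= !mulrDl -!mulrA !(mulrC q) mul1r => hC h1 h2.
move: hC h1 h2; move: (N * _) (M * _) (rnorm (A _)) (rnorm (B _)) => *; lra.
Qed.

End ClosedSpan.

Section SumSubset.
Variables (R : numDomainType) (I : eqType).

Lemma ler_sum_subset (F F' : seq I) (f : I -> R) :
  (forall i, 0 <= f i) -> uniq F -> {subset F <= F'} ->
  \sum_(i <- F) f i <= \sum_(i <- F') f i.
Proof.
move=> f0; elim: F F' => [|i F IH] F' /=.
  by move=> _ _; rewrite big_nil sumr_ge0.
move=> /andP[iF uF] sub.
have iF' : i \in F' by apply: sub; rewrite mem_head.
rewrite (perm_big _ (perm_to_rem iF')) !big_cons lerD2l IH // => j jF.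
have /sub : j \in i :: F by rewrite inE jF orbT.
rewrite (perm_mem (perm_to_rem iF')) inE => /orP[/eqP ji|//].
by rewrite -ji jF in iF.
Qed.

End SumSubset.

Lemma sum_split_subset (V : nmodType) (I : eqType) (F F0 : seq I) (f : I -> V) :
  uniq F -> uniq F0 -> {subset F0 <= F} ->
  \sum_(i <- F) f i
  = \sum_(i <- F0) f i + \sum_(i <- [seq i <- F | i \notin F0]) f i.
Proof.
move=> uF u0 sub; rewrite (bigID (mem F0)) /= -!(big_filter F); congr (_ + _).
apply: perm_big; apply: uniq_perm => //; first by rewrite filter_uniq.
by move=> i; rewrite mem_filter; case: (boolP (i \in F0)) => //= /sub ->.
Qed.

(** * Square-summable families *)

Section FiniteCS.
Variables (R : realType) (I : Type).

(** Termwise arithmetic-geometric mean with weights [Q / P] and [P / Q]; both bounds are first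
    increased by [d], since either may be zero. *)
Lemma sum_cauchy_schwarz (F : seq I) (p q : I -> R) (P Q : R) :
  0 <= P -> 0 <= Q -> (forall i, 0 <= p i) -> (forall i, 0 <= q i) ->
  \sum_(i <- F) p i ^+ 2 <= P ^+ 2 -> \sum_(i <- F) q i ^+ 2 <= Q ^+ 2 ->
  \sum_(i <- F) p i * q i <= P * Q.
Proof.
move=> P0 Q0 p0 q0 hp hq; apply/ler_addgt0Pr => e e0.
suff h d : 0 < d -> \sum_(i <- F) p i * q i <= (P + d) * (Q + d).
  have c0 : 0 < P + Q + 1 by lra.
  pose d := Num.min 1 (e / (P + Q + 1)).
  have d0 : 0 < d by rewrite lt_min ltr01 divr_gt0.
  have d1 : d <= 1 by rewrite ge_min lexx.
  have d2 : d * (P + Q + 1) <= e by rewrite -ler_pdivlMr // ge_min lexx orbT.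
  by apply: le_trans (h d d0) _; nra.
move=> d0; pose P' := P + d; pose Q' := Q + d.
have P'0 : 0 < P' by rewrite /P'; lra.
have Q'0 : 0 < Q' by rewrite /Q'; lra.
have hp' : \sum_(i <- F) p i ^+ 2 <= P' ^+ 2.
  by apply: le_trans hp _; rewrite /P'; nra.
have hq' : \sum_(i <- F) q i ^+ 2 <= Q' ^+ 2.
  by apply: le_trans hq _; rewrite /Q'; nra.
have amgm i : p i * q i <= (Q' / P') / 2 * p i ^+ 2 + (P' / Q') / 2 * q i ^+ 2.
  have -> : Q' / P' / 2 * p i ^+ 2 + P' / Q' / 2 * q i ^+ 2
          = p i * q i + (Q' * p i - P' * q i) ^+ 2 / (P' * Q') / 2.
    by field; rewrite !gt_eqF.
  by rewrite lerDl divr_ge0 // divr_ge0 ?sqr_ge0 ?mulr_ge0 ?ltW.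
apply: (@le_trans _ _ (Q' / P' / 2 * P' ^+ 2 + P' / Q' / 2 * Q' ^+ 2)); last first.
  have -> : Q' / P' / 2 * P' ^+ 2 + P' / Q' / 2 * Q' ^+ 2 = P' * Q'.
    by field; rewrite !gt_eqF.
  by [].
apply: le_trans (ler_sum _ (fun i _ => amgm i)) _.
rewrite big_split /= -!mulr_sumr lerD // ler_wpM2l //.
  by rewrite divr_ge0 // divr_ge0 // ltW.
by rewrite divr_ge0 // divr_ge0 // ltW.
Qed.

End FiniteCS.

(** * Unordered sums of scalars *)

Section Hassum.
Variable R : realType.
Implicit Types I J : eqType.

(** Convergence along finite subsets instead of initial segments: the value does not depend on an
    enumeration, and any index type with decidable equality is allowed. *)
Definition hassum I (f : I -> R[i]) (s : R[i]) : Prop :=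
  forall e : R, 0 < e -> exists F0 : seq I, forall F, uniq F ->
    {subset F0 <= F} -> cabs (\sum_(i <- F) f i - s) <= e.

Lemma hassum_unique I (f : I -> R[i]) s t : hassum f s -> hassum f t -> s = t.
Proof.
move=> hs ht; apply/eqP; rewrite -subr_eq0; apply/eqP/cabs_small => e e0.
have e2 : 0 < e / 2 by lra.
have [F1 h1] := hs _ e2; have [F2 h2] := ht _ e2.
pose F := undup (F1 ++ F2).
have {}h1 := h1 F (undup_uniq _); have {}h2 := h2 F (undup_uniq _).
have {}h1 : cabs (\sum_(i <- F) f i - s) <= e / 2.
  by apply: h1 => i hi; rewrite mem_undup mem_cat hi.
have {}h2 : cabs (\sum_(i <- F) f i - t) <= e / 2.
  by apply: h2 => i hi; rewrite mem_undup mem_cat hi orbT.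
rewrite -(subrKA (\sum_(i <- F) f i)).
apply: le_trans (cabsD _ _) _; rewrite cabsB; lra.
Qed.

Lemma hassum_lin I (f g : I -> R[i]) s t (a : R[i]) :
  hassum f s -> hassum g t -> hassum (fun i => a * f i + g i) (a * s + t).
Proof.
move=> hs ht e e0.
have ca : 0 < cabs a + 1 by have := cabs_ge0 a; lra.
have [F1 h1] := hs _ (divr_gt0 (divr_gt0 e0 (ltr0n _ 2)) ca).
have [F2 h2] := ht _ (divr_gt0 e0 (ltr0n _ 2)).
exists (F1 ++ F2) => F uF sub.
have {}h1 : cabs (\sum_(i <- F) f i - s) <= e / 2 / (cabs a + 1).
  by apply: h1 => // i hi; apply: sub; rewrite mem_cat hi.
have {}h2 : cabs (\sum_(i <- F) g i - t) <= e / 2.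
  by apply: h2 => // i hi; apply: sub; rewrite mem_cat hi orbT.
rewrite big_split /= -mulr_sumr.
have -> : a * \sum_(i <- F) f i + \sum_(i <- F) g i - (a * s + t)
  = a * (\sum_(i <- F) f i - s) + (\sum_(i <- F) g i - t) by ring.
apply: le_trans (cabsD _ _) _; rewrite cabsM.
have : (cabs a + 1) * cabs (\sum_(i <- F) f i - s) <= e / 2.
  by rewrite mulrC -ler_pdivlMr.
have := cabs_ge0 (\sum_(i <- F) f i - s).
by move: (cabs (_ - s)) (cabs (_ - t)) h2 => x y; lra.
Qed.

Lemma eq_hassum I (f g : I -> R[i]) s : f =1 g -> hassum f s -> hassum g s.
Proof. by move=> fg hs e e0; have [F0 h] := hs e e0; exists F0 => F uF sF; under eq_bigr do rewrite -fg; exact: h. Qed.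

(** Given finitely many rows, each is cut off at a finite set that contains its part of [F0] and is
    within [e / 2 / (size F + 1)] of the row sum; the union of these pieces is a test set for the
    double sum. The successor covers an empty set of rows. *)
Lemma hassum_fubini I J (f : I * J -> R[i]) (g : I -> R[i]) s :
  hassum f s -> (forall i, hassum (fun j => f (i, j)) (g i)) -> hassum g s.
Proof.
move=> hs hg e e0.
have [F0 h0] := hs _ (divr_gt0 e0 (ltr0n _ 2)).
exists (map fst F0) => F uF sub.
have n0 : 0 < e / 2 / (size F).+1%:R :> R by rewrite divr_gt0 ?divr_gt0 ?ltr0n.
have ex i : exists Gi : seq J, [/\ uniq Gi, forall j, (i, j) \in F0 -> j \in Gi &
    cabs (\sum_(j <- Gi) f (i, j) - g i) <= e / 2 / (size F).+1%:R].
  have [Gi hGi] := hg i _ n0.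
  exists (undup (Gi ++ [seq p.2 | p <- F0 & p.1 == i])); split.
  - exact: undup_uniq.
  - move=> j ij; rewrite mem_undup mem_cat; apply/orP; right.
    by apply/mapP; exists (i, j) => //; rewrite mem_filter eqxx.
  by apply: hGi => [|j hj]; rewrite ?undup_uniq // mem_undup mem_cat hj.
have [G hG] := choice ex.
pose F' := [seq (i, j) | i <- F, j <- G i].
have uF' : uniq F'.
  apply: allpairs_uniq_dep => //; first by move=> i _; case: (hG i).
  by move=> [i j] [i' j'] _ _ /= [-> ->].
have sF' : {subset F0 <= F'}.
  move=> [i j] hij; apply/allpairsPdep; exists i, j; split=> //.
    by apply: sub; apply/mapP; exists (i, j).
  by case: (hG i) => _ h _; apply: h.
have := h0 F' uF' sF'; rewrite big_allpairs_dep /= => h1.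
have h2 : cabs (\sum_(i <- F) (\sum_(j <- G i) f (i, j) - g i)) <= e / 2.
  apply: le_trans (cabs_sum _ _) _.
  apply: (@le_trans _ _ (\sum_(i <- F) e / 2 / (size F).+1%:R)).
    by apply: ler_sum => i _; case: (hG i).
  rewrite big_const_seq count_predT iter_addr_0 -[e / 2 / _ *+ _]mulr_natr.
  rewrite -mulrAC -[leRHS]mulr1 -mulrA; apply: ler_wpM2l.
    by rewrite ltW // divr_gt0.
  by rewrite ler_pdivrMr ?ltr0n // mul1r ler_nat.
rewrite sumrB in h2.
rewrite -(subrKA (\sum_(i <- F) \sum_(j <- G i) f (i, j))).
apply: le_trans (cabsD _ _) _; rewrite cabsB.
by move: h1 h2; move: (cabs _) (cabs _) => x y; lra.
Qed.

Variables (I J : eqType) (p : J -> option I) (q : I -> J).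
Hypotheses (pq : pcancel q p) (qp : ocancel p q).

Lemma sum_pmap (V : nmodType) (F : seq J) (f : I -> V) :
  \sum_(j <- F) oapp f 0 (p j) = \sum_(i <- pmap p F) f i.
Proof.
elim: F => [|j F IH]; first by rewrite !big_nil.
by rewrite big_cons IH /=; case: (p j) => [i|] /=; rewrite ?big_cons ?add0r.
Qed.

Lemma pmap_subset (F0 : seq I) (F : seq J) :
  {subset map q F0 <= F} -> {subset F0 <= pmap p F}.
Proof.
move=> h i hi; rewrite mem_pmap; apply/mapP; exists (q i); last by rewrite pq.
by apply: h; apply/mapP; exists i.
Qed.

Lemma pmap_disjoint (F0 : seq I) (F : seq J) :
  (forall j, j \in F -> j \notin map q F0) ->
  forall i, i \in pmap p F -> i \notin F0.
Proof.
move=> h i; rewrite mem_pmap => /mapP [j jF pj].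
apply/negP => iF0; have /negP := h j jF; apply; apply/mapP; exists i => //.
by have := qp j; rewrite -pj /= => ->.
Qed.

(** Zero padding along an injection [q] with partial inverse [p] serves both for bijective
    reindexing and for numbering a countable index type by [nat]. In the converse direction a test
    set is completed by indices at which the padded terms vanish. *)
Lemma hassum_pad (f : I -> R[i]) s :
  hassum f s <-> hassum (fun j => oapp f 0 (p j)) s.
Proof.
split=> hs e e0; have [F0 h] := hs e e0.
  exists (map q F0) => F uF sub; rewrite sum_pmap.
  by apply: h; [exact: (pmap_uniq qp)|exact: pmap_subset].
exists (pmap p F0) => F uF sub.
pose F' := map q F ++ [seq j <- undup F0 | j \notin map q F].
have uF' : uniq F'.
  rewrite cat_uniq map_inj_uniq ?uF //=; last exact: pcan_inj pq.
  rewrite filter_uniq ?undup_uniq // andbT; apply/hasPn => j.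
  by rewrite mem_filter => /andP[].
have sF' : {subset F0 <= F'}.
  move=> j jF0; rewrite mem_cat mem_filter mem_undup jF0 andbT.
  by case: (boolP (j \in _)).
have := h F' uF' sF'; rewrite big_cat big_map /=.
under eq_bigr do rewrite pq /=.
rewrite [X in _ + X - _]big_seq [X in _ + X - _]big1 ?addr0 // => j.
rewrite mem_filter mem_undup => /andP[/negP jq jF0].
case pj : (p j) => [i|] //=; case: jq; apply/mapP; exists i.
  by apply: sub; rewrite mem_pmap; apply/mapP; exists j.
by have := qp j; rewrite pj.
Qed.

End Hassum.

(** * Square-summable columns of operators and their pairings *)

Section Families.
Variable R : realType.
Implicit Types G H K L : hilbertType R.

(** With [S] the formal sum of all [a_i^* a_i], [sqb] says [S <= M], and [uni] says that the tails
    of [S] are small in norm: for positive operators the norm is the supremum of the quadratic form.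
    Squared lengths keep both conditions free of adjoints. *)
Definition sqb (I : eqType) H K (a : I -> H -> K) (M : R) : Prop :=
  forall (F : seq I) x, uniq F -> \sum_(i <- F) rnorm (a i x) ^+ 2 <= M * rnorm x ^+ 2.

Definition uni (I : eqType) H K (a : I -> H -> K) : Prop :=
  forall e : R, 0 < e -> exists F0 : seq I, forall F x, uniq F ->
    (forall i, i \in F -> i \notin F0) ->
    \sum_(i <- F) rnorm (a i x) ^+ 2 <= e * rnorm x ^+ 2.

Definition fam (I : eqType) H K (a : I -> H -> K) : Prop :=
  (forall i, bounded_op (a i)) /\ uni a.

Definition opsum (I : eqType) H K (u : I -> H -> K) (D : H -> K) : Prop :=
  bounded_op D /\ forall e : R, 0 < e -> exists F0 : seq I, forall F, uniq F ->
    {subset F0 <= F} -> op_bound (\sum_(i <- F) u i - D) e.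

Definition pairing (I : eqType) H K L (a : I -> K -> L) (b : I -> H -> L) : H -> K :=
  xget (fun=> 0) [set D | opsum (fun i => adj (a i) \o b i) D].

Lemma sqb_le (I : eqType) H K (a : I -> H -> K) (M N : R) :
  M <= N -> sqb a M -> sqb a N.
Proof.
by move=> MN h F x uF; apply: le_trans (h F x uF) _; rewrite ler_wpM2r ?sqr_ge0.
Qed.

Lemma fam_sqb (I : eqType) H K (a : I -> H -> K) :
  fam a -> exists2 M, 0 < M & sqb a M.
Proof.
move=> [ba ua]; have [F0 h0] := ua 1 ltr01.
have [C C0 hC] : exists2 C, 0 < C & forall x, \sum_(i <- F0) rnorm (a i x) ^+ 2 <= C * rnorm x ^+ 2.
  elim: F0 {h0} => [|i F [C C0 hC]].
    by exists 1 => // x; rewrite big_nil mul1r sqr_ge0.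
  have [N N0 [_ hN]] := op_bound_gt0 (ba i).
  exists (N ^+ 2 + C) => [|x]; first by rewrite addr_gt0 // exprn_gt0.
  rewrite big_cons mulrDl lerD // -exprMn ler_sqr ?nnegrE ?rnorm_ge0 //.
  by rewrite mulr_ge0 ?rnorm_ge0 ?ltW.
exists (C + 1); first lra.
move=> F x uF; rewrite (bigID (mem F0)) /= mulrDl mul1r lerD //.
  rewrite -big_filter; apply: le_trans (hC x).
  apply: ler_sum_subset => [i||i]; rewrite ?sqr_ge0 ?filter_uniq //.
  by rewrite mem_filter => /andP[].
rewrite -big_filter -[leRHS]mul1r; apply: h0; first by rewrite filter_uniq.
by move=> i; rewrite mem_filter => /andP[].
Qed.

Lemma op_bound_pairing_sum (I : eqType) H K L (F : seq I) (a : I -> K -> L)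
    (b : I -> H -> L) (A B : R) :
  (forall i, bounded_op (a i)) -> 0 <= A -> 0 <= B ->
  (forall x, \sum_(i <- F) rnorm (a i x) ^+ 2 <= A ^+ 2 * rnorm x ^+ 2) ->
  (forall x, \sum_(i <- F) rnorm (b i x) ^+ 2 <= B ^+ 2 * rnorm x ^+ 2) ->
  op_bound (\sum_(i <- F) (adj (a i) \o b i)) (A * B).
Proof.
move=> ba A0 B0 hA hB; apply: op_bound_iprod; first exact: mulr_ge0.
move=> x y; rewrite fct_sumE iprod_sumr.
apply: le_trans (cabs_sum _ _) _.
apply: (@le_trans _ _ (\sum_(i <- F) rnorm (a i y) * rnorm (b i x))).
  by apply: ler_sum => i _ /=; rewrite adjPr //; apply: cauchy_schwarz.
have -> : A * B * rnorm x * rnorm y = (A * rnorm y) * (B * rnorm x) by ring.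
by apply: sum_cauchy_schwarz; rewrite ?mulr_ge0 ?rnorm_ge0 ?exprMn // => i; rewrite rnorm_ge0.
Qed.

(** By Cauchy-Schwarz a tail of the sum is bounded by the tail of [a] times the whole of [b], so
    small tails of [a] and a plain bound for [b] give norm convergence. *)
Lemma pairing_exists (I : eqType) H K L (a : I -> K -> L) (b : I -> H -> L) (M : R) :
  fam a -> (forall i, bounded_op (b i)) -> sqb b M ->
  exists D, opsum (fun i => adj (a i) \o b i) D.
Proof.
move=> [ba ua] bb hb.
wlog M0 : M hb / 0 < M.
  move=> h; apply: (h (`|M| + 1)); last by have := normr_ge0 M; lra.
  by apply: sqb_le hb; apply: le_trans (ler_norm _) _; rewrite lerDl.
pose S F := \sum_(i <- F) (adj (a i) \o b i).
have bS F : bounded_op (S F).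
  by apply: bounded_sum => i; apply: bounded_comp => //; apply: bounded_adj.
have cauchy (e : R) : 0 < e -> exists F0 : seq I, uniq F0 /\ forall F, uniq F ->
    {subset F0 <= F} -> op_bound (S F - S F0) e.
  move=> e0; pose s := Num.sqrt M.
  have s0 : 0 < s by rewrite sqrtr_gt0.
  have [F0 h0] := ua ((e / s) ^+ 2) (exprn_gt0 _ (divr_gt0 e0 s0)).
  exists (undup F0); split=> [|F uF sub]; first exact: undup_uniq.
  rewrite /S (sum_split_subset _ uF (undup_uniq F0) sub) addrAC subrr add0r.
  have -> : e = (e / s) * s by rewrite divfK ?gt_eqF.
  apply: op_bound_pairing_sum => //; rewrite ?divr_ge0 ?ltW // => x.
    apply: h0 => [|i]; first by rewrite filter_uniq.
    by rewrite mem_filter mem_undup => /andP[].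
  by rewrite /s sqr_sqrtr ?(ltW M0) //; apply: hb; rewrite filter_uniq.
have [F hF] := choice (fun n => cauchy n.+1%:R^-1 ltac:(by rewrite invr_gt0 ltr0n)).
(* The sets [F m] are not nested; two of them are compared through their union. *)
have near m n (e : R) : m.+1%:R^-1 <= e -> n.+1%:R^-1 <= e ->
    op_bound (S (F m) - S (F n)) (e + e).
  move=> he he'; pose U := undup (F m ++ F n).
  have [_ hm] := hF m; have [_ hn] := hF n.
  have {}hm : op_bound (S U - S (F m)) (m.+1%:R^-1).
    by apply: hm => [|i hi]; rewrite ?undup_uniq // mem_undup mem_cat hi.
  have {}hn : op_bound (S U - S (F n)) (n.+1%:R^-1).
    by apply: hn => [|i hi]; rewrite ?undup_uniq // mem_undup mem_cat hi orbT.
  by apply: op_bound_le (op_bound_tri (op_bound_sym hm) hn); apply: lerD.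
have limx x : exists y, forall e : R, 0 < e -> exists N, forall n, (N <= n)%N ->
    rnorm (S (F n) x - y) <= e.
  apply: complete_rnorm => e e0.
  have xp : 0 < rnorm x + 1 by have := rnorm_ge0 x; lra.
  have e2 : 0 < e / (rnorm x + 1) / 2 by rewrite divr_gt0 ?divr_gt0.
  have [N hN] := archi_inv e2; exists N => m n Nm Nn.
  have [_ /(_ x)] := near _ _ _ (hN m Nm) (hN n Nn).
  rewrite -splitr => /le_trans -> //; rewrite mulrAC ler_pdivrMr //.
  by rewrite ler_wpM2l ?ltW // ltrDl.
have [D hD] := choice limx.
have SD n (e : R) : n.+1%:R^-1 <= e -> op_bound (S (F n) - D) (e + e).
  move=> he; have e0 : 0 < e by apply: lt_le_trans he; rewrite invr_gt0 ltr0n.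
  split=> [|x]; first by rewrite ltW // addr_gt0.
  apply/ler_addgt0Pr => d d0.
  have [N1 h1] := archi_inv e0; have [N2 h2] := hD x d d0.
  pose k := maxn N1 N2.
  have [_ /(_ x)] := near _ _ _ he (h1 k (leq_maxl _ _)).
  have := h2 k (leq_maxr _ _) => hk1 hk2.
  by apply: le_trans (rnorm_dist _ (S (F k) x) _) _; apply: lerD.
have lD : linear D.
  move=> c x y; apply: rnorm_small_sub => e e0.
  have C0 : 0 < 2 + 2 * cabs c by have := cabs_ge0 c; lra.
  have e1 := divr_gt0 e0 C0.
  have qE : e / (2 + 2 * cabs c) * (2 + 2 * cabs c) = e by rewrite divfK ?gt_eqF.
  move: (e / (2 + 2 * cabs c)) e1 qE => q e1 qE.
  have [N1 h1] := hD (c *: x + y) _ e1; have [N2 h2] := hD x _ e1; have [N3 h3] := hD y _ e1.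
  pose k := maxn N1 (maxn N2 N3).
  have {}h1 := h1 k (leq_maxl _ _).
  have {}h2 := h2 k (leq_trans (leq_maxl _ _) (leq_maxr _ _)).
  have {}h3 := h3 k (leq_trans (leq_maxr _ _) (leq_maxr _ _)).
  rewrite (bounded_lin (bS _)) in h1.
  have -> : D (c *: x + y) - (c *: D x + D y) =
      - (c *: S (F k) x + S (F k) y - D (c *: x + y))
      + (c *: (S (F k) x - D x) + (S (F k) y - D y)).
    by rewrite scalerBr addrACA -opprD opprB addrA addrNK.
  apply: le_trans (rnormD _ _) _; rewrite rnormN.
  apply: le_trans (lerD h1 (rnormD _ _)) _; rewrite rnormZ.
  have := ler_wpM2l (cabs_ge0 c) h2.
  have := cabs_ge0 c; move: h2 h3 e1 qE.
  move: (cabs c) => t.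
  by move: (rnorm (S (F k) x - D x)) (rnorm (S (F k) y - D y)) => u v *; nra.
have bD : bounded_op D.
  split=> //; have [M1 _ hM1] := op_bound_gt0 (bS (F 0%N)).
  have h1 : (0.+1)%:R^-1 <= 1 :> R by rewrite invr1.
  have := op_boundD (op_bound_sym (SD 0%N 1 h1)) hM1; rewrite subrK => h.
  by exists (1 + 1 + M1).
exists D; split=> // e e0.
have e3 : 0 < e / 3 by lra.
have [N hN] := archi_inv e3.
have [_ hFN] := hF N; exists (F N) => U uU sU.
apply: op_bound_le (op_bound_tri (hFN U uU sU) (SD N _ (hN N (leqnn N)))).
have := hN N (leqnn N); move: (N.+1%:R^-1) => r *; lra.
Qed.

Section Pairing.
Variables (I : eqType) (H K L : hilbertType R) (a : I -> K -> L) (b : I -> H -> L).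
Hypotheses (fa : fam a) (fb : fam b).

Lemma pairingP : opsum (fun i => adj (a i) \o b i) (pairing a b).
Proof.
have [M _ hM] := fam_sqb fb.
by have [D hD] := pairing_exists fa (proj1 fb) hM; apply: xgetPex; exists D.
Qed.

Lemma pairing_bounded : bounded_op (pairing a b).
Proof. by case: pairingP. Qed.

Lemma pairing_hassum x y :
  hassum (fun i => iprod (a i y) (b i x)) (iprod y (pairing a b x)).
Proof.
move=> e e0.
have c0 : 0 < rnorm x * rnorm y + 1.
  by have := mulr_ge0 (rnorm_ge0 x) (rnorm_ge0 y); lra.
have [_ /(_ _ (divr_gt0 e0 c0)) [F0 h]] := pairingP.
exists F0 => F uF sF; have [_ /(_ x)] := h F uF sF.
rewrite !fctE fct_sumE => hx.
have -> : \sum_(i <- F) iprod (a i y) (b i x) - iprod y (pairing a b x)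
   = iprod y (\sum_(i <- F) (adj (a i) \o b i) x - pairing a b x).
  rewrite iprodBr iprod_sumr; congr (_ - _); apply: eq_bigr => i _ /=.
  by rewrite adjPr //; case: fa.
apply: le_trans (cauchy_schwarz _ _) _.
apply: le_trans (ler_wpM2l (rnorm_ge0 y) hx) _.
have -> (c : R) : rnorm y * (e / c * rnorm x) = e * (rnorm x * rnorm y) / c by ring.
by rewrite ler_pdivrMr // ler_wpM2l ?(ltW e0) // lerDl.
Qed.

Lemma pairing_unique D : bounded_op D ->
  (forall x y, hassum (fun i => iprod (a i y) (b i x)) (iprod y (D x))) ->
  pairing a b = D.
Proof.
move=> bD h; apply/funext => x; apply: iprod_ext => y.
exact: hassum_unique (pairing_hassum x y) (h x y).
Qed.

Lemma pairing_bound A B : 0 <= A -> 0 <= B ->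
  sqb a (A ^+ 2) -> sqb b (B ^+ 2) -> op_bound (pairing a b) (A * B).
Proof.
move=> A0 B0 hA hB; split=> [|x]; first exact: mulr_ge0.
apply/ler_addgt0Pr => e e0.
have xp : 0 < rnorm x + 1 by have := rnorm_ge0 x; lra.
have [_ /(_ _ (divr_gt0 e0 xp)) [F0 h]] := pairingP.
have uF := undup_uniq F0.
have [_ /(_ x)] := op_boundB (op_bound_pairing_sum (F := undup F0) (proj1 fa)
  A0 B0 (fun x => hA _ x uF) (fun x => hB _ x uF))
  (h _ uF (fun i => etrans (mem_undup _ i))).
rewrite subKr => /le_trans -> //; rewrite mulrDl lerD2l mulrAC ler_pdivrMr //.
by rewrite ler_wpM2l ?ltW // ltrDl.
Qed.

End Pairing.

Lemma fam_comp_left (I : eqType) H K L (T : K -> L) (a : I -> H -> K) :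
  bounded_op T -> fam a -> fam (fun i => T \o a i).
Proof.
move=> bT [ba ua]; split=> [i|e e0]; first exact: bounded_comp.
have [M M0 [_ hM]] := op_bound_gt0 bT.
have [F0 h] := ua (e / M ^+ 2) (divr_gt0 e0 (exprn_gt0 _ M0)).
exists F0 => F x uF dF.
apply: (@le_trans _ _ (\sum_(i <- F) M ^+ 2 * rnorm (a i x) ^+ 2)).
  apply: ler_sum => i _; rewrite -exprMn ler_sqr ?nnegrE ?rnorm_ge0 ?hM //.
  by rewrite mulr_ge0 ?rnorm_ge0 ?(ltW M0).
rewrite -mulr_sumr mulrC -ler_pdivlMr ?exprn_gt0 // mulrAC.
exact: h.
Qed.

Lemma sqb_contract (I : eqType) H K L (a : I -> H -> K) (b : I -> H -> L) M :
  (forall i x, rnorm (b i x) <= rnorm (a i x)) -> sqb a M -> sqb b M.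
Proof.
move=> ba h F x uF; apply: le_trans (h F x uF); apply: ler_sum => i _.
by rewrite ler_sqr ?nnegrE ?rnorm_ge0.
Qed.

Section Composite.
Variables (I J : eqType) (H K L : hilbertType R).
Variables (a : I -> K -> L) (x : J -> H -> K).

Definition cfam (p : I * J) : H -> L := a p.1 \o x p.2.

Lemma cfam_sqb A X : 0 <= A -> sqb a A -> sqb x X -> sqb cfam (A * X).
Proof.
move=> A0 hA hX F z uF.
pose F1 := undup (map fst F); pose F2 := undup (map snd F).
apply: (@le_trans _ _ (\sum_(p <- [seq (i, j) | i <- F1, j <- F2])
    rnorm (cfam p z) ^+ 2)).
  apply: ler_sum_subset => // [p|[i j] ij]; first exact: sqr_ge0.
  apply/allpairsP; exists (i, j); rewrite !mem_undup; split=> //=;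
    by apply/mapP; exists (i, j).
rewrite big_allpairs /= exchange_big /=.
apply: (@le_trans _ _ (\sum_(j <- F2) A * rnorm (x j z) ^+ 2)).
  by apply: ler_sum => j _; exact: (hA _ (x j z) (undup_uniq _)).
by rewrite -mulr_sumr -mulrA ler_wpM2l // hX ?undup_uniq.
Qed.

(** A pair outside the rectangle spanned by [F1] and [F2] has its first index outside [F1] or its
    second outside [F2]. Either way a small tail of one family meets the full bound of the other,
    whence the divisors [X] and [A]. *)
Lemma cfam_fam : fam a -> fam x -> fam cfam.
Proof.
move=> fa fx; split=> [p|e e0].
  by apply: bounded_comp; [exact: (proj1 fa)|exact: (proj1 fx)].
have [A A0 hA] := fam_sqb fa; have [X X0 hX] := fam_sqb fx.
have [F1 h1] := (proj2 fa) _ (divr_gt0 (divr_gt0 e0 (ltr0n _ 2)) X0).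
have [F2 h2] := (proj2 fx) _ (divr_gt0 (divr_gt0 e0 (ltr0n _ 2)) A0).
exists [seq (i, j) | i <- F1, j <- F2] => F z uF dF.
have split2 (P : pred (I * J)) F' : uniq F' ->
    \sum_(p <- F') rnorm (cfam p z) ^+ 2
    <= \sum_(p <- [seq p <- F' | P p]) rnorm (cfam p z) ^+ 2
     + \sum_(p <- [seq p <- F' | ~~ P p]) rnorm (cfam p z) ^+ 2.
  by move=> _; rewrite (bigID P) /= -!(big_filter F').
apply: le_trans (split2 (fun p => p.1 \notin F1) F uF) _.
have -> : e * rnorm z ^+ 2 = e / 2 * rnorm z ^+ 2 + e / 2 * rnorm z ^+ 2.
  by rewrite -mulrDl -splitr.
pose rect (F' : seq (I * J)) := [seq (i, j) | i <- undup (map fst F'), j <- undup (map snd F')].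
have rectP F' : uniq F' -> \sum_(p <- F') rnorm (cfam p z) ^+ 2
    <= \sum_(p <- rect F') rnorm (cfam p z) ^+ 2.
  move=> uF'; apply: ler_sum_subset => // [p|[i j] ij]; first exact: sqr_ge0.
  apply/allpairsP; exists (i, j); rewrite !mem_undup; split=> //=;
    by apply/mapP; exists (i, j).
apply: lerD.
  apply: le_trans (rectP _ (filter_uniq _ uF)) _.
  rewrite big_allpairs /= exchange_big /=.
  set F'2 := undup _; set F'1 := undup _.
  apply: (@le_trans _ _ (\sum_(j <- F'2) e / 2 / X * rnorm (x j z) ^+ 2)).
    apply: ler_sum => j _; apply: (h1 F'1 (x j z)); first exact: undup_uniq.
    move=> i; rewrite mem_undup => /mapP[p]; rewrite mem_filter => /andP[hp _] ->.
    exact: hp.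
  have e3 : 0 <= e / 2 / X by rewrite !divr_ge0 ?(ltW e0) ?(ltW X0).
  rewrite -mulr_sumr; apply: le_trans (ler_wpM2l e3 (hX _ z (undup_uniq _))) _.
  by rewrite mulrA divfK ?gt_eqF.
apply: le_trans (rectP _ (filter_uniq _ uF)) _.
rewrite big_allpairs /= exchange_big /=.
set F'2 := undup _; set F'1 := undup _.
apply: (@le_trans _ _ (\sum_(j <- F'2) A * rnorm (x j z) ^+ 2)).
  by apply: ler_sum => j _; exact: (hA _ (x j z) (undup_uniq _)).
have : \sum_(j <- F'2) rnorm (x j z) ^+ 2 <= e / 2 / A * rnorm z ^+ 2.
  apply: h2 => [|j]; first exact: undup_uniq.
  rewrite mem_undup => /mapP[p]; rewrite mem_filter negbK => /andP[hp pF] ->.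
  apply/negP => p2; have /negP := dF p pF; apply.
  by apply/allpairsP; exists p; split=> //; case: (p).
by rewrite -mulr_sumr mulrAC ler_pdivlMr // mulrC.
Qed.

End Composite.

Section Pad.
Variables (I J : eqType) (p : J -> option I) (q : I -> J).
Hypotheses (pq : pcancel q p) (qp : ocancel p q).
Variables (H K : hilbertType R).
Implicit Types a : I -> H -> K.

Definition pad a (j : J) : H -> K := oapp a 0 (p j).

Lemma pad_sq a j x : rnorm (pad a j x) ^+ 2 = oapp (fun i => rnorm (a i x) ^+ 2) 0 (p j).
Proof. by rewrite /pad; case: (p j) => //=; rewrite rnorm0 expr0n. Qed.

Lemma pad_sqb a M : sqb a M -> sqb (pad a) M.
Proof.
move=> h F x uF; under eq_bigr do rewrite pad_sq.
by rewrite sum_pmap; apply: h; apply: (pmap_uniq qp).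
Qed.

Lemma pad_fam a : fam a -> fam (pad a).
Proof.
move=> [ba ua]; split=> [j|e e0].
  by rewrite /pad; case: (p j) => //=; exact: bounded0.
have [F0 h] := ua e e0; exists (map q F0) => F x uF dF.
under eq_bigr do rewrite pad_sq.
rewrite sum_pmap; apply: h; first exact: (pmap_uniq qp).
exact: pmap_disjoint dF.
Qed.

End Pad.

End Families.

Section BigFam.
Variables (R : realType) (K I : eqType) (H G : hilbertType R).
Variables (a : K -> I -> H -> G) (M : K -> R).
Hypotheses (fa : forall k, fam (a k)) (Ma : forall k, sqb (a k) (M k)).

Definition bigfam (p : K * I) : H -> G := a p.1 p.2.

Lemma bigfam_sqb C : (forall F, uniq F -> \sum_(k <- F) M k <= C) -> sqb bigfam C.
Proof.
move=> hC F x uF.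
pose F1 := undup (map fst F); pose F2 := undup (map snd F).
apply: (@le_trans _ _ (\sum_(p <- [seq (i, j) | i <- F1, j <- F2])
    rnorm (bigfam p x) ^+ 2)).
  apply: ler_sum_subset => // [p|[i j] ij]; first exact: sqr_ge0.
  apply/allpairsP; exists (i, j); rewrite !mem_undup; split=> //=;
    by apply/mapP; exists (i, j).
rewrite big_allpairs /=.
apply: (@le_trans _ _ (\sum_(k <- F1) M k * rnorm x ^+ 2)).
  by apply: ler_sum => k _; exact: (Ma k _ (undup_uniq _)).
by rewrite -mulr_suml ler_wpM2r ?sqr_ge0 // hC ?undup_uniq.
Qed.

(** Outside [F0] the bounds [M k] themselves have a small sum, and each of the finitely many [k] in
    [F0] contributes only a tail of its own family, below an equal share of [e / 2]. *)
Lemma bigfam_fam :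
  (forall e : R, 0 < e -> exists F0 : seq K, forall F, uniq F ->
     (forall k, k \in F -> k \notin F0) -> \sum_(k <- F) M k <= e) ->
  fam bigfam.
Proof.
move=> tail; split=> [p|e e0]; first by case: (fa p.1) => h _; apply: h.
have e2 : 0 < e / 2 by lra.
have [F0 h0] := tail _ e2.
have n0 : 0 < e / 2 / (size F0).+1%:R :> R by rewrite divr_gt0 ?ltr0n.
have [G0 hG] := choice (fun k => proj2 (fa k) _ n0).
exists [seq (k, i) | k <- F0, i <- G0 k] => F x uF dF.
rewrite (bigID (fun p => p.1 \notin F0)) /= -!(big_filter F) [e in leRHS]splitr mulrDl.
apply: lerD.
  set F' := seq.filter _ F.
  pose F1 := undup (map fst F'); pose F2 := undup (map snd F').
  apply: (@le_trans _ _ (\sum_(p <- [seq (i, j) | i <- F1, j <- F2])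
      rnorm (bigfam p x) ^+ 2)).
    apply: ler_sum_subset => // [p||[i j] ij]; rewrite ?sqr_ge0 ?filter_uniq //.
    apply/allpairsP; exists (i, j); rewrite !mem_undup; split=> //=;
      by apply/mapP; exists (i, j).
  rewrite big_allpairs /=.
  apply: (@le_trans _ _ (\sum_(k <- F1) M k * rnorm x ^+ 2)).
    by apply: ler_sum => k _; exact: (Ma k _ (undup_uniq _)).
  rewrite -mulr_suml ler_wpM2r ?sqr_ge0 //; apply: h0; first exact: undup_uniq.
  by move=> k; rewrite mem_undup => /mapP [p]; rewrite mem_filter => /andP[hp _] ->.
set F' := seq.filter _ F.
pose S k := undup [seq p.2 | p <- F & p.1 == k].
apply: (@le_trans _ _ (\sum_(p <- [seq (k, j) | k <- undup F0, j <- S k])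
    rnorm (bigfam p x) ^+ 2)).
  apply: ler_sum_subset => // [p||[i j]]; rewrite ?sqr_ge0 ?filter_uniq //.
  rewrite mem_filter negbK /= => /andP[iF0 ijF].
  apply/allpairsPdep; exists i, j; split=> //; rewrite mem_undup //.
  by apply/mapP; exists (i, j) => //; rewrite mem_filter eqxx.
rewrite big_allpairs_dep /=.
apply: (@le_trans _ _ (\sum_(k <- undup F0) e / 2 / (size F0).+1%:R * rnorm x ^+ 2)).
  rewrite big_seq [leRHS]big_seq; apply: ler_sum => k; rewrite mem_undup => kF0.
  apply: (hG k (S k) x (undup_uniq _)) => j.
  rewrite mem_undup => /mapP[p]; rewrite mem_filter => /andP[/eqP pk pF] jp.
  apply/negP => jG; have /negP := dF p pF; apply.
  by apply/allpairsPdep; exists k, j; split=> //; rewrite -pk jp; case: (p).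
rewrite -mulr_suml ler_wpM2r ?sqr_ge0 //.
rewrite big_const_seq count_predT iter_addr_0 -[e / 2 / _ *+ _]mulr_natr.
rewrite -mulrAC -[leRHS]mulr1 -mulrA; apply: ler_wpM2l; first exact: ltW.
rewrite ler_pdivrMr ?ltr0n // mul1r ler_nat ltnW // ltnS.
exact: size_undup.
Qed.

End BigFam.

(** * Comparison with norm-convergent series *)

Section Series.
Variable R : realType.
Implicit Types G H K L : hilbertType R.

Lemma opsum_series H K (u : nat -> H -> K) D : opsum u D -> op_series_to u D.
Proof.
move=> [bD h]; split=> // e e0; have [F0 hF] := h e e0.
exists (\max_(i <- F0) i).+1 => // n /= hn.
rewrite /series /=; apply: hF; first exact: iota_uniq.
move=> i iF0; rewrite mem_index_iota /=; apply: leq_ltn_trans hn.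
by rewrite (big_rem i iF0) /= leq_maxl.
Qed.

Lemma op_series_unique H K (u : nat -> H -> K) D D' :
  op_series_to u D -> op_series_to u D' -> D = D'.
Proof.
move=> [_ h] [_ h']; apply: op_bound_eq => e e0.
have e2 : 0 < e / 2 by lra.
have [N1 _ h1] := h _ e2; have [N2 _ h2] := h' _ e2.
pose N := maxn N1 N2.
have {}h1 := h1 N (leq_maxl _ _); have {}h2 := h2 N (leq_maxr _ _).
by apply: op_bound_le (op_bound_tri (op_bound_sym h1) h2); lra.
Qed.

Lemma op_seriesE H K (u : nat -> H -> K) D : op_series_to u D -> op_series u = D.
Proof.
move=> h; apply: (op_series_unique _ h).
by rewrite /op_series; apply: (@xgetPex _ _ [set S | op_series_to u S]); exists D.
Qed.

Lemma op_series_pairing H K L (a : nat -> K -> L) (b : nat -> H -> L) :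
  fam a -> fam b -> op_series (fun k => adj (a k) \o b k) = pairing a b.
Proof. by move=> fa fb; apply: op_seriesE; apply: opsum_series; apply: pairingP. Qed.

Lemma sum_adj_sq (I : eqType) H K (F : seq I) (a : I -> H -> K) x :
  (forall i, bounded_op (a i)) ->
  \sum_(i <- F) rnorm (a i x) ^+ 2
  = complex.Re (iprod x ((\sum_(i <- F) (adj (a i) \o a i)) x)).
Proof.
move=> ba; rewrite fct_sumE iprod_sumr.
elim: F => [|i F IH]; first by rewrite !big_nil.
by rewrite !big_cons ReD IH /= adjPr // Re_iprodxx.
Qed.

Lemma op_bound_sum_sq (I : eqType) H K (F : seq I) (a : I -> H -> K) M :
  (forall i, bounded_op (a i)) ->
  op_bound (\sum_(i <- F) (adj (a i) \o a i)) M ->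
  forall x, \sum_(i <- F) rnorm (a i x) ^+ 2 <= M * rnorm x ^+ 2.
Proof.
move=> ba [_ h] x; rewrite sum_adj_sq //.
apply: le_trans (Re_le_cabs _) _; apply: le_trans (cauchy_schwarz _ _) _.
by rewrite mulrC expr2 mulrA ler_wpM2r ?rnorm_ge0.
Qed.

(** The terms are nonnegative as quadratic forms, so a finite set beyond [N] is dominated by an
    interval beginning at [N]; convergence along initial segments therefore already makes all tails
    uniformly small. *)
Lemma series_uni H K (a : nat -> H -> K) S :
  (forall k, bounded_op (a k)) -> op_series_to (fun k => adj (a k) \o a k) S -> uni a.
Proof.
move=> ba [_ h] e e0.
have e2 : 0 < e / 2 by lra.
have [N _ hN] := h _ e2; exists (iota 0 N) => F x uF dF.
pose n := maxn N (\max_(i <- F) i).+1.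
apply: (@le_trans _ _ (\sum_(i <- index_iota N n) rnorm (a i x) ^+ 2)).
  apply: ler_sum_subset => // [i|i iF]; first exact: sqr_ge0.
  have := dF i iF; rewrite mem_iota add0n /= -leqNgt => Ni.
  rewrite mem_index_iota Ni /= /n leq_max; apply/orP; right.
  by rewrite ltnS (big_rem i iF) /= leq_maxl.
apply: op_bound_sum_sq => //.
have Nn : (N <= n)%N by exact: leq_maxl.
have := op_bound_tri (hN n Nn) (op_bound_sym (hN N (leqnn N))).
rewrite -splitr /series /= (big_cat_nat (n := N)) //= addrAC subrr add0r.
exact.
Qed.

End Series.

Section Seqs.
Variables (R : realType) (L H : hilbertType R) (alpha : set (L -> H)).
Hypothesis ba : alpha `<=` @bounded_op R L H.

Lemma seqs_fam eta : seqs alpha eta -> fam eta.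
Proof.
move=> [ae [S hS]]; have be k : bounded_op (eta k) by apply: ba.
by split=> //; apply: series_uni hS.
Qed.

Lemma fam_seqs eta : (forall k, alpha (eta k)) -> fam eta -> seqs alpha eta.
Proof.
by move=> ae fe; split=> //; exists (pairing eta eta); apply: opsum_series; apply: pairingP.
Qed.

Lemma seqs_norm_ge0 (eta : nat -> L -> H) : 0 <= seqs_norm eta.
Proof. exact: sqrtr_ge0. Qed.

Lemma fam_norm_sqb (eta : nat -> L -> H) : fam eta -> sqb eta (seqs_norm eta ^+ 2).
Proof.
move=> fe F x uF; rewrite /seqs_norm op_series_pairing //.
have bp : bounded_op (pairing eta eta) := pairing_bounded fe fe.
rewrite sqr_sqrtr ?opnorm_ge0 //.
have [_ hb] := op_bound_opnorm bp.
apply/ler_addgt0Pr => e e0.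
have [F0 hF] := pairing_hassum fe fe x x e0.
pose F' := undup (F ++ F0).
apply: (@le_trans _ _ (\sum_(i <- F') rnorm (eta i x) ^+ 2)).
  apply: ler_sum_subset => // [i|i iF]; first exact: sqr_ge0.
  by rewrite mem_undup mem_cat iF.
have {}hF : cabs (\sum_(i <- F') iprod (eta i x) (eta i x) - iprod x (pairing eta eta x)) <= e.
  by apply: hF => [|i hi]; rewrite ?undup_uniq // mem_undup mem_cat hi orbT.
have -> : \sum_(i <- F') rnorm (eta i x) ^+ 2
    = complex.Re (\sum_(i <- F') iprod (eta i x) (eta i x)).
  elim: F' {hF} => [|i F' IH]; first by rewrite !big_nil.
  by rewrite !big_cons ReD IH Re_iprodxx.
have := le_trans (Re_le_cabs _) hF; rewrite ReB lerBlDr => /le_trans; apply.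
rewrite addrC lerD2r; apply: le_trans (Re_le_cabs _) _.
apply: le_trans (cauchy_schwarz _ _) _.
by rewrite mulrC expr2 mulrA ler_wpM2r ?rnorm_ge0.
Qed.

Lemma fam_norm_le (eta : nat -> L -> H) M : fam eta -> 0 <= M ->
  sqb eta (M ^+ 2) -> seqs_norm eta <= M.
Proof.
move=> fe M0 h; rewrite /seqs_norm op_series_pairing //.
have -> : M = Num.sqrt (M ^+ 2) by rewrite sqrtr_sqr ger0_norm.
apply: ler_wsqrtr; apply: opnorm_le; rewrite expr2.
exact: pairing_bound.
Qed.

End Seqs.

(** * The spaces Omega *)

Section Geometric.
Variable R : realType.
Let r : R := 2^-1.

Lemma half_pow_gt0 n : 0 < r ^+ n.
Proof. by rewrite exprn_gt0 // invr_gt0 ltr0n. Qed.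

Lemma half_pow_small (e : R) : 0 < e -> exists K, r ^+ K <= e.
Proof.
move=> e0; have [N hN] := archi_inv e0; exists N.
apply: le_trans (hN N (leqnn N)).
rewrite /r exprVn lef_pV2 ?posrE ?exprn_gt0 ?ltr0n // -natrX ler_nat.
exact: ltn_expl.
Qed.

Lemma half_pow_sum (F : seq nat) n : uniq F -> (forall k, k \in F -> (n <= k)%N) ->
  \sum_(k <- F) r ^+ k <= 2 * r ^+ n.
Proof.
move=> uF hF; pose m := (\max_(i <- F) i).+1.
apply: (@le_trans _ _ (\sum_(k <- index_iota n (n + m)) r ^+ k)).
  apply: ler_sum_subset => // [k|k kF]; first exact: ltW (half_pow_gt0 k).
  rewrite mem_index_iota hF //= (leq_trans _ (leq_addl n m)) // ltnS.
  by rewrite (big_rem k kF) /= leq_maxl.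
suff -> : \sum_(n <= k < n + m) r ^+ k = 2 * r ^+ n - 2 * r ^+ (n + m).
  by have := half_pow_gt0 (n + m); lra.
elim: m => [|m IH]; first by rewrite addn0 big_geq // subrr.
rewrite addnS big_nat_recr ?leq_addr //= IH exprS.
have -> : r * r ^+ (n + m) = r ^+ (n + m) / 2 by rewrite mulrC.
by field.
Qed.

End Geometric.

Lemma hassum_shift (R : realType) (f : nat -> R[i]) s :
  hassum f s -> hassum (fun k => f k.+1) (s - f 0%N).
Proof.
move=> hs e e0; have [F0 hF] := hs e e0; exists (map predn F0) => F uF sF.
have u' : uniq (0%N :: map succn F).
  by rewrite /= map_inj_uniq ?uF ?andbT; [apply/mapP => -[]|exact: succn_inj].
have s' : {subset F0 <= 0%N :: map succn F}.
  move=> [|k] kF; rewrite inE //=; apply/mapP; exists k => //.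
  by apply: sF; apply/mapP; exists k.+1.
by have := hF _ u' s'; rewrite big_cons big_map opprB addrCA addrA.
Qed.

Lemma sqb_scale (R : realType) (I : eqType) (H K : hilbertType R)
    (a : I -> H -> K) (c : R[i]) M :
  sqb a M -> sqb (fun i => c *: a i) (cabs c ^+ 2 * M).
Proof.
move=> h F x uF.
under eq_bigr do rewrite fctE rnormZ exprMn.
by rewrite -mulr_sumr -mulrA ler_wpM2l ?sqr_ge0 // h.
Qed.

Lemma fam_scale (R : realType) (I : eqType) (H K : hilbertType R)
    (a : I -> H -> K) (c : R[i]) : fam a -> fam (fun i => c *: a i).
Proof.
move=> fa; apply: (fam_comp_left (T := c *: (@id K))) fa.
by apply: boundedZ; exact: bounded_id.
Qed.

Lemma pos_sqrt (R : realType) (x : R) : 0 < x -> exists2 t, 0 < t & t ^+ 2 = x.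
Proof.
move=> x0; exists (Num.sqrt x); first by rewrite sqrtr_gt0.
by rewrite sqr_sqrtr // ltW.
Qed.

Lemma ratio_sq_le (R : realType) (P Q p : R) :
  0 < P -> 0 < Q -> 0 <= p -> p <= P -> Q / P * p ^+ 2 <= P * Q.
Proof.
move=> P0 Q0 p0 pP; rewrite mulrAC ler_pdivrMr // mulrAC [leRHS]mulrC.
by rewrite ler_pM2l // -expr2 ler_sqr ?nnegrE // ltW.
Qed.

Section OmegaSpace.
Variables (R : realType) (L H : hilbertType R).
Implicit Types (be al : set (L -> H)) (A : set (H -> H)).

(** [omega] for an arbitrary index type and with unordered sums: products and disjoint unions of
    index sets occur before everything is renumbered by [nat]. *)
Definition omf (I : eqType) A (a b : I -> L -> H) : (H -> H) -> L -> L :=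
  on_set A (fun T => pairing a (fun i => T \o b i)).

Lemma on_set_in (V : zmodType) A (f : (H -> H) -> V) T : A T -> on_set A f T = f T.
Proof. by move=> AT; rewrite /on_set patchT // inE. Qed.

Lemma on_set_out (V : zmodType) A (f : (H -> H) -> V) T : ~ A T -> on_set A f T = 0.
Proof. by move=> AT; rewrite /on_set patchC // inE. Qed.

Lemma sub_bounded be : cspan be = be -> be `<=` @bounded_op R L H.
Proof. by move=> <- x; exact: cspan_bounded. Qed.

Variables (be al : set (L -> H)) (A : set (H -> H)).
Hypotheses (cb : cspan be = be) (ca : cspan al = al).
Hypothesis hA : A `<=` @bounded_op R H H.

Let bbe : be `<=` @bounded_op R L H := sub_bounded cb.
Let bal : al `<=` @bounded_op R L H := sub_bounded ca.
Let N := Omega_norm be al A.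

Lemma omega_omf xi eta : seqs be xi -> seqs al eta -> omega A xi eta = omf A xi eta.
Proof.
move=> sx se; apply/funext => T; have [AT|nAT] := pselect (A T); last first.
  by rewrite /omega /omf !on_set_out.
rewrite /omega /omf !on_set_in //; apply: (op_series_pairing (b := fun k => T \o eta k)).
  exact: (seqs_fam bbe).
by apply: fam_comp_left; [exact: hA|exact: (seqs_fam bal)].
Qed.

Lemma omf_hassum (I : eqType) (a b : I -> L -> H) T z w : fam a -> fam b -> A T ->
  hassum (fun i => iprod (a i z) (T (b i w))) (iprod z (omf A a b T w)).
Proof.
move=> fa fb AT; rewrite /omf on_set_in //.
apply: (pairing_hassum (b := fun i => T \o b i)) => //.
by apply: fam_comp_left => //; exact: hA.
Qed.

Lemma omf_bounded (I : eqType) (a b : I -> L -> H) T : fam a -> fam b ->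
  bounded_op (omf A a b T).
Proof.
move=> fa fb; have [AT|nAT] := pselect (A T); last first.
  by rewrite /omf on_set_out //; exact: bounded0.
rewrite /omf on_set_in //; apply: pairing_bounded => //.
by apply: fam_comp_left => //; exact: hA.
Qed.

Lemma omf_unique (I : eqType) (a b : I -> L -> H) w : fam a -> fam b ->
  (forall T, ~ A T -> w T = 0) ->
  (forall T x y, A T -> hassum (fun i => iprod (a i x) (T (b i y))) (iprod x (w T y))) ->
  w = omf A a b.
Proof.
move=> fa fb w0 hw; apply/funext => T; have [AT|nAT] := pselect (A T); last first.
  by rewrite w0 // /omf on_set_out.
apply/funext => y; apply: iprod_ext => x.
exact: hassum_unique (hw T x y AT) (omf_hassum x y fa fb AT).
Qed.

Lemma Omega_omf w : Omega be al A w -> exists xi eta : nat -> L -> H,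
  [/\ seqs be xi, seqs al eta, w = omega A xi eta & w = omf A xi eta].
Proof.
by move=> [xi sx [eta se <-]]; exists xi, eta; split=> //; exact: omega_omf.
Qed.

Lemma Omega_out w T : Omega be al A w -> ~ A T -> w T = 0.
Proof. by move=> [xi sx [eta se <-]] nA; rewrite /omega on_set_out. Qed.

Lemma Omega_norm_has_inf w : Omega be al A w ->
  has_inf [set r | exists eta eta', [/\ seqs be eta, seqs al eta',
    w = omega A eta eta' & r = seqs_norm eta * seqs_norm eta']].
Proof.
move=> [xi sx [eta se <-]]; split; first by exists (seqs_norm xi * seqs_norm eta), xi, eta.
by exists 0 => _ [x [y [_ _ _ ->]]]; rewrite mulr_ge0 ?seqs_norm_ge0.
Qed.

Lemma Omega_norm_ge0 w : Omega be al A w -> 0 <= N w.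
Proof.
move=> /Omega_norm_has_inf [ne _]; apply: lb_le_inf => //.
by move=> _ [x [y [_ _ _ ->]]]; rewrite mulr_ge0 ?seqs_norm_ge0.
Qed.

Lemma Omega_norm_le xi eta M M' : seqs be xi -> seqs al eta -> 0 <= M -> 0 <= M' ->
  sqb xi (M ^+ 2) -> sqb eta (M' ^+ 2) -> N (omega A xi eta) <= M * M'.
Proof.
move=> sx se M0 M'0 hx he.
have ow : Omega be al A (omega A xi eta) by exists xi => //; exists eta.
have [_ lb] := Omega_norm_has_inf ow.
apply: (@le_trans _ _ (seqs_norm xi * seqs_norm eta)).
  by apply: ge_inf => //; exists xi, eta.
apply: ler_pM; rewrite ?seqs_norm_ge0 //; apply: fam_norm_le => //.
  exact: (seqs_fam bbe).
exact: (seqs_fam bal).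
Qed.

(** [pickle] numbers the index type and zero operators fill the gaps, which changes neither the map
    nor the bounds. *)
Lemma omf_Omega (I : countType) (a b : I -> L -> H) M M' :
  (forall i, be (a i)) -> (forall i, al (b i)) -> fam a -> fam b ->
  0 <= M -> 0 <= M' -> sqb a (M ^+ 2) -> sqb b (M' ^+ 2) ->
  Omega be al A (omf A a b) /\ N (omf A a b) <= M * M'.
Proof.
move=> ba ab fa fb M0 M'0 ha hb.
pose p := @pickle_inv I; pose xi := pad p a; pose eta := pad p b.
have qp : ocancel p pickle := @pickle_invK I.
have pq : pcancel pickle p := @pickleK_inv I.
have fx : fam xi := pad_fam qp fa.
have fe : fam eta := pad_fam qp fb.
have sx : seqs be xi.
  apply: fam_seqs => // k; rewrite /xi /pad; case: (p k) => [i|] //=.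
  by rewrite -cb; exact: cspan0.
have se : seqs al eta.
  apply: fam_seqs => // k; rewrite /eta /pad; case: (p k) => [i|] //=.
  by rewrite -ca; exact: cspan0.
have E : omf A a b = omega A xi eta.
  rewrite omega_omf //; apply: omf_unique => // [T nA|T x y AT].
    by rewrite /omf on_set_out.
  have /(hassum_pad pq qp) := omf_hassum x y fa fb AT.
  apply: eq_hassum => j; rewrite /xi /eta /pad; case: (p j) => //=.
  by rewrite iprod0l.
split; first by rewrite E; exists xi => //; exists eta.
rewrite E; apply: Omega_norm_le => //; exact: (pad_sqb qp).
Qed.

(** Replacing [(xi, eta)] by [(t xi, t^-1 eta)] leaves the map unchanged; with [t ^+ 2 = Q / P] both
    families get the same squared bound [P * Q]. This balance turns a product of norms into a
    quantity that adds up, as the triangle inequality requires. The summand [d] in [P] and [Q] keeps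
    [t] defined and positive when a norm vanishes. *)
Lemma Omega_rep w (e : R) : Omega be al A w -> 0 < e ->
  exists (xi eta : nat -> L -> H) (M : R), [/\ seqs be xi, seqs al eta,
    w = omf A xi eta, 0 <= M & [/\ sqb xi (M ^+ 2), sqb eta (M ^+ 2) & M ^+ 2 <= N w + e]].
Proof.
move=> ow e0.
have [_ [xi [eta [sx se wE ->]]] lt] := inf_adherent e0 (Omega_norm_has_inf ow).
have fx := seqs_fam bbe sx; have fe := seqs_fam bal se.
pose p := seqs_norm xi; pose q := seqs_norm eta.
have p0 : 0 <= p := seqs_norm_ge0 _; have q0 : 0 <= q := seqs_norm_ge0 _.
rewrite -/(N w) -/p -/q in lt.
have [d d0 hd] : exists2 d, 0 < d & (p + d) * (q + d) <= N w + e.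
  have c0 : 0 < p + q + 1 by lra.
  have s0 : 0 < N w + e - p * q by lra.
  exists (Num.min 1 ((N w + e - p * q) / (p + q + 1))).
    by rewrite lt_min ltr01 divr_gt0.
  set d := Num.min _ _.
  have d0 : 0 < d by rewrite lt_min ltr01 divr_gt0.
  have d1 : d <= 1 by rewrite ge_min lexx.
  have d2 : d * (p + q + 1) <= N w + e - p * q.
    by rewrite -ler_pdivlMr // ge_min lexx orbT.
  by nra.
pose P := p + d; pose Q := q + d.
have P0 : 0 < P by rewrite /P; lra.
have Q0 : 0 < Q by rewrite /Q; lra.
have [t t0 t2] := pos_sqrt (divr_gt0 Q0 P0).
have [M M0 M2] := pos_sqrt (mulr_gt0 P0 Q0).
pose xi' k := (t%:C) *: xi k; pose eta' k := (t^-1%:C) *: eta k.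
have fx' : fam xi' := fam_scale _ fx.
have fe' : fam eta' := fam_scale _ fe.
have sx' : seqs be xi'.
  apply: fam_seqs => // k; rewrite -cb /xi' -[_ *: _]addr0; apply: cspan_lin.
    by rewrite cb; case: sx.
  exact: cspan0.
have se' : seqs al eta'.
  apply: fam_seqs => // k; rewrite -ca /eta' -[_ *: _]addr0; apply: cspan_lin.
    by rewrite ca; case: se.
  exact: cspan0.
exists xi', eta', M; split=> //.
- apply: omf_unique => // [T nA|T x y AT]; first by rewrite (Omega_out ow).
  have := omf_hassum x y fx fe AT; rewrite -omega_omf // -wE.
  apply: eq_hassum => k; rewrite /xi' /eta' /= !fctE.
  rewrite (linZ (bounded_lin (hA AT))) iprodZl iprodZr conj_real mulrA -rmorphM.
  by rewrite divff ?gt_eqF // mul1r.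
- exact: ltW.
split.
- apply: sqb_le (sqb_scale (t%:C) (fam_norm_sqb fx)).
  rewrite cabs_real real_normK ?num_real // t2 M2 -/p.
  by apply: ratio_sq_le; rewrite ?lerDl ?(ltW d0).
- apply: sqb_le (sqb_scale (t^-1%:C) (fam_norm_sqb fe)).
  rewrite cabs_real real_normK ?num_real // exprVn t2 M2 -/q invf_div.
  by rewrite mulrC [leRHS]mulrC mulrC; apply: ratio_sq_le; rewrite ?lerDl ?(ltW d0).
by rewrite M2.
Qed.

(** The norm dominates evaluation at each operator. Hence it vanishes only on the zero map, and
    limits in it may be identified pointwise. *)
Lemma Omega_val_bound w T C : Omega be al A w -> A T -> op_bound T C ->
  op_bound (w T) (N w * C).
Proof.
move=> ow AT [C0 hC]; split=> [|x]; first by rewrite mulr_ge0 ?Omega_norm_ge0.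
apply/ler_addgt0Pr => e e0.
have c0 : 0 < C * rnorm x + 1 by have := mulr_ge0 C0 (rnorm_ge0 x); lra.
have [xi [eta [M [sx se -> M0 [hx he hM]]]]] := Omega_rep ow (divr_gt0 e0 c0).
have fx := seqs_fam bbe sx; have fe := seqs_fam bal se.
have ft : fam (fun k => T \o eta k) by apply: fam_comp_left => //; exact: hA.
have hT : sqb (fun k => T \o eta k) ((C * M) ^+ 2).
  move=> F y uF; rewrite exprMn -mulrA.
  apply: le_trans (ler_wpM2l (sqr_ge0 C) (he F y uF)); rewrite mulr_sumr.
  apply: ler_sum => i _; rewrite -exprMn ler_sqr ?nnegrE ?rnorm_ge0 ?mulr_ge0 ?rnorm_ge0 //.
  exact: hC.
have [_ /(_ x)] := pairing_bound fx ft M0 (mulr_ge0 C0 M0) hx hT.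
rewrite /omf on_set_in // => /le_trans; apply.
have -> : M * (C * M) * rnorm x = M ^+ 2 * (C * rnorm x) by ring.
apply: le_trans (ler_wpM2r (mulr_ge0 C0 (rnorm_ge0 x)) hM) _.
rewrite mulrDl mulrA lerD2l mulrAC ler_pdivrMr // ler_wpM2l ?(ltW e0) //.
by rewrite lerDl.
Qed.

End OmegaSpace.

(** * Sums, limits and the Banach space structure *)

Section OmegaBanach.
Variables (R : realType) (L H : hilbertType R).
Variables (be al : set (L -> H)) (A : set (H -> H)).
Hypotheses (cb : cspan be = be) (ca : cspan al = al).
Hypothesis hA : A `<=` @bounded_op R H H.

Let bbe : be `<=` @bounded_op R L H := sub_bounded cb.
Let bal : al `<=` @bounded_op R L H := sub_bounded ca.
Let N := Omega_norm be al A.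
Let O := Omega be al A.

(** Concatenating the columns represents the sum of all [omf A (a k) (b k)] by a single pair. Since
    [a k] and [b k] share the bound [M k], both concatenations are bounded by [C], and the norm is
    at most [sqrt C * sqrt C]. Addition uses the index type [bool], infinite sums use [nat]. *)
Lemma bigfam_omf (K I : countType) (a b : K -> I -> L -> H) (M : K -> R) C :
  (forall k i, be (a k i)) -> (forall k i, al (b k i)) ->
  (forall k, fam (a k)) -> (forall k, fam (b k)) ->
  (forall k, sqb (a k) (M k)) -> (forall k, sqb (b k) (M k)) -> 0 <= C ->
  (forall F, uniq F -> \sum_(k <- F) M k <= C) ->
  (forall e : R, 0 < e -> exists F0 : seq K, forall F, uniq F ->
     (forall k, k \in F -> k \notin F0) -> \sum_(k <- F) M k <= e) ->
  exists w, [/\ O w, N w <= C & forall T x y, A T ->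
    hassum (fun k => iprod x (omf A (a k) (b k) T y)) (iprod x (w T y))].
Proof.
move=> ab bb fa fb Ma Mb C0 hC tail.
have f1 : fam (bigfam a) := bigfam_fam fa Ma tail.
have f2 : fam (bigfam b) := bigfam_fam fb Mb tail.
have s0 : 0 <= Num.sqrt C := sqrtr_ge0 C.
have s2 : Num.sqrt C ^+ 2 = C := sqr_sqrtr C0.
have [ow nw] : O (omf A (bigfam a) (bigfam b)) /\
    N (omf A (bigfam a) (bigfam b)) <= Num.sqrt C * Num.sqrt C.
  apply: omf_Omega => //; try (by move=> [k i]; rewrite /bigfam).
    by rewrite s2; apply: bigfam_sqb hC.
  by rewrite s2; apply: bigfam_sqb hC.
rewrite -expr2 s2 in nw.
exists (omf A (bigfam a) (bigfam b)); split=> // T x y AT.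
apply: (hassum_fubini (omf_hassum hA x y f1 f2 AT)) => k.
exact: (omf_hassum hA x y (fa k) (fb k) AT).
Qed.

Lemma Omega_ext w w' : O w -> O w' ->
  (forall T x y, A T -> iprod x (w T y) = iprod x (w' T y)) -> w = w'.
Proof.
move=> ow ow' h; apply/funext => T; have [AT|nA] := pselect (A T); last first.
  by rewrite (Omega_out ow) // (Omega_out ow').
by apply/funext => y; apply: iprod_ext => x; apply: h.
Qed.

Lemma Omega_add w w' : O w -> O w' -> O (w + w') /\ N (w + w') <= N w + N w'.
Proof.
move=> ow ow'.
have key (e : R) : 0 < e -> O (w + w') /\ N (w + w') <= N w + N w' + e.
  move=> e0; have e2 : 0 < e / 2 by lra.
  have [xi [eta [M [sx se wE M0 [hx he hM]]]]] := Omega_rep cb ca hA ow e2.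
  have [xi' [eta' [M' [sx' se' wE' M0' [hx' he' hM']]]]] := Omega_rep cb ca hA ow' e2.
  have := @bigfam_omf bool nat (fun k => if k then xi else xi')
    (fun k => if k then eta else eta') (fun k => if k then M ^+ 2 else M' ^+ 2)
    (N w + N w' + e).
  case.
  - by case=> k; [case: sx|case: sx'].
  - by case=> k; [case: se|case: se'].
  - by case; [exact: (seqs_fam bbe)|exact: (seqs_fam bbe)].
  - by case; [exact: (seqs_fam bal)|exact: (seqs_fam bal)].
  - by case.
  - by case.
  - by have := sqr_ge0 M; have := sqr_ge0 M'; lra.
  - move=> F uF.
    apply: (@le_trans _ _ (\sum_(k <- [:: true; false]) (if k then M ^+ 2 else M' ^+ 2))).
      by apply: ler_sum_subset => // -[]; rewrite ?sqr_ge0 // !inE.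
    by rewrite big_cons big_seq1; lra.
  - move=> d d0; exists [:: true; false] => F _ dF.
    case: F dF => [_|k F /(_ k (mem_head _ _))]; first by rewrite big_nil ltW.
    by case: k.
  move=> v [ov nv hv].
  suff -> : w + w' = v by [].
  apply/funext => T; have [AT|nA] := pselect (A T); last first.
    by rewrite fctE (Omega_out ow) // (Omega_out ow') // (Omega_out ov) // addr0.
  apply/funext => y; apply: iprod_ext => x.
  apply: hassum_unique _ (hv T x y AT) => d d0.
  exists [:: true; false] => F uF sF.
  have pF : perm_eq F [:: true; false].
    by apply: uniq_perm => // k; rewrite sF //; case: k.
  rewrite (perm_big _ pF) /= big_cons big_seq1 -wE -wE' !fctE iprodDr subrr.
  by rewrite cabs0 ltW.
have [h _] := key 1 ltr01; split=> //; apply/ler_addgt0Pr => e e0.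
by case: (key e e0).
Qed.

Lemma Omega_scale_le (c : R[i]) w : O w -> O (c *: w) /\ N (c *: w) <= cabs c * N w.
Proof.
move=> ow.
have key (e : R) : 0 < e -> O (c *: w) /\ N (c *: w) <= cabs c * (N w + e).
  move=> e0.
  have [xi [eta [M [sx se wE M0 [hx he hM]]]]] := Omega_rep cb ca hA ow e0.
  have fx := seqs_fam bbe sx; have fe := seqs_fam bal se.
  pose eta' k := c *: eta k.
  have fe' : fam eta' := fam_scale _ fe.
  have [ho hn] : O (omf A xi eta') /\ N (omf A xi eta') <= M * (cabs c * M).
    apply: omf_Omega => //.
    - by case: sx.
    - move=> k; rewrite -ca /eta' -[_ *: _]addr0; apply: cspan_lin.
        by rewrite ca; case: se.
      exact: cspan0.
    - by rewrite mulr_ge0 ?cabs_ge0.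
    - by rewrite exprMn; apply: sqb_scale.
  have -> : c *: w = omf A xi eta'.
    apply: omf_unique => // [T nA|T x y AT].
      by rewrite fctE (Omega_out ow) // scaler0.
    (* Scaling is obtained from linearity used twice: [c f + f], then minus [f]. *)
    have h := hassum_lin c (omf_hassum hA x y fx fe AT) (omf_hassum hA x y fx fe AT).
    have := hassum_lin (-1) (omf_hassum hA x y fx fe AT) h.
    rewrite -wE !fctE iprodZr addrCA mulN1r addNr addr0; apply: eq_hassum => k.
    by rewrite /eta' /= !fctE (linZ (bounded_lin (hA AT))) iprodZr addrCA mulN1r addNr addr0.
  split=> //; apply: le_trans hn _.
  by rewrite mulrCA -expr2 ler_wpM2l ?cabs_ge0.
have [h _] := key 1 ltr01; split=> //; apply/ler_addgt0Pr => e e0.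
have c0 : 0 < cabs c + 1 by have := cabs_ge0 c; lra.
have [_ h2] := key _ (divr_gt0 e0 c0).
apply: le_trans h2 _; rewrite mulrDr lerD2l mulrA ler_pdivrMr // mulrC.
by rewrite ler_wpM2l ?(ltW e0) // lerDl.
Qed.

Lemma Omega0 : O 0 /\ N 0 <= 0.
Proof.
have f0 : fam (fun _ : nat => 0 : L -> H).
  split=> [k|e e0]; first exact: bounded0.
  exists [::] => F x _ _; rewrite big1 => [|i _]; last by rewrite rnorm0 expr0n.
  by rewrite mulr_ge0 ?(ltW e0) // sqr_ge0.
have s0 : sqb (fun _ : nat => 0 : L -> H) (0 ^+ 2).
  by move=> F x _; rewrite expr0n mul0r big1 // => i _; rewrite rnorm0 expr0n.
have b0 (i : nat) : be 0 by rewrite -cb; exact: cspan0.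
have a0 (i : nat) : al 0 by rewrite -ca; exact: cspan0.
have [ho hn] := omf_Omega cb ca hA b0 a0 f0 f0 (lexx 0) (lexx 0) s0 s0.
suff -> : 0 = omf A (fun _ : nat => 0 : L -> H) (fun _ : nat => 0 : L -> H) by rewrite mulr0 in hn.
apply: omf_unique => // T x y AT.
have := omf_hassum hA x y f0 f0 AT.
move=> _ e e0; exists [::] => F _ _.
rewrite iprod0r subr0 big1 ?cabs0 ?ltW // => i _.
by rewrite iprod0l.
Qed.

Lemma Omega_lin (a : R[i]) w w' : O w -> O w' -> O (a *: w + w').
Proof.
by move=> ow ow'; apply: (proj1 (Omega_add _ ow')); apply: (proj1 (Omega_scale_le a ow)).
Qed.

Lemma Omega_opp w : O w -> O (- w) /\ N (- w) <= N w.
Proof.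
move=> ow; have := Omega_scale_le (-1) ow.
by rewrite scaleN1r cabsN cabs1 mul1r.
Qed.

Lemma Omega_sub w w' : O w -> O w' -> O (w - w') /\ N (w - w') <= N w + N w'.
Proof.
move=> ow ow'; have [ov nv] := Omega_opp ow'; have [ho hn] := Omega_add ow ov.
by split=> //; apply: le_trans hn _; rewrite lerD2l.
Qed.

(** The differences of a fast subsequence have balanced representatives, so every tail of their
    series is one concatenation. The tail from [K] on is the difference between the limit and the
    [K]-th term, and its bound is the rate of convergence. *)
Lemma Omega_complete (u : nat -> (H -> H) -> L -> L) : (forall n, O (u n)) ->
  (forall e : R, 0 < e -> exists n0, forall m n, (n0 <= m)%N -> (n0 <= n)%N ->
     N (u m - u n) < e) ->
  exists2 x, O x & forall e : R, 0 < e -> exists n0, forall n, (n0 <= n)%N ->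
    N (u n - x) <= e.
Proof.
move=> ou cau.
have [g hg] := choice (fun k => cau _ (half_pow_gt0 R k)).
(* The running maximum makes the subsequence monotone, so both terms of [v k] lie beyond [g k]. *)
pose f k := (\max_(j < k.+1) g j)%N.
have gf k : (g k <= f k)%N by apply: (leq_bigmax (ord_max : 'I_k.+1)).
have ff k : (f k <= f k.+1)%N by rewrite /f [leqRHS]big_ord_recr /= leq_maxl.
pose v k := u (f k.+1) - u (f k).
have ov k : O (v k) by case: (Omega_sub (ou (f k.+1)) (ou (f k))).
have nv k : N (v k) <= 2^-1 ^+ k.
  by apply: ltW; apply: hg => //; apply: leq_trans (gf k) (ff k).
have rep k : exists p : (nat -> L -> H) * (nat -> L -> H),
    [/\ seqs be p.1, seqs al p.2, v k = omf A p.1 p.2 &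
        sqb p.1 (2 * 2^-1 ^+ k) /\ sqb p.2 (2 * 2^-1 ^+ k)].
  have [xi [eta [M [sx se wE M0 [hx he hM]]]]] := Omega_rep cb ca hA (ov k) (half_pow_gt0 R k).
  have h : M ^+ 2 <= 2 * 2^-1 ^+ k.
    apply: le_trans hM _; apply: le_trans (lerD (nv k) (lexx _)) _.
    by rewrite mulrDl mul1r.
  by exists (xi, eta); split=> //; split; apply: sqb_le h _.
have [p hp] := choice rep.
pose r : R := 2^-1.
(* The bounds [2 * r ^+ (K + k)] of the representatives sum to [4 * r ^+ K]. *)
have tailK K : exists w, [/\ O w, N w <= 4 * r ^+ K & forall T x y, A T ->
    hassum (fun k => iprod x (v (K + k)%N T y)) (iprod x (w T y))].
  have := @bigfam_omf nat nat (fun k => (p (K + k)%N).1)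
    (fun k => (p (K + k)%N).2) (fun k => 2 * r ^+ (K + k)) (4 * r ^+ K).
  case.
  - by move=> k i; case: (hp (K + k)%N) => -[].
  - by move=> k i; case: (hp (K + k)%N) => _ [].
  - by move=> k; apply: (seqs_fam bbe); case: (hp (K + k)%N).
  - by move=> k; apply: (seqs_fam bal); case: (hp (K + k)%N).
  - by move=> k; case: (hp (K + k)%N) => _ _ _ [].
  - by move=> k; case: (hp (K + k)%N) => _ _ _ [].
  - by rewrite mulr_ge0 // ltW // half_pow_gt0.
  - move=> F uF; rewrite -mulr_sumr.
    have -> : \sum_(k <- F) r ^+ (K + k) = \sum_(k <- map (addn K) F) r ^+ k.
      by rewrite big_map.
    have h : \sum_(k <- map (addn K) F) r ^+ k <= 2 * r ^+ K.
      apply: half_pow_sum; first by rewrite map_inj_uniq //; exact: addnI.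
      by move=> _ /mapP[k _ ->]; exact: leq_addr.
    by move: h; rewrite -/r; move: (\sum_(k <- _) _) (r ^+ K) => *; lra.
  - move=> e e0; have [n hn] := half_pow_small (divr_gt0 e0 (ltr0n _ 4)).
    exists (iota 0 n) => F uF dF; rewrite -mulr_sumr.
    have -> : \sum_(k <- F) r ^+ (K + k) = \sum_(k <- map (addn K) F) r ^+ k.
      by rewrite big_map.
    have h : \sum_(k <- map (addn K) F) r ^+ k <= 2 * r ^+ n.
      apply: half_pow_sum; first by rewrite map_inj_uniq //; exact: addnI.
      move=> _ /mapP[k kF ->]; have := dF k kF.
      by rewrite mem_iota add0n /= -leqNgt => /leq_trans; apply; exact: leq_addl.
    by move: h hn; rewrite -/r; move: (\sum_(k <- _) _) (r ^+ n) => *; lra.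
  move=> w [ow nw hw]; exists w; split=> // T x y AT; apply: eq_hassum (hw T x y AT) => k.
  by case: (hp (K + k)%N) => _ _ -> _.
have [s hs] := choice tailK.
have step K : s K = v K + s K.+1.
  have [w1 _ h1] := hs K; have [w2 _ h2] := hs K.+1.
  apply: Omega_ext => // [|T x y AT]; first by case: (Omega_add (ov K) w2).
  have := hassum_shift (h1 T x y AT); rewrite addn0 => h3.
  have h4 : hassum (fun k => iprod x (v (K + k.+1)%N T y)) (iprod x (s K.+1 T y)).
    by apply: eq_hassum (h2 T x y AT) => k; rewrite addSnnS.
  by rewrite fctE iprodDr -(hassum_unique h3 h4) addrC subrK.
pose x := u (f 0%N) + s 0%N.
have xE K : x = u (f K) + s K.
  elim: K => // K ->; rewrite step /v addrA; congr (_ + _).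
  by rewrite addrC subrK.
have ox : O x by case: (Omega_add (ou (f 0%N)) (let: And3 h _ _ := hs 0%N in h)).
exists x => // e e0.
(* One share for the distance to the subsequence, four for the tail. *)
have [K hK] := half_pow_small (divr_gt0 e0 (ltr0n _ 5)).
exists (f K) => n hn; rewrite (xE K) opprD addrA.
have [os ns _] := hs K.
have [w1 _] := Omega_sub (ou n) (ou (f K)).
have [_ h1] := Omega_sub w1 os.
apply: le_trans h1 _.
have h2 : N (u n - u (f K)) <= r ^+ K.
  by apply: ltW; apply: hg; [exact: leq_trans hn|].
by move: h2 ns hK; rewrite -/r; move: (N _) (N _) (r ^+ K) => *; lra.
Qed.

Lemma Omega_banach : banach_space O N.
Proof.
split.
- by case: Omega0.
- exact: Omega_lin.
- by move=> w; apply: Omega_norm_ge0.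
- move=> w ow n0; apply: Omega_ext => //; first by case: Omega0.
  move=> T x y AT.
  have [C C0 hC] := op_bound_gt0 (hA AT).
  have [_ /(_ y)] := Omega_val_bound cb ca hA ow AT hC.
  rewrite -/N n0 !mul0r => h.
  have -> : w T y = 0.
    by apply: rnorm_eq0; apply/eqP; rewrite eq_le h rnorm_ge0.
  by [].
- move=> c w ow; have [ho hn] := Omega_scale_le c ow.
  apply/eqP; rewrite -/(cabs c) eq_le; apply/andP; split=> //.
  have [c0|c0] := eqVneq c 0.
    by rewrite {1}c0 cabs0 mul0r Omega_norm_ge0.
  have [_] := Omega_scale_le (c^-1) ho; rewrite scalerA mulVf // scale1r => h.
  apply: le_trans (ler_wpM2l (cabs_ge0 c) h) _.
  by rewrite mulrA -cabsM mulfV // cabs1 mul1r.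
- by move=> w w' ow ow'; case: (Omega_add ow ow').
move=> u ou cau; have [x ox hx] := Omega_complete ou cau.
exists x => //; apply/cvgrPdist_le => e e0.
have [n0 h] := hx e e0; exists n0 => // n /= hn.
rewrite sub0r normrN ger0_norm; first exact: h.
by apply: Omega_norm_ge0; case: (Omega_sub (ou n) ox).
Qed.

End OmegaBanach.

(** * Projective tensor products *)

Lemma linear_pack (K : nzRingType) (V W : lmodType K) (f : V -> W) :
  linear f -> exists g : {linear V -> W}, g =1 f.
Proof.
move=> lf.
pose g : {linear V -> W} := HB.pack f (GRing.isLinear.Build K V W *:%R f lf).
by exists g.
Qed.

Lemma bilinear_pack (K : comNzRingType) (V V' W : lmodType K) (f : V -> V' -> W) :
  (forall y, linear (f^~ y)) -> (forall x, linear (f x)) ->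
  exists g : {bilinear V -> V' -> W}, forall x y, g x y = f x y.
Proof.
move=> lf lg.
have h : bilinear_for *:%R *:%R f by split=> [y|x]; [apply: lf|apply: lg].
pose g : {bilinear V -> V' -> W} :=
  HB.pack f (bilinear_isBilinear.Build K V V' W *:%R *:%R f h).
by exists g.
Qed.

(** [tensor_eq] tests against maps that are bilinear on all of [E] and [F], whereas the map to be
    factored is bilinear only on [S] and [S']. Separating functionals permit the passage between the
    two. *)
Definition separated (K : pzRingType) (E : lmodType K) : Prop :=
  forall x : E, x != 0 -> exists2 phi : E -> K,
    (forall a u v, phi (a *: u + v) = a * phi u + phi v) & phi x != 0.

(** Composed with such projections, a map that is bilinear on [S] and [S'] becomes bilinear
    everywhere without changing on finitely many given tensors. Each new vector [x] costs a
    correction of rank one, along [x - P x] and by a functional that does not vanish there. *)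
Lemma finite_projection (K : fieldType) (E : lmodType K) (S : set E) (s : seq E) :
  separated E -> S 0 -> (forall a x y, S x -> S y -> S (a *: x + y)) ->
  (forall x, x \in s -> S x) ->
  exists P : E -> E, [/\ linear P, forall x, S (P x) & forall x, x \in s -> P x = x].
Proof.
move=> sep S0 Sl; elim: s => [|x s IH] hs.
  exists (fun=> 0); split=> // a u v; by rewrite scaler0 addr0.
have [|P [lP SP Ps]] := IH; first by move=> y ys; apply: hs; rewrite inE ys orbT.
have Sx : S x by apply: hs; rewrite mem_head.
pose r := x - P x.
have Sr : S r by rewrite /r addrC -scaleN1r; apply: Sl.
have [r0|r0] := eqVneq r 0.
  exists P; split=> // y; rewrite inE => /orP[/eqP ->|/Ps //].
  by apply/esym/eqP; rewrite -subr_eq0 -/r r0.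
have [phi lphi phir] := sep r r0.
pose c y := phi (y - P y) / phi r.
have lc a u v : c (a *: u + v) = a * c u + c v.
  rewrite /c lP opprD addrACA -scalerBr lphi mulrDl mulrA; congr (_ + _).
exists (fun y => P y + c y *: r); split.
- by move=> a u v /=; rewrite lc lP scalerDl -scalerA addrACA -scalerDr.
- by move=> y; rewrite addrC; apply: Sl.
have phi00 : phi 0 = 0.
  by have := lphi (-1) 0 0; rewrite scaler0 addr0 mulN1r addNr.
move=> y; rewrite inE => /orP[/eqP ->|ys].
  by rewrite /c -/r divff // scale1r /r addrC subrK.
by rewrite /c (Ps _ ys) subrr phi00 mul0r scale0r addr0.
Qed.

Section BanachSpace.
Variables (R : realType) (E : lmodType R[i]) (S : set E) (N : E -> R).
Hypothesis bS : banach_space S N.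

Lemma bs_opp x : S x -> S (- x).
Proof.
move=> Sx; rewrite -scaleN1r -[_ *: _]addr0.
by apply: (bs_lin bS) => //; exact: bs_zero bS.
Qed.

Lemma bs_add x y : S x -> S y -> S (x + y).
Proof. by move=> Sx Sy; rewrite -[x]scale1r; apply: (bs_lin bS). Qed.

Lemma bs_sub x y : S x -> S y -> S (x - y).
Proof. by move=> Sx Sy; apply: bs_add => //; apply: bs_opp. Qed.

Lemma bs_normN x : S x -> N (- x) = N x.
Proof.
move=> Sx; rewrite -scaleN1r (bs_scale bS) //.
by rewrite -/(cabs _) cabsN cabs1 mul1r.
Qed.

Lemma bs_norm0 : N 0 = 0.
Proof.
have := bs_scale bS 0 (bs_zero bS); rewrite scale0r -/(cabs _) cabs0 mul0r.
exact.
Qed.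

Lemma bs_normB x y : S x -> S y -> N (x - y) = N (y - x).
Proof. by move=> Sx Sy; rewrite -bs_normN ?opprB //; apply: bs_sub. Qed.

Lemma bs_sum (I : eqType) (s : seq I) (F : I -> E) (M : I -> R) :
  (forall i, i \in s -> S (F i) /\ N (F i) <= M i) ->
  S (\sum_(i <- s) F i) /\ N (\sum_(i <- s) F i) <= \sum_(i <- s) M i.
Proof.
elim: s => [|i s IH] h.
  by rewrite !big_nil bs_norm0; split=> //; exact: bs_zero bS.
have [Si Ni] := h i (mem_head _ _).
have [|Ss Ns] := IH; first by move=> j js; apply: h; rewrite inE js orbT.
rewrite !big_cons; split; first exact: bs_add.
by apply: le_trans (bs_tri bS Si Ss) _; apply: lerD.
Qed.

Lemma bs_limit (u : nat -> E) : (forall n, S (u n)) ->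
  (forall e : R, 0 < e -> exists n0, forall m n, (n0 <= m)%N -> (n0 <= n)%N ->
     N (u m - u n) <= e) ->
  exists2 x, S x & forall e : R, 0 < e -> exists n0, forall n, (n0 <= n)%N ->
    N (u n - x) <= e.
Proof.
move=> Su cau; have [e e0|x Sx hx] := bs_complete bS Su.
  have [n0 h] := cau _ (divr_gt0 e0 (ltr0n _ 2)); exists n0 => m n hm hn.
  by apply: le_lt_trans (h m n hm hn) _; lra.
exists x => // e e0; have /cvgrPdist_le /(_ e e0) [n0 _ h] := hx.
exists n0 => n hn; have := h n hn; rewrite sub0r normrN ger0_norm //.
by apply: (bs_ge0 bS); apply: bs_sub.
Qed.

End BanachSpace.

Section ProjContraction.
Variables (R : realType) (E F G : lmodType R[i]).
Variables (S : set E) (N : E -> R) (S' : set F) (N' : F -> R).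
Variables (U : set G) (NU : G -> R) (m : E -> F -> G).
Hypotheses (sE : separated E) (sF : separated F).
Hypotheses (bS : banach_space S N) (bS' : banach_space S' N').
Hypothesis bU : banach_space U NU.
Hypothesis lm : bilinear_on S S' m.
Hypothesis mU : forall x y, S x -> S' y -> U (m x y) /\ NU (m x y) <= N x * N' y.

Let B (s : seq (E * F)) : G := \sum_(p <- s) m p.1 p.2.

Lemma tensor_eq_bilinear s s' : in_tensor S S' s -> in_tensor S S' s' ->
  tensor_eq s s' -> B s = B s'.
Proof.
move=> ts ts' eqs.
have [|P [lP SP Ps]] := finite_projection (s := map fst (s ++ s')) sE (bs_zero bS) (bs_lin bS).
  by move=> x /mapP[p]; rewrite mem_cat => /orP[/ts|/ts'] [h _] ->.
have [|Q [lQ SQ Qs]] := finite_projection (s := map snd (s ++ s')) sF (bs_zero bS') (bs_lin bS').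
  by move=> x /mapP[p]; rewrite mem_cat => /orP[/ts|/ts'] [_ h] ->.
have [||g gE] := @bilinear_pack _ _ _ _ (fun x y => m (P x) (Q y)).
- by move=> y a u v /=; rewrite lP (proj1 lm).
- by move=> x a u v /=; rewrite lQ (proj2 lm).
have := eqs _ g.
suff h t : {subset t <= s ++ s'} -> \sum_(p <- t) g p.1 p.2 = B t.
  by rewrite !h // => p hp; rewrite mem_cat hp ?orbT.
move=> sub; rewrite /B big_seq [RHS]big_seq; apply: eq_bigr => p pt.
by rewrite gE Ps ?Qs //; apply/mapP; exists p => //; apply: sub.
Qed.

Lemma in_tensor_bound s : in_tensor S S' s ->
  U (B s) /\ NU (B s) <= \sum_(p <- s) N p.1 * N' p.2.
Proof. by move=> ts; apply: (bs_sum bU) => p /ts [h1 h2]; apply: mU. Qed.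

Lemma B_proj_norm s : in_tensor S S' s -> NU (B s) <= proj_norm S N S' N' s.
Proof.
move=> ts; apply: lb_le_inf.
  by exists (\sum_(p <- s) N p.1 * N' p.2), s.
move=> _ [s' [ts' eqs ->]]; rewrite (tensor_eq_bilinear ts ts' eqs).
by case: (in_tensor_bound ts').
Qed.

Lemma proj_contractionI : proj_contraction S N S' N' U NU m.
Proof.
move=> P t pt.
have [lt1 lt2] := pt_bilinear pt.
pose T (s : seq (E * F)) : P := \sum_(p <- s) t p.1 p.2.
have BT s : in_tensor S S' s -> NU (B s) <= rnorm (T s).
  by move=> ts; rewrite (pt_norm pt) //; exact: B_proj_norm.
have t0 y : S' y -> t 0 y = 0.
  move=> Sy; have := lt1 (-1) 0 0 y (bs_zero bS) (bs_zero bS) Sy.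
  by rewrite scaler0 addr0 scaleN1r addNr.
have tZ a x y : S x -> S' y -> t (a *: x) y = a *: t x y.
  move=> Sx Sy; have := lt1 a x 0 y Sx (bs_zero bS) Sy.
  by rewrite !addr0 t0 // addr0.
have m0 y : S' y -> m 0 y = 0.
  move=> Sy; have := proj1 lm (-1) 0 0 y (bs_zero bS) (bs_zero bS) Sy.
  by rewrite scaler0 addr0 scaleN1r addNr.
have mZ a x y : S x -> S' y -> m (a *: x) y = a *: m x y.
  move=> Sx Sy; have := proj1 lm a x 0 y Sx (bs_zero bS) Sy.
  by rewrite !addr0 m0 // addr0.
pose sc (a : R[i]) (s : seq (E * F)) := [seq (a *: p.1, p.2) | p <- s].
have SZ a x : S x -> S (a *: x).
  by move=> Sx; rewrite -[_ *: _]addr0; apply: (bs_lin bS) => //; exact: bs_zero bS.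
have sc_in a s s' : in_tensor S S' s -> in_tensor S S' s' -> in_tensor S S' (sc a s ++ s').
  move=> hs hs' p; rewrite mem_cat => /orP[/mapP[q /hs [h1 h2] ->]|/hs' //].
  by split=> //=; apply: SZ.
have Tsc a s s' : in_tensor S S' s -> T (sc a s ++ s') = a *: T s + T s'.
  move=> hs; rewrite /T big_cat big_map scaler_sumr; congr (_ + _).
  by rewrite big_seq [RHS]big_seq; apply: eq_bigr => p /hs [? ?]; exact: tZ.
have Bsc a s s' : in_tensor S S' s -> B (sc a s ++ s') = a *: B s + B s'.
  move=> hs; rewrite /B big_cat big_map scaler_sumr; congr (_ + _).
  by rewrite big_seq [RHS]big_seq; apply: eq_bigr => p /hs [? ?]; exact: mZ.
have UB s : in_tensor S S' s -> U (B s) by move=> /in_tensor_bound [].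
have near_ex p (e : R) : 0 < e -> exists s, in_tensor S S' s /\ rnorm (p - T s) <= e.
  move=> e0; have : [set: P] p by [].
  rewrite -(pt_dense pt) => /closureP_rnorm /(_ e e0) [q hq pq].
  suff [s [hs qE]] : exists s, in_tensor S S' s /\ q = T s.
    by exists s; rewrite -qE.
  move: q hq {pq}; apply: lspan_ind.
    by exists [::]; rewrite /T big_nil.
  move=> a _ v [x Sx [y Sy <-]] [s [hs ->]].
  exists ((a *: x, y) :: s); split; last by rewrite /T big_cons tZ.
  by move=> q; rewrite inE => /orP[/eqP ->|/hs //]; split=> //=; apply: SZ.
(* The closure of the graph [T s |-> B s], as in the extension of bounded operators; here the limits
   are taken in [U] for the norm [NU]. *)
pose rel p g := U g /\ forall e : R, 0 < e -> exists s,
  [/\ in_tensor S S' s, rnorm (p - T s) <= e & NU (g - B s) <= e].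
have rel_ex p : exists g, rel p g.
  have pos n : 0 < n.+1%:R^-1 :> R by rewrite invr_gt0 ltr0n.
  have [s hs] := choice (fun n => near_ex p _ (pos n)).
  have Us n : U (B (s n)) by apply: UB; case: (hs n).
  have [e e0|g Ug hg] := bs_limit bU Us.
    have [n0 h] := archi_inv (divr_gt0 e0 (ltr0n _ 2)).
    exists n0 => i j hi hj.
    have [ti ni] := hs i; have [tj nj] := hs j.
    have -> : B (s i) - B (s j) = B (sc (-1) (s j) ++ s i).
      by rewrite Bsc // scaleN1r addrC.
    apply: le_trans (BT _ (sc_in _ _ _ tj ti)) _.
    rewrite Tsc // scaleN1r addrC; apply: le_trans (rnorm_dist _ p _) _.
    rewrite rnormB; have := h i hi; have := h j hj.
    move: ni nj; move: (rnorm (p - T (s i))) (rnorm (p - T (s j))) (i.+1%:R^-1) (j.+1%:R^-1) => *; lra.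
  exists g; split=> // e e0.
  have [N1 h1] := archi_inv e0; have [N2 h2] := hg _ e0.
  have [tk nk] := hs (maxn N1 N2).
  exists (s (maxn N1 N2)); split=> //.
    by apply: le_trans nk _; apply: h1; apply: leq_maxl.
  by rewrite (bs_normB bU) //; apply: h2; apply: leq_maxr.
have rel_bd p g : rel p g -> NU g <= rnorm p.
  move=> [Ug h]; apply/ler_addgt0Pr => d d0.
  have [s [ts h1 h2]] := h _ (divr_gt0 d0 (ltr0n _ 2)).
  have h3 : NU g <= NU (g - B s) + NU (B s).
    by have := bs_tri bU (bs_sub bU Ug (UB _ ts)) (UB _ ts); rewrite subrK.
  have h4 : rnorm (T s) <= rnorm (p - T s) + rnorm p.
    by have := rnormD (T s - p) p; rewrite subrK rnormB.
  have h5 := BT s ts; move: h1 h2 h3 h4 h5.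
  by move: (NU _) (NU _) (NU _) (rnorm (T s)) (rnorm (p - T s)) (rnorm p) => *; lra.
have rel_lin a p g p' g' : rel p g -> rel p' g' -> rel (a *: p + p') (a *: g + g').
  move=> [Ug h] [Ug' h']; split=> [|d d0]; first exact: (bs_lin bU).
  have ca : 0 < cabs a + 1 by have := cabs_ge0 a; lra.
  have [s [ts h1 h2]] := h _ (divr_gt0 (divr_gt0 d0 (ltr0n _ 2)) ca).
  have [s' [ts' h3 h4]] := h' _ (divr_gt0 d0 (ltr0n _ 2)).
  have fin (x y : R) : 0 <= x -> x <= d / 2 / (cabs a + 1) -> y <= d / 2 -> cabs a * x + y <= d.
    move=> x0 hx hy; have : (cabs a + 1) * x <= d / 2 by rewrite mulrC -ler_pdivlMr.
    by lra.
  exists (sc a s ++ s'); split; first exact: sc_in.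
    rewrite Tsc //; have -> : a *: p + p' - (a *: T s + T s') = a *: (p - T s) + (p' - T s').
      by rewrite scalerBr opprD addrACA.
    apply: le_trans (rnormD _ _) _; rewrite rnormZ.
    by apply: fin; rewrite ?rnorm_ge0.
  rewrite Bsc //; have -> : a *: g + g' - (a *: B s + B s') = a *: (g - B s) + (g' - B s').
    by rewrite scalerBr opprD addrACA.
  have U1 := bs_sub bU Ug (UB _ ts); have U2 := bs_sub bU Ug' (UB _ ts').
  have U3 : U (a *: (g - B s)).
    by rewrite -[_ *: _]addr0; apply: (bs_lin bU) => //; exact: bs_zero bU.
  apply: le_trans (bs_tri bU U3 U2) _; rewrite (bs_scale bU) // -/(cabs a).
  by apply: fin => //; apply: (bs_ge0 bU).
have rel_uniq p g g' : rel p g -> rel p g' -> g = g'.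
  move=> h h'; apply/eqP; rewrite -subr_eq0; apply/eqP.
  have Ud := bs_sub bU (proj1 h) (proj1 h').
  apply: (bs_eq0 bU Ud); apply/eqP; rewrite eq_le (bs_ge0 bU Ud) andbT.
  have := rel_bd _ _ (rel_lin (-1) _ _ _ _ h' h).
  by rewrite !scaleN1r addNr rnorm0 addrC.
have [f hf] := choice rel_ex.
have lf : linear f.
  by move=> a p q; apply: rel_uniq (hf _) _; apply: rel_lin.
have [f' f'E] := linear_pack lf.
exists f'; split=> [p|x y Sx Sy]; rewrite f'E.
  by split; [case: (hf p)|exact: rel_bd].
apply: rel_uniq (hf _) _; split; first by case: (mU Sx Sy).
move=> e e0; exists [:: (x, y)]; rewrite /T /B !big_seq1 !subrr rnorm0 (bs_norm0 bU).
by split; rewrite ?ltW // => q; rewrite inE => /eqP ->.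
Qed.

End ProjContraction.

Lemma separated_ops (R : realType) (X : Type) (L : hilbertType R) :
  separated (X -> L -> L : lmodType R[i]).
Proof.
move=> w w0.
have [T [z wz]] : exists T z, w T z != 0.
  apply: contrapT => h; case/eqP: w0; apply/funext => T; apply/funext => z.
  by apply/eqP; apply: contrapT => /negP h'; apply: h; exists T, z.
exists (fun v => iprod (w T z) (v T z)).
  by move=> a u v; rewrite !fctE iprodDr iprodZr.
apply: contra wz => /eqP h; apply/eqP/rnorm_eq0; apply/eqP.
by rewrite -sqrf_eq0 -Re_iprodxx h.
Qed.

(** * Relative tensor products *)

Section Total.
Variables (R : realType).
Implicit Types G H K L : hilbertType R.

Lemma iprod_ext_total G (D : set G) (u v : G) : cspan_vec D = setT ->
  (forall x, D x -> iprod x u = iprod x v) -> u = v.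
Proof.
move=> tD h; apply: iprod_ext => x; move/cspan_vecP: tD => tD.
apply/eqP; rewrite -subr_eq0 -iprodBr; apply/eqP/cabs_small => e e0.
have c0 : 0 < rnorm (u - v) + 1 by have := rnorm_ge0 (u - v); lra.
have [y Dy xy] := tD x _ (divr_gt0 e0 c0).
have y0 : iprod y (u - v) = 0.
  move: y Dy {xy}; apply: lspan_ind; first by rewrite iprod0l.
  move=> a y z Dy IH; rewrite iprodDl iprodZl IH addr0 iprodBr h // subrr.
  by rewrite mulr0.
rewrite -[iprod x _]subr0 -y0 -iprodBl.
apply: le_trans (cauchy_schwarz _ _) _.
apply: le_trans (ler_wpM2r (rnorm_ge0 _) xy) _.
rewrite mulrAC ler_pdivrMr // ler_wpM2l ?(ltW e0) //.
by rewrite lerDl.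
Qed.

Definition vals H L (be : set (L -> H)) : set H :=
  [set xi z | xi in be & z in [set: L]].

Lemma eq_on_vals H K L (be : set (L -> H)) (S T : H -> K) :
  cspan_vec (vals be) = setT -> bounded_op S -> bounded_op T ->
  (forall xi z, be xi -> S (xi z) = T (xi z)) -> S = T.
Proof.
move=> tb bS bT h; apply: (eq_bounded_total tb bS bT) => _ [xi bx [z _ <-]].
exact: h.
Qed.

Lemma iprod_ext_vals H L (be : set (L -> H)) (u v : H) :
  cspan_vec (vals be) = setT ->
  (forall xi z, be xi -> iprod (xi z) u = iprod (xi z) v) -> u = v.
Proof.
move=> tb h; apply: (iprod_ext_total tb) => _ [xi bx [z _ <-]]; exact: h.
Qed.

Definition ev H L (be : set (L -> H)) (p : {xi | be xi} * L) : H := sval p.1 p.2.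

Lemma total_ev H L (be : set (L -> H)) :
  cspan_vec (vals be) = setT -> cspan_vec (range (@ev H L be)) = setT.
Proof.
move=> tb; apply: (total_sub tb) => _ [xi bx [z _ <-]]; apply: lspan_gen.
by exists (exist _ xi bx, z).
Qed.

Lemma iter_bound H (S : H -> H) M n x : op_bound S M ->
  rnorm (iter n S x) <= M ^+ n * rnorm x.
Proof.
move=> [M0 hS]; elim: n => [|n IH]; first by rewrite mul1r.
rewrite iterS exprS -mulrA; apply: le_trans (hS _) _.
exact: ler_wpM2l.
Qed.

(* The algebraic identity behind the representation attached to a module:
   [xi z |-> xi (c z)] is well defined and bounded as soon as [c] and its
   adjoint commute with all [xi^* xi']. *)
Lemma mult_exists H L (be : set (L -> H)) (c : L -> L) M :
  be `<=` @bounded_op R L H -> cspan_vec (vals be) = setT ->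
  bounded_op c -> op_bound c M ->
  (forall xi xi' z, be xi -> be xi' ->
     adj c (adj xi (xi' z)) = adj xi (xi' (adj c z))) ->
  exists X : H -> H, [/\ bounded_op X, op_bound X M &
    forall xi z, be xi -> X (xi z) = xi (c z)].
Proof.
move=> bb tb bc hc comm; have [M0 _] := hc.
pose f (p : {xi | be xi} * L) : H := sval p.1 (c p.2).
(* The twist [c^* c] acts on the [L]-component only, so for a fixed [xi] its iterates grow at most
   like the powers of [M ^+ 2]. *)
pose a (p : {xi | be xi} * L) := (p.1, adj c (c p.2)).
have bx (x : {xi | be xi}) : bounded_op (sval x) by case: x => x /= /bb.
have fE i j : iprod (f i) (f j) = iprod (ev i) (ev (a j)).
  case: i j => [x z] [x' z']; rewrite /f /ev /a /=.
  rewrite -[LHS](adjPr _ _ (bx x)) -[LHS](adjPr _ _ bc) comm.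
  - by rewrite adjPr //; exact: bx.
  - by case: (x).
  - by case: (x').
have badc := bounded_adj bc.
have hK : op_bound (adj c \o c) (M ^+ 2).
  by rewrite expr2; exact: (op_bound_comp (adj_bound bc hc) hc).
have gr i : exists C, forall n, rnorm (ev (iter n a i)) <= C * (M ^+ 2) ^+ n.
  case: i => x z; have [C C0 [_ hC]] := op_bound_gt0 (bx x).
  exists (C * rnorm z) => n.
  have -> : iter n a (x, z) = (x, iter n (adj c \o c) z).
    by elim: n => [//|n IH]; rewrite !iterS IH.
  apply: le_trans (hC _) _; rewrite -mulrA ler_pM2l // mulrC.
  exact: iter_bound.
have [X [lX bX Xe]] := ext_dom (sqr_ge0 M) (total_ev tb) fE gr.
rewrite sqrtr_sqr ger0_norm // in bX.
exists X; split=> //; first by split=> //; exists M.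
by move=> xi z bxi; exact: (Xe (exist _ xi bxi, z)).
Qed.

End Total.

(** * Kets and operators on relative tensor products *)

Section Adm.
Variables (R : realType) (L : hilbertType R).

(** [adm_comm] is the trace of the base: inner products from the two legs commute, as the two
    algebras of the base do. The condition is symmetric in the legs, so facts about [ket1] follow
    from those about [ket2]. *)
Record adm (H K : hilbertType R) (be : set (L -> H)) (ga : set (L -> K)) : Prop := Adm {
  adm_bl : be `<=` @bounded_op R L H ;
  adm_br : ga `<=` @bounded_op R L K ;
  adm_tl : cspan_vec (vals be) = setT ;
  adm_tr : cspan_vec (vals ga) = setT ;
  adm_comm : forall xi xi' eta eta' z, be xi -> be xi' -> ga eta -> ga eta' ->
    adj xi (xi' (adj eta (eta' z))) = adj eta (eta' (adj xi (xi' z)))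
}.

Lemma adm_sym (H K : hilbertType R) (be : set (L -> H)) (ga : set (L -> K)) :
  adm be ga -> adm ga be.
Proof. by case=> *; split=> // *; symmetry; auto. Qed.

Section FlipT.
Variables (H K : hilbertType R) (be : set (L -> H)) (ga : set (L -> K)).
Hypothesis ab : adm be ga.
Variable T : rtp be ga.

Lemma flipT_iprod eta eta' z z' xi xi' :
  ga eta -> ga eta' -> be xi -> be xi' ->
  iprod (tens T xi z eta) (tens T xi' z' eta')
  = iprod z (adj eta (eta' (adj xi (xi' z')))).
Proof. by move=> ge ge' bx bx'; rewrite tens_iprod // (adm_comm ab z' bx bx' ge ge'). Qed.

Lemma flipT_total :
  cspan_vec [set v | exists eta z xi,
    [/\ ga eta, be xi & v = tens T xi z eta]] = [set: T].
Proof.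
apply: (total_sub (tens_total T)) => v [xi [z [eta [bx ge ->]]]].
by apply: lspan_gen; exists eta, z, xi.
Qed.

(* The same Hilbert space with the two legs exchanged; [ket1 T] is convertible
   to [ket2 flipT]. *)
Definition flipT : rtp ga be := @Rtp R L K H ga be T (fun eta z xi => tens T xi z eta)
  (fun eta eta' z z' xi xi' => @flipT_iprod eta eta' z z' xi xi') flipT_total.

End FlipT.

Section Kets.
Variables (H K : hilbertType R) (be : set (L -> H)) (ga : set (L -> K)).
Hypothesis ab : adm be ga.
Variable T : rtp be ga.

Let bl xi : be xi -> bounded_op xi. Proof. exact: (adm_bl ab). Qed.
Let br eta : ga eta -> bounded_op eta. Proof. exact: (adm_br ab). Qed.

Lemma ket2_exists eta M : ga eta -> op_bound eta M ->
  exists X : H -> T, [/\ bounded_op X, op_bound X M &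
    forall xi z, be xi -> X (xi z) = tens T xi z eta].
Proof.
move=> ge he; have be' := br ge; have [M0 _] := he.
pose f (p : {xi | be xi} * L) : T := tens T (sval p.1) p.2 eta.
(* The prescribed inner product is [<xi z, xi' (eta^* eta z')>], a twist by [eta^* eta]. *)
pose a (p : {xi | be xi} * L) := (p.1, adj eta (eta p.2)).
have bx (x : {xi | be xi}) : bounded_op (sval x) by case: x => x /= /bl.
have fE i j : iprod (f i) (f j) = iprod (ev i) (ev (a j)).
  case: i j => [[x px] z] [[x' px'] z']; rewrite /f /ev /a /= tens_iprod //.
  by rewrite adjPr //; exact: bl.
have hK : op_bound (adj eta \o eta) (M ^+ 2).
  by rewrite expr2; exact: (op_bound_comp (adj_bound be' he) he).
have gr i : exists C, forall n, rnorm (ev (iter n a i)) <= C * (M ^+ 2) ^+ n.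
  case: i => x z; have [C C0 [_ hC]] := op_bound_gt0 (bx x).
  exists (C * rnorm z) => n.
  have -> : iter n a (x, z) = (x, iter n (adj eta \o eta) z).
    by elim: n => [//|n IH]; rewrite !iterS IH.
  apply: le_trans (hC _) _; rewrite -mulrA ler_pM2l // mulrC.
  exact: iter_bound.
have [X [lX bX Xe]] := ext_dom (sqr_ge0 M) (total_ev (adm_tl ab)) fE gr.
rewrite sqrtr_sqr ger0_norm // in bX.
exists X; split=> //; first by split=> //; exists M.
by move=> xi z bxi; exact: (Xe (exist _ xi bxi, z)).
Qed.

Lemma ket2_spec eta : ga eta -> bounded_op (ket2 T eta) /\
  forall xi z, be xi -> ket2 T eta (xi z) = tens T xi z eta.
Proof.
move=> ge; have [M M0 hM] := op_bound_gt0 (br ge).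
have [X [bX _ hX]] := ket2_exists ge hM.
exact: (@xgetPex _ (fun=> 0) [set X | bounded_op X /\
    forall xi z, be xi -> X (xi z) = tens T xi z eta] (ex_intro _ X (conj bX hX))).
Qed.

Lemma ket2_bounded eta : ga eta -> bounded_op (ket2 T eta).
Proof. by move/ket2_spec => []. Qed.

Lemma ket2E eta xi z : ga eta -> be xi -> ket2 T eta (xi z) = tens T xi z eta.
Proof. by move/ket2_spec => [_]; apply. Qed.

Lemma ket2_iprod eta eta' xi z v : ga eta -> ga eta' -> be xi ->
  iprod (ket2 T eta v) (ket2 T eta' (xi z)) = iprod v (xi (adj eta (eta' z))).
Proof.
move=> ge ge' bx; rewrite -adjPr; last exact: ket2_bounded.
congr (iprod v _).
apply: (iprod_ext_vals (adm_tl ab)) => xi' z' bx'.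
rewrite adjPr; last exact: ket2_bounded.
by rewrite !ket2E // tens_iprod // adjPr //; exact: bl.
Qed.

Lemma ket2_gram eta eta' xi z : ga eta -> ga eta' -> be xi ->
  adj (ket2 T eta) (ket2 T eta' (xi z)) = xi (adj eta (eta' z)).
Proof.
move=> ge ge' bx; apply: iprod_ext => v.
by rewrite adjPr ?ket2_iprod //; exact: ket2_bounded.
Qed.

Lemma ket2_total : cspan_vec [set ket2 T eta v | eta in ga & v in [set: H]] = setT.
Proof.
apply: (total_sub (tens_total T)) => _ [xi [z [eta [bx ge ->]]]].
apply: lspan_gen; exists eta => //; exists (xi z) => //.
by rewrite ket2E.
Qed.

(** The sum of the operators [|a_i>_2^* |a_i>_2] sends [xi z] to [xi (c z)] with
    [c = \sum_i a_i^* a_i], and [mult_exists] bounds it by the bound of [c]. Thus a column of kets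
    inherits the constant of the column it comes from. *)
Lemma ket2_fam_sum (I : eqType) (a : I -> L -> K) (M : R) (F : seq I) :
  (forall i, ga (a i)) -> 0 <= M ->
  (forall x, \sum_(i <- F) rnorm (a i x) ^+ 2 <= M * rnorm x ^+ 2) ->
  forall v, \sum_(i <- F) rnorm (ket2 T (a i) v) ^+ 2 <= M * rnorm v ^+ 2.
Proof.
move=> ga_a M0 hM.
have ba i : bounded_op (a i) by exact: br.
have bk i : bounded_op (ket2 T (a i)) by exact: ket2_bounded.
pose c : L -> L := \sum_(i <- F) (adj (a i) \o a i).
have hc : op_bound c M.
  have s2 : Num.sqrt M ^+ 2 = M by rewrite sqr_sqrtr.
  rewrite -s2 expr2; apply: op_bound_pairing_sum; rewrite ?sqrtr_ge0 ?s2 //.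
have bc : bounded_op c.
  by apply: bounded_sum => i; apply: bounded_comp => //; exact: bounded_adj.
have ac : adj c = c.
  apply: adj_unique => // x y; rewrite /c !fct_sumE iprod_suml iprod_sumr.
  apply: eq_bigr => i _ /=; rewrite adjP // ?adjPr //; exact: bounded_adj.
have comm xi xi' z : be xi -> be xi' ->
    adj c (adj xi (xi' z)) = adj xi (xi' (adj c z)).
  move=> bx bx'; rewrite ac /c !fct_sumE.
  have lx := bounded_lin (bounded_adj (bl bx)).
  rewrite (lin_sum (bounded_lin (bl bx'))) (lin_sum lx).
  by apply: eq_bigr => i _; exact: esym (adm_comm ab z bx bx' (ga_a i) (ga_a i)).
have [X [bX hX XE]] := mult_exists (adm_bl ab) (adm_tl ab) bc hc comm.
have XS v : \sum_(i <- F) rnorm (ket2 T (a i) v) ^+ 2 = complex.Re (iprod v (X v)).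
  rewrite (sum_adj_sq F (a := fun i => ket2 T (a i)) v bk); congr (complex.Re (iprod v _)).
  move: v; apply/funeqP; apply: (eq_on_vals (adm_tl ab)) => //.
    by apply: bounded_sum => i; apply: bounded_comp => //; exact: bounded_adj.
  move=> xi z bx; rewrite XE // /c !fct_sumE (lin_sum (bounded_lin (bl bx))).
  by apply: eq_bigr => i _ /=; rewrite ket2_gram.
move=> v; rewrite XS; apply: le_trans (Re_le_cabs _) _.
apply: le_trans (cauchy_schwarz _ _) _; have [_ /(_ v) h] := hX.
by apply: le_trans (ler_wpM2l (rnorm_ge0 v) h) _; rewrite mulrCA -expr2.
Qed.

Lemma ket2_sqb (I : eqType) (a : I -> L -> K) (M : R) :
  (forall i, ga (a i)) -> 0 <= M -> sqb a M -> sqb (fun i => ket2 T (a i)) M.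
Proof. by move=> ga_a M0 h F x uF; apply: ket2_fam_sum => // y; apply: h. Qed.

Lemma ket2_fam (I : eqType) (a : I -> L -> K) :
  (forall i, ga (a i)) -> fam a -> fam (fun i => ket2 T (a i)).
Proof.
move=> ga_a [ba ua]; split=> [i|e e0]; first exact: ket2_bounded.
have [F0 h] := ua e e0; exists F0 => F x uF dF.
by apply: ket2_fam_sum => // [|y]; [exact: ltW|exact: h].
Qed.

(** On ket vectors the form of [S (x) id] is twisted by [S^* S], provided that [S^*] also commutes
    with the operators [|eta>_2^* |eta'>_2]; this follows from the commutation for [S] by taking
    adjoints. *)
Lemma op_id_spec (S : H -> H) : bounded_op S ->
  (forall eta eta' v, ga eta -> ga eta' ->
     S (adj (ket2 T eta) (ket2 T eta' v)) = adj (ket2 T eta) (ket2 T eta' (S v))) ->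
  bounded_op (op_id T T S) /\
  forall eta v, ga eta -> op_id T T S (ket2 T eta v) = ket2 T eta (S v).
Proof.
move=> bS comm.
have bk eta : ga eta -> bounded_op (ket2 T eta) := @ket2_bounded eta.
have bAS := bounded_adj bS.
have comm' eta eta' v : ga eta -> ga eta' ->
    adj S (adj (ket2 T eta) (ket2 T eta' v)) = adj (ket2 T eta) (ket2 T eta' (adj S v)).
  move=> ge ge'; apply: iprod_extl => x.
  have b1 := bk _ ge; have b2 := bk _ ge'.
  rewrite [LHS]adjP // [LHS]adjP // -[LHS]adjPr // -comm //.
  by rewrite [RHS]adjP // -[RHS]adjPr // [RHS]adjP.
have [M M0 hM] := op_bound_gt0 bS.
pose e (p : {eta | ga eta} * H) : T := ket2 T (sval p.1) p.2.
pose f (p : {eta | ga eta} * H) : T := ket2 T (sval p.1) (S p.2).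
pose a (p : {eta | ga eta} * H) := (p.1, adj S (S p.2)).
have te : cspan_vec (range e) = setT.
  apply: (total_sub ket2_total) => _ [eta ge [v _ <-]]; apply: lspan_gen.
  by exists (exist _ eta ge, v).
have fE i j : iprod (f i) (f j) = iprod (e i) (e (a j)).
  case: i j => [[x px] v] [[x' px'] v']; rewrite /f /e /a /=.
  have b1 := bk _ px.
  by rewrite -[LHS]adjPr // -[LHS]adjPr // comm' // adjPr.
have hK : op_bound (adj S \o S) (M ^+ 2).
  by rewrite expr2; exact: (op_bound_comp (adj_bound bS hM) hM).
have gr i : exists C, forall n, rnorm (e (iter n a i)) <= C * (M ^+ 2) ^+ n.
  case: i => [[x px] v]; have [C C0 [_ hC]] := op_bound_gt0 (bk _ px).
  exists (C * rnorm v) => n.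
  have -> : iter n a (exist _ x px, v) = (exist _ x px, iter n (adj S \o S) v).
    by elim: n => [//|n IH]; rewrite !iterS IH.
  apply: le_trans (hC _) _; rewrite -mulrA ler_pM2l // mulrC.
  exact: iter_bound.
have [X [lX bX Xe]] := ext_dom (sqr_ge0 M) te fE gr.
have [bI hI] : bounded_op (op_id T T S) /\ forall eta, ga eta ->
    op_id T T S \o ket2 T eta = ket2 T eta \o S.
  apply: (@xgetPex _ (fun=> 0) [set X | bounded_op X /\ forall eta, ga eta ->
    X \o ket2 T eta = ket2 T eta \o S]).
  exists X; split; first by split=> //; exists (Num.sqrt (M ^+ 2)).
  by move=> eta ge; apply/funext => v; exact: (Xe (exist _ eta ge, v)).
by split=> // eta v ge; have /(congr1 (@^~ v)) := hI eta ge.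
Qed.

End Kets.

Section TensIsometry.
Variables (H K H' K' : hilbertType R).
Variables (be : set (L -> H)) (ga : set (L -> K)) (be' : set (L -> H')) (ga' : set (L -> K')).
Variables (T : rtp be ga) (T' : rtp be' ga').
Variables (phi : (L -> H) -> (L -> H')) (psi : (L -> K) -> (L -> K')).
Hypotheses (hphi : forall xi, be xi -> be' (phi xi)) (hpsi : forall eta, ga eta -> ga' (psi eta)).
Hypothesis gphi : forall xi xi' z, be xi -> be xi' ->
  adj (phi xi) (phi xi' z) = adj xi (xi' z).
Hypothesis gpsi : forall eta eta' z, ga eta -> ga eta' ->
  adj (psi eta) (psi eta' z) = adj eta (eta' z).

(** Only Gram data matter: maps of the two modules that preserve inner products induce an isometry.
    The flip and the amplification of a unitary are instances. *)
Lemma tens_isometry : exists X : T -> T', bounded_op X /\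
  forall xi z eta, be xi -> ga eta -> X (tens T xi z eta) = tens T' (phi xi) z (psi eta).
Proof.
pose e (p : {xi | be xi} * L * {eta | ga eta}) := tens T (sval p.1.1) p.1.2 (sval p.2).
pose f (p : {xi | be xi} * L * {eta | ga eta}) :=
  tens T' (phi (sval p.1.1)) p.1.2 (psi (sval p.2)).
have te : cspan_vec (range e) = setT.
  apply: (total_sub (tens_total T)) => _ [xi [z [eta [bx ge ->]]]]; apply: lspan_gen.
  by exists (exist _ xi bx, z, exist _ eta ge).
have fE i j : iprod (f i) (f j) = iprod (e i) (e j).
  case: i j => [[[x px] z] [y py]] [[[x' px'] z'] [y' py']]; rewrite /f /e /=.
  by rewrite !tens_iprod ?gphi ?gpsi //; auto.
have [X [bX Xe]] := ext_isom te fE.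
exists X; split=> // xi z eta bx ge.
exact: (Xe (exist _ xi bx, z, exist _ eta ge)).
Qed.

End TensIsometry.

End Adm.

Section Ket1.
Variables (R : realType) (L H K : hilbertType R) (be : set (L -> H)) (ga : set (L -> K)).
Hypothesis ab : adm be ga.
Variable T : rtp be ga.
Let F := flipT ab T.
Let ab' := adm_sym ab.

Lemma ket1_bounded xi : be xi -> bounded_op (ket1 T xi).
Proof. exact: (ket2_bounded ab' F). Qed.

Lemma ket1E xi eta z : be xi -> ga eta -> ket1 T xi (eta z) = tens T xi z eta.
Proof. exact: (ket2E ab' F). Qed.

Lemma ket12 xi eta z : be xi -> ga eta -> ket1 T xi (eta z) = ket2 T eta (xi z).
Proof. by move=> bx ge; rewrite ket1E // (ket2E ab). Qed.

Lemma ket1_gram xi xi' eta z : be xi -> be xi' -> ga eta ->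
  adj (ket1 T xi) (ket1 T xi' (eta z)) = eta (adj xi (xi' z)).
Proof. exact: (ket2_gram ab' F). Qed.

Lemma ket1_total : cspan_vec [set ket1 T xi v | xi in be & v in [set: K]] = setT.
Proof. exact: (ket2_total ab' F). Qed.

Lemma ket1_sqb (I : eqType) (a : I -> L -> H) (M : R) :
  (forall i, be (a i)) -> 0 <= M -> sqb a M -> sqb (fun i => ket1 T (a i)) M.
Proof. exact: (ket2_sqb ab' F). Qed.

Lemma ket1_fam (I : eqType) (a : I -> L -> H) :
  (forall i, be (a i)) -> fam a -> fam (fun i => ket1 T (a i)).
Proof. exact: (ket2_fam ab' F). Qed.

Lemma ltri_closed (J : hilbertType R) (alpha : set (J -> H)) :
  cspan (ltri T alpha) = ltri T alpha.
Proof.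
apply/seteqP; split; last by move=> x hx; apply: cspan_gen => //; exact: cspan_bounded hx.
by apply: cspan_sub.
Qed.

Lemma rtri_closed (J : hilbertType R) (delta : set (J -> K)) :
  cspan (rtri T delta) = rtri T delta.
Proof.
apply/seteqP; split; last by move=> x hx; apply: cspan_gen => //; exact: cspan_bounded hx.
by apply: cspan_sub.
Qed.

Lemma ltri_gen (J : hilbertType R) (alpha : set (J -> H)) eta x :
  alpha `<=` @bounded_op R J H -> ga eta -> alpha x -> ltri T alpha (ket2 T eta \o x).
Proof.
move=> ba ge ax; apply: cspan_gen; last by exists eta => //; exists x.
by apply: bounded_comp; [exact: (ket2_bounded ab)|exact: ba].
Qed.

Lemma rtri_gen (J : hilbertType R) (delta : set (J -> K)) xi x :
  delta `<=` @bounded_op R J K -> be xi -> delta x -> rtri T delta (ket1 T xi \o x).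
Proof.
move=> ba ge ax; apply: cspan_gen; last by exists xi => //; exists x.
by apply: bounded_comp; [exact: ket1_bounded|exact: ba].
Qed.

End Ket1.

(** * The box product *)

Section Box.
Variables (R : realType) (L H : hilbertType R) (Y X : set (L -> H)).
Hypothesis ab : adm Y X.
Variable T : rtp Y X.
Variables (A : set (H -> H)) (A2 : set (T -> T)).
Hypotheses (cX : cspan X = X) (cY : cspan Y = Y).
Hypotheses (hA : A `<=` @bounded_op R H H) (hA2 : A2 `<=` @bounded_op R T T).
Hypothesis slice2 : forall S xi xi', A2 S -> X xi -> X xi' ->
  A (adj (ket2 T xi) \o S \o ket2 T xi').
Hypothesis slice1 : forall S eta eta', A2 S -> Y eta -> Y eta' ->
  A (adj (ket1 T eta) \o S \o ket1 T eta').

Let bX : X `<=` @bounded_op R L H := adm_br ab.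
Let bY : Y `<=` @bounded_op R L H := adm_bl ab.
Let O := Omega X Y A.
Let N := Omega_norm X Y A.
Let O2 := Omega (ltri T X) (rtri T Y) A2.
Let N2 := Omega_norm (ltri T X) (rtri T Y) A2.

Definition thL (xi xi' : nat -> L -> H) (p : nat * nat) : L -> T :=
  ket2 T (xi' p.2) \o xi p.1.
Definition thR (eta eta' : nat -> L -> H) (p : nat * nat) : L -> T :=
  ket1 T (eta p.1) \o eta' p.2.
Definition boxv (xi eta xi' eta' : nat -> L -> H) : (T -> T) -> L -> L :=
  omf A2 (thL xi xi') (thR eta eta').

Let sw (p : nat * nat) := (p.2, p.1).
Let swK : pcancel sw (fun p => Some (sw p)). Proof. by case. Qed.
Let swO : ocancel (fun p => Some (sw p)) sw. Proof. by case. Qed.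

Section Reps.
Variables (xi eta xi' eta' : nat -> L -> H).
Hypotheses (sx : seqs X xi) (se : seqs Y eta) (sx' : seqs X xi') (se' : seqs Y eta').

Let fx := seqs_fam bX sx.
Let fe := seqs_fam bY se.
Let fx' := seqs_fam bX sx'.
Let fe' := seqs_fam bY se'.
Let ax k : X (xi k). Proof. by case: sx. Qed.
Let ae k : Y (eta k). Proof. by case: se. Qed.
Let ax' k : X (xi' k). Proof. by case: sx'. Qed.
Let ae' k : Y (eta' k). Proof. by case: se'. Qed.

Lemma thL_fam : fam (thL xi xi').
Proof.
have h : fam (cfam (fun n => ket2 T (xi' n)) xi).
  by apply: cfam_fam => //; apply: (ket2_fam ab).
exact: (pad_fam swO h).
Qed.

Lemma thR_fam : fam (thR eta eta').
Proof.
by apply: (cfam_fam (a := fun n => ket1 T (eta n))) => //; apply: (ket1_fam ab).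
Qed.

Lemma thL_sqb M M' : 0 <= M' -> sqb xi M -> sqb xi' M' -> sqb (thL xi xi') (M * M').
Proof.
move=> M0 h h'; rewrite mulrC.
have := cfam_sqb M0 (ket2_sqb ab T ax' M0 h') h.
by move/(pad_sqb swO).
Qed.

Lemma thR_sqb M M' : 0 <= M -> sqb eta M -> sqb eta' M' -> sqb (thR eta eta') (M * M').
Proof. by move=> M0 h h'; exact: (cfam_sqb M0 (ket1_sqb ab T ae M0 h) h'). Qed.

Lemma thL_ltri p : ltri T X (thL xi xi' p).
Proof. exact: (ltri_gen ab). Qed.

Lemma thR_rtri p : rtri T Y (thR eta eta' p).
Proof. exact: (rtri_gen ab). Qed.

Lemma boxv_hassum S z w : A2 S ->
  hassum (fun p => iprod (thL xi xi' p z) (S (thR eta eta' p w)))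
    (iprod z (boxv xi eta xi' eta' S w)).
Proof. by move=> AS; apply: (omf_hassum hA2) => //; [exact: thL_fam|exact: thR_fam]. Qed.

(** The part of the box product summed over the first factor, [\sum_m xi_m^* <v|_2 S |eta_m>_1]. On
    a vector [ba w] it is the first map evaluated at the slice [<v|_2 S |ba>_2], hence independent
    of the families representing that map. [rsl] does the same for the second factor. *)
Definition lsl (v : L -> H) (S : T -> T) : H -> L :=
  pairing (fun m => ket2 T v \o xi m) (fun m => S \o ket1 T (eta m)).

Definition rsl (v : L -> H) (S : T -> T) : L -> H :=
  pairing (fun n => ket2 T (xi' n)) (fun n => S \o (ket1 T v \o eta' n)).

Lemma lsl_fams v S : X v -> A2 S ->
  fam (fun m => ket2 T v \o xi m) /\ fam (fun m => S \o ket1 T (eta m)).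
Proof.
move=> Xv AS; split; first by apply: fam_comp_left => //; exact: (ket2_bounded ab).
by apply: fam_comp_left; [exact: hA2|exact: (ket1_fam ab)].
Qed.

Lemma rsl_fams v S : Y v -> A2 S ->
  fam (fun n => ket2 T (xi' n)) /\ fam (fun n => S \o (ket1 T v \o eta' n)).
Proof.
move=> Yv AS; split; first exact: (ket2_fam ab).
apply: fam_comp_left; first exact: hA2.
by apply: fam_comp_left => //; exact: (ket1_bounded ab).
Qed.

Lemma lsl_bounded v S : X v -> A2 S -> bounded_op (lsl v S).
Proof. by move=> Xv AS; have [? ?] := lsl_fams Xv AS; exact: pairing_bounded. Qed.

Lemma lsl_val v S ba w : X v -> A2 S -> X ba ->
  lsl v S (ba w) = omf A xi eta (adj (ket2 T v) \o S \o ket2 T ba) w.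
Proof.
move=> Xv AS Xb; apply: iprod_ext => z; have [f1 f2] := lsl_fams Xv AS.
apply: hassum_unique (pairing_hassum f1 f2 (ba w) z) _.
have := omf_hassum hA z w fx fe (slice2 AS Xv Xb); apply: eq_hassum => m /=.
by rewrite adjPr; [rewrite (ket12 ab)|exact: (ket2_bounded ab)].
Qed.

Lemma rsl_val v S al z w : Y v -> A2 S -> Y al ->
  iprod (al z) (rsl v S w) = iprod z (omf A xi' eta' (adj (ket1 T al) \o S \o ket1 T v) w).
Proof.
move=> Yv AS Ya; have [f1 f2] := rsl_fams Yv AS.
apply: hassum_unique (pairing_hassum f1 f2 w (al z)) _.
have := omf_hassum hA z w fx' fe' (slice1 AS Ya Yv); apply: eq_hassum => n /=.
by rewrite adjPr; [rewrite (ket12 ab)|exact: (ket1_bounded ab)].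
Qed.

Lemma boxv_lsl S z w : A2 S ->
  hassum (fun n => iprod z (lsl (xi' n) S (eta' n w))) (iprod z (boxv xi eta xi' eta' S w)).
Proof.
move=> AS; have /(hassum_pad swK swO) h := boxv_hassum z w AS.
apply: (hassum_fubini h) => n /=; have [f1 f2] := lsl_fams (ax' n) AS.
exact: (pairing_hassum f1 f2 (eta' n w) z).
Qed.

Lemma boxv_rsl S z w : A2 S ->
  hassum (fun m => iprod (xi m z) (rsl (eta m) S w)) (iprod z (boxv xi eta xi' eta' S w)).
Proof.
move=> AS; apply: (hassum_fubini (boxv_hassum z w AS)) => m.
have [f1 f2] := rsl_fams (ae m) AS.
exact: (pairing_hassum f1 f2 w (xi m z)).
Qed.

Lemma boxv_Omega M M' : 0 <= M -> 0 <= M' ->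
  sqb xi (M ^+ 2) -> sqb eta (M ^+ 2) -> sqb xi' (M' ^+ 2) -> sqb eta' (M' ^+ 2) ->
  O2 (boxv xi eta xi' eta') /\ N2 (boxv xi eta xi' eta') <= M ^+ 2 * M' ^+ 2.
Proof.
move=> M0 M0' h1 h2 h3 h4; rewrite -exprMn expr2.
apply: omf_Omega => //; rewrite ?mulr_ge0 ?exprMn //.
- exact: ltri_closed.
- exact: rtri_closed.
- exact: thL_ltri.
- exact: thR_rtri.
- exact: thL_fam.
- exact: thR_fam.
- by apply: thL_sqb => //; exact: sqr_ge0.
- by apply: thR_sqb => //; exact: sqr_ge0.
Qed.

Lemma box_reindex (i : nat * nat -> nat) (theta theta' : nat -> L -> T) :
  bijective i -> (forall m n, theta (i (m, n)) = ket2 T (xi' n) \o xi m) ->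
  (forall m n, theta' (i (m, n)) = ket1 T (eta m) \o eta' n) ->
  [/\ seqs (ltri T X) theta, seqs (rtri T Y) theta' &
      boxv xi eta xi' eta' = omega A2 theta theta'].
Proof.
move=> [j ij ji] hth hth'.
pose p k := Some (j k).
have pq : pcancel i p by move=> x; rewrite /p ij.
have qp : ocancel p i by move=> x; rewrite /p /= ji.
have E : theta = pad p (thL xi xi').
  apply/funext => k; rewrite /pad /p /=; case: (j k) (ji k) => m n <-; exact: hth.
have E' : theta' = pad p (thR eta eta').
  apply/funext => k; rewrite /pad /p /=; case: (j k) (ji k) => m n <-; exact: hth'.
have f1 : fam theta by rewrite E; apply: (pad_fam qp); exact: thL_fam.
have f2 : fam theta' by rewrite E'; apply: (pad_fam qp); exact: thR_fam.
have s1 : seqs (ltri T X) theta.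
  by apply: fam_seqs => // k; rewrite E /pad /p /=; exact: thL_ltri.
have s2 : seqs (rtri T Y) theta'.
  by apply: fam_seqs => // k; rewrite E' /pad /p /=; exact: thR_rtri.
split=> //; rewrite (omega_omf (ltri_closed _ _) (rtri_closed _ _) hA2 s1 s2).
apply: omf_unique => // [S nA|S z w AS].
  by rewrite /boxv /omf on_set_out.
have /(hassum_pad pq qp) := boxv_hassum z w AS.
by apply: eq_hassum => k; rewrite E E' /pad /p.
Qed.

End Reps.

(** Representing families are chosen by [xget]; [boxv_ext] shows that the choice is immaterial. *)
Definition box (w w' : (H -> H) -> L -> L) : (T -> T) -> L -> L :=
  xget 0 [set v | exists xi eta xi' eta' : nat -> L -> H,
    [/\ seqs X xi, seqs Y eta, seqs X xi' & seqs Y eta'] /\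
    [/\ w = omf A xi eta, w' = omf A xi' eta' & v = boxv xi eta xi' eta']].

Lemma lsl_lin c xi1 eta1 xi2 eta2 xi3 eta3 v S :
  seqs X xi1 -> seqs Y eta1 -> seqs X xi2 -> seqs Y eta2 -> seqs X xi3 -> seqs Y eta3 ->
  omf A xi3 eta3 = c *: omf A xi1 eta1 + omf A xi2 eta2 -> X v -> A2 S ->
  lsl xi3 eta3 v S = c *: lsl xi1 eta1 v S + lsl xi2 eta2 v S.
Proof.
move=> s1 t1 s2 t2 s3 t3 E Xv AS.
apply: (eq_on_vals (adm_tr ab)).
- exact: lsl_bounded.
- by apply: bounded_lin_comb; exact: lsl_bounded.
by move=> ba w Xb; rewrite !fctE !lsl_val // E.
Qed.

Lemma rsl_lin c xi1 eta1 xi2 eta2 xi3 eta3 v S :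
  seqs X xi1 -> seqs Y eta1 -> seqs X xi2 -> seqs Y eta2 -> seqs X xi3 -> seqs Y eta3 ->
  omf A xi3 eta3 = c *: omf A xi1 eta1 + omf A xi2 eta2 -> Y v -> A2 S ->
  rsl xi3 eta3 v S = c *: rsl xi1 eta1 v S + rsl xi2 eta2 v S.
Proof.
move=> s1 t1 s2 t2 s3 t3 E Yv AS; apply/funext => w.
apply: (iprod_ext_vals (adm_tl ab)) => al z Ya.
by rewrite !fctE iprodDr iprodZr !rsl_val // E !fctE iprodDr iprodZr.
Qed.

Lemma boxv_lin1 c xi1 eta1 xi2 eta2 xi3 eta3 xi' eta' :
  seqs X xi1 -> seqs Y eta1 -> seqs X xi2 -> seqs Y eta2 -> seqs X xi3 -> seqs Y eta3 ->
  seqs X xi' -> seqs Y eta' ->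
  omf A xi3 eta3 = c *: omf A xi1 eta1 + omf A xi2 eta2 ->
  boxv xi3 eta3 xi' eta' = c *: boxv xi1 eta1 xi' eta' + boxv xi2 eta2 xi' eta'.
Proof.
move=> s1 t1 s2 t2 s3 t3 s' t' E; apply/funext => S.
have [AS|nA] := pselect (A2 S); last first.
  have Z x y x' y' : boxv x y x' y' S = 0 by exact: on_set_out.
  transitivity (c *: boxv xi1 eta1 xi' eta' S + boxv xi2 eta2 xi' eta' S) => //.
  by rewrite !Z scaler0 addr0.
apply/funext => w; apply: iprod_ext => z.
apply: hassum_unique (boxv_lsl s3 t3 s' t' z w AS) _.
have := hassum_lin c (boxv_lsl s1 t1 s' t' z w AS) (boxv_lsl s2 t2 s' t' z w AS).
rewrite !fctE iprodDr iprodZr; apply: eq_hassum => n.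
have Xn : X (xi' n) by case: s'.
by rewrite (lsl_lin s1 t1 s2 t2 s3 t3 E Xn AS) !fctE iprodDr iprodZr.
Qed.

Lemma boxv_lin2 c xi1 eta1 xi2 eta2 xi3 eta3 xi eta :
  seqs X xi1 -> seqs Y eta1 -> seqs X xi2 -> seqs Y eta2 -> seqs X xi3 -> seqs Y eta3 ->
  seqs X xi -> seqs Y eta ->
  omf A xi3 eta3 = c *: omf A xi1 eta1 + omf A xi2 eta2 ->
  boxv xi eta xi3 eta3 = c *: boxv xi eta xi1 eta1 + boxv xi eta xi2 eta2.
Proof.
move=> s1 t1 s2 t2 s3 t3 s' t' E; apply/funext => S.
have [AS|nA] := pselect (A2 S); last first.
  have Z x y x' y' : boxv x y x' y' S = 0 by exact: on_set_out.
  transitivity (c *: boxv xi eta xi1 eta1 S + boxv xi eta xi2 eta2 S) => //.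
  by rewrite !Z scaler0 addr0.
apply/funext => w; apply: iprod_ext => z.
apply: hassum_unique (boxv_rsl s' t' s3 t3 z w AS) _.
have := hassum_lin c (boxv_rsl s' t' s1 t1 z w AS) (boxv_rsl s' t' s2 t2 z w AS).
rewrite !fctE iprodDr iprodZr; apply: eq_hassum => n.
have Yn : Y (eta n) by case: t'.
by rewrite (rsl_lin s1 t1 s2 t2 s3 t3 E Yn AS) !fctE iprodDr iprodZr.
Qed.

Lemma boxv_ext xi1 eta1 xi2 eta2 xi1' eta1' xi2' eta2' :
  seqs X xi1 -> seqs Y eta1 -> seqs X xi2 -> seqs Y eta2 ->
  seqs X xi1' -> seqs Y eta1' -> seqs X xi2' -> seqs Y eta2' ->
  omf A xi1 eta1 = omf A xi2 eta2 -> omf A xi1' eta1' = omf A xi2' eta2' ->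
  boxv xi1 eta1 xi1' eta1' = boxv xi2 eta2 xi2' eta2'.
Proof.
move=> s1 t1 s2 t2 s1' t1' s2' t2' E E'.
(* Equality of two maps is fed to the linearity lemmas as a combination with coefficient [0]. *)
have E0 (x y : nat -> L -> H) : omf A x y = 0 *: omf A x y + omf A x y by rewrite scale0r add0r.
have := boxv_lin1 s2 t2 s2 t2 s1 t1 s1' t1' (etrans E (E0 _ _)).
rewrite scale0r add0r => ->.
have := boxv_lin2 s2' t2' s2' t2' s1' t1' s2 t2 (etrans E' (E0 _ _)).
by rewrite scale0r add0r.
Qed.

Lemma box_rep xi eta xi' eta' :
  seqs X xi -> seqs Y eta -> seqs X xi' -> seqs Y eta' ->
  box (omf A xi eta) (omf A xi' eta') = boxv xi eta xi' eta'.
Proof.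
move=> sx se sx' se'.
have [|xi1 [eta1 [xi1' [eta1' [[? ? ? ?] [E E' h]]]]]] := @xgetPex _ 0 [set v |
  exists xi1 eta1 xi1' eta1' : nat -> L -> H,
    [/\ seqs X xi1, seqs Y eta1, seqs X xi1' & seqs Y eta1'] /\
    [/\ omf A xi eta = omf A xi1 eta1, omf A xi' eta' = omf A xi1' eta1' &
      v = boxv xi1 eta1 xi1' eta1']].
  by exists (boxv xi eta xi' eta'), xi, eta, xi', eta'.
by rewrite /box h; apply: boxv_ext.
Qed.

Lemma O_rep w : O w -> exists xi eta : nat -> L -> H,
  [/\ seqs X xi, seqs Y eta & w = omf A xi eta].
Proof.
move=> ow; have [xi [eta [sx se _ wE]]] := Omega_omf cX cY hA ow.
by exists xi, eta.
Qed.

Lemma box_bilinear : bilinear_on O O box.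
Proof.
split=> c w1 w2 w3.
  move=> h1 h2 h3; have h := Omega_lin cX cY hA c h1 h2.
  have [x [y [s t E]]] := O_rep h; rewrite E.
  have [x1 [y1 [s1 t1 E1]]] := O_rep h1; have [x2 [y2 [s2 t2 E2]]] := O_rep h2.
  have [x3 [y3 [s3 t3 ->]]] := O_rep h3.
  rewrite E1 E2 in E *; rewrite !box_rep //; exact: boxv_lin1.
move=> h1 h2 h3; have h := Omega_lin cX cY hA c h2 h3.
have [x [y [s t E]]] := O_rep h; rewrite E.
have [x1 [y1 [s1 t1 ->]]] := O_rep h1; have [x2 [y2 [s2 t2 E2]]] := O_rep h2.
have [x3 [y3 [s3 t3 E3]]] := O_rep h3.
rewrite E2 E3 in E *; rewrite !box_rep //; exact: boxv_lin2.
Qed.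

Lemma box_bound w w' : O w -> O w' -> O2 (box w w') /\ N2 (box w w') <= N w * N w'.
Proof.
move=> ow ow'.
have key (e : R) : 0 < e -> O2 (box w w') /\ N2 (box w w') <= (N w + e) * (N w' + e).
  move=> e0.
  have [xi [eta [M [sx se wE M0 [hx he hM]]]]] := Omega_rep cX cY hA ow e0.
  have [xi' [eta' [M' [sx' se' wE' M0' [hx' he' hM']]]]] := Omega_rep cX cY hA ow' e0.
  have [h1 h2] := boxv_Omega sx se sx' se' M0 M0' hx he hx' he'.
  rewrite [in box _ _]wE [in box _ _]wE' box_rep //; split=> //.
  by apply: le_trans h2 _; apply: ler_pM; rewrite ?sqr_ge0.
have [h _] := key 1 ltr01; split=> //; apply/ler_addgt0Pr => e e0.
have n1 := Omega_norm_ge0 ow; have n2 := Omega_norm_ge0 ow'.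
have c0 : 0 < N w + N w' + 1 by rewrite /N; lra.
(* Chosen so that [(N w + d) * (N w' + d) <= N w * N w' + e]. *)
pose d := Num.min 1 (e / (N w + N w' + 1)).
have d0 : 0 < d by rewrite lt_min ltr01 divr_gt0.
have d1 : d <= 1 by rewrite ge_min lexx.
have d2 : d * (N w + N w' + 1) <= e by rewrite -ler_pdivlMr // ge_min lexx orbT.
have [_ hd] := key d d0; apply: le_trans hd _.
move: n1 n2 d2 d0 d1; rewrite -/(N w) -/(N w'); move: (N w) (N w') d {c0} => p q r *; nra.
Qed.

Lemma box_contraction : proj_contraction O N O N O2 N2 box.
Proof.
apply: proj_contractionI.
- exact: separated_ops.
- exact: separated_ops.
- exact: Omega_banach.
- exact: Omega_banach.
- by apply: Omega_banach => //; [exact: ltri_closed|exact: rtri_closed].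
- exact: box_bilinear.
- exact: box_bound.
Qed.

End Box.

(** * Approximate units built from kets *)

(* Positivity of the polynomials [u_l] in [g] is checked in the multiplicative
   cone spanned by the monomials
   [g^a (1 - g)^b], so no functional calculus is needed. *)
Section Cone.
Variables (R : realType) (G : hilbertType R) (g : G -> G).
Hypothesis lg : linear g.
Hypothesis sg : forall x y, iprod (g x) y = iprod x (g y).
Hypothesis pg : forall v, 0 <= complex.Re (iprod v (g v)).
Hypothesis cg : forall v, complex.Re (iprod v (g v)) <= rnorm v ^+ 2.

Let h v := v - g v.

Inductive cone : (G -> G) -> Prop :=
| cone_mon a b : cone (fun v => iter a g (iter b h v))
| cone_add S S' : cone S -> cone S' -> cone (fun v => S v + S' v).

Let lh : linear h.
Proof. by move=> a x y; rewrite /h lg scalerBr opprD addrACA. Qed.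

Let sh x y : iprod (h x) y = iprod x (h y).
Proof. by rewrite /h iprodBl iprodBr sg. Qed.

Let ph v : 0 <= complex.Re (iprod v (h v)).
Proof. by rewrite /h iprodBr ReB Re_iprodxx subr_ge0. Qed.

Let gh v : g (h v) = h (g v). Proof. by rewrite /h linB. Qed.

Let iter_lin (f : G -> G) n : linear f -> linear (iter n f).
Proof. by move=> lf; elim: n => [//|n IH] a x y; rewrite !iterS IH lf. Qed.

Let iter_sa (f : G -> G) n x y : (forall x y, iprod (f x) y = iprod x (f y)) ->
  iprod (iter n f x) y = iprod x (iter n f y).
Proof. by move=> sf; elim: n x y => [//|n IH] x y; rewrite iterS sf IH -iterSr. Qed.

Let iter_gh a b v : iter b h (iter a g v) = iter a g (iter b h v).
Proof.
have h1 v' : h (iter a g v') = iter a g (h v').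
  by elim: a v' => [//|a IH] v'; rewrite !iterS -gh IH.
by elim: b v => [//|b IH] v; rewrite !iterS IH h1.
Qed.

Lemma cone_linear S : cone S -> linear S.
Proof.
elim=> [a b|S1 S2 _ l1 _ l2] c x y; last by rewrite l1 l2 scalerDr addrACA.
by rewrite iter_lin // iter_lin.
Qed.

Lemma cone_sa S x y : cone S -> iprod (S x) y = iprod x (S y).
Proof.
elim=> [a b|S1 S2 _ s1 _ s2]; last by rewrite iprodDl iprodDr s1 s2.
by rewrite iter_sa // iter_sa // iter_gh.
Qed.

(** Even powers move to the two sides of the form by self-adjointness, which leaves exponents 0 and
    1. The mixed case is [g h = g h g + h g h], from [g + h = 1]. *)
Lemma cone_pos S v : cone S -> 0 <= complex.Re (iprod v (S v)).
Proof.
elim=> [a b|S1 S2 _ p1 _ p2]; last by rewrite iprodDr ReD addr_ge0.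
have red n (P : nat -> Prop) : P 0%N -> P 1%N -> (forall n, P n -> P n.+2) -> P n.
  move=> h0 h1 h2; suff: P n /\ P n.+1 by case.
  by elim: n => [//|n [IH1 IH2]]; split; auto.
elim/red: a v => [v|v|a IH v].
- elim/red: b v => [v|v|b IH v] /=; first by rewrite Re_iprodxx sqr_ge0.
    exact: ph.
  by rewrite -sh -iterS iterSr; exact: IH.
- elim/red: b v => [v|v|b IH v] /=; first exact: pg.
    have -> : g (h v) = g (h (g v)) + h (g (h v)).
      by rewrite -gh -[h (g (h v))]/(g (h v) - g (g (h v))) addrC subrK.
    rewrite iprodDr ReD -[iprod v (g _)]sg -[iprod v (h _)]sh.
    by apply: addr_ge0; [exact: ph|exact: pg].
  have := IH (h v); rewrite sh /=.
  by rewrite -gh -[h (iter b h (h v))]/(iter b.+1 h (h v)) -iterSr.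
have E : iter b h (g v) = g (iter b h v) := iter_gh 1 b v.
by have := IH (g v); rewrite sg E -iterSr.
Qed.

Lemma cone_comp S S' : cone S -> cone S' -> cone (fun v => S (S' v)).
Proof.
elim=> [a b|S1 S2 _ c1 _ c2] hS'; last exact: cone_add (c1 hS') (c2 hS').
elim: hS' => [a' b'|S1 S2 _ c1 _ c2].
  have -> : (fun v => iter a g (iter b h (iter a' g (iter b' h v))))
          = (fun v => iter (a + a') g (iter (b + b') h v)).
    by apply/funext => v; rewrite iter_gh !iterD.
  exact: cone_mon.
have -> : (fun v => iter a g (iter b h (S1 v + S2 v)))
    = (fun v => iter a g (iter b h (S1 v)) + iter a g (iter b h (S2 v))).
  by apply/funext => v; rewrite !(linD (iter_lin _ _)).
exact: cone_add.
Qed.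

Lemma cone_commute S S' v : cone S -> cone S' -> S (S' v) = S' (S v).
Proof.
move=> cS cS'.
have commg S0 x : cone S0 -> S0 (g x) = g (S0 x).
  move=> c0; elim: c0 x => [a b|S1 S2 _ h1 _ h2] x; last by rewrite h1 h2 linD.
  by rewrite -[g x]/(iter 1 g x) iter_gh -iterS -iterSr.
have commh S0 x : cone S0 -> S0 (h x) = h (S0 x).
  by move=> c0; rewrite /h (linB (cone_linear c0)) commg.
elim: cS' v => [a b|S1 S2 _ h1 _ h2] v; last by rewrite (linD (cone_linear cS)) h1 h2.
have hb x : S (iter b h x) = iter b h (S x) by elim: b => [//|n IH]; rewrite !iterS commh // IH.
elim: a => [|n IH]; first exact: hb.
by rewrite !iterS commg // IH.
Qed.

Fixpoint resid (l : nat) : G -> G :=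
  if l is l'.+1 then fun v => resid l' v - g (resid l' (resid l' v)) else id.

Lemma cone_id : cone id. Proof. exact: (cone_mon 0 0). Qed.
Lemma cone_g : cone g. Proof. exact: (cone_mon 1 0). Qed.

(** The two claims support each other: [u_{l+1} = u_l (1 - g u_l)] and
    [1 - g u_{l+1} = (1 - g u_l) + g^2 u_l^2]. *)
Lemma resid_cone l : cone (resid l) /\ cone (fun v => v - g (resid l v)).
Proof.
elim: l => [|l [c1 c2]] /=; first by split; [exact: cone_id|exact: (cone_mon 0 1)].
have lr := cone_linear c1; split.
  have -> : (fun v => resid l v - g (resid l (resid l v)))
      = (fun v => resid l (v - g (resid l v))).
    by apply/funext => v; rewrite (linB lr) (cone_commute _ c1 cone_g).
  exact: cone_comp.
have -> : (fun v => v - g (resid l v - g (resid l (resid l v))))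
    = (fun v => (v - g (resid l v)) + g (g (resid l (resid l v)))).
  by apply/funext => v; rewrite linB // opprB addrCA addrC.
apply: cone_add => //; apply: (cone_comp cone_g); apply: (cone_comp cone_g).
exact: cone_comp.
Qed.

Lemma resid_linear l : linear (resid l).
Proof. by apply: cone_linear; case: (resid_cone l). Qed.

Lemma resid_sa l x y : iprod (resid l x) y = iprod x (resid l y).
Proof. by apply: cone_sa; case: (resid_cone l). Qed.

Lemma resid_comm l v : resid l (g v) = g (resid l v).
Proof. by apply: cone_commute; [case: (resid_cone l)|exact: cone_g]. Qed.

Lemma resid_sum n v : \sum_(l < n) resid l (g (resid l v)) = v - resid n v.
Proof.
elim: n => [|n IH]; first by rewrite big_ord0 subrr.
by rewrite big_ord_recr /= IH resid_comm opprB [RHS]addrCA [RHS]addrC -addrA [X in _ + X]addrC.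
Qed.

Lemma Re_iprod_sumr (I : Type) (s : seq I) x (F : I -> G) :
  complex.Re (iprod x (\sum_(i <- s) F i)) = \sum_(i <- s) complex.Re (iprod x (F i)).
Proof.
elim: s => [|i s IH]; first by rewrite !big_nil iprod0r.
by rewrite !big_cons iprodDr ReD IH.
Qed.

(** Both [1 - u_n] and [(1 - u_n) u_n] are sums of cone elements, so [u_n^2 <= u_n <= 1] as
    forms. *)
Lemma resid_contract n v : rnorm (resid n v) <= rnorm v.
Proof.
rewrite -ler_sqr ?nnegrE ?rnorm_ge0 //.
have [c _] := resid_cone n.
have cl l : cone (fun v => resid l (g (resid l v))).
  have [c1 _] := resid_cone l; apply: (cone_comp c1).
  exact: (cone_comp cone_g c1).
have h1 : 0 <= complex.Re (iprod v (v - resid n v)).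
  rewrite -resid_sum Re_iprod_sumr sumr_ge0 // => l _; exact: (cone_pos _ (cl l)).
have h2 : 0 <= complex.Re (iprod v (resid n v - resid n (resid n v))).
  rewrite -resid_sum Re_iprod_sumr sumr_ge0 // => l _.
  exact: (cone_pos _ (cone_comp (cl l) c)).
move: h1 h2; rewrite !iprodBr !ReB Re_iprodxx -(resid_sa n v (resid n v)) Re_iprodxx.
by move: (complex.Re _) (rnorm _ ^+ 2) (rnorm _ ^+ 2) => *; lra.
Qed.

(** The forms [D l] of [g u_l^2] decrease in [l], and their sum over [l < n] is the form of
    [1 - u_n], at most [|v|^2]; so each of them with index at least [n] is at most [|v|^2 / n].
    Monotonicity comes from factoring [u_l^2 - u_{l+1}^2] with [u_l - u_{l+1} = g u_l^2]. *)
Lemma resid_small n v :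
  n%:R * complex.Re (iprod (resid n v) (g (resid n v))) <= rnorm v ^+ 2.
Proof.
pose D l := complex.Re (iprod (resid l v) (g (resid l v))).
have DE l : D l = complex.Re (iprod v (g (resid l (resid l v)))).
  by rewrite /D resid_sa resid_comm.
have step l : D l.+1 <= D l.
  have [c1 _] := resid_cone l; have [c2 _] := resid_cone l.+1.
  pose p x := g (resid l (resid l x)).
  have cp : cone p := cone_comp cone_g (cone_comp c1 c1).
  suff E : D l - D l.+1 = complex.Re (iprod v (g (p (resid l v + resid l.+1 v)))).
    rewrite -subr_ge0 E.
    exact: (cone_pos _ (cone_comp cone_g (cone_comp cp (cone_add c1 c2)))).
  rewrite !DE -ReB -iprodBr -linB //; congr (complex.Re (iprod v (g _))).
  have -> : resid l.+1 (resid l.+1 v) = resid l (resid l v) - resid l (p v) - p (resid l.+1 v).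
    by rewrite /= -/(p v) -/(p _) (linB (resid_linear l)).
  rewrite -[_ - _ - p _]addrA -opprD subKr.
  have -> : p (resid l v + resid l.+1 v) = p (resid l v) + p (resid l.+1 v).
    exact: (linD (cone_linear cp)).
  by rewrite (cone_commute v c1 cp).
have mono l : (l <= n)%N -> D n <= D l.
  elim: n => [|m IH]; first by rewrite leqn0 => /eqP ->.
  by rewrite leq_eqVlt => /orP[/eqP -> //|/IH]; apply: le_trans.
apply: (@le_trans _ _ (\sum_(l < n) D l)).
  have -> : n%:R * complex.Re (iprod (resid n v) (g (resid n v))) = \sum_(l < n) D n.
    by rewrite sumr_const card_ord mulr_natl.
  by apply: ler_sum => l _; apply: mono; apply: ltnW.
have [c _] := resid_cone n.
have : complex.Re (iprod v (v - resid n v)) <= rnorm v ^+ 2.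
  by rewrite iprodBr ReB Re_iprodxx gerBl; exact: cone_pos.
apply: le_trans; rewrite -resid_sum Re_iprod_sumr; apply: ler_sum => l _.
by rewrite /D resid_sa.
Qed.

End Cone.

Lemma Re_sum (R : realType) (I : Type) (s : seq I) (f : I -> R[i]) :
  complex.Re (\sum_(i <- s) f i) = \sum_(i <- s) complex.Re (f i).
Proof.
elim: s => [|i s IH]; first by rewrite !big_nil.
by rewrite !big_cons ReD IH.
Qed.

Lemma scaled_share (R : realType) (a q M : R) : 0 <= a -> 0 < q -> 0 < M ->
  a * (q / ((a + 1) * M) * M) <= q.
Proof.
move=> a0 q0 M0; have a1 : 0 < a + 1 by lra.
have -> : a * (q / ((a + 1) * M) * M) = q * (a / (a + 1)).
  by field; rewrite !gt_eqF.
by rewrite ger_pMr // ler_pdivrMr ?mul1r //; lra.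
Qed.

(** * Families in a closed span: splitting and convergence *)

Section Conv.
Variables (R : realType) (L H G : hilbertType R) (X Y : set (L -> H)).
Variables (KK : set (H -> G)) (A : set (H -> H)) (tl : (H -> H) -> G -> G).
Hypotheses (cX : cspan X = X) (cY : cspan Y = Y).
Hypothesis hA : A `<=` @bounded_op R H H.
Hypothesis bK : KK `<=` @bounded_op R H G.
Hypothesis tK : cspan_vec [set k v | k in KK & v in [set: H]] = setT.
Hypothesis tlb : forall T, A T -> bounded_op (tl T).
Hypothesis tlK : forall T k v, A T -> KK k -> tl T (k v) = k (T v).
Hypothesis gX : forall k k' x, KK k -> KK k' -> X x -> X (adj k \o (k' \o x)).
Hypothesis gY : forall k k' x, KK k -> KK k' -> Y x -> Y (adj k \o (k' \o x)).
Hypothesis gA : forall k k' T v, KK k -> KK k' -> A T ->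
  T (adj k (k' v)) = adj k (k' (T v)).

Let Xt : set (L -> G) := cspan [set k \o x | k in KK & x in X].
Let Yt : set (L -> G) := cspan [set k \o x | k in KK & x in Y].
Let O := Omega X Y A.
Let N := Omega_norm X Y A.
Let bX : X `<=` @bounded_op R L H := sub_bounded cX.
Let bY : Y `<=` @bounded_op R L H := sub_bounded cY.

Definition stab (u : G -> G) : Prop :=
  [/\ bounded_op u, forall p, Xt p -> Xt (u \o p), forall p, Yt p -> Yt (u \o p) &
      forall T v, A T -> u (tl T v) = tl T (u v)].

(** Such a map can be inserted into both families at once: [<c p, T (c p')> = <c p, c (tl T p')>],
    and [c p], [c p'] are admissible for [X] and [Y]. *)
Definition good (c : G -> H) : Prop :=
  [/\ bounded_op c, forall p, Xt p -> X (c \o p), forall p, Yt p -> Y (c \o p) &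
      forall T v, A T -> c (tl T v) = T (c v)].

Lemma good_adj k : KK k -> good (adj k).
Proof.
move=> kK; have bk := bK kK; have bak := bounded_adj bk.
split=> //.
- move=> p; rewrite -cX; apply: cspan_comp_left => // _ [k' k'K [x Xx <-]].
  by rewrite cX; apply: gX.
- move=> p; rewrite -cY; apply: cspan_comp_left => // _ [k' k'K [x Xx <-]].
  by rewrite cY; apply: gY.
move=> T v AT.
have b1 : bounded_op (adj k \o tl T) by apply: bounded_comp => //; exact: tlb.
have b2 : bounded_op (T \o adj k) by apply: bounded_comp => //; exact: hA.
have E : adj k \o tl T = T \o adj k.
  apply: (eq_bounded_total tK b1 b2) => _ [k' k'K [w _ <-]] /=.
  by rewrite tlK // gA.
exact: (congr1 (@^~ v) E).
Qed.

Lemma stab_id : stab id.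
Proof. by split=> //; exact: bounded_id. Qed.

Lemma stab_comp u u' : stab u -> stab u' -> stab (u \o u').
Proof.
move=> [b1 x1 y1 t1] [b2 x2 y2 t2]; split.
- exact: bounded_comp.
- by move=> p hp; apply: (x1 (u' \o p)); apply: x2.
- by move=> p hp; apply: (y1 (u' \o p)); apply: y2.
by move=> T v AT /=; rewrite t2 // t1.
Qed.

Lemma stab_lin a u u' : stab u -> stab u' -> stab (a *: u + u').
Proof.
move=> [b1 x1 y1 t1] [b2 x2 y2 t2]; split.
- exact: bounded_lin_comb.
- move=> p hp; have -> : (a *: u + u') \o p = a *: (u \o p) + (u' \o p) by [].
  by apply: cspan_lin; [exact: x1|exact: x2].
- move=> p hp; have -> : (a *: u + u') \o p = a *: (u \o p) + (u' \o p) by [].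
  by apply: cspan_lin; [exact: y1|exact: y2].
move=> T v AT; rewrite !fctE t1 // t2 // (bounded_lin (tlb AT)).
by [].
Qed.

Lemma good_stab c u : good c -> stab u -> good (c \o u).
Proof.
move=> [b1 x1 y1 t1] [b2 x2 y2 t2]; split.
- exact: bounded_comp.
- by move=> p hp; apply: (x1 (u \o p)); apply: x2.
- by move=> p hp; apply: (y1 (u \o p)); apply: y2.
by move=> T v AT /=; rewrite t2 // t1.
Qed.

Lemma good_scale a c : good c -> good (a *: c).
Proof.
move=> [b1 x1 y1 t1]; split.
- exact: boundedZ.
- move=> p hp; rewrite -cX -[_ \o p]addr0.
  have -> : (a *: c) \o p + 0 = a *: (c \o p) + 0 by [].
  by apply: cspan_lin; [rewrite cX; exact: x1|exact: cspan0].
- move=> p hp; rewrite -cY -[_ \o p]addr0.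
  have -> : (a *: c) \o p + 0 = a *: (c \o p) + 0 by [].
  by apply: cspan_lin; [rewrite cY; exact: y1|exact: cspan0].
by move=> T v AT; rewrite !fctE t1 // (linZ (bounded_lin (hA AT))).
Qed.

Lemma stab_proj k : KK k -> stab (k \o adj k).
Proof.
move=> kK; have [b1 x1 y1 t1] := good_adj kK; have bk := bK kK.
split.
- exact: bounded_comp.
- move=> p hp; apply: cspan_gen.
    by apply: bounded_comp; [exact: bounded_comp|exact: cspan_bounded hp].
  by exists k => //; exists (adj k \o p) => //; exact: x1.
- move=> p hp; apply: cspan_gen.
    by apply: bounded_comp; [exact: bounded_comp|exact: cspan_bounded hp].
  by exists k => //; exists (adj k \o p) => //; exact: y1.
by move=> T v AT /=; rewrite t1 // tlK.
Qed.

Lemma stab_sum (I : Type) (s : seq I) (u : I -> G -> G) :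
  (forall i, stab (u i)) -> stab (\sum_(i <- s) u i).
Proof.
move=> hu; elim: s => [|i s IH].
  rewrite big_nil; have := stab_lin (-1) stab_id stab_id.
  by rewrite scaleN1r addNr.
by rewrite big_cons -[u i]scale1r; apply: stab_lin.
Qed.

Lemma approx_finite (psi : nat -> L -> G) (s : seq nat) (e : R) : 0 < e ->
  (forall k, Xt (psi k)) ->
  exists (I : finType) (kap : I -> H -> G), (forall i, KK (kap i)) /\
    forall k, k \in s -> exists S, [/\
      lspan [set kap i \o x | i in [set: I] & x in X] S & op_bound (psi k - S) e].
Proof.
move=> e0 hpsi; elim: s => [|k s [I [kap [hk IH]]]].
  by exists void, (fun i : void => match i with end); split=> // -[].
suff [J [kap' [hk' [S hS Se]]]] : exists (J : finType) (kap' : J -> H -> G),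
   (forall j, KK (kap' j)) /\ exists2 S,
   lspan [set kap' i \o x | i in [set: J] & x in X] S & op_bound (psi k - S) e.
  exists (I + J)%type, (fun p => match p with inl i => kap i | inr j => kap' j end).
  split=> [[i|j] //|m].
  rewrite inE => /orP[/eqP ->|/IH [S' [hS' Se']]].
    exists S; split=> //; apply: lspan_sub hS => _ [j _ [x Xx <-]].
    by apply: lspan_gen; exists (inr j) => //; exists x.
  exists S'; split=> //; apply: lspan_sub hS' => _ [i _ [x Xx <-]].
  by apply: lspan_gen; exists (inl i) => //; exists x.
have [_ /(_ e e0) [S hS Se]] := hpsi k.
suff [J [kap' [hk' hS']]] : exists (J : finType) (kap' : J -> H -> G),
    (forall j, KK (kap' j)) /\ lspan [set kap' i \o x | i in [set: J] & x in X] S.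
  by exists J, kap'; split=> //; exists S.
move: S hS {Se}; apply: lspan_ind.
  by exists void, (fun i : void => match i with end); split=> [[]|]; exact: lspan0.
move=> a _ T [k0 k0K [x Xx <-]] [J [kap' [hk' hT]]].
exists (option J), (fun o => if o is Some j then kap' j else k0).
split=> [[j|] //|]; apply: lspan_lin.
  by apply: lspan_gen; exists None => //; exists x.
apply: lspan_sub hT => _ [j _ [y Xy <-]]; apply: lspan_gen.
by exists (Some j) => //; exists y.
Qed.

(** There are two regimes: the finitely many [psi k] that carry most of the square sum are
    approximated by finitely many kets, on which [u] is small; the others remain small because [u]
    is a contraction. *)
Lemma good_step (psi : nat -> L -> G) (e : R) : 0 < e ->
  (forall k, Xt (psi k)) -> fam psi ->
  exists (I : finType) (c : I -> G -> H) (u : G -> G), [/\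
    forall i, good (c i), stab u,
    forall v v', \sum_(i : I) iprod (c i v) (c i v') = iprod (v - u v) v',
    forall v, \sum_(i : I) rnorm (c i v) ^+ 2 <= rnorm v ^+ 2 &
    sqb (fun k => u \o psi k) e].
Proof.
move=> e0 hpsi fpsi.
have [F0 hF0] := (proj2 fpsi) _ (divr_gt0 e0 (ltr0n _ 2)).
(* [d ^+ 2] is the share of each of the at most [size F0] large members; half of [d] pays for the
   approximation by kets, half for [u] on the approximant. *)
have n1 : 0 < e / 2 / (size F0).+1%:R :> R by rewrite !divr_gt0 ?ltr0n.
have [d d0 d2] := pos_sqrt n1.
have [J [kap [hk happ]]] := approx_finite F0 (divr_gt0 d0 (ltr0n _ 2)) hpsi.
have bk i : bounded_op (kap i) := bK (hk i).
pose g0 : G -> G := \sum_(i : J) (kap i \o adj (kap i)).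
have sg0 : stab g0 by apply: stab_sum => i; exact: stab_proj.
have g0E v v' : iprod (g0 v) v' = \sum_(i : J) iprod (adj (kap i) v) (adj (kap i) v').
  rewrite /g0 fct_sumE iprod_suml; apply: eq_bigr => i _ /=.
  by rewrite -adjPr.
(* Dividing [g0] by a bound for it puts [g] between 0 and 1. *)
have [C C0 hC] : exists2 C, 0 < C & op_bound g0 C.
  by apply: op_bound_gt0; case: sg0.
pose g : G -> G := (C^-1)%:C *: g0 + 0.
have Ci : 0 < C^-1 by rewrite invr_gt0.
have gE v : g v = (C^-1)%:C *: g0 v by rewrite /g fctE addr0.
have sg : stab g.
  have s0 : stab 0 by have := stab_sum [::] (fun _ : unit => stab_id); rewrite big_nil.
  exact: stab_lin.
have gip v v' : iprod (g v) v' = (C^-1)%:C * \sum_(i : J) iprod (adj (kap i) v) (adj (kap i) v').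
  by rewrite gE iprodZl conj_real g0E.
have gsa v v' : iprod (g v) v' = iprod v (g v').
  rewrite gip gE iprodZr; congr (_ * _).
  rewrite /g0 fct_sumE iprod_sumr; apply: eq_bigr => i _ /=.
  by rewrite adjP.
have gRe v : complex.Re (iprod v (g v)) = C^-1 * \sum_(i : J) rnorm (adj (kap i) v) ^+ 2.
  rewrite -gsa gip Re_realM Re_sum; congr (_ * _); apply: eq_bigr => i _.
  by rewrite Re_iprodxx.
have gpos v : 0 <= complex.Re (iprod v (g v)).
  by rewrite gRe mulr_ge0 ?(ltW Ci) // sumr_ge0 // => i _; exact: sqr_ge0.
have gle v : complex.Re (iprod v (g v)) <= rnorm v ^+ 2.
  apply: le_trans (Re_le_cabs _) _; apply: le_trans (cauchy_schwarz _ _) _.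
  rewrite expr2 ler_wpM2l ?rnorm_ge0 // gE rnormZ cabs_real gtr0_norm //.
  by rewrite ler_pdivrMl //; case: hC.
have lg : linear g by apply: bounded_lin; case: sg.
have su n : stab (resid g n).
  elim: n => [|n IH]; first exact: stab_id.
  have -> : resid g n.+1 = (-1) *: (g \o (resid g n \o resid g n)) + resid g n.
    by apply/funext => v; rewrite /= !fctE scaleN1r addrC.
  by apply: stab_lin => //; apply: stab_comp => //; exact: stab_comp.
have con n v := resid_contract lg gsa gpos gle n v.
have usa n x y : iprod (resid g n x) y = iprod x (resid g n y) := resid_sa lg gsa n x y.
(* [u_n k_i] is estimated through its adjoint: [|k_i^* u_n v|^2 <= C <u_n v, g u_n v> <= C |v|^2 /
   n]. The shift of the index is due to [archi_inv], which speaks of [n.+1]. *)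
have smk i (dd : R) : 0 < dd -> exists n0, forall n, (n0 <= n)%N ->
    op_bound (resid g n \o kap i) dd.
  move=> dd0; have dd2 : 0 < dd ^+ 2 / C by rewrite divr_gt0 ?exprn_gt0.
  have [n0 hn0] := archi_inv dd2; exists n0.+1 => n hn.
  have bun : bounded_op (resid g n) by case: (su n).
  have bc : bounded_op (resid g n \o kap i) by exact: bounded_comp.
  have -> : resid g n \o kap i = adj (adj (resid g n \o kap i)) by rewrite adjK.
  apply: adj_bound; first exact: bounded_adj.
  split=> [|v]; first exact: ltW.
  rewrite adj_comp // /= -ler_sqr ?nnegrE ?rnorm_ge0 ?mulr_ge0 ?(ltW dd0) ?rnorm_ge0 //.
  have -> : adj (resid g n) v = resid g n v.
    by apply: iprod_ext => x; rewrite adjPr // usa.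
  have := resid_small lg gsa gpos gle n v; rewrite gRe.
  have h1 : rnorm (adj (kap i) (resid g n v)) ^+ 2
     <= \sum_(j : J) rnorm (adj (kap j) (resid g n v)) ^+ 2.
    by rewrite (bigD1 i) //= lerDl sumr_ge0 // => j _; exact: sqr_ge0.
  case: n hn {bun bc} h1 => [//|n]; rewrite ltnS => hn h1 h2.
  have h3 : n.+1%:R^-1 <= dd ^+ 2 / C := hn0 n hn.
  have np : 0 < n.+1%:R :> R by rewrite ltr0n.
  rewrite exprMn; apply: le_trans h1 _.
  rewrite mulrA -ler_pdivlMl in h2; last by rewrite mulr_gt0.
  apply: le_trans h2 _; apply: ler_wpM2r; first exact: sqr_ge0.
  by rewrite invfM invrK -ler_pdivlMr.
have smS S : lspan [set kap i \o x | i in [set: J] & x in X] S -> bounded_op S /\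
    forall dd : R, 0 < dd -> exists n0, forall n, (n0 <= n)%N -> op_bound (resid g n \o S) dd.
  move: S; apply: lspan_ind.
    split; first exact: bounded0.
    move=> dd dd0; exists 0%N => n _.
    have -> : resid g n \o (0 : L -> G) = 0.
      by apply/funext => v /=; rewrite (lin0 (resid_linear lg n)).
    by apply: op_bound_le (op_bound0 _ _); exact: ltW.
  move=> a _ T [i _ [x Xx <-]] [bT hT].
  have bx := bX Xx; split; first by apply: bounded_lin_comb => //; exact: bounded_comp.
  move=> dd dd0; have [M M0 hM] := op_bound_gt0 bx.
  have p0 : 0 < (cabs a + 1) * M by rewrite mulr_gt0 //; have := cabs_ge0 a; lra.
  have [n1' h1] := smk i _ (divr_gt0 (divr_gt0 dd0 (ltr0n _ 2)) p0).
  have [n2' h2] := hT _ (divr_gt0 dd0 (ltr0n _ 2)).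
  exists (maxn n1' n2') => n; rewrite geq_max => /andP[/h1 k1 /h2 k2].
  have -> : resid g n \o (a *: (kap i \o x) + T) =
      a *: ((resid g n \o kap i) \o x) + (resid g n \o T).
    by apply/funext => v; rewrite /= !fctE (resid_linear lg n).
  apply: op_bound_le (op_boundD (op_boundZ a (op_bound_comp k1 hM)) k2).
  set q := dd / 2; have q0 : 0 < q by rewrite divr_gt0.
  have -> : dd = q + q by rewrite -splitr.
  by rewrite lerD2r; apply: scaled_share => //; exact: cabs_ge0.
have happ' (k : nat) : exists Sk : L -> G, k \in F0 ->
    lspan [set kap i \o x | i in [set: J] & x in X] Sk /\
    op_bound (psi k - Sk) (d / 2).
  have [kF|kF] := boolP (k \in F0); last by exists 0.
  by have [Sk [h1 h2]] := happ k kF; exists Sk.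
have [S hS] := choice happ'.
have d2' : 0 < d / 2 by rewrite divr_gt0.
have [n hn] : exists n, forall k, k \in F0 -> op_bound (resid g n \o S k) (d / 2).
  suff [n0 h0] : exists n0, forall n, (n0 <= n)%N ->
      forall k, k \in F0 -> op_bound (resid g n \o S k) (d / 2).
    by exists n0; exact: h0.
  elim: F0 {hF0 d2 happ happ' n1} hS => [|k0 F0 IH] hS; first by exists 0%N.
  have [k kF|n1 h1] := IH; first by apply: hS; rewrite inE kF orbT.
  have [hk0 _] := hS k0 (mem_head _ _).
  have [_ /(_ _ d2') [n2 h2]] := smS _ hk0.
  exists (maxn n1 n2) => m; rewrite geq_max => /andP[m1 m2] k.
  by rewrite inE => /orP[/eqP -> |kF]; [exact: h2|exact: h1].
have bu : bounded_op (resid g n) by case: (su n).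
have uF k v : k \in F0 -> rnorm (resid g n (psi k v)) <= d * rnorm v.
  move=> kF; have [_ [_ h1]] := hS k kF; have [_ h2] := hn k kF.
  have -> : psi k v = (psi k - S k) v + S k v by rewrite !fctE subrK.
  rewrite (linD (bounded_lin bu)); apply: le_trans (rnormD _ _) _.
  rewrite [d in _ <= d * _](splitr d) mulrDl lerD //; first exact: le_trans (con _ _) (h1 v).
  exact: h2.
have Ci0 : 0 <= C^-1 := ltW Ci.
(* The square root of [C^-1] makes the sum over [J] equal to [u_l g u_l], so the whole sum
   telescopes to [1 - u_n]. *)
exists ('I_n * J)%type, (fun p : 'I_n * J => (Num.sqrt C^-1)%:C *: (adj (kap p.2) \o resid g p.1)).
exists (resid g n).
have cE v v' : \sum_(p : 'I_n * J) iprod (((Num.sqrt C^-1)%:C *: (adj (kap p.2) \o resid g p.1)) v)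
    (((Num.sqrt C^-1)%:C *: (adj (kap p.2) \o resid g p.1)) v') = iprod (v - resid g n v) v'.
  rewrite -(resid_sum lg) iprod_suml.
  rewrite (eq_bigr (fun p : 'I_n * J => (C^-1)%:C * (iprod (adj (kap p.2) (resid g p.1 v))
     (adj (kap p.2) (resid g p.1 v'))))); last first.
    move=> [l i] _; rewrite !fctE iprodZl iprodZr conj_real mulrA -rmorphM /=.
    by rewrite -expr2 sqr_sqrtr.
  rewrite -(pair_bigA _ (fun (l : 'I_n) (i : J) => (C^-1)%:C * (iprod (adj (kap i) (resid g l v))
     (adj (kap i) (resid g l v'))))) /=.
  by apply: eq_bigr => l _; rewrite -mulr_sumr usa gip.
split=> //.
- move=> [l i] /=; apply: good_scale; apply: good_stab => //; exact: good_adj.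
- move=> v; apply: (@le_trans _ _ (complex.Re (iprod (v - resid g n v) v))).
    rewrite -cE Re_sum; apply: ler_sum => p _.
    by rewrite Re_iprodxx.
  rewrite iprodBl ReB Re_iprodxx lerBlDr lerDl usa.
  by apply: (cone_pos lg gsa gpos gle); case: (resid_cone lg n).
move=> F x uF0; rewrite (bigID (fun k => k \in F0)) /= [e](splitr e) mulrDl.
apply: lerD.
  rewrite -big_filter; set F1 := [seq _ <- F | _].
  have sz : (size F1 <= size F0)%N.
    apply: uniq_leq_size; first exact: filter_uniq.
    by move=> k; rewrite mem_filter => /andP[].
  apply: (@le_trans _ _ (\sum_(k <- F1) d ^+ 2 * rnorm x ^+ 2)).
    rewrite big_seq [leRHS]big_seq; apply: ler_sum => k; rewrite mem_filter => /andP[kF _].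
    rewrite -exprMn ler_sqr ?nnegrE ?rnorm_ge0 ?mulr_ge0 ?(ltW d0) ?rnorm_ge0 //.
    exact: uF.
  rewrite big_const_seq count_predT iter_addr_0.
  have -> : (d ^+ 2 * rnorm x ^+ 2) *+ size F1
      = (d ^+ 2 * (size F1)%:R) * rnorm x ^+ 2 by rewrite -mulr_natr; ring.
  apply: ler_wpM2r; first exact: sqr_ge0.
  rewrite d2 -[leLHS]mulrA ger_pMr ?divr_gt0 // mulrC ler_pdivrMr ?ltr0n // mul1r ler_nat.
  exact: leqW.
rewrite -big_filter.
have hF1 k : k \in [seq k <- F | k \notin F0] -> k \notin F0 by rewrite mem_filter => /andP[].
apply: le_trans (hF0 _ x (filter_uniq _ uF0) hF1).
apply: ler_sum => k _; rewrite ler_sqr ?nnegrE ?rnorm_ge0 //; exact: con.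
Qed.

Lemma hassum_fin (I : finType) (f : I -> R[i]) : hassum f (\sum_i f i).
Proof.
move=> e e0; exists (index_enum I) => F uF sF.
have -> : \sum_(i <- F) f i = \sum_i f i.
  apply: perm_big; apply: uniq_perm => //; first exact: index_enum_uniq.
  by move=> i; rewrite mem_index_enum sF // mem_index_enum.
by rewrite subrr cabs0 ltW.
Qed.

Lemma hassum_swap (I J : eqType) (f : I * J -> R[i]) s :
  hassum f s -> hassum (fun p : J * I => f (p.2, p.1)) s.
Proof.
move=> hf.
have pq : pcancel (fun p : I * J => (p.2, p.1)) (fun p : J * I => Some (p.2, p.1)) by case.
have qp : ocancel (fun p : J * I => Some (p.2, p.1)) (fun p : I * J => (p.2, p.1)) by case.
by have /(_ hf) := proj1 (hassum_pad pq qp f s).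
Qed.

Let W (psi psi' : nat -> L -> G) : (H -> H) -> L -> L :=
  on_set A (fun T => pairing psi (fun k => tl T \o psi' k)).

(** From [\sum_i c_i^* c_i = 1 - u] and [c_i (tl T) = T c_i] one gets [<psi, tl T psi'> = \sum_i
    <c_i psi, T (c_i psi')> + <u psi, tl T psi'>]. The first part keeps the bounds of the families
    because the column of the [c_i] is a contraction; in the second only the left family shrinks. *)
Lemma conv_step (psi psi' : nat -> L -> G) (M M' e : R) : 0 <= M -> 0 <= M' -> 0 < e ->
  (forall k, Xt (psi k)) -> (forall k, Yt (psi' k)) -> fam psi -> fam psi' ->
  sqb psi (M ^+ 2) -> sqb psi' (M' ^+ 2) ->
  exists (w : (H -> H) -> L -> L) (psi1 : nat -> L -> G), [/\
    O w /\ N w <= M * M', forall k, Xt (psi1 k), fam psi1, sqb psi1 (e ^+ 2) &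
    W psi psi' = w + W psi1 psi'].
Proof.
move=> M0 M'0 e0 hx hy fx fy qx qy.
have [I [c [u [gc su cE cle qu]]]] := good_step (exprn_gt0 2 e0) hx fx.
have bc i : bounded_op (c i) by case: (gc i).
have bu : bounded_op u by case: su.
have fc : fam c.
  split=> // d d0; exists (index_enum I) => F x _ hF.
  have -> : F = [::].
    case: F hF => // i F /(_ i (mem_head _ _)); by rewrite mem_index_enum.
  by rewrite big_nil mulr_ge0 ?(ltW d0) ?sqr_ge0.
have qc : sqb c 1.
  move=> F x uF; rewrite mul1r; apply: le_trans (cle x).
  apply: (@ler_sum_subset _ _ F (index_enum I) (fun i => rnorm (c i x) ^+ 2)) => //.
  by move=> i; exact: sqr_ge0.
have fux : fam (fun k => u \o psi k) by exact: fam_comp_left.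
have [Ow Nw] : O (omf A (cfam c psi) (cfam c psi')) /\ N (omf A (cfam c psi) (cfam c psi')) <= M * M'.
  apply: omf_Omega => //.
  - by move=> [i k]; case: (gc i) => _ + _ _; apply.
  - by move=> [i k]; case: (gc i) => _ _ + _; apply.
  - exact: cfam_fam.
  - exact: cfam_fam.
  - by have := cfam_sqb ler01 qc qx; rewrite mul1r.
  - by have := cfam_sqb ler01 qc qy; rewrite mul1r.
exists (omf A (cfam c psi) (cfam c psi')), (fun k => u \o psi k); split=> //.
  by move=> k; case: su => _ + _ _; apply.
apply/funext => T; have [AT|nAT] := pselect (A T); last first.
  rewrite -[RHS]/(omf A (cfam c psi) (cfam c psi') T + W (fun k => u \o psi k) psi' T).
  by rewrite /W /omf !on_set_out // addr0.
have bT := tlb AT.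
have fty : fam (fun k => tl T \o psi' k) by exact: fam_comp_left.
rewrite -[RHS]/(omf A (cfam c psi) (cfam c psi') T + W (fun k => u \o psi k) psi' T).
rewrite /W !on_set_in //.
have bw : bounded_op (omf A (cfam c psi) (cfam c psi') T).
  by apply: (omf_bounded hA); exact: cfam_fam.
have bp := pairing_bounded fux fty.
apply: pairing_unique => //; first exact: boundedD.
move=> y x; rewrite iprodDr.
have h1 := pairing_hassum fux fty y x.
have h2 := hassum_swap (omf_hassum hA x y (cfam_fam fc fx) (cfam_fam fc fy) AT).
have := hassum_fubini h2 (fun k => hassum_fin _) => h3.
have := hassum_lin 1 h3 h1; rewrite mul1r; apply: eq_hassum => k /=; rewrite mul1r.
rewrite (eq_bigr (fun i => iprod (c i (psi k x)) (c i (tl T (psi' k y))))); last first.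
  by move=> i _; rewrite /cfam /=; case: (gc i) => _ _ _ ->.
by rewrite cE iprodBl subrK.
Qed.

Lemma W_bound (psi psi' : nat -> L -> G) (M M' C : R) T : 0 <= M -> 0 <= M' ->
  fam psi -> fam psi' -> sqb psi (M ^+ 2) -> sqb psi' (M' ^+ 2) ->
  A T -> op_bound (tl T) C -> op_bound (W psi psi' T) (M * (C * M')).
Proof.
move=> M0 M'0 fx fy qx qy AT hC; rewrite /W on_set_in //.
have C0 : 0 <= C by case: hC.
apply: pairing_bound => //; last 1 first.
- move=> F x uF; rewrite exprMn -mulrA.
  apply: le_trans (ler_wpM2l (sqr_ge0 C) (qy F x uF)); rewrite mulr_sumr.
  apply: ler_sum => k _; rewrite -exprMn ler_sqr ?nnegrE ?rnorm_ge0 ?mulr_ge0 ?rnorm_ge0 //.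
  by case: hC => _; apply.
- exact: fam_comp_left (tlb AT) fy.
- exact: mulr_ge0.
Qed.

(** Splitting again and again with remainder bounds [M, e/2, e/4, ...] yields pieces of norm at most
    [M M', e M'/2, e M'/4, ...]. Their series converges in [Omega], and it agrees with [W] at every
    operator because the remaining pairing tends to zero there. *)
Lemma conv_Omega (psi psi' : nat -> L -> G) (M M' : R) : 0 <= M -> 0 <= M' ->
  (forall k, Xt (psi k)) -> (forall k, Yt (psi' k)) -> fam psi -> fam psi' ->
  sqb psi (M ^+ 2) -> sqb psi' (M' ^+ 2) ->
  O (W psi psi') /\ N (W psi psi') <= M * M'.
Proof.
move=> M0 M'0 hx hy fx fy qx qy.
pose r : R := 2^-1.
(* [M' + 1] in place of [M'] permits the division when [M' = 0]. *)
suff key (e : R) : 0 < e -> O (W psi psi') /\ N (W psi psi') <= M * M' + e * (M' + 1).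
  have [Ow _] := key 1 ltr01; split=> //.
  apply/ler_addgt0Pr => e e0.
  have p : 0 < M' + 1 by lra.
  have [_] := key _ (divr_gt0 e0 p); move/le_trans; apply; rewrite lerD2l.
  by rewrite divfK // gt_eqF.
move=> e0.
have r0 n : 0 < r ^+ n := half_pow_gt0 R n.
pose M_ n := if n is 0%N then M else e * r ^+ n.
have M_0 n : 0 <= M_ n by case: n => // n; rewrite /M_ mulr_ge0 ?(ltW e0) ?(ltW (r0 _)).
(* The step number belongs to the state, since the bound required of the remainder depends on it. *)
pose P (p : nat * (nat -> L -> G)) :=
  [/\ forall k, Xt (p.2 k), fam p.2 & sqb p.2 (M_ p.1 ^+ 2)].
have step (s : {p | P p}) : exists q : {p | P p} * ((H -> H) -> L -> L),
   [/\ (sval q.1).1 = (sval s).1.+1, O q.2, N q.2 <= M_ (sval s).1 * M' &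
    W (sval s).2 psi' = q.2 + W (sval q.1).2 psi'].
  case: s => [[n p] [px pf pq]] /=.
  have en : 0 < e * r ^+ n.+1 by rewrite mulr_gt0.
  have [w [p1 [[Ow Nw] x1 f1 q1 E]]] := conv_step (M_0 n) M'0 en px hy pf fy pq qy.
  have Pp1 : P (n.+1, p1) by [].
  by exists (exist _ (n.+1, p1) Pp1, w).
have [f hf] := choice step.
have P0 : P (0%N, psi) by [].
pose st n := iter n (fun s => (f s).1) (exist _ (0%N, psi) P0).
have st1 n : (sval (st n)).1 = n.
  by elim: n => [//|n IH] /=; have [-> _ _ _] := hf (st n); rewrite IH.
have [stx stf stq] : [/\ forall n k, Xt ((sval (st n)).2 k), forall n, fam (sval (st n)).2 &
    forall n, sqb (sval (st n)).2 (M_ n ^+ 2)].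
  by split=> n; case: (svalP (st n)); rewrite ?st1.
pose om n := (f (st n)).2; pose ss n := \sum_(j < n) om j.
have om0 n : O (om n) /\ N (om n) <= M_ n * M'.
  by have [_ h1 h2 _] := hf (st n); rewrite st1 in h2.
have ssS n : ss n.+1 = ss n + om n by rewrite /ss big_ord_recr.
have ssO n : O (ss n).
  elim: n => [|n IH]; first by rewrite /ss big_ord0; case: (Omega0 cX cY hA).
  by rewrite ssS; have [] := Omega_add cX cY hA IH (proj1 (om0 n)).
have WE n : W psi psi' = ss n + W (sval (st n)).2 psi'.
  elim: n => [|n IH]; first by rewrite /ss big_ord0 add0r.
  by rewrite IH ssS -addrA; have [_ _ _ ->] := hf (st n).
have rS n : r ^+ n = 2 * r ^+ n.+1 by rewrite exprS mulrA divff // mul1r.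
have tail n k : N (ss (n.+1 + k)%N - ss n.+1) <= 2 * e * M' * (r ^+ n.+1 - r ^+ (n.+1 + k)%N).
  elim: k => [|k IH].
    by rewrite addn0 !subrr mulr0; case: (Omega0 cX cY hA).
  rewrite addnS ssS addrAC.
  have [w1 _] := Omega_sub cX cY hA (ssO (n.+1 + k)%N) (ssO n.+1).
  have [w2 n2] := om0 (n.+1 + k)%N.
  have [_ /le_trans] := Omega_add cX cY hA w1 w2; apply.
  apply: le_trans (lerD IH n2) _; rewrite /M_ /= [r ^+ (n.+1 + k)]rS.
  have E p q : 2 * e * M' * (p - 2 * q) + e * (2 * q) * M' = 2 * e * M' * (p - q) by ring.
  by rewrite E.
have tail' n m : (n < m)%N -> N (ss m - ss n.+1) <= 2 * e * M' * r ^+ n.+1.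
  move=> nm; rewrite -(subnKC nm); apply: le_trans (tail _ _) _.
  by apply: ler_wpM2l; [rewrite !mulr_ge0 // ltW|rewrite gerBl ltW].
have ssB n : N (ss n.+1) <= M * M' + e * M'.
  have [w1 _] := Omega_sub cX cY hA (ssO n.+1) (ssO 1%N).
  have -> : ss n.+1 = ss 1%N + (ss n.+1 - ss 1%N) by rewrite addrC subrK.
  have [_ /le_trans] := Omega_add cX cY hA (ssO 1%N) w1; apply; apply: lerD.
    by rewrite /ss big_ord1; case: (om0 0%N).
  apply: le_trans (tail' 0%N _ _) _ => //.
  have E : 2 * e * M' * r ^+ 1 = e * M' by rewrite /r expr1; field.
  by rewrite E.
have [x Ox hx'] : exists2 x, O x & forall d : R, 0 < d -> exists n0, forall n, (n0 <= n)%N ->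
    N (ss n - x) <= d.
  apply: (Omega_complete cX cY hA ssO) => d d0.
  have p : 0 < 2 * (2 * e * M' + 1) by rewrite mulr_gt0 // ltr_wpDl // !mulr_ge0 // ltW.
  have [n0 hn0] := half_pow_small (divr_gt0 d0 p).
  have hd n : (n0 < n)%N -> N (ss n - ss n0.+1) < d / 2.
    move=> /tail' /le_lt_trans; apply.
    have c0 : 0 <= 2 * e * M' by rewrite !mulr_ge0 // ltW.
    apply: (@le_lt_trans _ _ (2 * e * M' * (d / (2 * (2 * e * M' + 1))))).
      apply: ler_wpM2l => //; apply: le_trans hn0.
      by rewrite -/r [leRHS]rS mulr_natl mulr2n lerDl ltW.
    move: c0; set c := 2 * e * M' => c0; have c1 : 0 < c + 1 by lra.
    have -> : c * (d / (2 * (c + 1))) = d / 2 * (c / (c + 1)) by field; rewrite gt_eqF.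
    by rewrite gtr_pMr ?divr_gt0 // ltr_pdivrMr // mul1r; lra.
  exists n0.+1 => m n hm hn.
  have [w1 _] := Omega_sub cX cY hA (ssO m) (ssO n0.+1).
  have [w2 _] := Omega_sub cX cY hA (ssO n) (ssO n0.+1).
  have -> : ss m - ss n = (ss m - ss n0.+1) - (ss n - ss n0.+1).
    by rewrite opprB addrA subrK.
  have [_ /le_lt_trans] := Omega_sub cX cY hA w1 w2; apply.
  by rewrite [ltRHS](splitr d) ltrD // hd.
have Wx : W psi psi' = x.
  apply/funext => T; have [AT|nAT] := pselect (A T); last first.
    by rewrite (Omega_out Ox nAT) /W on_set_out.
  have [C C0 hC] := op_bound_gt0 (hA AT).
  have [D D0 hD] := op_bound_gt0 (tlb AT).
  apply: op_bound_eq => d d0.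
  have p1 : 0 < d / 2 / C by rewrite !divr_gt0.
  have [n1 h1] := hx' _ p1.
  have p2 : 0 < d / 2 / (e * (D * M' + 1)).
    by rewrite !divr_gt0 // mulr_gt0 // ltr_wpDl // mulr_ge0 // ltW.
  have [n2 h2] := half_pow_small p2.
  pose n := (n1 + n2).+1.
  have -> : W psi psi' T - x T = (ss n - x) T + W (sval (st n)).2 psi' T.
    rewrite (WE n) -[(ss n - x) T]/(ss n T - x T) addrAC.
    by rewrite -[(ss n + _) T]/(ss n T + W (sval (st n)).2 psi' T).
  have [w1 _] := Omega_sub cX cY hA (ssO n) Ox.
  have b1 := Omega_val_bound cX cY hA w1 AT hC.
  have b2 := W_bound (M_0 n) M'0 (stf n) fy (stq n) qy AT hD.
  apply: op_bound_le (op_boundD b1 b2).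
  rewrite [leRHS](splitr d) lerD //.
    rewrite -ler_pdivlMr //; apply: h1; rewrite /n; exact: leq_trans (leq_addr _ _) (leqnSn _).
  have h3 : r ^+ n <= d / 2 / (e * (D * M' + 1)).
    apply: le_trans h2; rewrite /n -addSn addnC exprD ger_pMr ?half_pow_gt0 //.
    by apply: exprn_ile1; rewrite /r; lra.
  rewrite -/r in h3; rewrite /M_ /n -/n.
  have DM : 0 <= D * M' by rewrite mulr_ge0 // ltW.
  have q0 : 0 <= r ^+ n := ltW (r0 n).
  move: (r ^+ n) (D * M') q0 h3 DM => q m q0 h3 m0.
  have q1 : 0 < e * (m + 1) by rewrite mulr_gt0 // ltr_wpDl.
  move: h3; rewrite ler_pdivlMr // => h3; apply: le_trans h3.
  have -> : q * (e * (m + 1)) = e * q * m + e * q by ring.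
  by rewrite lerDl mulr_ge0 // ltW.
rewrite Wx; split=> //; apply/ler_addgt0Pr => d d0.
have [n0 h0] := hx' _ d0.
have [_] := Omega_sub cX cY hA (ssO n0.+1) (proj1 (Omega_sub cX cY hA (ssO n0.+1) Ox)).
rewrite opprB [ss _ + _]addrC subrK => /le_trans; apply; apply: lerD (h0 _ (leqnSn _)).
by apply: le_trans (ssB _) _; rewrite lerD2l ler_wpM2l ?(ltW e0) // lerDl.
Qed.

End Conv.

(** * Convolution algebras and their representations *)

Lemma hassum_bij (R : realType) (I J : eqType) (g : I -> J) (g' : J -> I)
    (f : I -> R[i]) s : cancel g g' -> cancel g' g ->
  hassum f s -> hassum (f \o g') s.
Proof.
move=> gK g'K hf.
have pq : pcancel g (fun j => Some (g' j)) by move=> i; rewrite gK.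
have qp : ocancel (fun j => Some (g' j)) g by move=> j /=; rewrite g'K.
by have /(_ hf) := proj1 (hassum_pad pq qp f s).
Qed.

Definition swap (I J : Type) (p : I * J) : J * I := (p.2, p.1).

Lemma swapK (I J : Type) : cancel (@swap I J) (@swap J I).
Proof. by case. Qed.

Lemma fam_bij (R : realType) (I J : eqType) (H K : hilbertType R) (g : I -> J) (g' : J -> I)
    (a : I -> H -> K) : cancel g g' -> cancel g' g -> fam a -> fam (fun j => a (g' j)).
Proof.
move=> gK g'K fa.
have pq : pcancel g (fun j => Some (g' j)) by move=> i; rewrite gK.
have qp : ocancel (fun j => Some (g' j)) g by move=> j /=; rewrite g'K.
exact: (pad_fam qp fa).
Qed.

Section Unitary.
Variables (R : realType) (G G' : hilbertType R) (U : G -> G').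
Hypothesis uU : unitary_op U.

Lemma unitary_norm v : rnorm (U v) = rnorm v.
Proof.
case: uU => _ ip _; apply/eqP; rewrite -(eqrXn2 (n := 2)) ?rnorm_ge0 //.
by rewrite -!Re_iprodxx ip.
Qed.

Lemma unitary_bounded : bounded_op U.
Proof.
case: (uU) => lU _ _; split=> //; exists 1; split=> // x.
by rewrite mul1r unitary_norm.
Qed.

Lemma unitaryK v : adj U (U v) = v.
Proof.
have bU := unitary_bounded; case: uU => _ ip _.
by apply: iprod_ext => x; rewrite adjPr // ip.
Qed.

Lemma unitaryVK v : U (adj U v) = v.
Proof. by case: (uU) => _ _ /(_ v) [x <-]; rewrite unitaryK. Qed.

Lemma unitary_adj : unitary_op (adj U).
Proof.
case: (uU) => _ ip _; split.
- exact: bounded_lin (bounded_adj unitary_bounded).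
- by move=> x y; rewrite -ip !unitaryVK.
by move=> y; exists (U y); rewrite unitaryK.
Qed.

Lemma unitary_adj_norm v : rnorm (adj U v) = rnorm v.
Proof. by rewrite -unitary_norm unitaryVK. Qed.

End Unitary.

(** * Convolution and representation, treated for one leg *)

Section Half.
Variables (R : realType) (L H : hilbertType R) (Y X : set (L -> H)).
Hypothesis ab : adm Y X.
Variable T : rtp Y X.
Variables (A : set (H -> H)) (A2 : set (T -> T)).
Hypotheses (cX : cspan X = X) (cY : cspan Y = Y).
Hypotheses (hA : A `<=` @bounded_op R H H) (hA2 : A2 `<=` @bounded_op R T T).
Hypothesis slice2 : forall S xi xi', A2 S -> X xi -> X xi' ->
  A (adj (ket2 T xi) \o S \o ket2 T xi').
Hypothesis slice1 : forall S eta eta', A2 S -> Y eta -> Y eta' ->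
  A (adj (ket1 T eta) \o S \o ket1 T eta').
Variable Dl : (H -> H) -> T -> T.
Hypothesis DlA : forall Z, A Z -> A2 (Dl Z).
Let bX : X `<=` @bounded_op R L H := adm_br ab.
Let bY : Y `<=` @bounded_op R L H := adm_bl ab.
Let O := Omega X Y A.
Let N := Omega_norm X Y A.
Let bx := @box R L H Y X T A A2.

Definition omul (w w' : (H -> H) -> L -> L) : (H -> H) -> L -> L :=
  on_set A (bx w w' \o Dl).

Lemma omul_boxv xi eta xi' eta' Z :
  seqs X xi -> seqs Y eta -> seqs X xi' -> seqs Y eta' -> A Z ->
  omul (omf A xi eta) (omf A xi' eta') Z = boxv A2 xi eta xi' eta' (Dl Z).
Proof.
move=> sx se sx' se' AZ; rewrite /omul on_set_in //=.
by rewrite /bx box_rep.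
Qed.

Lemma omul_bilinear : bilinear_on O O omul.
Proof.
have [l1 l2] := box_bilinear ab cX cY hA hA2 slice2 slice1.
split=> c w w' w'' Ow Ow' Ow''; apply/funext => Z;
  have [AZ|nAZ] := pselect (A Z).
- rewrite -[RHS]/(c *: omul w w'' Z + omul w' w'' Z) /omul !on_set_in //=.
  by rewrite /bx l1.
- rewrite -[RHS]/(c *: omul w w'' Z + omul w' w'' Z) /omul !on_set_out //.
  by rewrite scaler0 addr0.
- rewrite -[RHS]/(c *: omul w w' Z + omul w w'' Z) /omul !on_set_in //=.
  by rewrite /bx l2.
rewrite -[RHS]/(c *: omul w w' Z + omul w w'' Z) /omul !on_set_out //.
by rewrite scaler0 addr0.
Qed.

Section Submul.
Variables (G : hilbertType R) (KK : set (H -> G)) (tl : (H -> H) -> G -> G) (U : G -> T).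
Hypothesis bK : KK `<=` @bounded_op R H G.
Hypothesis tK : cspan_vec [set k v | k in KK & v in [set: H]] = setT.
Hypothesis tlb : forall Z, A Z -> bounded_op (tl Z).
Hypothesis tlK : forall Z k v, A Z -> KK k -> tl Z (k v) = k (Z v).
Hypothesis gX : forall k k' x, KK k -> KK k' -> X x -> X (adj k \o (k' \o x)).
Hypothesis gY : forall k k' x, KK k -> KK k' -> Y x -> Y (adj k \o (k' \o x)).
Hypothesis gA : forall k k' Z v, KK k -> KK k' -> A Z ->
  Z (adj k (k' v)) = adj k (k' (Z v)).
Hypothesis uU : unitary_op U.
Hypothesis DlU : forall Z v, A Z -> Dl Z (U v) = U (tl Z v).
Hypothesis UX : forall p, ltri T X p ->
  cspan [set k \o x | k in KK & x in X] (adj U \o p).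
Hypothesis UY : forall p, rtri T Y p ->
  cspan [set k \o x | k in KK & x in Y] (adj U \o p).

(** For a representing pair of the box product, [theta^* Dl(Z) theta' = (U^* theta)^* tl(Z) (U^*
    theta')]. By [UX] and [UY] the transported families lie in the closed spans built from [KK], and
    [conv_Omega] applies without loss of norm. *)
Lemma omul_submul w w' : O w -> O w' -> O (omul w w') /\ N (omul w w') <= N w * N w'.
Proof.
move=> Ow Ow'.
have [w2 n2] := box_bound ab cX cY hA hA2 slice2 slice1 Ow Ow'.
have bU : bounded_op U := unitary_bounded uU.
have UU v : U (adj U v) = v by exact: unitaryVK.
have nU v : rnorm (adj U v) <= rnorm v by rewrite unitary_adj_norm.
have cl := ltri_closed T X.
have cr := rtri_closed T Y.
suff key (e : R) : 0 < e -> O (omul w w') /\ N (omul w w') <= N w * N w' + e.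
  split; first by have [] := key 1 ltr01.
  by apply/ler_addgt0Pr => e /key [].
move=> e0.
have [th [th' [M [sl sr E M0 [ql qr Me]]]]] := Omega_rep cl cr hA2 w2 e0.
have fl := seqs_fam (sub_bounded cl) sl.
have fr := seqs_fam (sub_bounded cr) sr.
have bau := bounded_adj bU.
have fl' := fam_comp_left bau fl.
have fr' := fam_comp_left bau fr.
have [] := @conv_Omega R L H G X Y KK A tl cX cY hA bK tK tlb tlK gX gY gA
  (fun k => adj U \o th k) (fun k => adj U \o th' k) M M M0 M0 _ _ fl' fr' _ _.
- by move=> k; apply: UX; case: sl => + _; apply.
- by move=> k; apply: UY; case: sr => + _; apply.
- by apply: sqb_contract ql => k x; exact: nU.
- by apply: sqb_contract qr => k x; exact: nU.
set W := on_set _ _; suff -> : omul w w' = W.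
  by move=> OW NW; split=> //; apply: le_trans NW _; rewrite -expr2; apply: le_trans Me _; rewrite lerD2r.
apply/funext => Z; rewrite /omul /W; have [AZ|nAZ] := pselect (A Z); last by rewrite !on_set_out.
rewrite !on_set_in //= /bx E.
apply/esym; apply: pairing_unique => //.
- by apply: fam_comp_left; [exact: tlb|].
- exact: (omf_bounded hA2).
move=> y x; have := omf_hassum hA2 x y fl fr (DlA AZ).
apply: eq_hassum => k /=.
by rewrite [RHS]adjP // -DlU // UU.
Qed.

Lemma omul_banach :
  (forall x y z, O x -> O y -> O z -> omul x (omul y z) = omul (omul x y) z) ->
  banach_algebra O N omul.
Proof.
move=> hassoc; split=> //.
- exact: Omega_banach.
- by move=> x y Ox Oy; have [] := omul_submul Ox Oy.
- exact: omul_bilinear.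
by move=> x y Ox Oy; have [] := omul_submul Ox Oy.
Qed.

End Submul.

Section Assoc.
(** Coassociativity in the form in which it is used: [k1] and [k3] are kets into the first and third
    legs of a threefold product, [Th] is the twofold coproduct of [Z] there, and slicing [Dl Z] in
    one leg before applying [Dl] amounts to slicing [Th]. *)
Hypothesis coassoc : forall Z, A Z ->
  exists (S2 : hilbertType R) (k1 k3 : (L -> H) -> T -> S2) (Th : S2 -> S2),
  [/\ [/\ bounded_op Th, forall eta, Y eta -> bounded_op (k1 eta) &
          forall xi, X xi -> bounded_op (k3 xi)],
      (forall a : nat -> L -> H, (forall i, Y (a i)) -> fam a -> fam (fun i => k1 (a i))),
      (forall a : nat -> L -> H, (forall i, X (a i)) -> fam a -> fam (fun i => k3 (a i))),
      (forall eta xi v, Y eta -> X xi -> k1 eta (ket2 T xi v) = k3 xi (ket1 T eta v)) &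
      (forall xi xi', X xi -> X xi' ->
        Dl (adj (ket2 T xi) \o Dl Z \o ket2 T xi') = adj (k3 xi) \o Th \o k3 xi') /\
      (forall eta eta', Y eta -> Y eta' ->
        Dl (adj (ket1 T eta) \o Dl Z \o ket1 T eta') = adj (k1 eta) \o Th \o k1 eta')].
Hypothesis omul_O : forall w w', O w -> O w' -> O (omul w w').

Lemma omul_assoc x y z : O x -> O y -> O z -> omul x (omul y z) = omul (omul x y) z.
Proof.
move=> Ox Oy Oz.
have [rho [sig [srho ssig Erho]]] := O_rep cX cY hA (omul_O Oy Oz).
have [rho' [sig' [srho' ssig' Erho']]] := O_rep cX cY hA (omul_O Ox Oy).
have [xi [eta [sx se Ex]]] := O_rep cX cY hA Ox.
have [xi' [eta' [sx' se' Ey]]] := O_rep cX cY hA Oy.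
have [xi'' [eta'' [sx'' se'' Ez]]] := O_rep cX cY hA Oz.
apply/funext => Z; have [AZ|nAZ] := pselect (A Z); last by rewrite /omul !on_set_out.
rewrite [in LHS]Erho [in RHS]Erho' [in LHS]Ex [in RHS]Ez !omul_boxv //.
have [S2 [k1 [k3 [Th [[bTh bk1' bk3'] f1 f3 k13 [h3 h1]]]]]] := coassoc AZ.
have AS := DlA AZ; set S := Dl Z in AS h1 h3 *.
have fx := seqs_fam bX sx; have fx' := seqs_fam bX sx'; have fx'' := seqs_fam bX sx''.
have fe := seqs_fam bY se; have fe' := seqs_fam bY se'; have fe'' := seqs_fam bY se''.
have X0 : forall i, X (xi i) by case: sx.
have X1 : forall i, X (xi' i) by case: sx'.
have X2 : forall i, X (xi'' i) by case: sx''.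
have Y0 : forall i, Y (eta i) by case: se.
have Y1 : forall i, Y (eta' i) by case: se'.
have Y2 : forall i, Y (eta'' i) by case: se''.
have fk1 := f1 eta Y0 fe; have fk3 := f3 xi'' X2 fx''.
have fket2 := ket2_fam ab T X1 fx'.
have fket1 := ket1_fam ab T Y1 fe'.
have fL := fam_bij (@swapK nat nat) (@swapK nat nat) (cfam_fam fk3 fket2).
set aL := (fun p => _) in fL.
have fR := thR_fam ab T se' se''.
have fEl := fam_bij (@swapK _ nat) (@swapK nat _) (cfam_fam fL fx).
have fEr := fam_comp_left bTh (cfam_fam fk1 fR).
have bk1 m : bounded_op (k1 (eta m)) := fk1.1 m.
have bk3 p : bounded_op (k3 (xi'' p)) := fk3.1 p.
apply/funext => w; apply: iprod_ext => v.
(* both sides equal the triple sum over [(m, (n, p))] *)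
have hD := pairing_hassum fEl fEr w v.
transitivity (iprod v (pairing (fun i => cfam aL xi (swap i))
  (fun i => Th \o cfam (fun m => k1 (eta m)) (thR T eta' eta'') i) w)).
  have hL := boxv_rsl ab hA2 sx se srho ssig v w AS.
  apply: (hassum_unique hL); apply: (hassum_fubini hD) => m.
  have fm := fam_comp_left bTh (fam_comp_left (bk1 m) fR).
  (* [rho, sig] is an arbitrary representative of the product of [y] and [z]. The slice depends only
     on that product, so it may be computed from the families of [y] and [z]. *)
  suff -> : rsl rho sig (eta m) S = pairing aL (fun np => Th \o (k1 (eta m) \o thR T eta' eta'' np)).
    exact: (pairing_hassum fL fm w (xi m v)).
  apply/funext => w'; apply: (iprod_ext_vals (adm_tl ab)) => al z' Yal.
  rewrite (rsl_val ab hA hA2 slice1) // -Erho Ey Ez omul_boxv //; last exact: slice1.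
  have hI := boxv_hassum ab hA2 sx' se' sx'' se'' z' w' (DlA (slice1 AS Yal (Y0 m))).
  apply: (hassum_unique hI); apply: eq_hassum (pairing_hassum fL fm w' (al z')) => -[n p] /=.
  rewrite (h1 al (eta m)) //= adjPr; last exact: bk1'.
  by rewrite /aL /cfam /thL /= k13 // (ket12 ab).
have hR := boxv_lsl ab hA2 srho' ssig' sx'' se'' v w AS.
apply: hassum_unique hR.
(* Moves the index [p] of the third factor to the front, so that Fubini sums over [(m, n)] first. *)
pose g (q : nat * (nat * nat)) : nat * (nat * nat) := (q.2.2, (q.1, q.2.1)).
pose g' (q : nat * (nat * nat)) : nat * (nat * nat) := (q.2.1, (q.2.2, q.1)).
have gK : cancel g g' by move=> [m [n p]].
have g'K : cancel g' g by move=> [p [m n]].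
apply: (hassum_fubini (hassum_bij gK g'K hD)) => p.
have fl := fam_comp_left (bk3 p) (thL_fam ab T sx sx').
have fr := fam_comp_left bTh (cfam_fam fk1 fket1).
suff -> : lsl rho' sig' (xi'' p) S = pairing (fun mn => k3 (xi'' p) \o thL T xi xi' mn)
    (fun mn => Th \o cfam (fun m => k1 (eta m)) (fun n => ket1 T (eta' n)) mn).
  exact: (pairing_hassum fl fr (eta'' p w) v).
apply: (eq_on_vals (adm_tr ab)).
- exact: (lsl_bounded ab hA2 srho' ssig' (X2 p) AS).
- exact: pairing_bounded.
move=> ba w' Xba; rewrite (lsl_val ab hA hA2 slice2) // -Erho' Ex Ey omul_boxv //; last exact: slice2.
apply: iprod_ext => z'.
have hI := boxv_hassum ab hA2 sx se sx' se' z' w' (DlA (slice2 AS (X2 p) Xba)).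
apply: (hassum_unique hI); apply: eq_hassum (pairing_hassum fl fr (ba w') z') => -[m n] /=.
rewrite (h3 (xi'' p) ba) //= adjPr; last exact: bk3.
by rewrite /cfam /thR /= -k13 // (ket12 ab).
Qed.

End Assoc.

Section Hom.
Variables (G1 : hilbertType R) (x1 y1 : (L -> H) -> H -> G1).
Variables (Qa Qz : set (L -> H)) (q : (L -> H) -> (L -> H) -> H -> H).
Hypothesis x1b : forall xi, X xi -> bounded_op (x1 xi).
Hypothesis y1b : forall eta, Y eta -> bounded_op (y1 eta).
Hypothesis x1_sqb : forall (a : nat -> L -> H) M, (forall i, X (a i)) -> 0 <= M ->
  sqb a M -> sqb (fun i => x1 (a i)) M.
Hypothesis y1_sqb : forall (a : nat -> L -> H) M, (forall i, Y (a i)) -> 0 <= M ->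
  sqb a M -> sqb (fun i => y1 (a i)) M.
Hypothesis x1_fam : forall a : nat -> L -> H, (forall i, X (a i)) -> fam a -> fam (fun i => x1 (a i)).
Hypothesis y1_fam : forall a : nat -> L -> H, (forall i, Y (a i)) -> fam a -> fam (fun i => y1 (a i)).
Hypotheses (tQa : cspan_vec (vals Qa) = setT) (tQz : cspan_vec (vals Qz) = setT).
Hypothesis qA : forall al ze, Qa al -> Qz ze -> A (q al ze).
Hypothesis q_val : forall xi eta al ze z z', X xi -> Y eta -> Qa al -> Qz ze ->
  iprod (x1 xi (al z)) (y1 eta (ze z')) = iprod (xi z) (q al ze (eta z')).
Let p xi eta : H -> H := adj (x1 xi) \o y1 eta.
Hypothesis q_mul : forall xi eta xi' eta' al ze z z',
  X xi -> Y eta -> X xi' -> Y eta' -> Qa al -> Qz ze ->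
  iprod (ket2 T xi' (xi z)) (Dl (q al ze) (ket1 T eta (eta' z')))
  = iprod (al z) (p xi eta (p xi' eta' (ze z'))).
Hypothesis omul_O : forall w w', O w -> O w' -> O (omul w w').

(** In the applications [q al ze] is a slice of the unitary along the other leg. The coefficients
    involve [w] itself and no representing families, which settles well-definedness and linearity at
    once. *)
Definition pi_op (w : (H -> H) -> L -> L) : H -> H :=
  xget (fun=> 0) [set B | bounded_op B /\ forall al ze z z', Qa al -> Qz ze ->
    iprod (al z) (B (ze z')) = iprod z (w (q al ze) z')].

Lemma pi_op_unique w B : bounded_op B -> (forall al ze z z', Qa al -> Qz ze ->
    iprod (al z) (B (ze z')) = iprod z (w (q al ze) z')) -> pi_op w = B.
Proof.
move=> bB hB; rewrite /pi_op; case: xgetP => [B' _ [bB' hB']|/(_ B) []//].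
apply: (eq_on_vals tQz) => // ze z' zz; apply: (iprod_ext_vals tQa) => al z aa.
by rewrite hB // hB'.
Qed.

Section Rep.
Variables (xi eta : nat -> L -> H).
Hypotheses (sx : seqs X xi) (se : seqs Y eta).
Let fx := x1_fam (proj1 sx) (seqs_fam bX sx).
Let fe := y1_fam (proj1 se) (seqs_fam bY se).

Lemma pairing_legs al ze z z' : Qa al -> Qz ze ->
  iprod (al z) (pairing (x1 \o xi) (y1 \o eta) (ze z')) = iprod z (omf A xi eta (q al ze) z').
Proof.
move=> aa zz; apply: (hassum_unique (pairing_hassum fx fe (ze z') (al z))).
have h2 := omf_hassum hA z z' (seqs_fam bX sx) (seqs_fam bY se) (qA aa zz).
apply: eq_hassum h2 => k /=; rewrite q_val //; by [case: sx|case: se].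
Qed.

Lemma pi_op_rep : pi_op (omf A xi eta) = pairing (x1 \o xi) (y1 \o eta).
Proof. by apply: pi_op_unique => [|*]; [exact: pairing_bounded|exact: pairing_legs]. Qed.

Lemma pi_op_series : op_series_to (fun n => p (xi n) (eta n)) (pi_op (omf A xi eta)).
Proof. by rewrite pi_op_rep; apply: opsum_series; exact: pairingP. Qed.

Lemma pi_op_leg : cspan [set p x y | x in X & y in Y] (pi_op (omf A xi eta)).
Proof.
rewrite pi_op_rep; have [bD hD] := pairingP fx fe; split=> // e e0.
have [F0 h0] := hD e e0.
exists (\sum_(i <- undup F0) (adj (x1 (xi i)) \o y1 (eta i))).
  elim: (undup F0) => [|i F IH]; first by rewrite big_nil; exact: lspan0.
  rewrite big_cons -[_ \o _]scale1r; apply: lspan_lin => //; apply: lspan_gen.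
  by exists (xi i); [case: sx|exists (eta i) => //; case: se].
apply: op_bound_sym; apply: h0; first exact: undup_uniq.
by move=> i; rewrite mem_undup.
Qed.

Lemma pi_op_bound M : 0 <= M -> sqb xi (M ^+ 2) -> sqb eta (M ^+ 2) ->
  op_bound (pi_op (omf A xi eta)) (M ^+ 2).
Proof.
move=> M0 qx qe; rewrite pi_op_rep expr2; apply: pairing_bound => //.
- by apply: x1_sqb => //; [case: sx|exact: sqr_ge0].
- by apply: y1_sqb => //; [case: se|exact: sqr_ge0].
Qed.

End Rep.

Lemma pi_op_spec w : O w -> bounded_op (pi_op w) /\
  forall al ze z z', Qa al -> Qz ze ->
    iprod (al z) (pi_op w (ze z')) = iprod z (w (q al ze) z').
Proof.
move=> /(O_rep cX cY hA) [xi [eta [sx se ->]]].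
rewrite pi_op_rep //; split=> [|al ze z z' aa zz]; last exact: pairing_legs.
exact: pairing_bounded (x1_fam (proj1 sx) (seqs_fam bX sx)) (y1_fam (proj1 se) (seqs_fam bY se)).
Qed.

Lemma pi_op_hom : contractive_hom O N omul (cspan [set p x y | x in X & y in Y]) pi_op.
Proof.
split=> [w /(O_rep cX cY hA) [xi [eta [sx se ->]]]|c w w' Ow Ow'|w w' Ow Ow'|w Ow].
- exact: pi_op_leg.
- have [b1 h1] := pi_op_spec Ow; have [b2 h2] := pi_op_spec Ow'.
  apply: pi_op_unique => [|al ze z z' aa zz]; first exact: boundedD (boundedZ c b1) b2.
  by rewrite -[(c *: w + w') _ _]/(c *: w (q al ze) z' + w' (q al ze) z') !iprodDr !iprodZr h1 // h2.
- have [b1 _] := pi_op_spec Ow; have [b2 _] := pi_op_spec Ow'.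
  apply: pi_op_unique => [|al ze z z' aa zz]; first exact: bounded_comp.
  move: Ow Ow' => /(O_rep cX cY hA) [xi [eta [sx se ->]]] /(O_rep cX cY hA) [xi' [eta' [sx' se' ->]]].
  rewrite omul_boxv //; last exact: qA.
  have hB := boxv_hassum ab hA2 sx se sx' se' z z' (DlA (qA aa zz)).
  have fx := x1_fam (proj1 sx) (seqs_fam bX sx).
  have fe := y1_fam (proj1 se) (seqs_fam bY se).
  have fx' := x1_fam (proj1 sx') (seqs_fam bX sx').
  have fe' := y1_fam (proj1 se') (seqs_fam bY se').
  rewrite !pi_op_rep //=.
  (* The double sum of the product is summed over [n] for fixed [m]: the inner sum is the operator
     of [w'], the outer one that of [w]. *)
  apply: (hassum_unique (pairing_hassum fx fe _ _)); apply: (hassum_fubini hB) => m.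
  have bxm := x1b (proj1 sx m); have bym := y1b (proj1 se m).
  rewrite -adjP //; apply: eq_hassum (pairing_hassum fx' fe' (ze z') _) => n /=.
  rewrite /thL /thR /= q_mul //; try by [apply: (proj1 sx)|apply: (proj1 se)|apply: (proj1 sx')|apply: (proj1 se')].
  have bxn := x1b (proj1 sx' n).
  by rewrite /p /= -(adjPr _ _ bxn) (adjP _ _ bym) -(adjPr _ _ bxm).
have key (e : R) : 0 < e -> opnorm (pi_op w) <= N w + e.
  move=> e0.
  have [xi [eta [M [sx se -> M0 [qx qe Me]]]]] := Omega_rep cX cY hA Ow e0.
  exact: le_trans (opnorm_le (pi_op_bound sx se M0 qx qe)) Me.
by apply/ler_addgt0Pr.
Qed.

End Hom.

End Half.

(** * Modules *)

Section Modules.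
Variables (R : realType) (L : hilbertType R).
Implicit Types (H K G : hilbertType R).

Lemma total_image H K (KK : set (H -> K)) (D : set H) :
  (forall k, KK k -> bounded_op k) ->
  cspan_vec [set k v | k in KK & v in [set: H]] = setT -> cspan_vec D = setT ->
  cspan_vec [set k v | k in KK & v in D] = setT.
Proof.
move=> bk tk /cspan_vecP tD; apply: total_closure tk _ => _ [k Kk [v _ <-]] e e0.
have [M M0 [_ hM]] := op_bound_gt0 (bk k Kk).
have [w Dw vw] := tD v _ (divr_gt0 e0 M0).
have lk := bounded_lin (bk k Kk).
exists (k w); last first.
  rewrite -(linB lk); apply: le_trans (hM _) _.
  by rewrite mulrC -ler_pdivlMr.
move: w Dw {vw}; apply: lspan_ind; first by rewrite (lin0 lk); exact: lspan0.
move=> a u u' Du hu'; rewrite lk; apply: lspan_lin => //.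
by apply: lspan_gen; exists k => //; exists u.
Qed.

(** The closure is taken in one variable at a time; the adjoint exchanges the two. *)
Lemma inner_cspan H (B : set (L -> L)) (Y : set (L -> H)) :
  cspan B = B -> (forall S, B S -> B (adj S)) -> Y `<=` @bounded_op R L H ->
  (forall x y, Y x -> Y y -> B (adj x \o y)) ->
  forall x y, cspan Y x -> cspan Y y -> B (adj x \o y).
Proof.
move=> cB aB bY h.
have h1 x y : Y x -> cspan Y y -> B (adj x \o y).
  move=> Yx; rewrite -cB; apply: cspan_comp_left; first exact: bounded_adj (bY _ Yx).
  by move=> z Yz; rewrite cB; exact: h.
move=> x y Yx Yy.
have bx := cspan_bounded Yx; have by' := cspan_bounded Yy.
have -> : adj x \o y = adj (adj y \o x).
  by rewrite adj_comp ?adjK //; exact: bounded_adj.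
apply: (aB); rewrite -cB; move: (x) Yx; apply: cspan_comp_left; first exact: bounded_adj.
move=> z Yz; rewrite cB.
have -> : adj y \o z = adj (adj z \o y).
  by rewrite adj_comp ?adjK //; [exact: bY|exact: bounded_adj (bY _ Yz)].
exact/aB/h1.
Qed.

(** The coefficient set is a bare parameter, so that the same lemmas serve for modules over either
    algebra of the base. *)
Record pmod (B : set (L -> L)) H (a : set (L -> H)) : Prop := PMod {
  pmod_closed : cspan a = a ;
  pmod_total : cspan_vec (vals a) = setT ;
  pmod_inner : forall x y, a x -> a y -> B (adj x \o y)
}.

Lemma pmod_bounded B H (a : set (L -> H)) : pmod B a -> a `<=` @bounded_op R L H.
Proof. by move=> ha; apply: sub_bounded; exact: pmod_closed ha. Qed.

Lemma pmod_adm B B' H K (a : set (L -> H)) (d : set (L -> K)) :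
  (forall S T, B S -> B' T -> S \o T = T \o S) -> pmod B a -> pmod B' d -> adm a d.
Proof.
move=> BB' ha hd; split.
- exact: pmod_bounded ha.
- exact: pmod_bounded hd.
- exact: pmod_total ha.
- exact: pmod_total hd.
move=> x x' y y' z ax ax' dy dy'.
exact: (congr1 (@^~ z) (BB' _ _ (pmod_inner ha ax ax') (pmod_inner hd dy dy'))).
Qed.

(** [rho a c] as a relation: operators that arise otherwise, such as [|x>_1^* |x'>_1] or
    [id (x) rho], can be recognised as representation operators without a choice. *)
Definition multop H (a : set (L -> H)) (c : L -> L) (X : H -> H) : Prop :=
  bounded_op X /\ forall xi z, a xi -> X (xi z) = xi (c z).

Definition stable (C : set (L -> L)) H (a d : set (L -> H)) : Prop :=
  forall c X y, C c -> multop a c X -> d y -> d (X \o y).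

Lemma multop_unique H (a : set (L -> H)) c X X' : cspan_vec (vals a) = setT ->
  multop a c X -> multop a c X' -> X = X'.
Proof.
by move=> ta [bX hX] [bX' hX']; apply: (eq_on_vals ta) => // xi z ax; rewrite hX ?hX'.
Qed.

Lemma multop_rho B B' H (a : set (L -> H)) c : pmod B a ->
  (forall S T, B S -> B' T -> S \o T = T \o S) -> bounded_op c -> B' (adj c) ->
  multop a c (rho a c).
Proof.
move=> ha BB' bc Bc; have [M M0 hM] := op_bound_gt0 bc.
have [|X [bX _ hX]] := mult_exists (pmod_bounded ha) (pmod_total ha) bc hM _.
  move=> xi xi' z ax ax'.
  exact: (congr1 (@^~ z) (esym (BB' _ _ (pmod_inner ha ax ax') Bc))).
by rewrite /rho; case: xgetP => [X' _ [bX' hX']|/(_ X) []]; split.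
Qed.

Lemma rho_eq H (a : set (L -> H)) c X : cspan_vec (vals a) = setT ->
  multop a c X -> rho a c = X.
Proof.
move=> ta [bX hX]; rewrite /rho; case: xgetP => [X' _ [bX' hX']|/(_ X) []//].
by apply: (multop_unique (c := c) ta); split.
Qed.

Section Tri.
Variables (H K : hilbertType R) (a : set (L -> H)) (g : set (L -> K)).
Hypothesis ag : adm a g.
Variable T : rtp a g.

(** This is how the module conditions control kets: [|x>_1^* |x'>_1] is the representation of
    [x^* x'] on the other leg. *)
Lemma ket1_multop x x' : a x -> a x' -> multop g (adj x \o x') (adj (ket1 T x) \o ket1 T x').
Proof.
move=> ax ax'; split=> [|y z gy]; last by rewrite /= (ket1_gram ag).
by apply: bounded_comp; [apply: bounded_adj|]; exact: (ket1_bounded ag).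
Qed.

Lemma rtri_pmod (D : set (L -> L)) (d : set (L -> K)) :
  cspan D = D -> (forall S, D S -> D (adj S)) -> pmod D d ->
  (forall x x' y, a x -> a x' -> d y -> d (adj (ket1 T x) \o ket1 T x' \o y)) ->
  pmod D (rtri T d).
Proof.
move=> cD aD hd st; have bd := pmod_bounded hd; split.
- exact: rtri_closed.
- apply/seteqP; split=> // v _.
  have h : cspan_vec [set k w | k in [set ket1 T x | x in a] & w in vals d] = setT.
    apply: total_image (pmod_total hd) => [_ [x ax <-]|]; first exact: (ket1_bounded ag).
    apply: total_sub (ket1_total ag T) _ => _ [x ax [w _ <-]]; apply: lspan_gen.
    by exists (ket1 T x); [exists x|exists w].
  have : cspan_vec (vals (rtri T d)) = setT.
    apply: total_sub h _ => _ [_ [x ax <-] [_ [y dy [z _ <-]] <-]]; apply: lspan_gen.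
    by exists (ket1 T x \o y); [exact: rtri_gen|exists z].
  by move=> ->.
apply: inner_cspan => // [_ [x ax [y dy <-]]|_ _ [x ax [y dy <-]] [x' ax' [y' dy' <-]]].
  by apply: bounded_comp; [exact: (ket1_bounded ag)|exact: bd].
rewrite adj_comp; [|exact: (ket1_bounded ag)|exact: bd].
exact: (pmod_inner hd dy (st _ _ _ ax ax' dy')).
Qed.

End Tri.

Lemma ltri_pmod H K (a : set (L -> H)) (g : set (L -> K)) (ag : adm a g) (T : rtp a g)
    (D : set (L -> L)) (d : set (L -> H)) :
  cspan D = D -> (forall S, D S -> D (adj S)) -> pmod D d ->
  (forall x x' y, g x -> g x' -> d y -> d (adj (ket2 T x) \o ket2 T x' \o y)) ->
  pmod D (ltri T d).
Proof. exact: (rtri_pmod (adm_sym ag) (T := flipT ag T)). Qed.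

Lemma ket2_multop H K (a : set (L -> H)) (g : set (L -> K)) (ag : adm a g) (T : rtp a g) x x' :
  g x -> g x' -> multop a (adj x \o x') (adj (ket2 T x) \o ket2 T x').
Proof. exact: (ket1_multop (adm_sym ag) (flipT ag T)). Qed.

End Modules.

Section PreUnitary.
Variables (R : realType) (b : cbase R) (H : hilbertType R).
Notation L := (bspace b).
Notation B := (balg b).
Notation Bd := (balgd b).
Implicit Types (hb al be : set (L -> H)).

Lemma balg_closed : cspan B = B. Proof. by case: (balg_cstar b). Qed.
Lemma balgd_closed : cspan Bd = Bd. Proof. by case: (balgd_cstar b). Qed.
Lemma balg_adj S : B S -> B (adj S). Proof. by case: (balg_cstar b) => _ _; apply. Qed.
Lemma balgd_adj S : Bd S -> Bd (adj S). Proof. by case: (balgd_cstar b) => _ _; apply. Qed.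

(* A C*-pseudo-multiplicative unitary without its pentagon equation. *)
Record premu hb al be (T : rtp hb al) (T' : rtp al be) (V : T -> T') : Prop := PreMu {
  pm_hb : pmod Bd hb ; pm_al : pmod B al ; pm_be : pmod Bd be ;
  pm_hb_al : stable B hb al ; pm_hb_be : stable B hb be ;
  pm_al_hb : stable Bd al hb ; pm_al_be : stable Bd al be ;
  pm_be_hb : stable B be hb ; pm_be_al : stable B be al ;
  pm_unitary : unitary_op V ;
  pm_aa : forall x, ltri T al x -> rtri T' al (V \o x) ;
  pm_aaV : forall x, rtri T' al x -> ltri T al (adj V \o x) ;
  pm_hb' : forall x, rtri T be x -> ltri T' hb (V \o x) ;
  pm_hbV : forall x, ltri T' hb x -> rtri T be (adj V \o x) ;
  pm_hh : forall x, rtri T hb x -> rtri T' hb (V \o x) ;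
  pm_hhV : forall x, rtri T' hb x -> rtri T hb (adj V \o x) ;
  pm_ba : forall x, ltri T be x -> ltri T' be (V \o x) ;
  pm_baV : forall x, ltri T' be x -> ltri T be (adj V \o x)
}.

Lemma comm_dB S T : Bd S -> B T -> S \o T = T \o S.
Proof. by move=> hS hT; rewrite (balg_comm hT hS). Qed.

Lemma pmod_adm_dB (H1 H2 : hilbertType R) (a : set (L -> H1)) (d : set (L -> H2)) :
  pmod Bd a -> pmod B d -> adm a d.
Proof. exact: pmod_adm comm_dB. Qed.

Lemma pmod_adm_Bd (H1 H2 : hilbertType R) (a : set (L -> H1)) (d : set (L -> H2)) :
  pmod B a -> pmod Bd d -> adm a d.
Proof. by apply: pmod_adm => S T hS hT; rewrite balg_comm. Qed.

Lemma stable_rho (C : set (L -> L)) (H1 : hilbertType R) (a d : set (L -> H1)) :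
  cspan_vec (vals a) = setT -> d `<=` @bounded_op R L H1 ->
  cspan [set rho a c \o xi | c in C & xi in d] = d -> stable C a d.
Proof.
move=> ta bd hd c X y Cc hX dy; rewrite -hd; apply: cspan_gen.
  by apply: bounded_comp; [case: hX|exact: bd].
by exists c => //; exists y => //; rewrite (rho_eq ta hX).
Qed.

Lemma cpmu_premu hb al be (T : rtp hb al) (T' : rtp al be) (V : T -> T') :
  cpmu V -> premu V.
Proof.
case=> -[m1 m2 m3 h12 h13 h21 h23 h31 h32] uV aa hbb hh ba _.
have p (c : cbase R) (a : set (bspace c -> H)) : cmodule a -> pmod (balg c) a.
  move=> [c1 c2 c3 c4]; split=> // x y ax ay; rewrite -c4; apply: cspan_gen.
    by apply: bounded_comp; [apply: bounded_adj|]; apply: (sub_bounded c1).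
  by exists x => //; exists y.
have p1 : pmod Bd hb := p _ _ m1.
have p2 : pmod B al := p _ _ m2.
have p3 : pmod Bd be := p _ _ m3.
have b1 := pmod_bounded p1; have b2 := pmod_bounded p2; have b3 := pmod_bounded p3.
have im (P : set (L -> T)) (Q : set (L -> T')) : [set V \o x | x in P] = Q ->
    (forall x, P x -> Q (V \o x)) /\ (forall x, Q x -> P (adj V \o x)).
  move=> E; split=> x; first by move=> Px; rewrite -E; exists x.
  rewrite -E => -[y Py <-]; have -> : adj V \o (V \o y) = y => //.
  by apply/funext => z /=; rewrite unitaryK.
have [i1 j1] := im _ _ aa; have [i2 j2] := im _ _ hbb.
have [i3 j3] := im _ _ hh; have [i4 j4] := im _ _ ba.
split=> //; apply: stable_rho => //; by [exact: pmod_total p1|exact: pmod_total p2|exact: pmod_total p3].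
Qed.

Section PreMu.
Variables (hb al be : set (L -> H)) (T : rtp hb al) (T' : rtp al be) (V : T -> T').
Hypothesis PM : premu V.
Let p_hb := pm_hb PM.
Let p_al := pm_al PM.
Let p_be := pm_be PM.

Lemma adm_ha : adm hb al. Proof. exact: pmod_adm_dB. Qed.
Lemma adm_ab : adm al be. Proof. exact: pmod_adm_Bd. Qed.
Let aha := adm_ha.
Let aab := adm_ab.
Let uV := pm_unitary PM.

(** Reading [V^*] with both legs exchanged swaps [hb] and [be] and permutes the conditions on [V]
    and [V^*], so a lemma about one of them yields its dual. *)
Lemma premu_flip : @premu be al hb (flipT aab T') (flipT aha T) (adj V).
Proof.
have EV : adj (adj V) = V by apply: adjK; exact: unitary_bounded.
case: PM => *; split=> //; try by rewrite EV.
exact: unitary_adj.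
Qed.

Lemma pmod_ltri_T_al : pmod B (ltri T al).
Proof.
apply: (ltri_pmod aha) balg_closed balg_adj p_al _ => x x' y ax ax' ay.
exact: (pm_hb_al PM (pmod_inner p_al ax ax') (ket2_multop aha T ax ax')).
Qed.

Lemma pmod_ltri_T_be : pmod Bd (ltri T be).
Proof.
apply: (ltri_pmod aha) balgd_closed balgd_adj p_be _ => x x' y ax ax' ay.
exact: (pm_hb_be PM (pmod_inner p_al ax ax') (ket2_multop aha T ax ax')).
Qed.

Lemma pmod_rtri_T_hb : pmod Bd (rtri T hb).
Proof.
apply: (rtri_pmod aha) balgd_closed balgd_adj p_hb _ => x x' y ax ax' ay.
exact: (pm_al_hb PM (pmod_inner p_hb ax ax') (ket1_multop aha T ax ax')).
Qed.

Lemma pmod_rtri_T_be : pmod Bd (rtri T be).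
Proof.
apply: (rtri_pmod aha) balgd_closed balgd_adj p_be _ => x x' y ax ax' ay.
exact: (pm_al_be PM (pmod_inner p_hb ax ax') (ket1_multop aha T ax ax')).
Qed.

End PreMu.

Section PreMu'.
Variables (hb al be : set (L -> H)) (T : rtp hb al) (T' : rtp al be) (V : T -> T').
Hypothesis PM : premu V.
Let PF := premu_flip PM.

Lemma pmod_rtri_T'_al : pmod B (rtri T' al). Proof. exact: (pmod_ltri_T_al PF). Qed.
Lemma pmod_rtri_T'_hb : pmod Bd (rtri T' hb). Proof. exact: (pmod_ltri_T_be PF). Qed.
Lemma pmod_ltri_T'_be : pmod Bd (ltri T' be). Proof. exact: (pmod_rtri_T_hb PF). Qed.
Lemma pmod_ltri_T'_hb : pmod Bd (ltri T' hb). Proof. exact: (pmod_rtri_T_be PF). Qed.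

End PreMu'.

End PreUnitary.

(** * Slices and commutants of represented algebras *)

Section SliceComm.
Variables (R : realType) (L H : hilbertType R) (Y X : set (L -> H)).
Hypothesis ab : adm Y X.
Variable T : rtp Y X.
Variable C : set (H -> H).
Hypothesis bC : C `<=` @bounded_op R H H.
Hypothesis CY : forall c y, C c -> Y y -> Y (c \o y).

Lemma adj_ket2_comm c x x' v : C c -> X x -> X x' ->
  c (adj (ket2 T x) (ket2 T x' v)) = adj (ket2 T x) (ket2 T x' (c v)).
Proof.
move=> Cc Xx Xx'; have bc := bC Cc.
have [bm hm] := ket2_multop ab T Xx Xx'.
have : c \o (adj (ket2 T x) \o ket2 T x') = (adj (ket2 T x) \o ket2 T x') \o c.
  apply: (eq_on_vals (adm_tl ab)) => [||y z Yy]; [exact: bounded_comp..|].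
  rewrite /= (ket2_gram ab) // -[c (y z)]/((c \o y) z) (ket2_gram ab) //; exact: CY.
by move/(congr1 (@^~ v)).
Qed.

Lemma op_id_C c : C c -> [/\ bounded_op (op_id T T c),
  forall x v, X x -> op_id T T c (ket2 T x v) = ket2 T x (c v) &
  forall y v, Y y -> op_id T T c (ket1 T y v) = ket1 T (c \o y) v].
Proof.
move=> Cc; have bc := bC Cc.
have [b1 h1] := op_id_spec ab bc (fun x x' v => adj_ket2_comm v Cc).
split=> // y v Yy.
have Ycy := CY Cc Yy.
have := @eq_on_vals R H T L X (op_id T T c \o ket1 T y) (ket1 T (c \o y)) (adm_tr ab).
move=> /(_ (bounded_comp b1 (ket1_bounded ab T Yy)) (ket1_bounded ab T Ycy)) E.
apply: (congr1 (@^~ v) (E _)) => x z Xx /=.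
by rewrite (ket12 ab) // h1 // (ket12 ab).
Qed.

Lemma adj_ket2_op_id c x w : C c -> X x ->
  adj (ket2 T x) (op_id T T c w) = c (adj (ket2 T x) w).
Proof.
move=> Cc Xx; have [b1 h1 _] := op_id_C Cc; have bc := bC Cc.
have bx := ket2_bounded ab T Xx; have ba := bounded_adj bx.
have : adj (ket2 T x) \o op_id T T c = c \o adj (ket2 T x).
  apply: (eq_bounded_total (ket2_total ab T)) => [||_ [y Xy [u _ <-]]] /=; [exact: bounded_comp..|].
  by rewrite h1 // adj_ket2_comm.
by move/(congr1 (@^~ w)).
Qed.

End SliceComm.

Section SliceComm2.
Variables (R : realType) (L H : hilbertType R) (Y X : set (L -> H)).
Hypothesis ab : adm Y X.
Variable T : rtp Y X.
Variable C : set (H -> H).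
Hypothesis bC : C `<=` @bounded_op R H H.
Hypothesis CY : forall c y, C c -> Y y -> Y (c \o y).
Hypothesis CX : forall c x, C c -> X x -> X (c \o x).

Lemma id_op_C c : C c -> [/\ bounded_op (id_op T T c),
  forall y v, Y y -> id_op T T c (ket1 T y v) = ket1 T y (c v) &
  forall x v, X x -> id_op T T c (ket2 T x v) = ket2 T (c \o x) v].
Proof. exact: (op_id_C (adm_sym ab) (flipT ab T) bC CX). Qed.

Lemma op_id_id_op_C c c' : C c -> C c' -> op_id T T c \o id_op T T c' = id_op T T c' \o op_id T T c.
Proof.
move=> Cc Cc'; have [b1 h1 _] := op_id_C ab T bC CY Cc; have [b2 _ h2] := id_op_C Cc'.
apply: (eq_bounded_total (ket2_total ab T)) => [||_ [x Xx [v _ <-]]] /=; [exact: bounded_comp..|].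
by rewrite h1 // !h2 // h1 //; exact: CX.
Qed.

Hypothesis CC : forall c c', C c -> C c' -> C (c \o c').
Hypothesis Cn : cspan_vec [set c v | c in C & v in [set: H]] = setT.
Let A := commutant C.
Let A2 := commutant (op_op T C C).

Lemma op_id_total : cspan_vec [set op_id T T c v | c in C & v in [set: T]] = setT.
Proof.
have bk k : [set ket2 T x | x in X] k -> bounded_op k.
  by move=> [x Xx <-]; exact: (ket2_bounded ab).
apply: total_sub (total_image bk _ Cn) _.
  apply: total_sub (ket2_total ab T) _ => _ [x Xx [v _ <-]]; apply: lspan_gen.
  by exists (ket2 T x); [exists x|exists v].
move=> _ [_ [x Xx <-] [_ [c Cc [v _ <-]] <-]]; apply: lspan_gen.
have [_ h1 _] := op_id_C ab T bC CY Cc.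
by exists c => //; exists (ket2 T x v); rewrite ?h1.
Qed.

Lemma op_id_comp c c' : C c -> C c' -> op_id T T (c \o c') = op_id T T c \o op_id T T c'.
Proof.
move=> Cc Cc'; have [b1 h1 _] := op_id_C ab T bC CY Cc; have [b2 h2 _] := op_id_C ab T bC CY Cc'.
have [b3 h3 _] := op_id_C ab T bC CY (CC Cc Cc').
apply: (eq_bounded_total (ket2_total ab T)) => [||_ [x Xx [v _ <-]]] /=; [|exact: bounded_comp|] => //.
by rewrite h3 // h2 // h1.
Qed.

(* Nondegeneracy of [C] separates the two legs: [S] commutes with [a (x) 1],
   because [S (a a' (x) b) = (a (x) 1) (S (a' (x) b))]. *)
Lemma A2_op_id_aux S c : A2 S -> C c ->
  cspan_vec [set id_op T T c v | c in C & v in [set: T]] = setT ->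
  S \o op_id T T c = op_id T T c \o S.
Proof.
move=> [bS hS] Cc tid.
have [b1 _ _] := op_id_C ab T bC CY Cc.
have t2 : cspan_vec [set k v | k in [set op_id T T c' | c' in C] & v in
    [set id_op T T c v | c in C & v in [set: T]]] = setT.
  apply: total_image tid => [_ [c' Cc' <-]|]; first by have [] := op_id_C ab T bC CY Cc'.
  apply: total_sub op_id_total _ => _ [c' Cc' [v _ <-]]; apply: lspan_gen.
  by exists (op_id T T c'); [exists c'|exists v].
apply: (eq_bounded_total t2) => [||_ [_ [c' Cc' <-] [_ [d Cd [v _ <-]] <-]]] /=; [exact: bounded_comp..|].
have M1 : op_op T C C (op_id T T (c \o c') \o id_op T T d).
  by exists (c \o c'); [exact: CC|exists d].
have M2 : op_op T C C (op_id T T c' \o id_op T T d) by exists c' => //; exists d.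
have := congr1 (@^~ v) (hS _ M1); rewrite /= op_id_comp //= => ->.
by have := congr1 (@^~ v) (hS _ M2) => /= ->.
Qed.

End SliceComm2.

Section SliceComm3.
Variables (R : realType) (L H : hilbertType R) (Y X : set (L -> H)).
Hypothesis ab : adm Y X.
Variable T : rtp Y X.
Variable C : set (H -> H).
Hypothesis bC : C `<=` @bounded_op R H H.
Hypothesis CY : forall c y, C c -> Y y -> Y (c \o y).
Hypothesis CX : forall c x, C c -> X x -> X (c \o x).
Hypothesis CC : forall c c', C c -> C c' -> C (c \o c').
Hypothesis Cn : cspan_vec [set c v | c in C & v in [set: H]] = setT.
Let A := commutant C.
Let A2 := commutant (op_op T C C).
Let ba := adm_sym ab.
Let F := flipT ab T.

(** Exchanging the legs reverses the order of the two factors in [op_op], which is harmless because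
    they commute. *)
Lemma A2_flip S : A2 S -> commutant (op_op F C C) S.
Proof.
move=> [bS hS]; split=> // _ [c Cc [c' Cc' <-]].
rewrite -[op_id F F c]/(id_op T T c) -[id_op F F c']/(op_id T T c').
by rewrite -(op_id_id_op_C ab T bC CY CX Cc' Cc); apply: hS; exists c' => //; exists c.
Qed.

Lemma A2_op_id S c : A2 S -> C c -> S \o op_id T T c = op_id T T c \o S.
Proof.
move=> hS Cc; apply: (A2_op_id_aux ab bC CY CC Cn hS Cc).
exact: (op_id_total ba F bC CX Cn).
Qed.

Lemma A2_intro S : bounded_op S ->
  (forall c, C c -> S \o op_id T T c = op_id T T c \o S) ->
  (forall c, C c -> S \o id_op T T c = id_op T T c \o S) -> A2 S.
Proof.
move=> bS h1 h2; split=> // _ [c Cc [c' Cc' <-]]; apply/funext => v /=.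
have := congr1 (@^~ (id_op T T c' v)) (h1 c Cc) => /= ->.
by have := congr1 (@^~ v) (h2 c' Cc') => /= ->.
Qed.

Lemma A2_slice2 S xi xi' : A2 S -> X xi -> X xi' ->
  A (adj (ket2 T xi) \o S \o ket2 T xi').
Proof.
move=> hS Xx Xx'; have bS : bounded_op S by case: hS.
have bx := ket2_bounded ab T Xx; have bx' := ket2_bounded ab T Xx'.
split; first by apply: bounded_comp => //; apply: bounded_comp => //; exact: bounded_adj.
move=> c Cc; have [b1 h1 _] := op_id_C ab T bC CY Cc.
apply/funext => v /=; rewrite -h1 //.
have := congr1 (@^~ (ket2 T xi' v)) (A2_op_id hS Cc) => /= ->.
exact: (adj_ket2_op_id ab bC CY).
Qed.

End SliceComm3.

Section SliceComm4.
Variables (R : realType) (L H : hilbertType R) (Y X : set (L -> H)).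
Hypothesis ab : adm Y X.
Variable T : rtp Y X.
Variable C : set (H -> H).
Hypothesis bC : C `<=` @bounded_op R H H.
Hypothesis CY : forall c y, C c -> Y y -> Y (c \o y).
Hypothesis CX : forall c x, C c -> X x -> X (c \o x).
Hypothesis CC : forall c c', C c -> C c' -> C (c \o c').
Hypothesis Cn : cspan_vec [set c v | c in C & v in [set: H]] = setT.

Lemma A2_slice1 S eta eta' : commutant (op_op T C C) S -> Y eta -> Y eta' ->
  commutant C (adj (ket1 T eta) \o S \o ket1 T eta').
Proof.
move=> hS; have hS' := A2_flip ab bC CY CX hS.
exact: (A2_slice2 (adm_sym ab) bC CX CY CC Cn hS').
Qed.

End SliceComm4.

(** * The unitary and the representations of the base *)

Section Intertwine.
Variables (R : realType) (b : cbase R) (H : hilbertType R).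
Notation L := (bspace b).
Notation B := (balg b).
Notation Bd := (balgd b).

Lemma multop_cspan (G : hilbertType R) (Y : set (L -> G)) c X :
  bounded_op X -> (forall x z, Y x -> X (x z) = x (c z)) -> multop (cspan Y) c X.
Proof.
move=> bX h; split=> // x z Yx.
by apply: (cspan_eq (B := id) bX (@bounded_id _ _) _ Yx) => y Yy; exact: h.
Qed.

(** [V] carries [P] into [Q], and the representation acts on [p z] through [z] alone, so
    [V (N (p z)) = V (p (c z)) = N' (V (p z))]. The commutation rules for [V] below come from
    this. *)
Lemma intertwine (G G' : hilbertType R) (P : set (L -> G)) (Q : set (L -> G')) c N N' (V : G -> G') :
  cspan_vec (vals P) = setT -> multop P c N -> multop Q c N' -> bounded_op V ->
  (forall x, P x -> Q (V \o x)) -> V \o N = N' \o V.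
Proof.
move=> tP [bN hN] [bN' hN'] bV PQ; apply: (eq_on_vals tP); try exact: bounded_comp.
move=> x z Px /=; rewrite hN // -[V (x z)]/((V \o x) z) hN' //; exact: PQ.
Qed.

Section RhoSet.
Variable a : set (L -> H).
Hypothesis pa : pmod Bd a.
Let C := [set rho a c | c in B].

Lemma rho_multop c : B c -> multop a c (rho a c).
Proof.
move=> Bc; apply: (multop_rho pa (@comm_dB R b)); last exact: balg_adj.
by apply: (sub_bounded (@balg_closed R b)).
Qed.

Lemma rhoC_bounded : C `<=` @bounded_op R H H.
Proof. by move=> _ [c Bc <-]; case: (rho_multop Bc). Qed.

Lemma rhoC_comp c c' : C c -> C c' -> C (c \o c').
Proof.
move=> [d Bd' <-] [d' Bd'' <-]; exists (d \o d'); first by case: (balg_cstar b) => _ + _; apply.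
have [b1 h1] := rho_multop Bd'; have [b2 h2] := rho_multop Bd''.
apply: (rho_eq (pmod_total pa)); split=> [|x z ax /=]; first exact: bounded_comp.
by rewrite h2 // h1.
Qed.

Lemma rhoC_total : cspan_vec [set c v | c in C & v in [set: H]] = setT.
Proof.
have bk k : a k -> bounded_op k by move=> ak; exact: (pmod_bounded pa ak).
apply: total_sub (total_image bk (pmod_total pa) (balg_nondeg b)) _ => _ [x ax [_ [c Bc [z _ <-]] <-]].
apply: lspan_gen; exists (rho a c); first by exists c.
by exists (x z) => //; have [_ ->] := rho_multop Bc.
Qed.

Lemma rhoC_stable (d : set (L -> H)) c x : stable B a d -> C c -> d x -> d (c \o x).
Proof. by move=> st [c' Bc' <-] dx; apply: (st c') => //; exact: rho_multop. Qed.

Lemma commutant_multop Z c X : commutant C Z -> B c -> multop a c X -> Z \o X = X \o Z.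
Proof.
move=> [_ hZ] Bc hX; rewrite -(rho_eq (pmod_total pa) hX); apply: hZ.
by exists c.
Qed.

End RhoSet.

Lemma multop_id_op (a g d : set (L -> H)) (ag : adm a g) (T0 : rtp a g) c :
  pmod Bd d -> stable B d g -> B c -> multop (rtri T0 d) c (id_op T0 T0 (rho d c)).
Proof.
move=> pd st Bc; have Cc : [set rho d c | c in B] (rho d c) by exists c.
have [b1 h1 _] := id_op_C ag T0 (rhoC_bounded pd) (fun c x => rhoC_stable pd st) Cc.
apply: multop_cspan => // _ z [x hx [y hy <-]] /=.
by rewrite h1 //; have [_ ->] := rho_multop pd Bc.
Qed.

Lemma multop_op_id (a g d : set (L -> H)) (ag : adm a g) (T0 : rtp a g) c :
  pmod Bd d -> stable B d a -> B c -> multop (ltri T0 d) c (op_id T0 T0 (rho d c)).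
Proof. exact: (multop_id_op (adm_sym ag) (flipT ag T0)). Qed.

Variables (hb al be : set (L -> H)) (T : rtp hb al) (T' : rtp al be) (V : T -> T').
Hypothesis PM : premu V.
Let aha := adm_ha PM.
Let aab := adm_ab PM.
Let uV := pm_unitary PM.
Let bV := unitary_bounded uV.
Let Chb := [set rho hb c | c in B].
Let Cbe := [set rho be c | c in B].
Let bhb := rhoC_bounded (pm_hb PM).
Let bbe := rhoC_bounded (pm_be PM).
Let hb_al c x : Chb c -> al x -> al (c \o x) := rhoC_stable (pm_hb PM) (pm_hb_al PM).
Let hb_be c x : Chb c -> be x -> be (c \o x) := rhoC_stable (pm_hb PM) (pm_hb_be PM).
Let be_al c x : Cbe c -> al x -> al (c \o x) := rhoC_stable (pm_be PM) (pm_be_al PM).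
Let be_hb c x : Cbe c -> hb x -> hb (c \o x) := rhoC_stable (pm_be PM) (pm_be_hb PM).
Let Ahb := commutant Chb.

Lemma premu_gA e e' Z v : Ahb Z -> al e -> al e' ->
  Z (adj (ket2 T e) (ket2 T e' v)) = adj (ket2 T e) (ket2 T e' (Z v)).
Proof.
move=> AZ ae ae'.
exact: (congr1 (@^~ v) (commutant_multop (pm_hb PM) AZ (pmod_inner (pm_al PM) ae ae')
  (ket2_multop aha T ae ae'))).
Qed.

Lemma premu_tl Z : Ahb Z -> bounded_op (op_id T T Z) /\
  forall e v, al e -> op_id T T Z (ket2 T e v) = ket2 T e (Z v).
Proof.
move=> AZ; apply: (op_id_spec aha); first by case: AZ.
by move=> e e' v ae ae'; exact: premu_gA.
Qed.

Lemma V_id_op_hb c : B c -> V \o id_op T T (rho hb c) = id_op T' T' (rho hb c) \o V.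
Proof.
move=> Bc; apply: (intertwine (pmod_total (pmod_rtri_T_hb PM)) _ _ bV (pm_hh PM)).
  exact: (multop_id_op aha T (pm_hb PM) (pm_hb_al PM)).
exact: (multop_id_op aab T' (pm_hb PM) (pm_hb_be PM)).
Qed.

Lemma V_id_op_be c : B c -> V \o id_op T T (rho be c) = op_id T' T' (rho hb c) \o V.
Proof.
move=> Bc; apply: (intertwine (pmod_total (pmod_rtri_T_be PM)) _ _ bV (pm_hb' PM)).
  exact: (multop_id_op aha T (pm_be PM) (pm_be_al PM)).
exact: (multop_op_id aab T' (pm_hb PM) (pm_hb_al PM)).
Qed.

Lemma V_op_id_be c : B c -> V \o op_id T T (rho be c) = op_id T' T' (rho be c) \o V.
Proof.
move=> Bc; apply: (intertwine (pmod_total (pmod_ltri_T_be PM)) _ _ bV (pm_ba PM)).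
  exact: (multop_op_id aha T (pm_be PM) (pm_be_hb PM)).
exact: (multop_op_id aab T' (pm_be PM) (pm_be_al PM)).
Qed.

Lemma tl_comm_id_op (C : set (H -> H)) Z c :
  C `<=` @bounded_op R H H -> (forall c x, C c -> al x -> al (c \o x)) ->
  Ahb Z -> C c -> op_id T T Z \o id_op T T c = id_op T T c \o op_id T T Z.
Proof.
move=> bC Cal AZ Cc; have [b1 h1] := premu_tl AZ; have [b2 _ h2] := id_op_C aha T bC Cal Cc.
apply: (eq_bounded_total (ket2_total aha T)); try exact: bounded_comp.
by move=> _ [x ax [v _ <-]] /=; rewrite h2 // !h1 ?h2 //; exact: Cal.
Qed.

Lemma Delta_bounded Z : Ahb Z -> bounded_op (Delta V Z).
Proof.
move=> AZ; have [b1 _] := premu_tl AZ.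
by apply: bounded_comp; [apply: bounded_comp|exact: bounded_adj].
Qed.

(** [V] carries [id (x) rho_be(c)] to [rho_hb(c) (x) id] and [id (x) rho_hb(c)] on [T] to its
    namesake on [T']. Both sources act on the second leg of [T] and hence commute with
    [Z (x) id]. *)
Lemma Delta_A2 Z : Ahb Z -> commutant (op_op T' Chb Chb) (Delta V Z).
Proof.
move=> AZ.
have key N N' : V \o N = N' \o V -> op_id T T Z \o N = N \o op_id T T Z ->
    Delta V Z \o N' = N' \o Delta V Z.
  move=> h1 h2.
  have h3 v : adj V (N' v) = N (adj V v).
    have := congr1 (@^~ (adj V v)) h1 => /= E.
    by rewrite -[N _](unitaryK uV) E (unitaryVK uV).
  apply/funext => v; rewrite /Delta /= h3.
  have := congr1 (@^~ (adj V v)) h2 => /= ->.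
  exact: (congr1 (@^~ (op_id T T Z (adj V v))) h1).
apply: A2_intro; first exact: Delta_bounded.
- move=> _ [c Bc <-]; apply: key (V_id_op_be Bc) _.
  by apply: (tl_comm_id_op bbe be_al AZ); exists c.
- move=> _ [c Bc <-]; apply: key (V_id_op_hb Bc) _.
  by apply: (tl_comm_id_op bhb hb_al AZ); exists c.
Qed.

Lemma premu_q1 e ze : al e -> hb ze -> Ahb (adj (ket1 T' e) \o V \o ket1 T ze).
Proof.
move=> ae hz; have b1 := ket1_bounded aab T' ae; have b2 := ket1_bounded aha T hz.
split; first by apply: bounded_comp => //; apply: bounded_comp => //; exact: bounded_adj.
move=> _ [c Bc <-]; have Cc : Chb (rho hb c) by exists c.
have [_ hc1 _] := id_op_C aha T bhb hb_al Cc.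
apply/funext => v /=; rewrite -hc1 //.
have := congr1 (@^~ (ket1 T ze v)) (V_id_op_hb Bc) => /= ->.
exact: (adj_ket2_op_id (adm_sym aab) (T := flipT aab T') bhb hb_be).
Qed.

Lemma premu_q2 xi e : be xi -> al e -> commutant Cbe (adj (ket2 T' xi) \o V \o ket2 T e).
Proof.
move=> bx ae; have b1 := ket2_bounded aab T' bx; have b2 := ket2_bounded aha T ae.
split; first by apply: bounded_comp => //; apply: bounded_comp => //; exact: bounded_adj.
move=> _ [c Bc <-]; have Cc : Cbe (rho be c) by exists c.
have [_ hc1 _] := op_id_C aha T bbe be_hb Cc.
apply/funext => v /=; rewrite -hc1 //.
have := congr1 (@^~ (ket2 T e v)) (V_op_id_be Bc) => /= ->.
exact: (adj_ket2_op_id aab bbe be_al).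
Qed.

End Intertwine.

(** * The pentagon equation *)

Lemma inter_adj (R : realType) (H1 H2 G1 G2 : hilbertType R) (U : G1 -> G2) (V : H1 -> H2)
    (k : H1 -> G1) (k' : H2 -> G2) :
  unitary_op U -> unitary_op V -> bounded_op k -> bounded_op k' ->
  (forall v, U (k v) = k' (V v)) ->
  (forall v, k (adj V v) = adj U (k' v)) /\ (forall s, adj k' (U s) = V (adj k s)).
Proof.
move=> uU uV bk bk' E.
have h v : k (adj V v) = adj U (k' v) by rewrite -(unitaryK uU (k _)) E unitaryVK.
split=> // s; apply: iprod_ext => v.
rewrite adjPr // -(adjP _ _ (unitary_bounded uU)) -h -adjPr //.
by rewrite adjP //; exact: unitary_bounded.
Qed.

Section PentagonData.
Variables (R : realType) (I : Type) (hb al be : set I) (H G G' S0 S1 S2 S3 S4 : hilbertType R).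
Variables (t1 t2 : I -> H -> G) (b1 b2 : I -> H -> G') (V : G -> G').
Variables (V12 : S0 -> S1) (V23 : S1 -> S2) (W23 : S0 -> S3) (V13 : S3 -> S4) (W12 : S4 -> S2).
Variables (k10 k30 : I -> G -> S0) (k11 : I -> G -> S1) (k31 : I -> G' -> S1).
Variables (k12 k32 : I -> G' -> S2) (k13 : I -> G' -> S3) (k23 : I -> G -> S3).
Variables (k24 : I -> G' -> S4) (k34 : I -> G -> S4).

(* [k_ij] inserts a vector into leg [i] of the threefold product [S_j]; the
   products occur along the two sides of the pentagon
   [S0 -> S1 -> S2] and [S0 -> S3 -> S4 -> S2]. *)
Record pentagon_data : Prop := PentagonData {
  pd_V : unitary_op V ; pd_V12 : unitary_op V12 ; pd_V23 : unitary_op V23 ;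
  pd_W23 : unitary_op W23 ; pd_V13 : unitary_op V13 ; pd_W12 : unitary_op W12 ;
  pd_pent : forall v, V23 (V12 v) = W12 (V13 (W23 v)) ;
  pd_t1 : forall x, hb x -> bounded_op (t1 x) ;
  pd_t2 : forall x, al x -> bounded_op (t2 x) ;
  pd_b1 : forall x, al x -> bounded_op (b1 x) ;
  pd_b2 : forall x, be x -> bounded_op (b2 x) ;
  pd_t2_total : cspan_vec [set t2 x v | x in al & v in [set: H]] = setT ;
  pd_b1_total : cspan_vec [set b1 x v | x in al & v in [set: H]] = setT ;
  pd_k10 : forall x, hb x -> bounded_op (k10 x) ;
  pd_k30 : forall x, al x -> bounded_op (k30 x) ;
  pd_k11 : forall x, al x -> bounded_op (k11 x) ;
  pd_k31 : forall x, al x -> bounded_op (k31 x) ;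
  pd_k12 : forall x, al x -> bounded_op (k12 x) ;
  pd_k32 : forall x, be x -> bounded_op (k32 x) ;
  pd_k13 : forall x, hb x -> bounded_op (k13 x) ;
  pd_k23 : forall x, al x -> bounded_op (k23 x) ;
  pd_k24 : forall x, al x -> bounded_op (k24 x) ;
  pd_k34 : forall x, be x -> bounded_op (k34 x) ;
  pd_e12 : forall e v, al e -> V12 (k30 e v) = k31 e (V v) ;
  pd_e23 : forall e v, al e -> V23 (k11 e v) = k12 e (V v) ;
  pd_f23 : forall x v, hb x -> W23 (k10 x v) = k13 x (V v) ;
  pd_e13 : forall e v, al e -> V13 (k23 e v) = k24 e (V v) ;
  pd_f12 : forall x v, be x -> W12 (k34 x v) = k32 x (V v) ;
  pd_a0 : forall x e w, hb x -> al e -> k30 e (t1 x w) = k10 x (t2 e w) ;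
  pd_a1 : forall x e w, al x -> al e -> k31 e (b1 x w) = k11 x (t2 e w) ;
  pd_a2 : forall x e w, be x -> al e -> k32 x (b1 e w) = k12 e (b2 x w) ;
  pd_a3 : forall x e w, hb x -> al e -> k13 x (b1 e w) = k23 e (t1 x w) ;
  pd_a4 : forall x e w, be x -> al e -> k34 x (t2 e w) = k24 e (b2 x w) ;
  pd_r0 : forall x e w, hb x -> al e -> adj (k10 x) (k30 e w) = t2 e (adj (t1 x) w) ;
  pd_r1 : forall x e w, al x -> al e -> adj (k11 x) (k31 e w) = t2 e (adj (b1 x) w) ;
  pd_r2 : forall x e w, be x -> al e -> adj (k32 x) (k12 e w) = b1 e (adj (b2 x) w) ;
  pd_r3 : forall x e w, hb x -> al e -> adj (k13 x) (k23 e w) = b1 e (adj (t1 x) w) ;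
  pd_r4 : forall x e w, be x -> al e -> adj (k34 x) (k24 e w) = t2 e (adj (b2 x) w)
}.

Hypothesis PD : pentagon_data.
Let uV := pd_V PD.
Let bV := unitary_bounded uV.
Let u12 := pd_V12 PD. Let u23 := pd_V23 PD. Let w23 := pd_W23 PD.
Let u13 := pd_V13 PD. Let w12 := pd_W12 PD.

Let bo (G1 G2 : hilbertType R) (U : G1 -> G2) : unitary_op U -> bounded_op U.
Proof. exact: unitary_bounded. Qed.

Section Coassoc.
Variables (tl : G -> G) (z0 : S0 -> S0) (z3 : S3 -> S3).
Hypotheses (bz0 : bounded_op z0) (bz3 : bounded_op z3).
Hypothesis z0E : forall e v, al e -> z0 (k30 e v) = k30 e (tl v).
Hypothesis z3E : forall e v, al e -> z3 (k23 e v) = k23 e (tl v).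
Hypothesis z03 : forall v, z3 (W23 v) = W23 (z0 v).
Let M := V23 \o V12.
Let Th := M \o z0 \o adj M.

Let adjM v : adj M v = adj V12 (adj V23 v).
Proof. by rewrite /M adj_comp //; exact: bo. Qed.

Lemma pentagon_Th_bounded : bounded_op Th.
Proof.
have bM : bounded_op M by apply: bounded_comp; exact: bo.
by apply: bounded_comp; [exact: bounded_comp|exact: bounded_adj].
Qed.

(** [D] amplifies a slice of [V tl V^*]. Inside the threefold product it is the slice of
    [V12 z0 V12^*] along [k11], and conjugation by [V] in the remaining legs crosses the ket as
    [V23]. *)
Lemma pentagon_coassoc1 x y D : al x -> al y -> bounded_op D ->
  (forall e w, al e -> D (t2 e w) = t2 e (adj (b1 x) (V (tl (adj V (b1 y w)))))) ->
  V \o D \o adj V = adj (k12 x) \o Th \o k12 y.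
Proof.
move=> ax ay bD hD.
have ED : D = adj (k11 x) \o V12 \o z0 \o adj V12 \o k11 y.
  apply: (eq_bounded_total (pd_t2_total PD)) => //.
    have ba := bounded_adj (pd_k11 PD ax).
    have bb := bounded_adj (bo u12).
    have bc := pd_k11 PD ay; have bd := bo u12.
    by do ![apply: bounded_comp => //].
  move=> _ [e ae [w _ <-]]; rewrite hD //= -(pd_a1 PD) //.
  have [h1 h2] := inter_adj u12 uV (pd_k30 PD ae) (pd_k31 PD ae) (fun v => pd_e12 PD v ae).
  by rewrite -h1 z0E // (pd_e12 PD) // (pd_r1 PD).
have [_ hx] := inter_adj u23 uV (pd_k11 PD ax) (pd_k12 PD ax) (fun v => pd_e23 PD v ax).
have [hy _] := inter_adj u23 uV (pd_k11 PD ay) (pd_k12 PD ay) (fun v => pd_e23 PD v ay).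
by apply/funext => v; rewrite ED /Th /= adjM -hx hy.
Qed.

(** The same [Th] seen along the other path: there [V23 V12] is [W12 V13 W23], and [W23] drops out
    because it intertwines [z0] with [z3]. *)
Lemma pentagon_coassoc2 x y D : be x -> be y -> bounded_op D ->
  (forall e w, al e -> D (t2 e w) = t2 e (adj (b2 x) (V (tl (adj V (b2 y w)))))) ->
  V \o D \o adj V = adj (k32 x) \o Th \o k32 y.
Proof.
move=> bx by' bD hD.
have ED : D = adj (k34 x) \o V13 \o z3 \o adj V13 \o k34 y.
  apply: (eq_bounded_total (pd_t2_total PD)) => //.
    have ba := bounded_adj (pd_k34 PD bx).
    have bb := bounded_adj (bo u13).
    have bc := pd_k34 PD by'; have bd := bo u13.
    by do ![apply: bounded_comp => //].
  move=> _ [e ae [w _ <-]]; rewrite hD //= (pd_a4 PD) //.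
  have [h1 h2] := inter_adj u13 uV (pd_k23 PD ae) (pd_k24 PD ae) (fun v => pd_e13 PD v ae).
  by rewrite -h1 z3E // (pd_e13 PD) // (pd_r4 PD).
have [_ hx] := inter_adj w12 uV (pd_k34 PD bx) (pd_k32 PD bx) (fun v => pd_f12 PD v bx).
have [hy _] := inter_adj w12 uV (pd_k34 PD by') (pd_k32 PD by') (fun v => pd_f12 PD v by').
have hM v : adj M v = adj W23 (adj V13 (adj W12 v)).
  have -> : M = W12 \o V13 \o W23 by apply/funext => u; exact: (pd_pent PD).
  rewrite (adj_comp (bounded_comp (bo w12) (bo u13)) (bo w23)) /=.
  by rewrite (adj_comp (bo w12) (bo u13)).
apply/funext => v; rewrite ED /Th /= hM -hx hy /M /= (pd_pent PD) -z03 unitaryVK //.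
Qed.

End Coassoc.

(** The slice [D] contributes [V12] and the outer [V] contributes [V23]; after the pentagon [W23]
    cancels the inner [V^*]. The remaining [V13] and [W12] act on different pairs of legs, which
    separates the two factors. *)
Lemma pentagon_mul1 x0 z0 x e D u u' : al x0 -> hb z0 -> be x -> al e -> bounded_op D ->
  (forall e w, al e -> D (t2 e w) = t2 e (adj (b1 x0) (V (t1 z0 w)))) ->
  iprod (b2 x u) (V (D (adj V (b1 e u'))))
  = iprod (b1 x0 u) (V (t2 e (adj (b2 x) (V (t1 z0 u'))))).
Proof.
move=> ax hz bx ae bD hD.
have ED : D = adj (k11 x0) \o V12 \o k10 z0.
  apply: (eq_bounded_total (pd_t2_total PD)) => //.
    have ba := bounded_adj (pd_k11 PD ax).
    have bc := pd_k10 PD hz; have bd := bo u12.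
    by do ![apply: bounded_comp => //].
  move=> _ [e' ae' [w _ <-]]; rewrite hD //= -(pd_a0 PD) //.
  by rewrite (pd_e12 PD) // (pd_r1 PD).
have [_ hx] := inter_adj u23 uV (pd_k11 PD ax) (pd_k12 PD ax) (fun v => pd_e23 PD v ax).
rewrite ED /= -hx adjPr; last exact: (pd_k12 PD).
rewrite (pd_pent PD) (pd_f23 PD) // unitaryVK // (pd_a3 PD) // (pd_e13 PD) //.
rewrite -(pd_a2 PD) //.
have [hy _] := inter_adj w12 uV (pd_k34 PD bx) (pd_k32 PD bx) (fun v => pd_f12 PD v bx).
rewrite -(adjP _ _ (bo w12)) -hy -(adjPr _ _ (pd_k34 PD bx)) (pd_r4 PD) //.
by rewrite adjP.
Qed.

(** Here [D] amplifies in the other leg and contributes [V23], while the inner [V] contributes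
    [V12]. After the pentagon it is [W12] that cancels, against the copy produced by moving the
    outer [V^*] to the left. *)
Lemma pentagon_mul2 x0 e0 ze e D u u' : be x0 -> al e0 -> hb ze -> al e -> bounded_op D ->
  (forall e w, al e -> D (b1 e w) = b1 e (adj (b2 x0) (V (t2 e0 w)))) ->
  iprod (t2 e u) (adj V (D (V (t1 ze u'))))
  = iprod (b2 x0 u) (V (t1 ze (adj (b1 e) (V (t2 e0 u'))))).
Proof.
move=> bx ae0 hz ae bD hD.
have ED : D = adj (k32 x0) \o V23 \o k31 e0.
  apply: (eq_bounded_total (pd_b1_total PD)) => //.
    have ba := bounded_adj (pd_k32 PD bx).
    have bc := pd_k31 PD ae0; have bd := bo u23.
    by do ![apply: bounded_comp => //].
  move=> _ [e' ae' [w _ <-]]; rewrite hD //= (pd_a1 PD) //.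
  by rewrite (pd_e23 PD) // (pd_r2 PD).
rewrite ED /= adjPr // adjPr; last exact: (pd_k32 PD).
rewrite -(pd_f12 PD) // -(pd_e12 PD) // (pd_pent PD).
case: (w12) => _ -> _.
rewrite (pd_a0 PD) // (pd_f23 PD) // (pd_a4 PD) //.
have [hy _] := inter_adj u13 uV (pd_k23 PD ae) (pd_k24 PD ae) (fun v => pd_e13 PD v ae).
rewrite -(adjP _ _ (bo u13)) -hy iprodC -(adjPr _ _ (pd_k13 PD hz)) (pd_r3 PD) // -iprodC.
rewrite -(adjPr _ _ (pd_b1 PD ae)) (adjP _ _ (pd_t1 PD hz)).
by rewrite adjP.
Qed.

End PentagonData.

(** Adjoints reverse the two paths of the pentagon, and reversing the order of the three legs
    restores its shape: [S0] and [S2] change places, as do [S3] and [S4]. *)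
Lemma pentagon_data_flip (R : realType) (I : Type) (hb al be : set I)
    (H G G' S0 S1 S2 S3 S4 : hilbertType R) t1 t2 b1 b2 V V12 V23 W23 V13 W12
    k10 k30 k11 k31 k12 k32 k13 k23 k24 k34 :
  @pentagon_data R I hb al be H G G' S0 S1 S2 S3 S4 t1 t2 b1 b2 V V12 V23 W23 V13 W12
    k10 k30 k11 k31 k12 k32 k13 k23 k24 k34 ->
  pentagon_data be al hb b2 b1 t2 t1 (adj V) (adj V23) (adj V12) (adj W12) (adj V13) (adj W23)
    k32 k12 k31 k11 k30 k10 k34 k24 k23 k13.
Proof.
move=> PD; have uV := pd_V PD.
have u12 := pd_V12 PD; have u23 := pd_V23 PD; have w23 := pd_W23 PD.
have u13 := pd_V13 PD; have w12 := pd_W12 PD.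
split; try by [exact: unitary_adj|exact: (pd_t1 PD)|exact: (pd_t2 PD)|exact: (pd_b1 PD)|
  exact: (pd_b2 PD)|exact: (pd_t2_total PD)|exact: (pd_b1_total PD)|exact: (pd_k10 PD)|
  exact: (pd_k30 PD)|exact: (pd_k11 PD)|exact: (pd_k31 PD)|exact: (pd_k12 PD)|
  exact: (pd_k32 PD)|exact: (pd_k13 PD)|exact: (pd_k23 PD)|exact: (pd_k24 PD)|
  exact: (pd_k34 PD)|exact: (pd_r0 PD)|exact: (pd_r2 PD)|exact: (pd_r3 PD)|exact: (pd_r4 PD)].
- move=> v; rewrite -(unitaryK u12 (adj W23 _)) -(unitaryK u23 (V12 _)) (pd_pent PD).
  by rewrite !unitaryVK.
- by move=> e v ae; rewrite -[v in LHS](unitaryVK uV) -(pd_e23 PD) // unitaryK.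
- by move=> e v ae; rewrite -[v in LHS](unitaryVK uV) -(pd_e12 PD) // unitaryK.
- by move=> e v ae; rewrite -[v in LHS](unitaryVK uV) -(pd_f12 PD) // unitaryK.
- by move=> e v ae; rewrite -[v in LHS](unitaryVK uV) -(pd_e13 PD) // unitaryK.
- by move=> e v ae; rewrite -[v in LHS](unitaryVK uV) -(pd_f23 PD) // unitaryK.
- by move=> x e w hx ae; rewrite (pd_a2 PD).
- by move=> x e w hx ae; rewrite (pd_a1 PD).
- by move=> x e w hx ae; rewrite (pd_a0 PD).
- by move=> x e w hx ae; rewrite (pd_a4 PD).
- by move=> x e w hx ae; rewrite (pd_a3 PD).
move=> x e w ax ae; apply: iprod_ext => v.
have c1 := pd_k31 PD ax; have c2 := pd_k11 PD ae.
have c3 := pd_b1 PD ae; have c4 := pd_t2 PD ax.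
rewrite (adjPr _ _ c1) -(adjP _ _ c2) (pd_r1 PD) // -(adjPr _ _ c4) (adjP _ _ c3) //.
Qed.

Lemma gram_unitary (R : realType) (G G' : hilbertType R) (I : Type) (e : I -> G) (f : I -> G')
    (X : G -> G') : bounded_op X ->
  cspan_vec (range e) = setT -> cspan_vec (range f) = setT ->
  (forall i, X (e i) = f i) -> (forall i j, iprod (f i) (f j) = iprod (e i) (e j)) ->
  unitary_op X.
Proof.
move=> bX te tf E gram; have baX := bounded_adj bX.
have XX : adj X \o X = id.
  apply: (eq_bounded_total te) => [||_ [j _ <-]]; [exact: bounded_comp|exact: bounded_id|].
  by apply: (iprod_ext_total te) => _ [i _ <-] /=; rewrite adjPr // !E gram.
have XV : X \o adj X = id.
  apply: (eq_bounded_total tf) => [||_ [j _ <-]] /=; [exact: bounded_comp|exact: bounded_id|].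
  by rewrite -E -[adj X (X _)]/((adj X \o X) _) XX.
split; first exact: bounded_lin.
  by move=> x y; rewrite -adjP // -[adj X (X _)]/((adj X \o X) x) XX.
by move=> y; exists (adj X y); rewrite -[X (adj X y)]/((X \o adj X) y) XV.
Qed.

(** * Amplified unitaries, flips and associators on concrete realizations *)

Section OpIdUnitary.
Variables (R : realType) (L H H' K : hilbertType R).
Variables (a : set (L -> H)) (a' : set (L -> H')) (g : set (L -> K)).
Hypotheses (ag : adm a g) (ag' : adm a' g).
Variables (T : rtp a g) (T' : rtp a' g) (S : H -> H').
Hypotheses (uS : unitary_op S) (Sa : forall x, a x -> a' (S \o x)).

Lemma op_id_unitary : [/\ unitary_op (op_id T T' S),
  forall y v, g y -> op_id T T' S (ket2 T y v) = ket2 T' y (S v) &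
  forall x w, a x -> op_id T T' S (ket1 T x w) = ket1 T' (S \o x) w].
Proof.
have bS := unitary_bounded uS.
have gS x x' z : a x -> a x' -> adj (S \o x) ((S \o x') z) = adj x (x' z).
  by move=> ax ax'; rewrite adj_comp //=; [rewrite unitaryK|exact: (adm_bl ag)].
have [X [bX hX]] := @tens_isometry R L H K H' K a g a' g T T' (fun x => S \o x) id
  Sa (fun _ => id) gS (fun _ _ _ _ _ => erefl).
have hX2 y v : g y -> X (ket2 T y v) = ket2 T' y (S v).
  move=> gy; have : X \o ket2 T y = ket2 T' y \o S.
    apply: (eq_on_vals (adm_tl ag)).
    - by apply: bounded_comp => //; exact: (ket2_bounded ag).
    - by apply: bounded_comp => //; exact: (ket2_bounded ag').
    by move=> x z ax /=; rewrite (ket2E ag) // hX // -[S (x z)]/((S \o x) z) (ket2E ag') //; exact: Sa.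
  by move/(congr1 (@^~ v)).
have E : op_id T T' S = X.
  rewrite /op_id; case: xgetP => [X' _ [bX' hX']|/(_ X) []]; last first.
    by split=> // y gy; apply/funext => v; exact: hX2.
  apply: (eq_bounded_total (ket2_total ag T)) => // _ [y gy [v _ <-]].
  by rewrite hX2 //; exact: (congr1 (@^~ v) (hX' y gy)).
rewrite E; split=> //.
  pose e (p : {y | g y} * H) := ket2 T (sval p.1) p.2.
  pose f (p : {y | g y} * H) := ket2 T' (sval p.1) (S p.2).
  apply: (@gram_unitary _ _ _ _ e f) => //.
  - apply: total_sub (ket2_total ag T) _ => _ [y gy [v _ <-]]; apply: lspan_gen.
    by exists (exist _ y gy, v).
  - apply: total_sub (ket2_total ag' T') _ => _ [y gy [v _ <-]]; apply: lspan_gen.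
    by exists (exist _ y gy, adj S v) => //; rewrite /f /= unitaryVK.
  - by move=> [[y gy] v]; exact: hX2.
  move=> [[y gy] v] [[y' gy'] v']; rewrite /e /f /=.
  have b2 := ket2_bounded ag T gy; have b2' := ket2_bounded ag' T' gy.
  rewrite -(adjPr _ _ b2) -(adjPr _ _ b2').
  have c2 := ket2_bounded ag T gy'; have c2' := ket2_bounded ag' T' gy'.
  have : (adj (ket2 T' y) \o ket2 T' y') \o S = S \o (adj (ket2 T y) \o ket2 T y').
    have ba := bounded_adj b2; have ba' := bounded_adj b2'.
    apply: (eq_on_vals (adm_tl ag)); try by do ![apply: bounded_comp => //].
    move=> x z ax /=; rewrite (ket2_gram ag) // -[S (x z)]/((S \o x) z) (ket2_gram ag') //.
    exact: Sa.
  by move/(congr1 (@^~ v')) => /= ->; case: uS => _ -> _.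
move=> x w ax.
have : X \o ket1 T x = ket1 T' (S \o x).
  apply: (eq_on_vals (adm_tr ag)).
  - by apply: bounded_comp => //; exact: (ket1_bounded ag).
  - by apply: (ket1_bounded ag'); exact: Sa.
  move=> y z gy /=; rewrite (ket1E ag) // hX // (ket1E ag') //; exact: Sa.
by move/(congr1 (@^~ w)).
Qed.

End OpIdUnitary.

Lemma id_op_unitary (R : realType) (L H K K' : hilbertType R)
    (a : set (L -> H)) (g : set (L -> K)) (g' : set (L -> K'))
    (ag : adm a g) (ag' : adm a g') (T : rtp a g) (T' : rtp a g') (S : K -> K') :
  unitary_op S -> (forall y, g y -> g' (S \o y)) ->
  [/\ unitary_op (id_op T T' S),
    forall x v, a x -> id_op T T' S (ket1 T x v) = ket1 T' x (S v) &
    forall y w, g y -> id_op T T' S (ket2 T y w) = ket2 T' (S \o y) w].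
Proof.
move=> uS h1.
by have [p1 p2 p3] := op_id_unitary (adm_sym ag) (adm_sym ag') (flipT ag T) (flipT ag' T') uS h1.
Qed.

Section Flip.
Variables (R : realType) (L H K : hilbertType R) (a : set (L -> H)) (g : set (L -> K)).
Hypotheses (ag : adm a g).
Variables (T : rtp a g) (T' : rtp g a).
Let ga := adm_sym ag.

Lemma flip_unitary : [/\ unitary_op (flip T T'),
  forall x w, a x -> flip T T' (ket1 T x w) = ket2 T' x w &
  forall y v, g y -> flip T T' (ket2 T y v) = ket1 T' y v].
Proof.
have [X [bX hX]] := @tens_isometry R L H K H K a g a g T (flipT ga T') id id
  (fun _ => id) (fun _ => id) (fun _ _ _ _ _ => erefl) (fun _ _ _ _ _ => erefl).
have E : flip T T' = X.
  rewrite /flip; case: xgetP => [X' _ [bX' hX']|/(_ X) []]; last by split.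
  apply: (eq_bounded_total (ket2_total ag T)) => // _ [y gy [v _ <-]].
  have b2 := ket2_bounded ag T gy.
  have : X' \o ket2 T y = X \o ket2 T y.
    apply: (eq_on_vals (adm_tl ag)); try exact: bounded_comp.
    by move=> x z ax /=; rewrite (ket2E ag) // hX' ?hX.
  by move/(congr1 (@^~ v)).
have h1 x w : a x -> X (ket1 T x w) = ket2 T' x w.
  move=> ax; have : X \o ket1 T x = ket2 T' x.
    apply: (eq_on_vals (adm_tr ag)).
    - by apply: bounded_comp => //; exact: (ket1_bounded ag).
    - exact: (ket2_bounded ga).
    by move=> y z gy /=; rewrite (ket1E ag) // hX // (ket2E ga).
  by move/(congr1 (@^~ w)).
have h2 y v : g y -> X (ket2 T y v) = ket1 T' y v.
  move=> gy; have : X \o ket2 T y = ket1 T' y.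
    apply: (eq_on_vals (adm_tl ag)).
    - by apply: bounded_comp => //; exact: (ket2_bounded ag).
    - exact: (ket1_bounded ga).
    by move=> x z ax /=; rewrite (ket2E ag) // hX // (ket1E ga).
  by move/(congr1 (@^~ v)).
rewrite E; split=> //.
pose e (p : {y | g y} * {x | a x} * L) := ket2 T (sval p.1.1) (sval p.1.2 p.2).
pose f (p : {y | g y} * {x | a x} * L) := ket1 T' (sval p.1.1) (sval p.1.2 p.2).
have bk y : g y -> bounded_op (ket2 T y) by exact: (ket2_bounded ag).
have bk' y : g y -> bounded_op (ket1 T' y) by exact: (ket1_bounded ga).
apply: (@gram_unitary _ _ _ _ e f) => //.
- have t : cspan_vec [set k v | k in [set ket2 T y | y in g] & v in vals a] = setT.
    apply: total_image (adm_tl ag) => [_ [y gy <-]|]; first exact: bk.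
    apply: total_sub (ket2_total ag T) _ => _ [y gy [v _ <-]]; apply: lspan_gen.
    by exists (ket2 T y); [exists y|exists v].
  apply: total_sub t _ => _ [_ [y gy <-] [_ [x ax [z _ <-]] <-]]; apply: lspan_gen.
  by exists (exist _ y gy, exist _ x ax, z).
- have t : cspan_vec [set k v | k in [set ket1 T' y | y in g] & v in vals a] = setT.
    apply: total_image (adm_tl ag) => [_ [y gy <-]|]; first exact: bk'.
    apply: total_sub (ket1_total ga T') _ => _ [y gy [v _ <-]]; apply: lspan_gen.
    by exists (ket1 T' y); [exists y|exists v].
  apply: total_sub t _ => _ [_ [y gy <-] [_ [x ax [z _ <-]] <-]]; apply: lspan_gen.
  by exists (exist _ y gy, exist _ x ax, z).
- by move=> [[[y gy] [x ax]] z]; exact: h2.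
move=> [[[y gy] [x ax]] z] [[[y' gy'] [x' ax']] z']; rewrite /e /f /=.
rewrite (ket1E ga) // (ket1E ga) // (ket2E ag) // (ket2E ag) //.
rewrite !tens_iprod //; congr (iprod z _).
exact: (adm_comm ga _ gy gy' ax ax').
Qed.

End Flip.

Section AssocUnitary.
Variables (R : realType) (L H K M : hilbertType R).
Variables (b1 : set (L -> H)) (g2 b2 : set (L -> K)) (g3 : set (L -> M)).
Variables (T12 : rtp b1 g2) (T23 : rtp b2 g3).
Variables (Pl : rtp (rtri T12 b2) g3) (Pr : rtp b1 (ltri T23 g2)).
Hypotheses (A12 : adm b1 g2) (A23 : adm b2 g3).
Hypotheses (Al : adm (rtri T12 b2) g3) (Ar : adm b1 (ltri T23 g2)).
Hypothesis st : forall x x' y, b1 x -> b1 x' -> b2 y ->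
  b2 (adj (ket1 T12 x) \o ket1 T12 x' \o y).
Let bb2 : b2 `<=` @bounded_op R L K := adm_bl A23.

Let I := ({x | b1 x} * K * {y | g3 y})%type.
Let e (i : I) := ket2 Pl (sval i.2) (ket1 T12 (sval i.1.1) i.1.2).
Let f (i : I) := ket1 Pr (sval i.1.1) (ket2 T23 (sval i.2) i.1.2).

Let te : cspan_vec (range e) = setT.
Proof.
have t : cspan_vec [set k v | k in [set ket2 Pl y | y in g3] &
    v in [set ket1 T12 x w | x in b1 & w in [set: K]]] = setT.
  apply: total_image (ket1_total A12 T12) => [_ [y gy <-]|]; first exact: (ket2_bounded Al).
  apply: total_sub (ket2_total Al Pl) _ => _ [y gy [v _ <-]]; apply: lspan_gen.
  by exists (ket2 Pl y); [exists y|exists v].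
apply: total_sub t _ => _ [_ [y gy <-] [_ [x ax [w _ <-]] <-]]; apply: lspan_gen.
by exists (exist _ x ax, w, exist _ y gy).
Qed.

Let tf : cspan_vec (range f) = setT.
Proof.
have t : cspan_vec [set k v | k in [set ket1 Pr x | x in b1] &
    v in [set ket2 T23 y w | y in g3 & w in [set: K]]] = setT.
  apply: total_image (ket2_total A23 T23) => [_ [x ax <-]|]; first exact: (ket1_bounded Ar).
  apply: total_sub (ket1_total Ar Pr) _ => _ [x ax [v _ <-]]; apply: lspan_gen.
  by exists (ket1 Pr x); [exists x|exists v].
apply: total_sub t _ => _ [_ [x ax <-] [_ [y gy [w _ <-]] <-]]; apply: lspan_gen.
by exists (exist _ x ax, w, exist _ y gy).
Qed.

Lemma assoc_ket1 x x' y w : b1 x -> b1 x' -> g3 y ->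
  adj (ket1 Pr x) (ket1 Pr x' (ket2 T23 y w)) = ket2 T23 y (adj (ket1 T12 x) (ket1 T12 x' w)).
Proof.
move=> bx bx' gy.
have k1 := ket1_bounded A12 T12 bx; have k1' := ket1_bounded A12 T12 bx'.
have k2 := ket2_bounded A23 T23 gy.
have p1 := ket1_bounded Ar Pr bx; have p1' := ket1_bounded Ar Pr bx'.
have ba := bounded_adj p1; have ba' := bounded_adj k1.
have : (adj (ket1 Pr x) \o ket1 Pr x') \o ket2 T23 y = ket2 T23 y \o (adj (ket1 T12 x) \o ket1 T12 x').
  apply: (eq_on_vals (adm_tr A12)); try by do ![apply: bounded_comp => //].
  move=> u z bu /=; rewrite (ket1_gram A12) // -[ket2 T23 y (u z)]/((ket2 T23 y \o u) z).
  by rewrite (ket1_gram Ar) //; apply: (ltri_gen A23) => //; exact: (adm_br A12).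
by move/(congr1 (@^~ w)).
Qed.

(** Both sides reduce to inner products in [K], one with [S Q] and the other with [Q S], where [Q]
    and [S] come from the outer legs. They commute since [Q] preserves [b2], while on [u z] with [u]
    in [b2] the operator [S] acts through [z] alone. *)
Let gram i j : iprod (f i) (f j) = iprod (e i) (e j).
Proof.
case: i j => [[[x bx] w] [y gy]] [[[x' bx'] w'] [y' gy']]; rewrite /e /f /=.
have k1 := ket1_bounded A12 T12 bx; have k1' := ket1_bounded A12 T12 bx'.
have k2 := ket2_bounded A23 T23 gy; have k2' := ket2_bounded A23 T23 gy'.
have p2 := ket2_bounded Al Pl gy; have p2' := ket2_bounded Al Pl gy'.
have p1 := ket1_bounded Ar Pr bx; have p1' := ket1_bounded Ar Pr bx'.
pose Q := adj (ket1 T12 x) \o ket1 T12 x'.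
pose S := adj (ket2 T23 y) \o ket2 T23 y'.
have bQ : bounded_op Q by apply: bounded_comp => //; exact: bounded_adj.
have bS : bounded_op S by apply: bounded_comp => //; exact: bounded_adj.
have E1 : (adj (ket2 Pl y) \o ket2 Pl y') \o ket1 T12 x' = ket1 T12 x' \o S.
  have ba := bounded_adj p2.
  apply: (eq_on_vals (adm_tl A23)); try by do ![apply: bounded_comp => //].
  move=> u z bu /=; rewrite /S /= (ket2_gram A23) // -[ket1 T12 x' (u z)]/((ket1 T12 x' \o u) z).
  by rewrite (ket2_gram Al) //; exact: rtri_gen.
have E3 : Q \o S = S \o Q.
  apply: (eq_on_vals (adm_tl A23)); try exact: bounded_comp.
  move=> u z bu /=; rewrite {1}/S /= (ket2_gram A23) // -[Q (u z)]/((Q \o u) z).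
  rewrite -[S _]/(adj (ket2 T23 y) (ket2 T23 y' ((Q \o u) z))).
  by rewrite (ket2_gram A23) //; exact: st.
rewrite -(adjPr _ _ p1) -(adjPr _ _ p2).
rewrite assoc_ket1 //; have := congr1 (@^~ w') E1 => /= ->.
rewrite -(adjPr _ _ k2) -(adjPr _ _ k1) -[adj (ket2 _ _) _]/(S (Q w')).
by rewrite -[adj (ket1 _ _) _]/(Q (S w')); have := congr1 (@^~ w') E3 => /= ->.
Qed.

Lemma assoc_unitary : unitary_op (assoc Pl Pr) /\
  forall x w y, b1 x -> g3 y -> assoc Pl Pr (ket2 Pl y (ket1 T12 x w)) = ket1 Pr x (ket2 T23 y w).
Proof.
have [X [bX hX]] := ext_isom te gram.
have hX' x w y : b1 x -> g3 y -> X (ket2 Pl y (ket1 T12 x w)) = ket1 Pr x (ket2 T23 y w).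
  by move=> bx gy; exact: (hX (exist _ x bx, w, exist _ y gy)).
have -> : assoc Pl Pr = X.
  rewrite /assoc; case: xgetP => [X' _ [bX' hX'']|/(_ X) []]; last by split.
  apply: (eq_bounded_total te) => // _ [[[[x bx] w] [y gy]] _ <-].
  by rewrite hX hX''.
by split=> //; exact: gram_unitary bX te tf hX gram.
Qed.

Lemma assocV_unitary : unitary_op (assocV Pl Pr) /\
  forall x w y, b1 x -> g3 y -> assocV Pl Pr (ket1 Pr x (ket2 T23 y w)) = ket2 Pl y (ket1 T12 x w).
Proof.
have gram' i j : iprod (e i) (e j) = iprod (f i) (f j) by rewrite gram.
have [X [bX hX]] := ext_isom tf gram'.
have hX' x w y : b1 x -> g3 y -> X (ket1 Pr x (ket2 T23 y w)) = ket2 Pl y (ket1 T12 x w).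
  by move=> bx gy; exact: (hX (exist _ x bx, w, exist _ y gy)).
have -> : assocV Pl Pr = X.
  rewrite /assocV; case: xgetP => [X' _ [bX' hX'']|/(_ X) []]; last by split.
  apply: (eq_bounded_total tf) => // _ [[[[x bx] w] [y gy]] _ <-].
  by rewrite hX hX''.
by split=> //; exact: gram_unitary bX tf te hX gram'.
Qed.

End AssocUnitary.

Lemma unitary_comp (R : realType) (G1 G2 G3 : hilbertType R) (U : G2 -> G3) (U' : G1 -> G2) :
  unitary_op U -> unitary_op U' -> unitary_op (U \o U').
Proof.
move=> [l1 i1 s1] [l2 i2 s2]; split=> [a x y|x y|y] /=; first by rewrite l2 l1.
  by rewrite i1 i2.
by have [x <-] := s1 y; have [x' <-] := s2 x; exists x'.
Qed.

Lemma eq_adj_comp_total (R : realType) (H G G' S : hilbertType R) (D : set G')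
    (k : G -> S) (k' : G' -> S) (t : H -> G) (s : H -> G') :
  cspan_vec D = setT -> bounded_op k -> bounded_op k' -> bounded_op t -> bounded_op s ->
  (forall v, D v -> adj k (k' v) = t (adj s v)) -> forall w, adj k (k' w) = t (adj s w).
Proof.
move=> tD bk bk' bt bs h w; have ba := bounded_adj bk; have ba' := bounded_adj bs.
have : adj k \o k' = t \o adj s by apply: (eq_bounded_total tD) => //; exact: bounded_comp.
by move/(congr1 (@^~ w)).
Qed.

Section LegOps.
Variables (R : realType) (b : cbase R) (H : hilbertType R).
Notation L := (bspace b).
Notation B := (balg b).
Notation Bd := (balgd b).
Variables (hb al be : set (L -> H)) (T : rtp hb al) (T' : rtp al be) (V : T -> T').
Hypothesis PM : premu V.
Let aha := adm_ha PM.
Let aab := adm_ab PM.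
Variables (P0 : rtp hb (ltri T al)) (P3 : rtp hb (rtri T' al)) (W : P0 -> P3).
Variables (k30 : (L -> H) -> T -> P0) (k23 : (L -> H) -> T -> P3).
Hypotheses (bW : bounded_op W) (WE : forall x v, hb x -> W (ket1 P0 x v) = ket1 P3 x (V v)).
Hypotheses (bk30 : forall e, al e -> bounded_op (k30 e)) (bk23 : forall e, al e -> bounded_op (k23 e)).
Hypothesis a0 : forall x e w, hb x -> al e -> k30 e (ket1 T x w) = ket1 P0 x (ket2 T e w).
Hypothesis a3 : forall x e w, hb x -> al e -> ket1 P3 x (ket1 T' e w) = k23 e (ket1 T x w).

(** [Z] acts on the first leg of both products. The kets [k30] and [k23] insert into another leg, so
    they reduce it to [Z (x) id] on [T], and [W] touches only the last two legs. This supplies [z0]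
    and [z3] for the coassociativity argument. *)
Lemma leg_ops Z : commutant [set rho hb c | c in B] Z ->
  exists (z0 : P0 -> P0) (z3 : P3 -> P3), [/\ bounded_op z0, bounded_op z3,
    forall e v, al e -> z0 (k30 e v) = k30 e (op_id T T Z v),
    forall e v, al e -> z3 (k23 e v) = k23 e (op_id T T Z v) &
    forall v, z3 (W v) = W (z0 v)].
Proof.
move=> AZ; have bZ : bounded_op Z by case: AZ.
have p0 := pmod_ltri_T_al PM; have p3 := pmod_rtri_T'_al PM.
have adm0 : adm hb (ltri T al) := pmod_adm_dB (pm_hb PM) p0.
have adm3 : adm hb (rtri T' al) := pmod_adm_dB (pm_hb PM) p3.
have hc (G : hilbertType R) (P : set (L -> G)) (Q : rtp hb P) (pP : pmod B P) p p' v : P p -> P p' ->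
    Z (adj (ket2 Q p) (ket2 Q p' v)) = adj (ket2 Q p) (ket2 Q p' (Z v)).
  move=> Pp Pp'; exact: (congr1 (@^~ v) (commutant_multop (pm_hb PM) AZ (pmod_inner pP Pp Pp')
    (ket2_multop (pmod_adm_dB (pm_hb PM) pP) Q Pp Pp'))).
have [bz0 z0E] := op_id_spec adm0 bZ (fun p p' v => hc _ _ P0 p0 p p' v).
have [bz3 z3E] := op_id_spec adm3 bZ (fun p p' v => hc _ _ P3 p3 p p' v).
have [btl tlE] := premu_tl PM AZ.
have bal := adm_br aha.
have bV := unitary_bounded (pm_unitary PM).
have k30E e y w : al e -> al y -> k30 e (ket2 T y w) = ket2 P0 (ket2 T e \o y) w.
  move=> ae ay; have ly : ltri T al (ket2 T e \o y) by apply: (ltri_gen aha).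
  have : k30 e \o ket2 T y = ket2 P0 (ket2 T e \o y).
    apply: (eq_on_vals (adm_tl aha)).
    - by apply: bounded_comp; [exact: bk30|exact: (ket2_bounded aha)].
    - exact: (ket2_bounded adm0).
    by move=> x z hx /=; rewrite -(ket12 aha) // a0 // -[ket2 T e (y z)]/((ket2 T e \o y) z) (ket12 adm0).
  by move/(congr1 (@^~ w)).
have k23E e y w : al e -> al y -> k23 e (ket2 T y w) = ket2 P3 (ket1 T' e \o y) w.
  move=> ae ay; have ly : rtri T' al (ket1 T' e \o y) by apply: (rtri_gen aab).
  have : k23 e \o ket2 T y = ket2 P3 (ket1 T' e \o y).
    apply: (eq_on_vals (adm_tl aha)).
    - by apply: bounded_comp; [exact: bk23|exact: (ket2_bounded aha)].
    - exact: (ket2_bounded adm3).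
    by move=> x z hx /=; rewrite -(ket12 aha) // -a3 // -[ket1 T' e (y z)]/((ket1 T' e \o y) z) (ket12 adm3).
  by move/(congr1 (@^~ w)).
have W2 p v : ltri T al p -> W (ket2 P0 p v) = ket2 P3 (V \o p) v.
  move=> lp; have lp' := pm_aa PM lp; have : W \o ket2 P0 p = ket2 P3 (V \o p).
    apply: (eq_on_vals (adm_tl aha)).
    - by apply: bounded_comp => //; exact: (ket2_bounded adm0).
    - exact: (ket2_bounded adm3).
    by move=> x z hx /=; rewrite -(ket12 adm0) // WE // -[V (p z)]/((V \o p) z) (ket12 adm3).
  by move/(congr1 (@^~ v)).
exists (op_id P0 P0 Z), (op_id P3 P3 Z); split=> //.
- move=> e v ae; have bke := bk30 ae; have : op_id P0 P0 Z \o k30 e = k30 e \o op_id T T Z.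
    apply: (eq_bounded_total (ket2_total aha T)); try exact: bounded_comp.
    move=> _ [y ay [w _ <-]] /=; rewrite k30E // tlE // k30E // z0E //.
    exact: (ltri_gen aha).
  by move/(congr1 (@^~ v)).
- move=> e v ae; have bke := bk23 ae; have : op_id P3 P3 Z \o k23 e = k23 e \o op_id T T Z.
    apply: (eq_bounded_total (ket2_total aha T)); try exact: bounded_comp.
    move=> _ [y ay [w _ <-]] /=; rewrite k23E // tlE // k23E // z3E //.
    exact: (rtri_gen aab).
  by move/(congr1 (@^~ v)).
move=> v; have : op_id P3 P3 Z \o W = W \o op_id P0 P0 Z.
  apply: (eq_bounded_total (ket2_total adm0 P0)); try exact: bounded_comp.
  move=> _ [p lp [w _ <-]] /=; rewrite W2 // z0E // W2 // z3E //.
  exact: (pm_aa PM).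
by move/(congr1 (@^~ v)).
Qed.

End LegOps.

Section Realization.
Variables (R : realType) (b : cbase R) (H : hilbertType R).
Notation L := (bspace b).
Notation B := (balg b).
Notation Bd := (balgd b).
Variables (hb al be : set (L -> H)) (T : rtp hb al) (T' : rtp al be) (V : T -> T').
Hypothesis PM : premu V.
Let aha := adm_ha PM.
Let aab := adm_ab PM.

Definition fam_pres (X : set (L -> H)) (G S : hilbertType R) (k : (L -> H) -> G -> S) : Prop :=
  forall a : nat -> L -> H, (forall i, X (a i)) -> fam a -> fam (fun i => k (a i)).

(** Associators and flips are absorbed into the kets and the unitaries: each threefold product is
    represented by one bracketing, and a ket into another bracketing is composed with the
    identification. What remains of the pentagon is an identity between five unitaries. *)
Lemma pentagon_realization : pentagon V ->
  exists (S0 S1 S2 S3 S4 : hilbertType R) V12 V23 W23 V13 W12 k10 k30 k11 k31 k12 k32 k13 k23 k24 k34,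
  [/\ @pentagon_data R (L -> H) hb al be H T T' S0 S1 S2 S3 S4 (ket1 T) (ket2 T) (ket1 T') (ket2 T')
        V V12 V23 W23 V13 W12 k10 k30 k11 k31 k12 k32 k13 k23 k24 k34,
      fam_pres hb k10 /\ fam_pres al k30, fam_pres al k12 /\ fam_pres be k32,
      forall Z, commutant [set rho hb c | c in B] Z ->
        exists (z0 : S0 -> S0) (z3 : S3 -> S3), [/\ bounded_op z0, bounded_op z3,
        forall e v, al e -> z0 (k30 e v) = k30 e (op_id T T Z v),
        forall e v, al e -> z3 (k23 e v) = k23 e (op_id T T Z v) &
        forall v, z3 (W23 v) = W23 (z0 v)] &
      forall Z, commutant [set rho be c | c in B] Z ->
        exists (z0 : S2 -> S2) (z3 : S4 -> S4), [/\ bounded_op z0, bounded_op z3,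
        forall e v, al e -> z0 (k12 e v) = k12 e (id_op T' T' Z v),
        forall e v, al e -> z3 (k24 e v) = k24 e (id_op T' T' Z v) &
        forall v, z3 (adj W12 v) = adj W12 (z0 v)]].
Proof.
move=> [T0 [P0l [P0r [P1l [P1r [P2l [P2r [P3 [Q1r [Q1l [Q2 [P4 E]]]]]]]]]]]].
have uV := pm_unitary PM; have bV := unitary_bounded uV.
have p_hb := pm_hb PM; have p_al := pm_al PM; have p_be := pm_be PM.
have aba : adm be al := pmod_adm_dB p_be p_al.
have q_hb_T := pmod_rtri_T_hb PM; have q_al_T := pmod_ltri_T_al PM.
have q_hb_T' := pmod_rtri_T'_hb PM; have q_be_T := pmod_ltri_T_be PM.
have q_al_T' := pmod_rtri_T'_al PM; have q_be_T' := pmod_ltri_T'_be PM.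
have q_beT := pmod_rtri_T_be PM; have q_hbT' := pmod_ltri_T'_hb PM.
have q_T0 : pmod B (ltri T0 al).
  apply: (ltri_pmod aba) (@balg_closed R b) (@balg_adj R b) (p_al) _ => x x' y ax ax' ay.
  exact: (pm_be_al PM (pmod_inner p_al ax ax') (ket2_multop aba T0 ax ax')).
have d0l : adm (rtri T hb) al := pmod_adm_dB q_hb_T p_al.
have d0r : adm hb (ltri T al) := pmod_adm_dB p_hb q_al_T.
have d1l : adm (rtri T' hb) al := pmod_adm_dB q_hb_T' p_al.
have d1r : adm al (ltri T be) := pmod_adm_Bd p_al q_be_T.
have d2l : adm (rtri T' al) be := pmod_adm_Bd q_al_T' p_be.
have d2r : adm al (ltri T' be) := pmod_adm_Bd p_al q_be_T'.
have d3 : adm hb (rtri T' al) := pmod_adm_dB p_hb q_al_T'.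
have dq1r : adm hb (ltri T0 al) := pmod_adm_dB p_hb q_T0.
have dq1l : adm (rtri T be) al := pmod_adm_dB q_beT p_al.
have dq2 : adm (ltri T' hb) al := pmod_adm_dB q_hbT' p_al.
have d4 : adm (ltri T al) be := pmod_adm_Bd q_al_T p_be.
have st0 x x' y : hb x -> hb x' -> hb y -> hb (adj (ket1 T x) \o ket1 T x' \o y).
  by move=> hx hx'; exact: (pm_al_hb PM (pmod_inner p_hb hx hx') (ket1_multop aha T hx hx')).
have st0' x x' y : hb x -> hb x' -> be y -> be (adj (ket1 T x) \o ket1 T x' \o y).
  by move=> hx hx'; exact: (pm_al_be PM (pmod_inner p_hb hx hx') (ket1_multop aha T hx hx')).
have st1 x x' y : al x -> al x' -> hb y -> hb (adj (ket1 T' x) \o ket1 T' x' \o y).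
  by move=> hx hx'; exact: (pm_be_hb PM (pmod_inner p_al hx hx') (ket1_multop aab T' hx hx')).
have st2 x x' y : al x -> al x' -> al y -> al (adj (ket1 T' x) \o ket1 T' x' \o y).
  by move=> hx hx'; exact: (pm_be_al PM (pmod_inner p_al hx hx') (ket1_multop aab T' hx hx')).
have st4 x x' y : be x -> be x' -> hb y -> hb (adj (ket2 T' x) \o ket2 T' x' \o y).
  by move=> hx hx'; exact: (pm_al_hb PM (pmod_inner p_be hx hx') (ket2_multop aab T' hx hx')).
have aba' := adm_sym aab.
pose F' := flipT aab T'.
have [ua0 a0E] := assoc_unitary P0l P0r aha aha d0l d0r st0.
have [ua1 a1E] := assoc_unitary P1l P1r aab aha d1l d1r st1.
have [ua2 a2E] := assoc_unitary P2l P2r aab aab d2l d2r st2.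
have [uav avE] := assocV_unitary Q1l Q1r aha aba dq1l dq1r st0'.
have [uf fE] : unitary_op (flip23 (P := Q2) P4) /\ forall x w y, be x -> al y ->
    flip23 (P := Q2) P4 (ket2 Q2 y (ket2 T' x w)) = ket2 P4 x (ket2 T y w).
  (* After exchanging the legs of [T'] and of the target, the partial flip satisfies the defining
     equation of an associator. *)
  have -> : flip23 (P := Q2) P4 = @assoc R L H H H be al hb al F' T Q2 (flipT d4 P4) :> (Q2 -> P4).
    by congr (xget _ _); apply/seteqP; split=> X [bX hX]; split=> // *; exact: hX.
  exact: (@assoc_unitary R L H H H be al hb al F' T Q2 (flipT d4 P4) aba' aha dq2 (adm_sym d4) st4).
have [ux0 x0E _] := op_id_unitary d0l d1l P0l P1l uV (pm_hh PM).
have [ux1 x1E _] := op_id_unitary dq1l dq2 Q1l Q2 uV (pm_hb' PM).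
have [ux4 x4E _] := op_id_unitary d4 d2l P4 P2l uV (pm_aa PM).
have [uy0 y0E _] := id_op_unitary d0r d3 P0r P3 uV (pm_aa PM).
have [uy1 y1E _] := id_op_unitary d1r d2r P1r P2r uV (pm_ba PM).
have [us s1E s2E] := flip_unitary aab T' T0.
have bs := unitary_bounded us.
have sal p : rtri T' al p -> ltri T0 al (flip T' T0 \o p).
  apply: cspan_comp_left => // _ [x ax [y ay <-]].
  have -> : flip T' T0 \o (ket1 T' x \o y) = ket2 T0 x \o y by apply/funext => z /=; rewrite s1E.
  by apply: (ltri_gen aba) => //; exact: (adm_br aba).
have [uy3 y3E _] := id_op_unitary d3 dq1r P3 Q1r us sal.
(* The part of [V13] that rearranges legs before [V (x) id] acts; its adjoint brings [ket2 Q1l e]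
   back to [P3] and so defines [k23]. *)
pose M3 := assocV Q1l Q1r \o id_op P3 Q1r (flip T' T0).
have uM3 : unitary_op M3 := unitary_comp uav uy3.
have M3E x e w : hb x -> al e -> M3 (ket1 P3 x (ket1 T' e w)) = ket2 Q1l e (ket1 T x w).
  by move=> hx ae; rewrite /M3 /= y3E // s1E // avE.
pose k10 x := ket1 P0r x.
pose k30 e := assoc P0l P0r \o ket2 P0l e.
pose k11 x := ket1 P1r x.
pose k31 e := assoc P1l P1r \o ket2 P1l e.
pose k12 e := adj (assoc P2l P2r) \o ket1 P2r e.
pose k32 x := ket2 P2l x.
pose k13 x := ket1 P3 x.
pose k23 e := adj M3 \o ket2 Q1l e.
pose k24 e := flip23 (P := Q2) P4 \o ket2 Q2 e.
pose k34 x := ket2 P4 x.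
have ub (G1 G2 : hilbertType R) (U : G1 -> G2) : unitary_op U -> bounded_op U by exact: unitary_bounded.
have bk10 x : hb x -> bounded_op (k10 x) by exact: (ket1_bounded d0r).
have bk30 e : al e -> bounded_op (k30 e).
  by move=> ae; apply: bounded_comp; [exact: ub|exact: (ket2_bounded d0l)].
have bk11 x : al x -> bounded_op (k11 x) by exact: (ket1_bounded d1r).
have bk31 e : al e -> bounded_op (k31 e).
  by move=> ae; apply: bounded_comp; [exact: ub|exact: (ket2_bounded d1l)].
have bk12 e : al e -> bounded_op (k12 e).
  by move=> ae; apply: bounded_comp; [apply: bounded_adj; exact: ub|exact: (ket1_bounded d2r)].
have bk32 x : be x -> bounded_op (k32 x) by exact: (ket2_bounded d2l).
have bk13 x : hb x -> bounded_op (k13 x) by exact: (ket1_bounded d3).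
have bk23 e : al e -> bounded_op (k23 e).
  by move=> ae; apply: bounded_comp; [apply: bounded_adj; exact: ub|exact: (ket2_bounded dq1l)].
have bk24 e : al e -> bounded_op (k24 e).
  by move=> ae; apply: bounded_comp; [exact: ub|exact: (ket2_bounded dq2)].
have bk34 x : be x -> bounded_op (k34 x) by exact: (ket2_bounded d4).
have A0 x e w : hb x -> al e -> k30 e (ket1 T x w) = k10 x (ket2 T e w).
  by move=> hx ae; rewrite /k30 /= a0E.
have A1 x e w : al x -> al e -> k31 e (ket1 T' x w) = k11 x (ket2 T e w).
  by move=> hx ae; rewrite /k31 /= a1E.
have A2 x e w : be x -> al e -> k32 x (ket1 T' e w) = k12 e (ket2 T' x w).
  by move=> hx ae; rewrite /k12 /= -a2E // unitaryK.
have A3 x e w : hb x -> al e -> k13 x (ket1 T' e w) = k23 e (ket1 T x w).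
  by move=> hx ae; rewrite /k23 /= -M3E // unitaryK.
have A4 x e w : be x -> al e -> k34 x (ket2 T e w) = k24 e (ket2 T' x w).
  by move=> hx ae; rewrite /k24 /= fE.
pose V12 := assoc P1l P1r \o op_id P0l P1l V \o adj (assoc P0l P0r).
pose V23 := adj (assoc P2l P2r) \o id_op P1r P2r V.
pose W23 := id_op P0r P3 V.
pose V13' := V13 V (P := P3) Q1r Q1l Q2 P4.
pose W12 := op_id P4 P2l V.
have uW12 : unitary_op W12 by [].
have bW12 := ub _ _ _ uW12.
have baW12 : bounded_op (adj W12) := bounded_adj bW12.
have F12 x v : be x -> W12 (k34 x v) = k32 x (V v) by move=> bx; rewrite /W12 /k34 x4E.
have R0 x e w : hb x -> al e -> adj (k10 x) (k30 e w) = ket2 T e (adj (ket1 T x) w).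
  move=> hx ae; apply: (eq_adj_comp_total (ket1_total aha T) (bk10 _ hx) (bk30 _ ae) (ket2_bounded aha T ae) (ket1_bounded aha T hx)).
  move=> _ [x' hx' [w' _ <-]]; rewrite A0 //.
  exact: (assoc_ket1 T P0r aha aha d0r).
have R1 x e w : al x -> al e -> adj (k11 x) (k31 e w) = ket2 T e (adj (ket1 T' x) w).
  move=> hx ae; apply: (eq_adj_comp_total (ket1_total aab T') (bk11 _ hx) (bk31 _ ae) (ket2_bounded aha T ae) (ket1_bounded aab T' hx)).
  move=> _ [x' hx' [w' _ <-]]; rewrite A1 //.
  exact: (assoc_ket1 T' P1r aab aha d1r).
have R2 x e w : be x -> al e -> adj (k32 x) (k12 e w) = ket1 T' e (adj (ket2 T' x) w).
  move=> hx ae; apply: (eq_adj_comp_total (ket2_total aab T') (bk32 _ hx) (bk12 _ ae) (ket1_bounded aab T' ae) (ket2_bounded aab T' hx)).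
  move=> _ [x' hx' [w' _ <-]]; rewrite -A2 //.
  exact: (@assoc_ket1 R L H H H be al be al F' F' (flipT d2l P2l) aba' aba' (adm_sym d2l)).
have R3 x e w : hb x -> al e -> adj (k13 x) (k23 e w) = ket1 T' e (adj (ket1 T x) w).
  move=> hx ae; apply: (eq_adj_comp_total (ket1_total aha T) (bk13 _ hx) (bk23 _ ae) (ket1_bounded aab T' ae) (ket1_bounded aha T hx)).
  move=> _ [x' hx' [w' _ <-]]; rewrite -A3 //.
  exact: (@assoc_ket1 R L H H H hb al be al T F' P3 aha aba' d3).
have R4 x e w : be x -> al e -> adj (k34 x) (k24 e w) = ket2 T e (adj (ket2 T' x) w).
  move=> hx ae; apply: (eq_adj_comp_total (ket2_total aab T') (bk34 _ hx) (bk24 _ ae) (ket2_bounded aha T ae) (ket2_bounded aab T' hx)).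
  move=> _ [x' hx' [w' _ <-]]; rewrite -A4 //.
  exact: (@assoc_ket1 R L H H H be al hb al F' T (flipT d4 P4) aba' aha (adm_sym d4)).
exists P0r, P1r, P2l, P3, P4, V12, V23, W23, V13', W12, k10, k30, k11, k31, k12, k32, k13, k23, k24, k34.
split.
- split=> //.
  + by apply: unitary_comp (unitary_adj ua0); exact: unitary_comp.
  + by apply: unitary_comp uy1; exact: unitary_adj.
  + by rewrite /V13' /V13; do ![apply: unitary_comp => //].
  + move=> v; have := congr1 (@^~ (adj (assoc P0l P0r) v)) E => /=; rewrite unitaryVK // => Ev.
    by rewrite /V23 /V12 /= Ev unitaryK.
  + by move=> x; exact: (ket1_bounded aha).
  + by move=> x; exact: (ket2_bounded aha).
  + by move=> x; exact: (ket1_bounded aab).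
  + by move=> x; exact: (ket2_bounded aab).
  + exact: ket2_total.
  + exact: ket1_total.
  + by move=> e v ae; rewrite /V12 /k30 /k31 /= unitaryK // x0E.
  + by move=> e v ae; rewrite /V23 /k11 /k12 /= y1E.
  + move=> e v ae; rewrite /V13' /V13 /k23 /k24 /= -[assocV _ _ _]/(M3 (adj M3 (ket2 Q1l e v))).
    by rewrite unitaryVK // x1E.
- split=> a aX fa; first exact: (ket1_fam d0r).
  apply: fam_comp_left; [exact: ub|exact: (ket2_fam d0l)].
- split=> a aX fa; last exact: (ket2_fam d2l).
  apply: fam_comp_left; [apply: bounded_adj; exact: ub|exact: (ket1_fam d2r)].
- move=> Z hZ; apply: (leg_ops PM) => //; first exact: ub.
move=> Z hZ.
have FW x v : be x -> adj W12 (k32 x v) = k34 x (adj V v).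
  by move=> bx; rewrite -[v in LHS](unitaryVK uV) -F12 // unitaryK.
(* The third leg of [S2] and [S4] is the first leg of the flipped products, with [V^*] in the role
   of [V]. *)
exact: (@leg_ops R b H be al hb F' (flipT aha T) (adj V) (premu_flip PM)
  (flipT d2l P2l) (flipT d4 P4) (adj W12) k12 k24 baW12 FW bk12 bk24
  (fun x e w bx ae => esym (A2 x e w bx ae)) (fun x e w bx ae => A4 x e w bx ae) Z hZ).
Qed.

End Realization.

(** * The two legs *)

Lemma image_comp_ket (R : realType) (I : Type) (L H G : hilbertType R) (E : set I) (X : set (L -> H))
    (k : I -> H -> G) :
  [set k' \o x | k' in [set k e | e in E] & x in X] = [set k e \o x | e in E & x in X].
Proof.
apply/seteqP; split=> p; first by move=> [_ [e Ee <-] [x Xx <-]]; exists e => //; exists x.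
by move=> [e Ee [x Xx <-]]; exists (k e); [exists e|exists x].
Qed.

Lemma total_ket (R : realType) (I : Type) (H G : hilbertType R) (E : set I) (k : I -> H -> G) :
  cspan_vec [set k e v | e in E & v in [set: H]] = setT ->
  cspan_vec [set k' v | k' in [set k e | e in E] & v in [set: H]] = setT.
Proof.
move=> t; apply: total_sub t _ => _ [e Ee [v _ <-]]; apply: lspan_gen.
by exists (k e); [exists e|exists v].
Qed.

Section Halves.
Variables (R : realType) (b : cbase R) (H : hilbertType R).
Notation L := (bspace b).
Notation B := (balg b).
Variables (hb al be : set (L -> H)) (T : rtp hb al) (T' : rtp al be) (V : T -> T').
Hypothesis HV : cpmu V.
Let PM := cpmu_premu HV.
Let aha := adm_ha PM.
Let aab := adm_ab PM.
Let uV := pm_unitary PM.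
Let bV := unitary_bounded uV.
Let EV : adj (adj V) = V := adjK bV.
Let Chb := [set rho hb c | c in B].
Let Cbe := [set rho be c | c in B].
Let Ahb := commutant Chb.
Let Abe := commutant Cbe.
Let Ahb2 := commutant (op_op T' Chb Chb).
Let Abe2 := commutant (op_op T Cbe Cbe).
Let p_hb := pm_hb PM.
Let p_al := pm_al PM.
Let p_be := pm_be PM.
Let c_hb : cspan hb = hb := pmod_closed p_hb.
Let c_al : cspan al = al := pmod_closed p_al.
Let c_be : cspan be = be := pmod_closed p_be.
Let bhb := rhoC_bounded p_hb.
Let bbe := rhoC_bounded p_be.

Let hA (G : hilbertType R) (C : set (G -> G)) : commutant C `<=` @bounded_op R G G.
Proof. by move=> ? []. Qed.

Let hb_al c x : Chb c -> al x -> al (c \o x) := rhoC_stable p_hb (pm_hb_al PM).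
Let hb_be c x : Chb c -> be x -> be (c \o x) := rhoC_stable p_hb (pm_hb_be PM).
Let be_al c x : Cbe c -> al x -> al (c \o x) := rhoC_stable p_be (pm_be_al PM).
Let be_hb c x : Cbe c -> hb x -> hb (c \o x) := rhoC_stable p_be (pm_be_hb PM).

Let sl2 S x y : Ahb2 S -> be x -> be y -> Ahb (adj (ket2 T' x) \o S \o ket2 T' y).
Proof. exact: (A2_slice2 aab bhb hb_al hb_be (rhoC_comp p_hb) (rhoC_total p_hb)). Qed.

Let sl1 S x y : Ahb2 S -> al x -> al y -> Ahb (adj (ket1 T' x) \o S \o ket1 T' y).
Proof. exact: (A2_slice1 aab bhb hb_al hb_be (rhoC_comp p_hb) (rhoC_total p_hb)). Qed.

Let sl2' S x y : Abe2 S -> al x -> al y -> Abe (adj (ket2 T x) \o S \o ket2 T y).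
Proof. exact: (A2_slice2 aha bbe be_hb be_al (rhoC_comp p_be) (rhoC_total p_be)). Qed.

Let sl1' S x y : Abe2 S -> hb x -> hb y -> Abe (adj (ket1 T x) \o S \o ket1 T y).
Proof. exact: (A2_slice1 aha bbe be_hb be_al (rhoC_comp p_be) (rhoC_total p_be)). Qed.

Let DA Z : Ahb Z -> Ahb2 (Delta V Z). Proof. exact: (Delta_A2 PM). Qed.

Let DA' Z : Abe Z -> Abe2 (Delta_hat V Z).
Proof.
(* [Delta_hat] of [V] is [Delta] of the flipped unitary [V^*]. *)
move=> AZ; have := Delta_A2 (premu_flip PM) AZ.
rewrite /Delta EV => h.
exact: (A2_flip (adm_sym aha) (T := flipT aha T) bbe be_al be_hb h).
Qed.

Definition box_hat := @box R L H al be T' Ahb Ahb2.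
Definition box_leg := @box R L H hb al T Abe Abe2.
Definition mul_hat := omul Ahb Ahb2 (Delta V).
Definition mul_leg := omul Abe Abe2 (Delta_hat V).

Lemma box_hat_contraction :
  proj_contraction (Omega be al Ahb) (Omega_norm be al Ahb) (Omega be al Ahb) (Omega_norm be al Ahb)
    (Omega (ltri T' be) (rtri T' al) Ahb2) (Omega_norm (ltri T' be) (rtri T' al) Ahb2) box_hat.
Proof. exact: (box_contraction aab c_be c_al (@hA _ _) (@hA _ _) sl2 sl1). Qed.

Lemma box_leg_contraction :
  proj_contraction (Omega al hb Abe) (Omega_norm al hb Abe) (Omega al hb Abe) (Omega_norm al hb Abe)
    (Omega (ltri T al) (rtri T hb) Abe2) (Omega_norm (ltri T al) (rtri T hb) Abe2) box_leg.
Proof. exact: (box_contraction aha c_al c_hb (@hA _ _) (@hA _ _) sl2' sl1'). Qed.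

Lemma box_hat_omega xi xi' eta eta' i theta theta' :
  seqs be xi -> seqs be xi' -> seqs al eta -> seqs al eta' -> bijective i ->
  (forall m n, theta (i (m, n)) = ket2 T' (xi' n) \o xi m) ->
  (forall m n, theta' (i (m, n)) = ket1 T' (eta m) \o eta' n) ->
  [/\ seqs (ltri T' be) theta, seqs (rtri T' al) theta' &
      box_hat (omega Ahb xi eta) (omega Ahb xi' eta') = omega Ahb2 theta theta'].
Proof.
move=> sx sx' se se' bi h1 h2; rewrite !(omega_omf c_be c_al (@hA _ _)) // /box_hat.
rewrite (box_rep aab (@hA _ _) (@hA _ _) sl2 sl1 sx se sx' se').
exact: (box_reindex aab (@hA _ _) sx se sx' se' bi h1 h2).
Qed.

Lemma box_leg_omega eta eta' zeta zeta' i kappa kappa' :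
  seqs al eta -> seqs al eta' -> seqs hb zeta -> seqs hb zeta' -> bijective i ->
  (forall m n, kappa (i (m, n)) = ket2 T (eta' n) \o eta m) ->
  (forall m n, kappa' (i (m, n)) = ket1 T (zeta m) \o zeta' n) ->
  [/\ seqs (ltri T al) kappa, seqs (rtri T hb) kappa' &
      box_leg (omega Abe eta zeta) (omega Abe eta' zeta') = omega Abe2 kappa kappa'].
Proof.
move=> sx sx' se se' bi h1 h2; rewrite !(omega_omf c_al c_hb (@hA _ _)) // /box_leg.
rewrite (box_rep aha (@hA _ _) (@hA _ _) sl2' sl1' sx se sx' se').
exact: (box_reindex aha (@hA _ _) sx se sx' se' bi h1 h2).
Qed.

Let KK := [set ket2 T e | e in al].

(** The splitting is done in [T], with the kets of [al] into the second leg, [tl Z = Z (x) id] and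
    [U = V]: indeed [V^*] takes [be <| be] to [be <| al] and [al |> al] to [al <| al]. *)
Lemma mul_hat_banach : banach_algebra (Omega be al Ahb) (Omega_norm be al Ahb) mul_hat.
Proof.
have bK : KK `<=` @bounded_op R H T by move=> _ [e ae <-]; exact: (ket2_bounded aha).
have tK := total_ket (ket2_total aha T).
have tlb Z : Ahb Z -> bounded_op (op_id T T Z) by move=> /(premu_tl PM) [].
have tlK Z k v : Ahb Z -> KK k -> op_id T T Z (k v) = k (Z v).
  by move=> /(premu_tl PM) [_ h] [e ae <-]; exact: h.
have gX k k' x : KK k -> KK k' -> be x -> be (adj k \o (k' \o x)).
  move=> [e ae <-] [e' ae' <-].
  exact: (pm_hb_be PM (pmod_inner p_al ae ae') (ket2_multop aha T ae ae')).
have gY k k' x : KK k -> KK k' -> al x -> al (adj k \o (k' \o x)).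
  move=> [e ae <-] [e' ae' <-].
  exact: (pm_hb_al PM (pmod_inner p_al ae ae') (ket2_multop aha T ae ae')).
have gA k k' Z v : KK k -> KK k' -> Ahb Z -> Z (adj k (k' v)) = adj k (k' (Z v)).
  by move=> [e ae <-] [e' ae' <-] AZ; exact: (premu_gA PM v AZ ae ae').
have DU Z v : Ahb Z -> Delta V Z (V v) = V (op_id T T Z v).
  by move=> _; rewrite /Delta /= unitaryK.
have UX p : ltri T' be p -> cspan [set k \o x | k in KK & x in be] (adj V \o p).
  by rewrite image_comp_ket; exact: (pm_baV PM).
have UY p : rtri T' al p -> cspan [set k \o x | k in KK & x in al] (adj V \o p).
  by rewrite image_comp_ket; exact: (pm_aaV PM).
have sub := omul_submul aab c_be c_al (@hA _ _) (@hA _ _) sl2 sl1 DA bK tK tlb tlK gX gY gA uV DU UX UY.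
apply: (omul_banach aab c_be c_al (@hA _ _) (@hA _ _) sl2 sl1 DA bK tK tlb tlK gX gY gA uV DU UX UY).
apply: (omul_assoc aab c_be c_al (@hA _ _) (@hA _ _) sl2 sl1 DA); last first.
  by move=> w w' hw hw'; have [] := sub w w' hw hw'.
move=> Z AZ.
have [S0 [S1 [S2 [S3 [S4 [V12 [V23 [W23 [V13 [W12 [k10 [k30 [k11 [k31 [k12 [k32 [k13 [k23 [k24 [k34
  [PD _ [f12 f32] hz _]]]]]]]]]]]]]]]]]]]]] := pentagon_realization PM (cpmu_pentagon HV).
have [z0 [z3 [bz0 bz3 z0E z3E z03]]] := hz Z AZ.
exists S2, k12, k32, ((V23 \o V12) \o z0 \o adj (V23 \o V12)); split=> //.
- split; [exact: (pentagon_Th_bounded PD)|exact: (pd_k12 PD)|exact: (pd_k32 PD)].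
- by move=> e x v ae bx; rewrite (pd_a2 PD).
split=> x y hx hy.
  have AS := sl2 (DA AZ) hx hy; have [bD hD] := premu_tl PM AS.
  by apply: (pentagon_coassoc2 PD bz3 z3E z03 hx hy bD) => e w ae; rewrite hD.
have AS := sl1 (DA AZ) hx hy; have [bD hD] := premu_tl PM AS.
by apply: (pentagon_coassoc1 PD bz0 z0E hx hy bD) => e w ae; rewrite hD.
Qed.

Let KK' := [set ket1 T' e | e in al].

(** Dual choice: the splitting is done in [T'], with the kets of [al] into the first leg,
    [tl Z = id (x) Z] and [U = V^*]; now [V] takes [al <| al] to [al |> al] and [hb |> hb] to
    [al |> hb]. *)
Lemma mul_leg_banach : banach_algebra (Omega al hb Abe) (Omega_norm al hb Abe) mul_leg.
Proof.
have PF := premu_flip PM.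
have bK : KK' `<=` @bounded_op R H T' by move=> _ [e ae <-]; exact: (ket1_bounded aab).
have tK := total_ket (ket1_total aab T').
have tl Z : Abe Z -> bounded_op (id_op T' T' Z) /\
    forall e v, al e -> id_op T' T' Z (ket1 T' e v) = ket1 T' e (Z v) := premu_tl PF (Z := Z).
have tlb Z : Abe Z -> bounded_op (id_op T' T' Z) by move=> /tl [].
have tlK Z k v : Abe Z -> KK' k -> id_op T' T' Z (k v) = k (Z v).
  by move=> /tl [_ h] [e ae <-]; exact: h.
have gX k k' x : KK' k -> KK' k' -> al x -> al (adj k \o (k' \o x)).
  move=> [e ae <-] [e' ae' <-].
  exact: (pm_be_al PM (pmod_inner p_al ae ae') (ket1_multop aab T' ae ae')).
have gY k k' x : KK' k -> KK' k' -> hb x -> hb (adj k \o (k' \o x)).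
  move=> [e ae <-] [e' ae' <-].
  exact: (pm_be_hb PM (pmod_inner p_al ae ae') (ket1_multop aab T' ae ae')).
have gA k k' Z v : KK' k -> KK' k' -> Abe Z -> Z (adj k (k' v)) = adj k (k' (Z v)).
  by move=> [e ae <-] [e' ae' <-] AZ; exact: (premu_gA PF v AZ ae ae').
have uU := unitary_adj uV.
have DU Z v : Abe Z -> Delta_hat V Z (adj V v) = adj V (id_op T' T' Z v).
  by move=> _; rewrite /Delta_hat /= unitaryVK.
have UX p : ltri T al p -> cspan [set k \o x | k in KK' & x in al] (adj (adj V) \o p).
  by rewrite image_comp_ket EV; exact: (pm_aa PM).
have UY p : rtri T hb p -> cspan [set k \o x | k in KK' & x in hb] (adj (adj V) \o p).
  by rewrite image_comp_ket EV; exact: (pm_hh PM).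
have sub := omul_submul aha c_al c_hb (@hA _ _) (@hA _ _) sl2' sl1' DA' bK tK tlb tlK gX gY gA uU DU UX UY.
apply: (omul_banach aha c_al c_hb (@hA _ _) (@hA _ _) sl2' sl1' DA' bK tK tlb tlK gX gY gA uU DU UX UY).
apply: (omul_assoc aha c_al c_hb (@hA _ _) (@hA _ _) sl2' sl1' DA'); last first.
  by move=> w w' hw hw'; have [] := sub w w' hw hw'.
move=> Z AZ.
have [S0 [S1 [S2 [S3 [S4 [V12 [V23 [W23 [V13 [W12 [k10 [k30 [k11 [k31 [k12 [k32 [k13 [k23 [k24 [k34
  [PD [f10 f30] _ _ hz]]]]]]]]]]]]]]]]]]]]] := pentagon_realization PM (cpmu_pentagon HV).
have [z0 [z3 [bz0 bz3 z0E z3E z03]]] := hz Z AZ.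
have PDF := pentagon_data_flip PD.
exists S0, k10, k30, ((adj V12 \o adj V23) \o z0 \o adj (adj V12 \o adj V23)); split=> //.
- split; [exact: (pentagon_Th_bounded PDF)|exact: (pd_k10 PD)|exact: (pd_k30 PD)].
- by move=> e x v ae bx; rewrite (pd_a0 PD).
split=> x y hx hy.
  have AS := sl2' (DA' AZ) hx hy; have [bD hD] := tl _ AS.
  have := pentagon_coassoc1 PDF bz0 z0E hx hy bD; rewrite EV; apply => e w ae.
  by rewrite hD.
have AS := sl1' (DA' AZ) hx hy; have [bD hD] := tl _ AS.
have := pentagon_coassoc2 PDF bz3 z3E z03 hx hy bD; rewrite EV; apply => e w ae.
by rewrite hD.
Qed.

(** The legs are crossed because exchanging kets turns [<xi|_2 V |eta>_2] between vectors of [al]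
    and [hb] into a slice in the first leg between vectors of [xi] and [eta], to which the map can
    be applied. *)
Definition pi_hat := pi_op al hb (fun e ze : L -> H => adj (ket1 T' e) \o V \o ket1 T ze).
Definition pi_leg := pi_op be al (fun x e : L -> H => adj (ket2 T' x) \o V \o ket2 T e).

Let nV v : rnorm (V v) <= rnorm v. Proof. by rewrite unitary_norm. Qed.

Let x1_val (xi eta al' ze : L -> H) z z' : be xi -> al eta -> al al' -> hb ze ->
  iprod (ket2 T' xi (al' z)) ((V \o ket2 T eta) (ze z'))
  = iprod (xi z) ((adj (ket1 T' al') \o V \o ket1 T ze) (eta z')).
Proof.
move=> bx ae aa hz /=; rewrite -(ket12 aab) // -(ket12 aha) //.
by rewrite adjPr //; exact: (ket1_bounded aab).
Qed.

Let x2_val (eta ze xi0 e0 : L -> H) z z' : al eta -> hb ze -> be xi0 -> al e0 ->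
  iprod (ket1 T' eta (xi0 z)) ((V \o ket1 T ze) (e0 z'))
  = iprod (eta z) ((adj (ket2 T' xi0) \o V \o ket2 T e0) (ze z')).
Proof.
move=> ae hz bx ae0 /=; rewrite (ket12 aab) // (ket12 aha) //.
by rewrite adjPr //; exact: (ket2_bounded aab).
Qed.

Lemma pi_hat_hom : contractive_hom (Omega be al Ahb) (Omega_norm be al Ahb) mul_hat (leg_hat V) pi_hat.
Proof.
apply: (@pi_op_hom R L H al be aab T' Ahb Ahb2 c_be c_al (@hA _ _) (@hA _ _) sl2 sl1 (Delta V) DA T'
  (ket2 T') (fun e => V \o ket2 T e) al hb).
- by move=> x; exact: (ket2_bounded aab).
- by move=> e ae; apply: bounded_comp => //; exact: (ket2_bounded aha).
- by move=> a M; exact: (ket2_sqb aab).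
- move=> a M aa M0 /(ket2_sqb aha T aa M0); apply: sqb_contract => i v; exact: nV.
- by move=> a; exact: (ket2_fam aab).
- by move=> a aa fa; apply: fam_comp_left bV _; exact: (ket2_fam aha).
- exact: (pmod_total p_al).
- exact: (pmod_total p_hb).
- by move=> *; exact: (premu_q1 PM).
- exact: x1_val.
move=> xi eta xi' eta' a ze z z' bx ae bx' ae' aa hz.
have [S0 [S1 [S2 [S3 [S4 [V12 [V23 [W23 [V13 [W12 [k10 [k30 [k11 [k31 [k12 [k32 [k13 [k23 [k24 [k34
  [PD _ _ _ _]]]]]]]]]]]]]]]]]]]]] := pentagon_realization PM (cpmu_pentagon HV).
have [bD hD] := premu_tl PM (premu_q1 PM aa hz).
rewrite (pentagon_mul1 PD (xi z) (eta' z') aa hz bx' ae bD); last by move=> e w ae0; rewrite hD.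
rewrite (ket12 aab) // (ket12 aha) //= adjPr //; exact: (ket2_bounded aab).
Qed.

Lemma pi_leg_hom : contractive_hom (Omega al hb Abe) (Omega_norm al hb Abe) mul_leg (leg V) pi_leg.
Proof.
apply: (@pi_op_hom R L H hb al aha T Abe Abe2 c_al c_hb (@hA _ _) (@hA _ _) sl2' sl1' (Delta_hat V) DA' T'
  (ket1 T') (fun e => V \o ket1 T e) be al).
- by move=> x; exact: (ket1_bounded aab).
- by move=> e ae; apply: bounded_comp => //; exact: (ket1_bounded aha).
- by move=> a M; exact: (ket1_sqb aab).
- move=> a M aa M0 /(ket1_sqb aha T aa M0); apply: sqb_contract => i v; exact: nV.
- by move=> a; exact: (ket1_fam aab).
- by move=> a aa fa; apply: fam_comp_left bV _; exact: (ket1_fam aha).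
- exact: (pmod_total p_be).
- exact: (pmod_total p_al).
- by move=> *; exact: (premu_q2 PM).
- exact: x2_val.
move=> xi eta xi' eta' a ze z z' bx ae bx' ae' aa hz.
have [S0 [S1 [S2 [S3 [S4 [V12 [V23 [W23 [V13 [W12 [k10 [k30 [k11 [k31 [k12 [k32 [k13 [k23 [k24 [k34
  [PD _ _ _ _]]]]]]]]]]]]]]]]]]]]] := pentagon_realization PM (cpmu_pentagon HV).
have [bD hD] := premu_tl (premu_flip PM) (premu_q2 PM aa hz).
rewrite (pentagon_mul2 PD (xi z) (eta' z') aa hz ae bx' bD); last by move=> e w ae0; exact: hD.
rewrite -(ket12 aab) // -(ket12 aha) //= adjPr //; exact: (ket1_bounded aab).
Qed.

Lemma pi_hat_omega xi eta : seqs be xi -> seqs al eta ->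
  op_series_to (fun n => adj (ket2 T' (xi n)) \o V \o ket2 T (eta n)) (pi_hat (omega Ahb xi eta)).
Proof.
move=> sx se; rewrite (omega_omf c_be c_al (@hA _ _)) //.
apply: (@pi_op_series R L H al be aab Ahb (@hA _ _) T' (ket2 T') (fun e => V \o ket2 T e) al hb) => //.
- by move=> a; exact: (ket2_fam aab).
- by move=> a aa fa; apply: fam_comp_left bV _; exact: (ket2_fam aha).
- exact: (pmod_total p_al).
- exact: (pmod_total p_hb).
- by move=> *; exact: (premu_q1 PM).
Qed.

Lemma pi_leg_omega eta zeta : seqs al eta -> seqs hb zeta ->
  op_series_to (fun n => adj (ket1 T' (eta n)) \o V \o ket1 T (zeta n)) (pi_leg (omega Abe eta zeta)).
Proof.
move=> sx se; rewrite (omega_omf c_al c_hb (@hA _ _)) //.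
apply: (@pi_op_series R L H hb al aha Abe (@hA _ _) T' (ket1 T') (fun e => V \o ket1 T e) be al) => //.
- by move=> a; exact: (ket1_fam aab).
- by move=> a aa fa; apply: fam_comp_left bV _; exact: (ket1_fam aha).
- exact: (pmod_total p_be).
- exact: (pmod_total p_al).
- by move=> *; exact: (premu_q2 PM).
Qed.

End Halves.

Theorem theorem3p14 (R : realType) (b : cbase R) (H : hilbertType R)
    (hb al be : set (bspace b -> H))
    (T : rtp hb al) (T' : rtp al be) (V : T -> T')
    (HV : cpmu V) :
  let Ahb := commutant [set rho hb c | c in balg b] in
  let Abe := commutant [set rho be c | c in balg b] in
  let Ahb2 := commutant (op_op T' [set rho hb c | c in balg b]
                                  [set rho hb c | c in balg b]) in
  let Abe2 := commutant (op_op T [set rho be c | c in balg b]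
                                 [set rho be c | c in balg b]) in
  let O1 := Omega be al Ahb in
  let N1 := Omega_norm be al Ahb in
  let O2 := Omega al hb Abe in
  let N2 := Omega_norm al hb Abe in
  exists (box1 : ((H -> H) -> bspace b -> bspace b) ->
                 ((H -> H) -> bspace b -> bspace b) ->
                 ((T' -> T') -> bspace b -> bspace b))
         (box2 : ((H -> H) -> bspace b -> bspace b) ->
                 ((H -> H) -> bspace b -> bspace b) ->
                 ((T -> T) -> bspace b -> bspace b)),
  let mul1 := fun w w' => on_set Ahb (box1 w w' \o Delta V) in
  let mul2 := fun w w' => on_set Abe (box2 w w' \o Delta_hat V) in
  [/\ proj_contraction O1 N1 O1 N1
        (Omega (ltri T' be) (rtri T' al) Ahb2)
        (Omega_norm (ltri T' be) (rtri T' al) Ahb2) box1,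
      proj_contraction O2 N2 O2 N2
        (Omega (ltri T al) (rtri T hb) Abe2)
        (Omega_norm (ltri T al) (rtri T hb) Abe2) box2,
      forall (xi xi' eta eta' : nat -> bspace b -> H)
             (i : nat * nat -> nat)
             (theta theta' : nat -> bspace b -> T'),
        seqs be xi -> seqs be xi' -> seqs al eta -> seqs al eta' ->
        bijective i ->
        (forall m n, theta (i (m, n)) = ket2 T' (xi' n) \o xi m) ->
        (forall m n, theta' (i (m, n)) = ket1 T' (eta m) \o eta' n) ->
        [/\ seqs (ltri T' be) theta, seqs (rtri T' al) theta' &
            box1 (omega Ahb xi eta) (omega Ahb xi' eta')
            = omega Ahb2 theta theta'] &
      forall (eta eta' zeta zeta' : nat -> bspace b -> H)
             (i : nat * nat -> nat)
             (kappa kappa' : nat -> bspace b -> T),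
        seqs al eta -> seqs al eta' -> seqs hb zeta -> seqs hb zeta' ->
        bijective i ->
        (forall m n, kappa (i (m, n)) = ket2 T (eta' n) \o eta m) ->
        (forall m n, kappa' (i (m, n)) = ket1 T (zeta m) \o zeta' n) ->
        [/\ seqs (ltri T al) kappa, seqs (rtri T hb) kappa' &
            box2 (omega Abe eta zeta) (omega Abe eta' zeta')
            = omega Abe2 kappa kappa']]
  /\ (banach_algebra O1 N1 mul1 /\ banach_algebra O2 N2 mul2)
  /\ (exists (pi_hat pi : ((H -> H) -> bspace b -> bspace b) -> H -> H),
      [/\ contractive_hom O1 N1 mul1 (leg_hat V) pi_hat,
          contractive_hom O2 N2 mul2 (leg V) pi,
          forall xi eta, seqs be xi -> seqs al eta ->
            op_series_to (fun n => adj (ket2 T' (xi n)) \o V \o ket2 T (eta n))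
              (pi_hat (omega Ahb xi eta)) &
          forall eta zeta, seqs al eta -> seqs hb zeta ->
            op_series_to (fun n => adj (ket1 T' (eta n)) \o V \o ket1 T (zeta n))
              (pi (omega Abe eta zeta))]).
Proof.
move=> Ahb Abe Ahb2 Abe2 O1 N1 O2 N2.
exists (@box R _ H al be T' Ahb Ahb2), (@box R _ H hb al T Abe Abe2) => mul1 mul2.
split; [split|split].
- exact: box_hat_contraction HV.
- exact: box_leg_contraction HV.
- by move=> xi xi' eta eta' i theta theta'; exact: (box_hat_omega HV).
- by move=> eta eta' zeta zeta' i kappa kappa'; exact: (box_leg_omega HV).
- by split; [exact: mul_hat_banach HV|exact: mul_leg_banach HV].
exists (pi_hat V), (pi_leg V); split.
- exact: pi_hat_hom HV.
- exact: pi_leg_hom HV.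
- by move=> xi eta; exact: (pi_hat_omega HV).
- by move=> eta zeta; exact: (pi_leg_omega HV).
Qed.
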